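(* Fix $\alpha,\nu>0$ and let $D_n^{\max}$ denote the maximum degree of the random hyperbolic graph $\mathcal{G}_{\alpha,\nu}(n)$ with nodes $X_1^n,\dots,X_n^n$. The following convergences in distribution hold as $n\to\infty$. (1) If $\alpha<1/2$, then $$\sum_{i=1}^n\delta_{n^{-(\alpha+1/2)}(\deg(X_i^n)-n)}\xrightarrow{d}\eta_{g_1}\quad\text{in }M_p((-\infty,0]),$$ where $\eta_{g_1}$ is the Poisson process on $(-\infty,0]$ whose intensity measure has density $g_1(y)=2\pi^2\nu^{2\alpha}|y|$. In particular, $$\pi\nu^{\alpha}\,\frac{n-D_n^{\max}}{n^{\alpha+1/2}}\xrightarrow{d}\mathrm{Weibull}(2).$$ (2) If $\alpha=1/2$, then $$\sum_{i=1}^n\delta_{n^{-1}\deg(X_i^n)}\xrightarrow{d}\eta_{g_2}\quad\text{in }M_p((0,1]),$$ where $\eta_{g_2}$ is the Poisson process on $(0,1]$ whose intensity measure has density $$g_2(y)=\nu\,\big|(V_{1/2}^{-1})'(y)\big|\,\sinh\!\big(V_{1/2}^{-1}(y)/2\big),\qquad y\in(0,1],$$ and $V_{1/2}$ is defined by $$V_{1/2}(r):=\frac1\pi\int_0^1\arccos\!\left(\max\!\left(-1,\frac{\cosh(r)-x^{-2}}{\sinh(r)}\right)\right)dx,\qquad r>0.$$ In particular, $n^{-1}D_n^{\max}\xrightarrow{d}V_{1/2}\big(2\,\mathrm{arcosh}(\mathcal{E}+1)\big)$, where $\mathcal{E}$ is an exponential random variable with parameter (rate) $2\nu$. (3) If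 $\alpha>1/2$, then $$\sum_{i=1}^n\delta_{n^{-1/(2\alpha)}\deg(X_i^n)}\xrightarrow{d}\eta_{g_3}\quad\text{in }M_p((0,\infty]),$$ where $\eta_{g_3}$ is the Poisson process on $(0,\infty]$ whose intensity measure has density $g_3(y)=2\alpha(C_\alpha\nu)^{2\alpha}y^{-2\alpha-1}$, with $C_\alpha:=\frac{2\alpha}{\pi(\alpha-1/2)}$. In particular, $$\frac{D_n^{\max}}{C_\alpha\,\nu\,n^{1/(2\alpha)}}\xrightarrow{d}\text{Fréchet}(2\alpha).$$
   Context: Hyperbolic plane: $\mathbb{H}$ is the Poincaré disc (open unit disc of $\mathbb{C}$ with metric $4\mathbf{g}_{\mathbb{C}}/(1-|w|^2)^2$, where $\mathbf{g}_{\mathbb{C}}$ is the Euclidean metric), with distance $d_{\mathbb{H}}$. A point $w$ has polar coordinates $(r(w),\theta(w))$, where $r(w)$ is its hyperbolic distance to the origin and $\theta(w)$ its angle. For points $x=(r,\theta)$, $y=(s,\beta)$: $\cosh d_{\mathbb{H}}(x,y)=\cosh r\cosh s-\sinh r\sinh s\cos(\theta-\beta)$. Random hyperbolic graph $\mathcal{G}_{\alpha,\nu}(n)$: for $\alpha,\nu>0$ and $n\in\mathbb{N}^*$ (with $n>\nu$), set $R_n:=2\log(n/\nu)$. Let $\mu_n$ be the probability measure on $\mathbb{H}$ under which the polar coordinates $r,\theta$ are independent, $\theta$ is uniform on $(-\pi,\pi]$, and $r$ has density $\rho_n(r)=\frac{\alpha\sinh(\alpha r)}{\cosh(\alpha R_n)-1}\mathbf{1}_{\{r<R_n\}}$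 on $\mathbb{R}_+$. The nodes $X_1^n,\dots,X_n^n$ are i.i.d. with law $\mu_n$, and two distinct nodes are joined by an (undirected) edge if and only if their hyperbolic distance is at most $R_n$. $\deg(X)$ denotes the number of neighbours of the node $X$ in the graph. Point processes: for a subspace $E$ of the compactified real line $[-\infty,\infty]$, $M_p(E)$ is the space of locally finite point measures on $E$ (finite on compact subsets of $E$) with the vague topology; a point process on $E$ is a random element of $M_p(E)$, $\delta_x$ is the Dirac measure at $x$, and $\xrightarrow{d}$ denotes convergence in distribution (weak convergence), of point processes in $M_p(E)$ or of random variables. Thus compact subsets of e.g. $(0,\infty]$ are closed sets bounded away from $0$. Point measures are viewed as elements of $M_p(E)$ by restriction to $E$ (a possible atom at $0\notin E$ is disregarded). Densities are with respect to Lebesgue measure (no mass at infinite points). $V_{1/2}$, extended by $V_{1/2}(0)=1$, is a decreasing diffeomorphism from $[0,\infty)$ to $(0,1]$, and $V_{1/2}^{-1}$ is its inverse. For $\beta>0$: $Z\sim\mathrm{Weibull}(\beta)$ means $\mathbb{P}[Z\le z]=1-e^{-z^{\beta}}$ for all $z\ge0$; $Z\sim\text{Fréchet}(\beta)$ means $\mathbb{P}[Z\le z]=e^{-z^{-\beta}}$ for all $z\ge 0$ (value $0$ at $z=0$). *)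

(* Defs.v *)
From HB Require Import structures.
From mathcomp Require Import all_boot all_order all_algebra.
From mathcomp Require Import all_classical all_reals all_analysis.
From mathcomp Require Import measurable_realfun.
From mathcomp Require Import ring lra.

Set Implicit Arguments.
Unset Strict Implicit.
Unset Printing Implicit Defensive.

Import Order.TTheory GRing.Theory Num.Theory.
Import numFieldNormedType.Exports.

Local Open Scope classical_set_scope.
Local Open Scope ring_scope.

Section hyperbolic_functions.
Context {R : realType}.
Implicit Types x : R.

Definition cosh x : R := (expR x + expR (- x)) / 2.
Definition sinh x : R := (expR x - expR (- x)) / 2.
Definition tanh x : R := sinh x / cosh x.
Definition arcosh x : R := ln (x + Num.sqrt (x ^+ 2 - 1)).

Lemma cosh_gt0 x : 0 < cosh x.
Proof. by rewrite divr_gt0// addr_gt0// expR_gt0. Qed.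

Lemma sinh_ge0 x : 0 <= x -> 0 <= sinh x.
Proof. by move=> x0; rewrite divr_ge0// subr_ge0 ler_expR; lra. Qed.

Lemma cosh2B1 x : cosh x ^+ 2 - 1 = sinh x ^+ 2.
Proof.
rewrite /cosh /sinh expRN; have := expR_gt0 x; move: (expR x) => a a0.
by field; lra.
Qed.

Lemma cosh_double x : cosh x = cosh (x / 2) ^+ 2 + sinh (x / 2) ^+ 2.
Proof.
have h : expR x = expR (x / 2) ^+ 2 by rewrite -expRM_natr; congr expR; lra.
rewrite /cosh /sinh !expRN h; have := expR_gt0 (x / 2).
by move: (expR _) => a a0; field; lra.
Qed.

Lemma sinh_double x : sinh x = 2 * sinh (x / 2) * cosh (x / 2).
Proof.
have h : expR x = expR (x / 2) ^+ 2 by rewrite -expRM_natr; congr expR; lra.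
rewrite /cosh /sinh !expRN h; have := expR_gt0 (x / 2).
by move: (expR _) => a a0; field; lra.
Qed.

Lemma arcoshK x : 1 <= x -> cosh (arcosh x) = x.
Proof.
move=> x1; have s0 : 0 <= x ^+ 2 - 1 by nra.
have h : 0 < x + Num.sqrt (x ^+ 2 - 1).
  by rewrite ltr_pwDl ?sqrtr_ge0//; lra.
rewrite /cosh /arcosh expRN lnK ?posrE//.
have := sqr_sqrtr s0; move: (Num.sqrt _) h => s h hs.
by apply: (@mulIf _ (x + s)); [lra | field: hs; lra].
Qed.

Lemma coshK x : 0 <= x -> arcosh (cosh x) = x.
Proof.
move=> x0; rewrite /arcosh cosh2B1 sqrtr_sqr ger0_norm ?sinh_ge0//.
by rewrite (_ : _ + _ = expR x) ?expRK// /cosh /sinh; lra.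
Qed.

End hyperbolic_functions.

(* Points of the Poincare disc are given by their Cartesian coordinates. *)

Section poincare_disc.
Context {R : realType}.
Implicit Types (w z : R * R) (r s t u : R).

Definition sqnorm w : R := w.1 ^+ 2 + w.2 ^+ 2.

(* The distance of the Riemannian metric 4 g / (1 - |w|^2)^2; see
   [cosh_disc_dist] for its form in polar coordinates. *)
Definition disc_dist w z : R :=
  arcosh (1 + 2 * sqnorm (w - z) / ((1 - sqnorm w) * (1 - sqnorm z))).

(* The point at hyperbolic distance [p.1] from the origin and with angle
   [p.2]; its Euclidean modulus is tanh (r / 2), see [disc_dist_origin]. *)
Definition polar_point (p : R * R) : R * R :=
  (tanh (p.1 / 2) * cos p.2, tanh (p.1 / 2) * sin p.2).

Lemma sqnorm_polar r t : sqnorm (polar_point (r, t)) = tanh (r / 2) ^+ 2.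
Proof. by rewrite /sqnorm /= !exprMn -mulrDr cos2Dsin2 mulr1. Qed.

Lemma one_sub_sqnorm_polar r t :
  1 - sqnorm (polar_point (r, t)) = (cosh (r / 2) ^+ 2)^-1.
Proof.
rewrite sqnorm_polar /tanh; have c0 := cosh_gt0 (r / 2).
have := cosh2B1 (r / 2); move: (cosh _) (sinh _) c0 => c s c0 h.
by rewrite expr_div_n -h; field; lra.
Qed.

Lemma polar_point_in_disc p : sqnorm (polar_point p) < 1.
Proof.
by case: p => r t; rewrite -subr_gt0 one_sub_sqnorm_polar invr_gt0 exprn_gt0// cosh_gt0.
Qed.

Lemma cosh_disc_dist r t s u :
  cosh (disc_dist (polar_point (r, t)) (polar_point (s, u))) =
  cosh r * cosh s - sinh r * sinh s * cos (t - u).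
Proof.
rewrite /disc_dist arcoshK; last first.
  rewrite lerDl divr_ge0//; first by rewrite mulr_ge0// addr_ge0// sqr_ge0.
  by rewrite mulr_ge0// subr_ge0 ltW// polar_point_in_disc.
rewrite !one_sub_sqnorm_polar cosB (cosh_double r) (cosh_double s).
rewrite (sinh_double r) (sinh_double s) /sqnorm /= /tanh.
have := cosh2B1 (r / 2); have := cosh2B1 (s / 2).
have := cos2Dsin2 t; have := cos2Dsin2 u.
have := cosh_gt0 (r / 2); have := cosh_gt0 (s / 2).
move: (cosh (r / 2)) (cosh (s / 2)) (sinh (r / 2)) (sinh (s / 2)).
move: (cos t) (sin t) (cos u) (sin u) => ct st cu su a b x y b0 a0 hu ht hb ha.
have -> : 1 + 2 * ((x / a * ct - y / b * cu) ^+ 2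
     + (x / a * st - y / b * su) ^+ 2) / ((a ^+ 2)^-1 * (b ^+ 2)^-1) =
   1 + 2 * (x ^+ 2 * b ^+ 2 * (ct ^+ 2 + st ^+ 2)
     + y ^+ 2 * a ^+ 2 * (cu ^+ 2 + su ^+ 2)
     - 2 * x * y * a * b * (ct * cu + st * su)).
  by field; apply/andP; split; lra.
by rewrite hu ht -ha -hb; ring.
Qed.

Lemma disc_dist_origin r t : 0 <= r -> disc_dist 0 (polar_point (r, t)) = r.
Proof.
move=> r0; rewrite /disc_dist one_sub_sqnorm_polar.
rewrite (_ : sqnorm (0 - _) = tanh (r / 2) ^+ 2); last first.
  by rewrite -(sqnorm_polar r t) /sqnorm /= !sub0r !sqrrN.
rewrite (_ : _ + _ = cosh r) ?coshK// (cosh_double r) /tanh /sqnorm /=.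
have := cosh2B1 (r / 2); have := cosh_gt0 (r / 2).
move: (cosh (r / 2)) (sinh (r / 2)) => c s c0 h.
by rewrite expr_div_n -h; field; lra.
Qed.

End poincare_disc.

Section probability_notions.
Context {R : realType}.

Definition mutually_independent d (Omega : measurableType d)
    (P : probability Omega R) (I : finType) d' (T : measurableType d')
    (X : I -> Omega -> T) : Prop :=
  forall (J : {set I}) (B : I -> set T), (forall i, measurable (B i)) ->
  P [set w | forall i, i \in J -> B i (X i w)] =
  (\prod_(i in J) P (X i @^-1` B i))%E.

Definition iid_of_law d (Omega : measurableType d) (P : probability Omega R)
    (I : finType) d' (T : measurableType d') (X : I -> Omega -> T)
    (mu : set T -> \bar R) : Prop :=
  mutually_independent P X /\
  forall i A, measurable A -> P (X i @^-1` A) = mu A.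

(* Measurability for the Borel sigma-algebra of [T]. *)
Definition random_element d (Omega : measurableType d) (T : topologicalType)
    (X : Omega -> T) : Prop :=
  forall U : set T, open U -> measurable (X @^-1` U).

Definition cvg_in_distribution (T : topologicalType)
    (d : nat -> measure_display) (Omega : forall n, measurableType (d n))
    (P : forall n, probability (Omega n) R) (X : forall n, Omega n -> T)
    d' (Omega' : measurableType d') (Q : probability Omega' R)
    (Y : Omega' -> T) : Prop :=
  [/\ forall n, random_element (X n), random_element Y &
    forall F : T -> R, continuous F -> (exists M, forall x, `|F x| <= M) ->
    ('E_(P n)[F \o X n] @[n --> \oo] --> 'E_Q[F \o Y])%E].

Definition weibull d (Omega : measurableType d) (P : probability Omega R)
    (beta : R) (Z : Omega -> R) : Prop :=
  forall z, 0 <= z -> P [set w | Z w <= z] = (1 - expR (- (z `^ beta)))%:E.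

Definition frechet d (Omega : measurableType d) (P : probability Omega R)
    (beta : R) (Z : Omega -> R) : Prop :=
  forall z, 0 <= z -> P [set w | Z w <= z] =
    (if z == 0 then 0 else expR (- (z `^ (- beta))))%:E.

End probability_notions.

Section point_measures.
Context {R : realType}.
Implicit Types (E : set \bar R) (m : set \bar R -> \bar R).

Definition is_point_measure E m : Prop :=
  exists (J : countType) (D : set J) (x : J -> \bar R),
    (forall j, D j -> E (x j)) /\
    forall A, measurable A -> m A = \esum_(j in D) \d_(x j) A.

Definition locally_finite E m : Prop :=
  forall K, compact K -> K `<=` E -> (m K < +oo)%E.

(* A point measure on [E] is represented by a measure on the compactified
   line all of whose atoms lie in [E]. Two records that agree on the Borel sets
   need not be equal, but no open set separates them. *)
Record Mp E := MkMp {
  Mp_measure :> {measure set \bar R -> \bar R};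
  Mp_is_point_measure : is_point_measure E Mp_measure;
  Mp_locally_finite : locally_finite E Mp_measure }.

(* The continuous functions on [E] with compact support, extended by 0. *)
Definition Cc E : set (\bar R -> R) :=
  [set f | {within E, continuous f} /\
    exists K, [/\ compact K, K `<=` E & forall x, ~ K x -> f x = 0]].

Definition Mp_integral E (m : Mp E) : {ptws Cc E -> R} :=
  fun f => \int[m]_(x in E) (\val f) x.

HB.instance Definition _ E := gen_eqMixin (Mp E).
HB.instance Definition _ E := gen_choiceMixin (Mp E).

(* The vague topology. *)
HB.instance Definition _ E :=
  Topological.copy (Mp E) (initial_topology (@Mp_integral E)).

End point_measures.

Section empirical_measure.
Context {R : realType} (E : set \bar R) (n : nat) (y : 'I_n -> \bar R).
Local Open Scope ereal_scope.

(* The restriction to [E] of the sum of the Dirac measures at the [y i]. *)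
Definition point_sum (A : set \bar R) : \bar R :=
  \sum_(i < n | y i \in E) \d_(y i) A.

Let point_sum0 : point_sum set0 = 0.
Proof. by rewrite /point_sum big1. Qed.

Let point_sum_ge0 A : 0 <= point_sum A.
Proof. exact: sume_ge0. Qed.

Let point_sum_sigma_additive : semi_sigma_additive point_sum.
Proof.
move=> F mF tF mUF; rewrite /point_sum.
under eq_fun do rewrite exchange_big/=.
apply: cvg_nnesum => [i _|i _].
  by apply: nearW => k; exact: sume_ge0.
exact: (@measure_semi_sigma_additive _ _ _ \d_(y i)).
Qed.

HB.instance Definition _ := isMeasure.Build _ _ _ point_sum
  point_sum0 point_sum_ge0 point_sum_sigma_additive.

Lemma point_sum_is_point_measure : is_point_measure E point_sum.
Proof.
exists 'I_n, [set i | E (y i)], y; split => // A mA.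
rewrite esum_mkcond esum_fset; [|exact: finite_finset|by move=> i _; case: ifP].
rewrite (fsbigE (index_enum 'I_n)) ?index_enum_uniq//=; last first.
  by move=> i _; rewrite mem_index_enum.
rewrite /point_sum big_mkcond/=; apply: eq_big => [i|i _]; first by rewrite in_setT.
by congr (if _ then _ else _); apply/idP/idP; rewrite !inE.
Qed.

Lemma point_sum_locally_finite : locally_finite E point_sum.
Proof.
move=> K _ _; rewrite /point_sum; apply: lte_sum_pinfty => i _.
by rewrite diracE ltry.
Qed.

Definition empirical : Mp E :=
  MkMp point_sum_is_point_measure point_sum_locally_finite.

End empirical_measure.

Section poisson_processes.
Context {R : realType}.
Implicit Types (E : set \bar R) (lambda : set \bar R -> \bar R).

(* The measure on [E] with density [g] with respect to the Lebesgue measure;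
   it does not charge infinite points. *)
Definition density_measure E (g : R -> R) (A : set \bar R) : \bar R :=
  (\int[lebesgue_measure]_(y in [set y : R | (E `&` A) y%:E]) (g y)%:E)%E.

(* The probability of [k] for the Poisson law of parameter [l], where the law
   of parameter 0 is the Dirac mass at 0 and that of parameter +oo is the
   Dirac mass at +oo. *)
Definition poisson_weight (l : \bar R) (k : nat) : R :=
  if l is r%:E then r ^+ k / k`!%:R * expR (- r) else 0.

Definition poisson_process d (Omega : measurableType d)
    (P : probability Omega R) E lambda (eta : Omega -> Mp E) : Prop :=
  [/\ random_element eta,
    forall A, measurable A -> A `<=` E -> forall k : nat,
      P [set w | eta w A = k%:R%:E] = (poisson_weight (lambda A) k)%:E &
    forall (I : finType) (A : I -> set \bar R),
      (forall i, measurable (A i) /\ A i `<=` E) -> trivIset setT A ->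
      mutually_independent P (fun i w => eta w (A i))].

End poisson_processes.

Section random_hyperbolic_graph.
Context {R : realType}.
Implicit Types (alpha nu : R) (n : nat).

Definition rhg_radius nu n : R := 2 * ln (n%:R / nu).

Definition radial_density alpha nu n (r : R) : R :=
  if (0 <= r) && (r < rhg_radius nu n) then
    alpha * sinh (alpha * r) / (cosh (alpha * rhg_radius nu n) - 1)
  else 0.

Definition radial_law alpha nu n (A : set R) : \bar R :=
  (\int[lebesgue_measure]_(r in A) (radial_density alpha nu n r)%:E)%E.

Lemma radial_density_ge0 alpha nu n r : 0 <= radial_density alpha nu n r.
Proof.
have sinhN x : sinh (- x) = - sinh x :> R by rewrite /sinh opprK; lra.
rewrite /radial_density; case: ifP => // /andP[r0 _]; apply: divr_ge0.
  have [a0|/ltW a0] := leP 0 alpha.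
    by rewrite mulr_ge0// sinh_ge0// mulr_ge0.
  rewrite -mulrNN -sinhN mulr_ge0 ?oppr_ge0// sinh_ge0//.
  by rewrite -mulNr mulr_ge0// oppr_ge0.
rewrite subr_ge0; move: (alpha * _) => x.
by have := cosh2B1 x; have := sqr_ge0 (sinh x); have := cosh_gt0 x; nra.
Qed.

Lemma measurable_radial_density alpha nu n :
  measurable_fun setT (radial_density alpha nu n).
Proof.
apply: measurable_fun_ifT => //.
  by apply: measurable_and; [apply: measurable_fun_ler|apply: measurable_fun_ltr].
apply: measurable_funM => //; apply: measurable_funM => //.
apply: (@measurableT_comp _ _ _ _ _ _ sinh); last by apply: measurable_funM.
rewrite /sinh; apply: measurable_funM => //; apply: measurable_funB; first exact: measurable_expR.
by apply: measurableT_comp => //; exact: measurable_expR.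
Qed.

Section radial_law_measure.
Variables (alpha nu : R) (n : nat).

Let radial_law0 : radial_law alpha nu n set0 = 0%E.
Proof. exact: integral_set0. Qed.

Let radial_law_ge0 A : (0 <= radial_law alpha nu n A)%E.
Proof. by apply: integral_ge0 => r _; rewrite lee_fin radial_density_ge0. Qed.

Let radial_law_sigma_additive : semi_sigma_additive (radial_law alpha nu n).
Proof.
move=> /= F mF tF mUF; rewrite /radial_law; apply: cvg_toP.
  apply: ereal_nondecreasing_is_cvgn => k m km.
  apply: lee_sum_nneg_natr => // i _ _.
  by apply: integral_ge0 => r _; rewrite lee_fin radial_density_ge0.
rewrite ge0_integral_bigcup//=.
- apply: measurable_funTS; apply: measurableT_comp => //.
  exact: measurable_radial_density.
- by move=> r _; rewrite lee_fin radial_density_ge0.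
Qed.

HB.instance Definition _ := isMeasure.Build _ _ _ (radial_law alpha nu n)
  radial_law0 radial_law_ge0 radial_law_sigma_additive.

End radial_law_measure.

Lemma ltNpipi : - pi < pi :> R.
Proof. by have := pi_gt0 R; lra. Qed.

(* The law of a node: its polar coordinates are independent with respective
   laws [radial_law] and the uniform law on [-pi, pi], the same measure as the
   uniform law on (-pi, pi]. It is a probability only for nu < n. *)
Definition rhg_law alpha nu n : set (R * R) -> \bar R :=
  pushforward (radial_law alpha nu n \x uniform_prob ltNpipi)%E polar_point.

Definition rhg_edge nu n (x : 'I_n -> R * R) : rel 'I_n :=
  fun i j => (i != j) && (disc_dist (x i) (x j) <= rhg_radius nu n).

Definition rhg_degree nu n (x : 'I_n -> R * R) (i : 'I_n) : nat :=
  #|[pred j | rhg_edge nu x i j]|.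

Definition rhg_max_degree nu n (x : 'I_n -> R * R) : nat :=
  \max_(i < n) rhg_degree nu x i.

(* The value at 0 is 1; the values at negative numbers are irrelevant. *)
Definition V_half (r : R) : R :=
  if 0 < r then
    pi^-1 * \int[lebesgue_measure]_(x in `[0, 1])
      acos (Num.max (-1) ((cosh r - x ^- 2) / sinh r))
  else 1.

Definition V_half_inv : R -> R := 'pinv_(fun=> 0) `[0, +oo[ V_half.

Definition rhg_g1 alpha nu (y : R) : R := 2 * pi ^+ 2 * nu `^ (2 * alpha) * `|y|.

Definition rhg_g2 nu (y : R) : R :=
  nu * `|derive1 V_half_inv y| * sinh (V_half_inv y / 2).

Definition rhg_C alpha : R := 2 * alpha / (pi * (alpha - 2^-1)).

Definition rhg_g3 alpha nu (y : R) : R :=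
  2 * alpha * (rhg_C alpha * nu) `^ (2 * alpha) * y `^ (- 2 * alpha - 1).

End random_hyperbolic_graph.

(* Main.v *)
(**
   A node at radius r is adjacent to another node with a probability p(r) that decreases in
   r. Conditionally on the position of a node its degree is binomial, so by a Chernoff bound
   and a union bound over the n nodes all rescaled degrees that matter are close to n p(r)
   (for alpha < 1/2, the numbers of non-neighbours are close to n (1 - p(r))). Hence a
   rescaled degree exceeds a exactly when the radius is at most some rho_n(a), up to an event
   of vanishing probability. The radii are independent, and the expected number of those
   below rho_n(a) converges to a limit G(a) which is the mass of [a, top] under the intensity
   measure, so the numbers of rescaled degrees in finitely many consecutive intervals are
   asymptotically independent Poisson variables. In the vague topology every neighbourhood
   of a point measure is determined by such counts on a fine enough mesh, and convergence in
   distribution follows. The maximum degree is treated with the single cell [a, top].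

   For a node at radius r, the nodes at relative angle f within distance R are those of radius
   at most about R - log(cosh r - sinh r cos f), and a radius at most s has probability about
   exp(-alpha (R - s)). Integrating over f gives the three regimes: 1 - p(r) ~ alpha r / pi as
   r -> 0, p(r) -> V_half(r) for alpha = 1/2, and p(r) ~ C_alpha exp(-r / 2) as r -> oo for
   alpha > 1/2.
*)
From HB Require Import structures.
Require Import Defs.
From mathcomp Require Import all_boot all_order all_algebra.
From mathcomp Require Import all_classical all_reals all_analysis.
From mathcomp Require Import measurable_realfun ring lra.
Set Implicit Arguments.
Unset Strict Implicit.
Unset Printing Implicit Defensive.
Import Order.TTheory GRing.Theory Num.Theory.
Import numFieldNormedType.Exports.
Local Open Scope classical_set_scope.
Local Open Scope ring_scope.

(** * Chernoff bound and multinomial limits *)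

(** The delicate point is the passage from radii to degrees. A union bound over n nodes needs a
    mismatch probability o(1/n) per node, while concentration says nothing about a node whose radius
    is close to the threshold. The threshold is therefore bracketed: between the radii attached to
    levels a1 < a < a2 lie on average about G(a1) - G(a2) nodes, few by continuity of G, and outside
    this annulus the Chernoff bound decays like exp(-k s), where the scale s of the counted degree
    is a positive power of n. Concentration also explains why non-neighbours are counted when alpha
    < 1/2: their number, of order n^(alpha + 1/2), concentrates on its own scale. Only limits of
    p(r) are then required, no rates. Weak convergence is obtained without Laplace functionals: a
    test function is bounded below by its infima over the classes of a discrete statistic, and
    convergence of the law of each statistic suffices when the classes are eventually contained in
    every neighbourhood. Meshes are uniform in the coordinate [contract], which treats infinite end
    points like finite ones. *)

Section chernoff.
Context {R : realType}.

Lemma probability_indicE d (Omega : measurableType d) (P : probability Omega R)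
  (A : set Omega) : measurable A -> P A = (\int[P]_w (\1_A w)%:E)%E.
Proof. by move=> mA; rewrite integral_indic// setIT. Qed.

(** With c = e^lam - 1 the exponential moment is the product of the 1 + c 1_(V j), which expands
    over subsets S into c^|S| times the indicator of an intersection. The only probabilistic input
    is thus the probability q^|S| of these intersections, and the mean is (1 + c q)^m <= exp(m c q).
    A negative [lam] gives the lower tail, so one statement covers both. *)
Lemma chernoff_events d (Omega : measurableType d) (P : probability Omega R)
    (m : nat) (V : 'I_m -> set Omega) (q lam t : R) :
  (forall j, measurable (V j)) ->
  (forall S : {set 'I_m}, P [set w | forall j, j \in S -> V j w] = (q ^+ #|S|)%:E) ->
  0 <= q -> q <= 1 ->
  (P [set w | (lam * t <= lam * \sum_(j < m) \1_(V j) w)%R] <=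
   (expR (m%:R * (q * (expR lam - 1)) - lam * t))%:E)%E.
Proof.
move=> mV hV q0 q1; set c := expR lam - 1.
have mVS (S : {set 'I_m}) : measurable [set w | forall j, j \in S -> V j w].
  rewrite [X in measurable X](_ : _ = \bigcap_(j in [set j | j \in S]) V j).
    by apply: fin_bigcap_measurable => // j _; exact: mV.
  by apply/seteqP; split=> w /= h j; [move=> /h|move=> /h].
pose f (S : {set 'I_m}) w : \bar R := ((c ^+ #|S|)%:E * (\1_[set w | forall j, j \in S -> V j w] w)%:E)%E.
have intf S : P.-integrable setT (f S).
  by apply: integrableZl => //; exact: integrable_indic.
have prodE w : (\sum_(S : {set 'I_m}) f S w = (\prod_(j < m) (1 + c * \1_(V j) w))%:E)%E.
  transitivity (\prod_(j < m) (c * \1_(V j) w + 1))%:E; last first.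
    by congr EFin; apply: eq_bigr => j _; rewrite addrC.
  rewrite bigA_distr -sumEFin; apply: eq_bigr => S _; rewrite /f -EFinM; congr EFin.
  rewrite -big_mkcond/= big_split/= prodr_const; congr (_ * _).
  rewrite indicE; have [h|h] := pselect (forall j, j \in S -> V j w).
    by rewrite mem_set// big1// => j /h Vj; rewrite indicE mem_set.
  rewrite memNset//; move/existsNP : h => [j /not_implyP[jS nV]].
  by rewrite (bigD1 j)//= indicE memNset// mul0r.
have -> : (expR (m%:R * (q * c) - lam * t))%:E =
    ((expR (- (lam * t)))%:E * (expR (m%:R * (q * c)))%:E)%E.
  by rewrite addrC expRD EFinM.
have h1 : (\int[P]_w \sum_(S : {set 'I_m}) f S w <= (expR (m%:R * (q * c)))%:E)%E.
  rewrite integral_sum//.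
  have intE (S : {set 'I_m}) : (\int[P]_w f S w = ((c * q) ^+ #|S|)%:E)%E.
    rewrite integralZl//; last exact: integrable_indic.
    rewrite integral_indic// setIT [X in (_ * X)%E](_ : _ = (q ^+ #|S|)%:E); last exact: hV.
    by rewrite -EFinM -exprMn.
  under eq_bigr do rewrite intE.
  rewrite sumEFin lee_fin.
  have -> : \sum_(S : {set 'I_m}) (c * q) ^+ #|S| = (1 + c * q) ^+ m.
    transitivity (\prod_(j < m) (c * q + 1)); last by rewrite prodr_const card_ord addrC.
    rewrite bigA_distr; apply: eq_bigr => S _.
    by rewrite -big_mkcond/= prodr_const.
  rewrite expRM_natl lerXn2r ?nnegrE ?expR_ge0//.
    by have := expR_gt0 lam; rewrite /c; nra.
  by rewrite [c * q]mulrC; exact: expR_ge1Dx.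
(* Markov's inequality: on the event, exp(lam sum - lam t) is at least 1. *)
apply: (@le_trans _ _ ((expR (- (lam * t)))%:E * \int[P]_w \sum_(S : {set 'I_m}) f S w)%E); last first.
  by rewrite lee_pmul2l// ?lte_fin ?expR_gt0.
rewrite -integralZl//; last exact: integrable_sum.
set E := [set w | _].
have mE : measurable E.
  rewrite /E -[X in measurable X]setTI; apply: measurable_fun_le => //.
  apply: measurable_funM => //; apply: measurable_sum => j.
  exact: measurable_indic.
rewrite (probability_indicE _ mE).
apply: ge0_le_integral => //.
- by apply/measurable_EFinP; exact: measurable_indic.
- by under eq_fun do rewrite prodE; apply/measurable_EFinP; apply: measurable_funM => //;
    apply: measurable_prod => j _; apply: measurable_funD => //; apply: measurable_funM => //; exact: measurable_indic.
move=> w _; rewrite prodE -EFinM lee_fin.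
have -> : \prod_(j < m) (1 + c * \1_(V j) w) = expR (lam * \sum_(j < m) \1_(V j) w).
  rewrite mulr_sumr expR_sum; apply: eq_bigr => j _.
  by rewrite indicE; case: (_ \in _); rewrite ?mulr1 ?mulr0 ?expR0 /c; ring.
rewrite -expRD indicE; case: (boolP (w \in E)) => [|_]; last exact: expR_ge0.
rewrite inE /E/= => h; rewrite -[leLHS]expR0 ler_expR; lra.
Qed.

(** Conditions on a single coordinate generate the sigma-algebra of tuples but are not stable under
    intersection; full rectangles are, as the Dynkin induction of [joint_law_tuple] requires. *)
Lemma measurable_tuple_rectangles d (T : measurableType d) m :
  @measurable _ (m.-tuple T) = <<s [set A | exists B : 'I_m -> set T,
     (forall j, measurable (B j)) /\ A = [set z | forall j, B j (tnth z j)]] >>.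
Proof.
set G := [set A | _].
have mG : G `<=` @measurable _ (m.-tuple T).
  move=> _ [B [mB ->]].
  rewrite [X in measurable X](_ : _ =
      \bigcap_(j in [set: 'I_m]) ((@tnth m T ^~ j) @^-1` B j)).
    apply: fin_bigcap_measurable => // j _; rewrite -[X in measurable X]setTI.
    exact: measurable_tnth.
  by apply/seteqP; split=> z /= h j; [move=> _|]; exact: h.
apply/seteqP; split; last first.
  by apply: smallest_sub => //; exact: sigma_algebra_measurable.
apply: smallest_sub => [|B]; first exact: smallest_sigma_algebra.
rewrite -bigcup_seq/= => -[i _ [C mC <-{B}]]; rewrite setTI.
apply: sub_sigma_algebra; exists (fun j => if j == i then C else setT); split.
  by move=> j; case: ifP.
by apply/seteqP; split=> z /= h => [j|]; [case: eqP => [->|]|have := h i; rewrite eqxx].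
Qed.

Lemma probability_setIC d (Omega : measurableType d) (P : probability Omega R)
    (A B : set Omega) : measurable A -> measurable B ->
  P (A `&` B) = (P A * P B)%E -> P (A `&` ~` B) = (P A * P (~` B))%E.
Proof.
move=> mA mB h; have -> : P (A `&` ~` B) = (P A - P (A `&` B))%E.
  by rewrite -setDE measureD// ltey_eq fin_num_measure.
by rewrite h probability_setC// muleBr ?mule1// ?fin_num_measure.
Qed.

(** The two measures agree on products C x B: for B a rectangle of tuples this is mutual
    independence, and a Dynkin induction extends it to all measurable B. [product_measure_unique]
    then covers every E. Fubini can afterwards freeze X_i while the other nodes vary. *)
Lemma joint_law_tuple d (Omega : measurableType d) (P : probability Omega R)
    d' (T : measurableType d') m (X : 'I_m.+1 -> {RV P >-> T}) (i : 'I_m.+1)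
    (Z : {RV P >-> m.-tuple T}) :
  (forall w, Z w = [tuple X (lift i j) w | j < m]) ->
  mutually_independent P (fun i w => X i w) ->
  forall E : set (T * m.-tuple T), measurable E ->
  P [set w | E (X i w, Z w)] = (distribution P (X i) \x distribution P Z)%E E.
Proof.
move=> ZE indX E mE.
have mXZ : measurable_fun setT (fun w => (X i w, Z w)) by exact: measurable_fun_pair.
have indCB C B : measurable C -> measurable B ->
    P (X i @^-1` C `&` Z @^-1` B) = (P (X i @^-1` C) * P (Z @^-1` B))%E.
  move=> mC; have mXC : measurable (X i @^-1` C) by rewrite -[X in measurable X]setTI; exact: measurable_funPT.
  have mZ A : measurable A -> measurable (Z @^-1` A).
    by move=> mA; rewrite -[X in measurable X]setTI; exact: measurable_funPT.
  rewrite measurable_tuple_rectangles; move: B; apply: dynkin_induction.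
  - exact: measurable_tuple_rectangles.
  - move=> _ _ [B1 [mB1 ->]] [B2 [mB2 ->]]; exists (fun j => B1 j `&` B2 j); split.
      by move=> j; exact: measurableI.
    by apply/seteqP; split=> z /=; [move=> [h1 h2] j; split|move=> h; split=> j; have [] := h j].
  - by rewrite !preimage_setT setIT probability_setT mule1.
  - move=> _ [B [mB ->]].
    (* [B'] assigns C to the index i and B j to the index [lift i j], which turns the event into one
       about all indices, as in [mutually_independent]. *)
    pose B' C k := if unlift i k is Some j then B j else C.
    have mB' D : measurable D -> forall k, measurable (B' D k).
      by move=> mD k; rewrite /B'; case: unlift.
    have HB D : measurable D -> P [set w | forall k, B' D k (X k w)] =
        (P (X i @^-1` D) * \prod_(j < m) P (X (lift i j) @^-1` B j))%E.
      move=> mD; have := indX [set: 'I_m.+1]%SET (B' D) (mB' D mD).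
      rewrite (_ : [set w | _] = [set w | forall k, B' D k (X k w)]); last first.
        by apply/seteqP; split=> w /= h k; [apply: h; rewrite inE|move=> _; exact: h].
      move=> ->; under eq_bigl do rewrite inE.
      rewrite (bigD1_ord i)//= /B' unlift_none; congr (_ * _)%E.
      by apply: eq_bigr => j _; rewrite liftK.
    have EB D : [set w | forall k, B' D k (X k w)] =
        X i @^-1` D `&` Z @^-1` [set z | forall j, B j (tnth z j)].
      apply/seteqP; split => w /=.
        move=> h; split; first by have := h i; rewrite /B' unlift_none.
        by move=> j; have := h (lift i j); rewrite /B' liftK ZE tnth_mktuple.
      move=> [h1 h2] k; rewrite /B'; case: unliftP => [j ->|-> //].
      by have := h2 j; rewrite ZE tnth_mktuple.
    rewrite -EB HB//; congr (_ * _)%E.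
    (* Taking the whole space for D identifies the product over j with the law of Z. *)
    have := HB setT measurableT; rewrite EB preimage_setT setTI probability_setT mul1e.
    by move=> ->.
  - move=> B mB h; rewrite preimage_setC; apply: probability_setIC => //; exact: mZ.
  - move=> F mF tF h; rewrite preimage_bigcup setI_bigcupr.
    rewrite measure_bigcup//; last 2 first.
    + by move=> k _; apply: measurableI => //; exact: mZ.
    + by move=> j k _ _ [w [[_ Fj] [_ Fk]]]; apply: tF => //; exists (Z w).
    rewrite measure_bigcup//; last 2 first.
    + by move=> k _; exact: mZ.
    + by move=> j k _ _ [w [Fj Fk]]; apply: tF => //; exists (Z w).
    have PC : P (X i @^-1` C) = (fine (P (X i @^-1` C)))%:E.
      by rewrite fineK// fin_num_measure.
    rewrite [X in (X * _)%E]PC -nneseriesZl//.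
    by apply: eq_eseriesr => k _; rewrite -PC; exact: h.
pose W : {RV P >-> (T * m.-tuple T)%type} := mfun_Sub (mem_set mXZ).
rewrite (@product_measure_unique _ _ _ _ _ _ _ (distribution P W))//.
Qed.

(* Given X_i the other indicators are independent Bernoulli variables, of mean at most p
   (lam > 0) or at least p (lam < 0) when X_i lies in C; this is Markov's inequality for
   the exponential moment. *)
Lemma chernoff_count d (Omega : measurableType d) (P : probability Omega R)
    d' (T : measurableType d') m (X : 'I_m.+1 -> {RV P >-> T})
    (mu : probability T R) (A : set (T * T)) (C : set T) (i : 'I_m.+1) (p lam t : R) :
  mutually_independent P (fun i w => X i w) ->
  (forall i B, measurable B -> P (X i @^-1` B) = mu B) ->
  measurable A -> measurable C ->
  (forall x, C x -> fine (mu (xsection A x)) * (expR lam - 1) <= p * (expR lam - 1)) ->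
  (P [set w | C (X i w) /\
     (lam * t <= lam * \sum_(j < m) \1_A (X i w, X (lift i j) w))%R] <=
   (expR (m%:R * (p * (expR lam - 1)) - lam * t))%:E)%E.
Proof.
move=> indX lawX mA mC hp.
have mZ : measurable_fun setT (fun w => [tuple X (lift i j) w | j < m]).
  apply/measurable_fun_tnthP => j.
  rewrite (_ : _ \o _ = X (lift i j)); first exact: measurable_funPT.
  by apply/funext => w /=; rewrite tnth_mktuple.
pose Z : {RV P >-> m.-tuple T} := mfun_Sub (mem_set mZ).
pose E := [set z : T * m.-tuple T | C z.1 /\
  (lam * t <= lam * \sum_(j < m) \1_A (z.1, tnth z.2 j))%R].
have mE : measurable E.
  rewrite /E -[X in measurable X]setTI.
  rewrite (_ : [set z | _] = (fst @^-1` C) `&` [set z : T * m.-tuple T |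
     (lam * t <= lam * \sum_(j < m) \1_A (z.1, tnth z.2 j))%R])//.
  rewrite setIA; apply: measurable_fun_le => //.
    by rewrite setTI -[X in measurable X]setTI; exact: measurable_fst.
  apply: measurable_funM => //; apply: measurable_sum => j.
  apply: (measurableT_comp (measurable_indic mA)).
  apply: measurable_funTS; apply: measurable_fun_pair => //.
  by apply: (measurableT_comp (measurable_tnth j)).
have -> : [set w | C (X i w) /\
     (lam * t <= lam * \sum_(j < m) \1_A (X i w, X (lift i j) w))%R] =
    [set w | E (X i w, Z w)].
  apply/seteqP; split=> w; rewrite /E/= => -[Cw h]; split=> //; move: h;
    by congr (_ <= _ * _); apply: eq_bigr => j _; rewrite tnth_mktuple.
rewrite (joint_law_tuple _ indX)//.
set b := expR _.
(* For frozen x the bound holds with the same constant on every section: the section is empty when x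
   is not in C, and otherwise [hp] compares the probability of the section of A with p in the
   direction given by the sign of e^lam - 1. *)
have hZ x : (distribution P Z (xsection E x) <= b%:E)%E.
  have [Cx|nCx] := pselect (C x); last first.
    rewrite (_ : xsection E x = set0) ?measure0 ?lee_fin ?expR_ge0//.
    by apply/seteqP; split=> z //=; rewrite /xsection/= inE => -[].
  have mAx : measurable (xsection A x) by exact: measurable_xsection.
  pose V (j : 'I_m) := X (lift i j) @^-1` xsection A x.
  have mV j : measurable (V j).
    by rewrite -[X in measurable X]setTI; exact: measurable_funPT.
  have q0 : 0 <= fine (mu (xsection A x)) by rewrite fine_ge0.
  have q1 : fine (mu (xsection A x)) <= 1.
    by rewrite -lee_fin fineK ?fin_num_measure// probability_le1.
  have hV (S : {set 'I_m}) : P [set w | forall j, j \in S -> V j w] =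
      ((fine (mu (xsection A x))) ^+ #|S|)%:E.
    transitivity (P [set w | forall k, k \in (lift i @: S)%SET -> xsection A x (X k w)]).
      congr (P _); apply/seteqP; split=> w /= h.
        by move=> k /imsetP[j jS ->]; exact: h.
      by move=> j jS; apply: h; apply/imsetP; exists j.
    have := indX (lift i @: S)%SET (fun=> xsection A x) (fun=> mAx).
    move=> ->; rewrite big_imset/=; last by move=> j k _ _; exact: lift_inj.
    under eq_bigr do rewrite lawX//.
    by rewrite -prodr_const -prodEFin; apply: eq_bigr => j _; rewrite fineK ?fin_num_measure.
  have VA j w : \1_(V j) w = \1_A (x, X (lift i j) w) :> R.
    rewrite !indicE (_ : (w \in V j) = ((x, X (lift i j) w) \in A))//.
    by apply/idP/idP; rewrite [X in X -> _]inE inE /V /xsection/= inE.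
  have := @chernoff_events _ _ P m V _ lam t mV hV q0 q1.
  rewrite (_ : [set w | _] = Z @^-1` xsection E x); last first.
    apply/seteqP; split=> w; rewrite /xsection/= inE/E/= => h.
      split => //; move: h; congr (_ <= _ * _).
      by apply: eq_bigr => j _; rewrite VA tnth_mktuple.
    have {h} [_] := h; congr (_ <= _ * _).
    by apply: eq_bigr => j _; rewrite VA tnth_mktuple.
  move=> /le_trans; apply; rewrite lee_fin ler_expR lerD2r ler_wpM2l//.
  exact: hp.
rewrite [leLHS](_ : _ = \int[distribution P (X i)]_x distribution P Z (xsection E x))%E//.
apply: (@le_trans _ _ (\int[distribution P (X i)]_x cst b%:E x)%E).
  apply: ge0_le_integral => //.
  by apply: measurable_fun_xsection.
rewrite integral_cst// [X in (_ * X)%E](_ : _ = 1%E) ?mule1//.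
exact: probability_setT.
Qed.

End chernoff.

(** * Multinomial law of the numbers of points in disjoint cells *)

Section cells.
Context {R : realType}.

Lemma measure_bigcup_finType d (T : measurableType d) (mu : {measure set T -> \bar R})
    (I : finType) (S : pred I) (F : I -> set T) :
  (forall i, S i -> measurable (F i)) -> trivIset [set i | S i] F ->
  mu (\bigcup_(i in [set i | S i]) F i) = (\sum_(i | S i) mu (F i))%E.
Proof.
move=> mF tF; rewrite measure_fin_bigcup//; last exact: finite_finset.
rewrite (fsbigE (enum S)) ?enum_uniq//=.
- rewrite big_enum_cond/=; apply: eq_bigl => i.
  by apply/andP/idP => [[]//|Si]; split=> //; rewrite inE.
- by move=> i /=; rewrite mem_enum.
- by move=> i Si; rewrite mem_enum [_ \in _]Si.
Qed.

Lemma bigcup_finType_measurable d (T : measurableType d)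
    (I : finType) (S : pred I) (F : I -> set T) :
  (forall i, S i -> measurable (F i)) ->
  measurable (\bigcup_(i in [set i | S i]) F i).
Proof. by move=> mF; apply: fin_bigcup_measurable => //; exact: finite_finset. Qed.

Lemma independent_forall d (Omega : measurableType d) (P : probability Omega R)
    (I : finType) d' (T : measurableType d') (X : I -> {RV P >-> T})
    (mu : probability T R) (B : I -> set T) :
  iid_of_law P (fun i w => X i w) mu -> (forall i, measurable (B i)) ->
  P [set w | forall i, B i (X i w)] = (\prod_i fine (mu (B i)))%:E.
Proof.
move=> [indX lawX] mB; have := indX [set: I]%SET B mB.
rewrite (_ : [set w | _] = [set w | forall i, B i (X i w)]); last first.
  by apply/seteqP; split=> w /= h i; [apply: h; rewrite inE|move=> _; exact: h].
move=> ->; rewrite -prodEFin; apply: eq_big => [i|i _]; first by rewrite inE.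
by rewrite lawX// fineK ?fin_num_measure.
Qed.

Lemma measurable_RV_forall d (Omega : measurableType d) (P : probability Omega R)
    (I : finType) d' (T : measurableType d') (X : I -> {RV P >-> T}) (B : I -> set T) :
  (forall i, measurable (B i)) -> measurable [set w | forall i, B i (X i w)].
Proof.
move=> mB.
rewrite [X in measurable X](_ : _ = \bigcap_(i in [set: I]) (X i @^-1` B i)).
  apply: fin_bigcap_measurable; first exact: finite_finset.
  by move=> i _; rewrite -[X in measurable X]setTI; exact: measurable_funPT.
by apply/seteqP; split=> w /= h i; [move=> _|]; exact: h.
Qed.

(** The multinomial weight of j points in m cells and a remainder of probability [p0], written as
    successive choices of the points of the last cell. When more points are requested than remain,
    the binomial coefficient vanishes, so the truncated difference is harmless. *)
Fixpoint cells_pmf (p : nat -> R) (p0 : R) (k : nat -> nat) (m j : nat) : R :=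
  if m is m'.+1 then
    'C(j, k m')%:R * p m' ^+ k m' * cells_pmf p p0 k m' (j - k m')
  else p0 ^+ j.

(** Indices outside J carry individual constraints B. They record the points that an induction on
    the number of cells has already placed, which is what makes the event stable under removing one
    cell. *)
Definition cells_event d (Omega : measurableType d) (I : finType) (T : Type)
    (X : I -> Omega -> T) (C : nat -> set T) (k : nat -> nat) (D : set T)
    (m : nat) (J : {set I}) (B : I -> set T) : set Omega :=
  [set w | [/\ forall i, i \in J -> (exists2 l, (l < m)%N & C l (X i w)) \/ D (X i w),
    forall l, (l < m)%N -> #|[pred i in J | `[< C l (X i w) >]]| = k l &
    forall i, i \notin J -> B i (X i w)]].

(** Induction on m: the event splits according to the set J1 of indices whose point lies in the last
    cell. These indices leave J and receive the constraint C m. For m = 0 every index has its own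
    constraint and independence applies directly. *)
Lemma cells_eventP d (Omega : measurableType d) (P : probability Omega R)
    (I : finType) d' (T : measurableType d') (X : I -> {RV P >-> T})
    (mu : probability T R) (C : nat -> set T) (k : nat -> nat) (D : set T) :
  iid_of_law P (fun i w => X i w) mu ->
  (forall l, measurable (C l)) -> measurable D ->
  (forall l l', l <> l' -> C l `&` C l' = set0) -> (forall l, C l `&` D = set0) ->
  forall m (J : {set I}) (B : I -> set T), (forall i, measurable (B i)) ->
  measurable (cells_event (fun i w => X i w) C k D m J B) /\
  P (cells_event (fun i w => X i w) C k D m J B) =
  (cells_pmf (fun l => fine (mu (C l))) (fine (mu D)) k m #|J| *
   \prod_(i in ~: J) fine (mu (B i)))%:E.
Proof.
move=> iidX mC mD CC CD; elim=> [|m IH] J B mB.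
  pose B' i := if i \in J then D else B i.
  have mB' i : measurable (B' i) by rewrite /B'; case: ifP.
  have -> : cells_event (fun i w => X i w) C k D 0 J B = [set w | forall i, B' i (X i w)].
    apply/seteqP; split=> w /=.
      move=> [h1 _ h2] i; rewrite /B'; case: ifPn => [/h1[[]//|//]|]; exact: h2.
    move=> h; split=> // i iJ; have := h i; rewrite /B' ?iJ; first by right.
    by rewrite (negbTE iJ).
  split; first exact: measurable_RV_forall.
  rewrite (independent_forall iidX)//; congr EFin.
  rewrite (bigID (fun i => i \in J))/=; congr (_ * _).
    under eq_bigr => i iJ do rewrite /B' iJ.
    by rewrite prodr_const.
  apply: eq_big => [i|i /negbTE iJ]; first by rewrite inE.
  by rewrite /B' iJ.
pose S (J1 : {set I}) := (J1 \subset J) && (#|J1| == k m).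
pose B' (J1 : {set I}) i := if i \in J1 then C m else B i.
have mB' J1 i : measurable (B' J1 i) by rewrite /B'; case: ifP.
pose F J1 := cells_event (fun i w => X i w) C k D m (J :\: J1)%SET (B' J1).
have nCD x l : C l x -> ~ D x.
  by move=> Cx Dx; have : (C l `&` D) x by []; rewrite CD.
have nCC x l l' : (l < l')%N -> C l x -> ~ C l' x.
  move=> ll' Cx Cx'; have : (C l `&` C l') x by [].
  by rewrite CC// => ll'E; rewrite ll'E ltnn in ll'.
(* J1 is determined by w, which makes the pieces of the decomposition disjoint. *)
have FJ1 J1 w : S J1 -> F J1 w -> J1 = [set i in J | `[< C m (X i w) >]]%SET.
  move=> /andP[J1J _] [h1 _ h2]; apply/setP => i; rewrite !inE.
  case: (boolP (i \in J1)) => [iJ1|niJ1].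
    have := h2 i; rewrite inE iJ1/= => /(_ erefl); rewrite /B' iJ1 => Ci.
    by rewrite (fintype.subsetP J1J)//=; apply/esym/asboolP.
  case: (boolP (i \in J)) => //= iJ; apply/esym/asboolP.
  have := h1 i; rewrite inE niJ1 iJ => /(_ erefl)[[l lm Cl]|Di].
    exact: nCC lm Cl.
  by move=> /nCD.
have EF : cells_event (fun i w => X i w) C k D m.+1 J B =
    \bigcup_(J1 in [set J1 | S J1]) F J1.
  apply/seteqP; split=> w.
    move=> [h1 h2 h3]; exists [set i in J | `[< C m (X i w) >]]%SET => /=.
      apply/andP; split; first by apply/fintype.subsetP => i; rewrite inE => /andP[].
      by rewrite -(h2 m)//; apply/eqP; apply: eq_card => i; rewrite !inE.
    split.
    - move=> i; rewrite !inE => /andP[+ iJ]; rewrite iJ/= => /asboolPn nCm.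
      have [[l lm Cl]|] := h1 i iJ; last by right.
      left; exists l => //; move: lm; rewrite ltnS leq_eqVlt => /orP[/eqP lE|//].
      by exfalso; apply: nCm; rewrite -lE.
    - move=> l lm; rewrite -(h2 l); last by rewrite ltnS ltnW.
      apply: eq_card => i; rewrite !inE; case: (boolP (i \in J)) => iJ; rewrite ?andbF//=.
      rewrite andbT; case: (boolP `[< C l (X i w) >]); rewrite ?andbF ?andbT//.
      by move/asboolP => Cl; apply/asboolPn; exact: nCC lm Cl.
    - move=> i; rewrite /B' !inE negb_and negbK.
      case: (boolP (i \in J)) => //= iJ; last by move=> _; exact: h3.
      by rewrite orbF => Ci; rewrite Ci; exact/asboolP.
  move=> [J1 SJ1 FJ]; have J1E := FJ1 _ _ SJ1 FJ; case: FJ => h1 h2 h3.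
  move: SJ1 => /andP[J1J /eqP cJ1]; split.
  - move=> i iJ; case: (boolP (i \in J1)) => iJ1.
      left; exists m => //; have := h3 i; rewrite /B' inE iJ1/=; exact.
    have [||] := h1 i; [by rewrite inE iJ1 iJ| |by right].
    by move=> [l lm Cl]; left; exists l => //; rewrite ltnS ltnW.
  - move=> l; rewrite ltnS leq_eqVlt => /orP[/eqP ->|lm].
      by rewrite -cJ1 J1E; apply: eq_card => i; rewrite !inE.
    rewrite -(h2 l)//; apply: eq_card => i; rewrite !inE; case: (boolP (i \in J)) => iJ; rewrite ?andbF//=.
    case: (boolP `[< C l (X i w) >]); rewrite ?andbF ?andbT// => /asboolP Cl.
    by apply/esym; rewrite J1E inE iJ/=; apply/asboolPn; exact: nCC lm Cl.
  - move=> i niJ; have := h3 i; rewrite /B' inE (negbTE niJ) andbF => /(_ erefl).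
    by rewrite ifN//; apply: contra niJ; exact: (fintype.subsetP J1J).
rewrite EF; split.
  by apply: bigcup_finType_measurable => J1 SJ1; have [] := IH (J :\: J1)%SET (B' J1) (mB' J1).
rewrite measure_bigcup_finType; last 2 first.
- by move=> J1 SJ1; have [] := IH (J :\: J1)%SET (B' J1) (mB' J1).
- by move=> J1 J2 S1 S2 [w [F1 F2]]; rewrite (FJ1 _ _ S1 F1) (FJ1 _ _ S2 F2).
transitivity (\sum_(J1 | S J1) (fine (mu (C m)) ^+ k m *
    cells_pmf (fun l => fine (mu (C l))) (fine (mu D)) k m (#|J| - k m) *
   \prod_(i in ~: J) fine (mu (B i)))%:E)%E.
  apply: eq_bigr => J1 SJ1; have [_ IHJ] := IH (J :\: J1)%SET (B' J1) (mB' J1).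
  etransitivity; first exact: IHJ.
  move: SJ1 => /andP[J1J /eqP cJ1].
  rewrite cardsDS// cJ1; congr EFin; rewrite [_ ^+ _ * _]mulrC -mulrA; congr (_ * _).
  rewrite (bigID (fun i => i \in J1))/=; congr (_ * _).
    rewrite -cJ1 -prodr_const; apply: eq_big => [i|i /andP[_ iJ1]].
      by rewrite !inE; do 2!case: (_ \in _).
    by rewrite /B' iJ1.
  apply: eq_big => [i|i /andP[_ /negbTE iJ1]]; last by rewrite /B' iJ1.
  by have := fintype.subsetP J1J i; rewrite !inE; do 2!case: (_ \in _) => //=; move/(_ isT).
(* All J1 contribute the same value, and they are counted by the binomial coefficient of
   [cells_pmf]. *)
rewrite sumEFin big_const/=; congr EFin.
rewrite iter_addr_0 -[LHS]mulr_natl -!mulrA; congr (_%:R * _).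
rewrite -cards_draws; apply: eq_card => J1; rewrite !inE//.
Qed.

End cells.

(** * Poisson limit of multinomial probabilities *)

Section poisson_limit.
Context {R : realType}.
Implicit Types (p x : nat -> R) (lam : R).

Lemma cvg_natV : (n%:R^-1 : R) @[n --> \oo] --> (0 : R).
Proof.
apply/gtr0_cvgV0; last exact: cvgr_idn.
by near=> n; rewrite ltr0n; near: n; exists 1%N.
Unshelve. all: by end_near. Qed.

Lemma cvg_mulrn_cst0 x lam : n%:R * x n @[n --> \oo] --> lam -> x n @[n --> \oo] --> 0.
Proof.
move=> nx; rewrite -(mul0r lam).
have : (n%:R^-1 : R) * (n%:R * x n) @[n --> \oo] --> 0 * lam.
  by apply: cvgM => //; exact: cvg_natV.
apply: cvg_trans; apply: near_eq_cvg; near=> n.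
by rewrite mulrA mulVf ?mul1r// pnatr_eq0 -lt0n; near: n; exists 1%N.
Unshelve. all: by end_near. Qed.

Lemma cvg_subn_mul c x lam : n%:R * x n @[n --> \oo] --> lam ->
  (n - c)%:R * x n @[n --> \oo] --> lam.
Proof.
move=> nx; have : n%:R * x n - c%:R * x n @[n --> \oo] --> lam - c%:R * 0.
  apply: cvgB => //; apply: cvgMl_tmp; exact: cvg_mulrn_cst0 nx.
rewrite mulr0 subr0; apply: cvg_trans; apply: near_eq_cvg; near=> n.
by rewrite -mulrBl natrB//; near: n; exists c.
Unshelve. all: by end_near. Qed.

(** Since (k+1) C(n-c, k+1) = (n-c-k) C(n-c, k), each step contributes the factor (n-c-k) p n /
    (k+1), which tends to lam / (k+1). The offset c stands for points already placed in other
    cells. *)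
Lemma cvg_binomial_mul c k p lam : n%:R * p n @[n --> \oo] --> lam ->
  'C(n - c, k)%:R * p n ^+ k @[n --> \oo] --> lam ^+ k / k`!%:R.
Proof.
move=> np; elim: k => [|k IH].
  by under eq_fun do rewrite bin0 expr0 mulr1; rewrite expr0 fact0 divr1; exact: cvg_cst.
rewrite (_ : lam ^+ k.+1 / _ = (lam ^+ k / k`!%:R) * (lam / k.+1%:R)); last first.
  by rewrite exprSr factS natrM invfM [X in _ * X]mulrC mulrACA.
apply: cvg_trans (cvgM IH (cvgMr_tmp (b := k.+1%:R^-1) (cvg_subn_mul (c + k) np))).
apply: near_eq_cvg; near=> n => /=.
have := mul_bin_left (n - c) k => /(congr1 (fun n => n%:R : R)).
rewrite !natrM => h; rewrite exprS subnDA.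
apply: (@mulfI _ k.+1%:R); first by rewrite pnatr_eq0.
rewrite [RHS]mulrA h; field.
by rewrite addrC natr1 pnatr_eq0.
Unshelve. all: by end_near. Qed.

Lemma expr_1B_le (x : R) N : 0 <= x <= 1 -> (1 - x) ^+ N <= expR (- (N%:R * x)) :> R.
Proof.
move=> /andP[x0 x1]; rewrite -mulrN expRM_natl lerXn2r ?nnegrE ?expR_ge0 ?subr_ge0//.
exact: expR_ge1Dx.
Qed.

(** Invert 1 / (1 - x) = 1 + x / (1 - x) <= exp(x / (1 - x)). *)
Lemma expr_1B_ge (x : R) N : 0 <= x < 1 -> expR (- (N%:R * (x / (1 - x)))) <= (1 - x) ^+ N :> R.
Proof.
move=> /andP[x0 x1]; rewrite -mulrN expRM_natl lerXn2r ?nnegrE ?expR_ge0 ?subr_ge0 ?(ltW x1)//.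
rewrite expRN -[leRHS]invrK lef_pV2 ?posrE ?expR_gt0 ?invr_gt0 ?subr_gt0//.
apply: le_trans (expR_ge1Dx _).
by rewrite le_eqVlt; apply/orP; left; apply/eqP; field; lra.
Qed.

Lemma cvg_expr_exp c x lam : (\forall n \near \oo, 0 <= x n) ->
  n%:R * x n @[n --> \oo] --> lam ->
  (1 - x n) ^+ (n - c) @[n --> \oo] --> expR (- lam).
Proof.
move=> x0 nx; have nx' := cvg_subn_mul c nx.
have xz := cvg_mulrn_cst0 nx.
apply: (@squeeze_cvgr _ _ _ _ (fun n => expR (- ((n - c)%:R * (x n / (1 - x n)))))
    (fun n => expR (- ((n - c)%:R * x n)))).
- near=> n.
  have h0 : 0 <= x n by near: n.
  have h1 : x n < 1 by near: n; apply: (cvgr_lt _ xz); exact: ltr01.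
  by apply/andP; split; [apply: expr_1B_ge|apply: expr_1B_le]; rewrite h0 ?(ltW h1).
- apply: continuous_cvg; [exact: continuous_expR|apply: cvgN].
  under eq_fun do rewrite mulrA.
  rewrite (_ : lam = lam / (1 - 0)); last by rewrite subr0 divr1.
  by apply: cvgM => //; apply: cvgV; [rewrite subr0 oner_neq0|apply: cvgB => //; exact: cvg_cst].
- by apply: continuous_cvg; [exact: continuous_expR|apply: cvgN].
Unshelve. all: by end_near. Qed.

(** Once the last cell has received its points, fewer points remain by a fixed number. Generalising
    over the offset c lets the induction absorb this, and a bounded offset changes no limit. The
    factor exp(-Lam) comes from the points that lie in no cell. *)
Lemma cells_pmf_cvg (p : nat -> nat -> R) (p0 : nat -> R) (lam : nat -> R) Lam k m c :
  (forall l, (l < m)%N -> n%:R * p n l @[n --> \oo] --> lam l) ->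
  (\forall n \near \oo, p0 n <= 1) ->
  n%:R * (1 - p0 n) @[n --> \oo] --> Lam ->
  cells_pmf (p n) (p0 n) k m (n - c) @[n --> \oo] -->
    (\prod_(l < m) (lam l ^+ k l / (k l)`!%:R)) * expR (- Lam).
Proof.
move=> + p01 np0; elim: m c => [|m IH] c np /=.
  rewrite big_ord0 mul1r.
  rewrite (_ : (fun n => _) = (fun n => (1 - (1 - p0 n)) ^+ (n - c))); last first.
    by apply/funext => n; rewrite opprB addrC subrK.
  by apply: cvg_expr_exp => //; near do rewrite subr_ge0.
rewrite big_ord_recr/= [X in X * _]mulrC -mulrA; apply: cvgM.
  by apply: cvg_binomial_mul; exact: np.
under eq_fun do rewrite -subnDA.
by apply: IH => l lm; apply: np; rewrite ltnS ltnW.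
Unshelve. all: by end_near. Qed.

End poisson_limit.

(** * Convergence in distribution *)

Section portmanteau.
Context {R : realType}.

Lemma integrable_EFinD d (T : measurableType d) (mu : {measure set T -> \bar R})
    (D : set T) (f g : T -> R) : measurable D -> mu.-integrable D (EFin \o f) ->
  mu.-integrable D (EFin \o g) -> mu.-integrable D (EFin \o (fun x => f x + g x)).
Proof.
by move=> mD intf intg; apply: eq_integrable (integrableD mD intf intg) => // x _ /=; rewrite EFinD.
Qed.

Lemma bounded_integrable_prob d (Omega : measurableType d) (P : probability Omega R)
    (f : Omega -> R) (M : R) : measurable_fun setT f -> (forall w, `|f w| <= M) ->
  P.-integrable setT (EFin \o f).
Proof.
move=> mf fM; apply: measurable_bounded_integrable => //.
  by rewrite (le_lt_trans (probability_le1 _ _))// ltry.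
exists M; split; first exact: num_real.
by move=> x Mx w _ /=; rewrite (le_trans (fM w))// ltW.
Qed.

Lemma random_element_continuous d (Omega : measurableType d) (T : topologicalType)
    (X : Omega -> T) (F : T -> R) : random_element X -> continuous F ->
  measurable_fun setT (F \o X).
Proof.
move=> rX cF _; apply: (measurability _ (RGenOInfty.measurableE R)) => //= _ [_ [a ->] <-]; rewrite setTI comp_preimage; apply: rX.
by apply: open_comp => //; exact: rray_open.
Qed.

Lemma measurable_sum_seq d (Omega : measurableType d) (S : eqType) (K : seq S)
    (f : S -> Omega -> R) : (forall k, k \in K -> measurable_fun setT (f k)) ->
  measurable_fun setT (fun w => \sum_(k <- K) f k w).
Proof.
elim: K => [|k K IH] mf.
  by rewrite (_ : (fun _ => _) = cst 0)//; apply/funext => w; rewrite big_nil.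
rewrite (_ : (fun _ => _) = f k \+ (fun w => \sum_(k <- K) f k w)); last first.
  by apply/funext => w; rewrite big_cons.
apply: measurable_funD; first by apply: mf; rewrite mem_head.
by apply: IH => l lK; apply: mf; rewrite inE lK orbT.
Qed.

Lemma cvg_sum_seq (S : eqType) (K : seq S) (f : S -> nat -> R) (l : S -> R) :
  (forall k, k \in K -> f k n @[n --> \oo] --> l k) ->
  \sum_(k <- K) f k n @[n --> \oo] --> \sum_(k <- K) l k.
Proof.
elim: K => [|k K IH] fl.
  rewrite big_nil (_ : (fun _ => _) = cst 0); first exact: cvg_cst.
  by apply/funext => n; rewrite big_nil.
rewrite big_cons (_ : (fun _ => _) = f k \+ (fun n => \sum_(k <- K) f k n)); last first.
  by apply/funext => n; rewrite big_cons.
apply: cvgD; first by apply: fl; rewrite mem_head.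
by apply: IH => i iK; apply: fl; rewrite inE iK orbT.
Qed.

Lemma Rintegral_prob_sum_indic d (Omega : measurableType d) (P : probability Omega R)
    (S : eqType) (K : seq S) (a : S -> R) (A : S -> set Omega) :
  (forall k, k \in K -> measurable (A k)) ->
  \int[P]_w (\sum_(k <- K) a k * \1_(A k) w) = \sum_(k <- K) a k * fine (P (A k)).
Proof.
move=> mAK; pose A' k := if k \in K then A k else set0.
have mA k : measurable (A' k) by rewrite /A'; case: ifPn => [/mAK//|_]; exact: measurable0.
transitivity (\int[P]_w (\sum_(k <- K) a k * \1_(A' k) w)).
  by apply: eq_Rintegral => w _; apply: eq_big_seq => k kK; rewrite /A' kK.
transitivity (\sum_(k <- K) a k * fine (P (A' k))); last first.
  by apply: eq_big_seq => k kK; rewrite /A' kK.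
rewrite /Rintegral; under eq_integral do rewrite -sumEFin.
rewrite integral_sum//; last first.
  by move=> k; under eq_fun do rewrite EFinM; apply: integrableZl => //; exact: integrable_indic.
have intE k : (\int[P]_w (a k * \1_(A' k) w)%:E = (a k * fine (P (A' k)))%:E)%E.
  under eq_integral do rewrite EFinM; rewrite integralZl//; last exact: integrable_indic.
  by rewrite -probability_indicE// EFinM fineK// fin_num_measure.
by under eq_bigr do rewrite intE; rewrite sumEFin.
Qed.

Lemma Rintegral_prob_cst d (Omega : measurableType d) (P : probability Omega R) (r : R) :
  \int[P]_w r = r.
Proof.
by rewrite /Rintegral integral_cst// [X in (_ * X)%E](_ : _ = 1%E) ?mule1//; exact: probability_setT.
Qed.

Section statistics.
Unset Implicit Arguments.
Variables (T : topologicalType) (d : nat -> measure_display)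
  (Omega : forall n, measurableType (d n)) (P : forall n, probability (Omega n) R)
  (X : forall n, Omega n -> T) (d' : measure_display)
  (Omega' : measurableType d') (Q : probability Omega' R) (Y : Omega' -> T).
(** Discrete statistics whose classes are eventually contained in every neighbourhood of the point.
    Only finitely many classes, carrying almost all of the limit mass, must be measurable with
    converging probabilities, so [c N] may take values in a large type without sigma-algebra. *)
Variables (S : nat -> eqType) (c : forall N, T -> S N).
Hypothesis rX : forall n, random_element (X n).
Hypothesis rY : random_element Y.
Hypothesis c_refines : forall (x : T) (U : set T), open U -> U x ->
  exists N0, forall N, (N0 <= N)%N -> forall y, c N y = c N x -> U y.
Hypothesis c_law : forall N (e : R), 0 < e -> exists K : seq (S N), [/\ uniq K,
  forall k, k \in K -> [/\ (forall n, measurable (X n @^-1` (c N @^-1` [set k]))),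
     measurable (Y @^-1` (c N @^-1` [set k])) &
     fine (P n (X n @^-1` (c N @^-1` [set k]))) @[n --> \oo] -->
       fine (Q (Y @^-1` (c N @^-1` [set k])))] &
  1 - e < \sum_(k <- K) fine (Q (Y @^-1` (c N @^-1` [set k])))].

Set Implicit Arguments.

(** [g N] replaces F + M by its infimum on each retained class and by 0 elsewhere, adding M so that
    0 is a lower bound; its integral under [P n] converges with n. Under Q little is lost: on
    retained classes the loss tends to 0 pointwise by refinement and continuity, hence in mean by
    dominated convergence, and the other classes have mass below 1/(N+1). *)
Lemma statistics_liminf (F : T -> R) (M : R) : continuous F -> (forall x, `|F x| <= M) ->
  forall e, 0 < e -> \forall n \near \oo,
    \int[Q]_w F (Y w) - e <= \int[P n]_w F (X n w).
Proof.
move=> cF FM e e0.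
have M0 : 0 <= M by exact: le_trans (FM (Y point)).
have e1 N : 0 < N.+1%:R^-1 :> R by rewrite invr_gt0 ltr0n.
pose K_ N := sval (cid (c_law N _ (e1 N))).
have hK N : [/\ uniq (K_ N),
  forall k, k \in K_ N -> [/\ (forall n, measurable (X n @^-1` (c N @^-1` [set k]))),
     measurable (Y @^-1` (c N @^-1` [set k])) &
     fine (P n (X n @^-1` (c N @^-1` [set k]))) @[n --> \oo] -->
       fine (Q (Y @^-1` (c N @^-1` [set k])))] &
  1 - N.+1%:R^-1 < \sum_(k <- K_ N) fine (Q (Y @^-1` (c N @^-1` [set k])))] :=
  svalP (cid (c_law N _ (e1 N))).
pose A N k := Y @^-1` (c N @^-1` [set k]).
pose a N k := inf (F @` (c N @^-1` [set k])) + M.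
have Fge x : - M <= F x by have := FM x; rewrite ler_norml => /andP[].
have Fle x : F x <= M by have := FM x; rewrite ler_norml => /andP[].
have lbF N k : has_lbound (F @` (c N @^-1` [set k])).
  by exists (- M) => _ [x _ <-].
have aF N x : a N (c N x) <= F x + M.
  by rewrite lerD2r; apply: ge_inf => //; exists x.
have a0 N x : 0 <= a N (c N x).
  rewrite /a -lerBlDr sub0r; apply: lb_le_inf; first by exists (F x); exists x.
  by move=> _ [y _ <-].
pose g N x := \sum_(k <- K_ N) a N k * \1_(c N @^-1` [set k]) x.
pose s N x := \sum_(k <- K_ N) (1 : R) * \1_(c N @^-1` [set k]) x.
have sumE N (b : S N -> R) x : \sum_(k <- K_ N) b k * \1_(c N @^-1` [set k]) x =
    if c N x \in K_ N then b (c N x) else 0.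
  have [uK _ _] := hK N; case: ifPn => cK.
    rewrite (bigD1_seq (c N x))//= indicE mem_set// mulr1 big1 ?addr0// => k kc.
    by rewrite indicE memNset ?mulr0// => ck; rewrite -ck eqxx in kc.
  rewrite big_seq big1// => k kK; rewrite indicE memNset ?mulr0// => ck.
  by rewrite ck kK in cK.
have gF N x : g N x <= F x + M.
  by rewrite /g sumE; case: ifP => _ //; rewrite -lerBlDr sub0r.
have g0 N x : 0 <= g N x by rewrite /g sumE; case: ifP.
have s01 N x : 0 <= s N x <= 1 by rewrite /s sumE; case: ifP => _; rewrite ?ler01 lexx.
have mgY N : measurable_fun setT (g N \o Y).
  rewrite /g (_ : _ \o _ = fun w => \sum_(k <- K_ N) a N k * \1_(A N k) w)//.
  apply: measurable_sum_seq => k kK; apply: measurable_funM => //.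
  by apply: measurable_indic; have [_ /(_ k kK)[]] := hK N.
have msY N : measurable_fun setT (s N \o Y).
  rewrite /s (_ : _ \o _ = fun w => \sum_(k <- K_ N) 1 * \1_(A N k) w)//.
  apply: measurable_sum_seq => k kK; apply: measurable_funM => //.
  by apply: measurable_indic; have [_ /(_ k kK)[]] := hK N.
have mFY := random_element_continuous rY cF.
have intFY : Q.-integrable setT (EFin \o (F \o Y)) 
  by apply: (bounded_integrable_prob _ mFY) => w; exact: FM.
have g2M N x : g N x <= 2 * M by rewrite (le_trans (gF N x))// mulrDl !mul1r lerD2r.
have intgY N : Q.-integrable setT (EFin \o (g N \o Y)).
  by apply: (bounded_integrable_prob (M := 2 * M) _ (mgY N)) => w; rewrite ger0_norm ?g2M//; exact: g0.
have intsY N : Q.-integrable setT (EFin \o (s N \o Y)).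
  apply: (bounded_integrable_prob (M := 1) _ (msY N)) => w.
  by have /andP[? ?] := s01 N (Y w); rewrite ger0_norm.
pose D N w := (F (Y w) + M - g N (Y w)) * s N (Y w).
have D0 w N : 0 <= D N w.
  by rewrite mulr_ge0//; [rewrite subr_ge0|have /andP[] := s01 N (Y w)].
have mD N : measurable_fun setT (D N).
  have mFM : measurable_fun setT (fun w => F (Y w) + M) by exact: measurable_funD.
  exact: (measurable_funM (measurable_funB mFM (mgY N)) (msY N)).
have D2M N w : D N w <= 2 * M.
  rewrite /D; have /andP[s0 s1] := s01 N (Y w); have := g0 N (Y w); have := Fle (Y w).
  by have := gF N (Y w); nra.
have intD N : Q.-integrable setT (EFin \o D N).
  by apply: (bounded_integrable_prob (M := 2 * M) _ (mD N)) => w; rewrite ger0_norm ?D2M.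
have D_cvg w : D N w @[N --> \oo] --> 0.
  apply/cvgr0Pnorm_le => r r0.
  have oU : open (F @^-1` `]F (Y w) - r, +oo[).
    by apply: open_comp => //; exact: rray_open.
  have [|N0 hN0] := c_refines (Y w) _ oU.
    by rewrite /= in_itv/= andbT ltrBlDr ltrDl.
  near=> N; rewrite ger0_norm//.
  rewrite /D /g /s !sumE; case: ifPn => _; last by rewrite mulr0 ltW.
  rewrite mulr1 /a opprD addrA addrAC addrK lerBlDr -lerBlDl.
  apply: lb_le_inf; first by exists (F (Y w)); exists (Y w).
  move=> _ [y cy <-]; have := hN0 N _ y cy.
  rewrite /= in_itv/= andbT => h; apply/ltW/h.
  by near: N; exists N0.
have intD_cvg : \int[Q]_w D N w @[N --> \oo] --> 0.
  rewrite -(Rintegral_prob_cst Q 0); apply: fine_cvg.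
  rewrite /Rintegral fineK; last first.
    by rewrite integral_cst// mul0e.
  apply: (@dominated_cvg _ _ _ _ _ _ _ _ (EFin \o cst (2 * M))) => //.
  - by move=> N; apply/measurable_EFinP; exact: mD.
  - by move=> w _; apply: cvg_EFin; [exact: nearW|exact: D_cvg].
  - exact: finite_measure_integrable_cst.
  - by move=> N w _ /=; rewrite lee_fin ger0_norm.
(* N is fixed before n: e/4 for each of the two losses leaves e/2 for the convergence of the
   finitely many class probabilities. *)
have [N [N1 N2]] : exists N, \int[Q]_w D N w <= e / 4 /\ 2 * M * N.+1%:R^-1 <= e / 4.
  have [N1 _ h1] := (cvgr_le _ intD_cvg (e / 4) ltac:(by rewrite divr_gt0)).
  have c2 : 2 * M * N.+1%:R^-1 @[N --> \oo] --> 2 * M * (0 : R).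
    by apply: cvgMl_tmp; exact: cvg_harmonic.
  rewrite mulr0 in c2.
  have [N2 _ h2] := (cvgr_le _ c2 (e / 4) ltac:(by rewrite divr_gt0)).
  by exists (maxn N1 N2); split; [apply: h1|apply: h2]; rewrite /= ?leq_maxl ?leq_maxr.
(* Pointwise F + M <= g + D + 2 M (1 - s), where D is the loss on retained classes and s their
   indicator. *)
have int_le : \int[Q]_w F (Y w) + M <= \int[Q]_w g N (Y w) + e / 2.
  have -> : \int[Q]_w F (Y w) + M = \int[Q]_w (F (Y w) + M).
    by rewrite RintegralD// ?Rintegral_prob_cst//; exact: finite_measure_integrable_cst.
  have intsle : \int[Q]_w (1 - s N (Y w)) <= N.+1%:R^-1.
    rewrite (RintegralB measurableT (finite_measure_integrable_cst Q 1 measurableT) (intsY N)).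
    rewrite Rintegral_prob_cst (@Rintegral_prob_sum_indic _ _ Q _ (K_ N) (fun=> 1) (A N)); last first.
      by move=> k kK; have [_ /(_ k kK)[]] := hK N.
    under eq_bigr do rewrite mul1r.
    by have [_ _ h] := hK N; rewrite lerBlDr -lerBlDl; exact: ltW.
  pose B w := 2 * M * (1 - s N (Y w)).
  have m1s : measurable_fun setT (fun w => 1 - s N (Y w)).
    exact: (measurable_funB (measurable_cst _) (msY N)).
  have mB : measurable_fun setT B by apply: measurable_funM.
  have intB : Q.-integrable setT (EFin \o B).
    apply: (bounded_integrable_prob (M := 2 * M) _ mB) => w.
    by rewrite /B; have /andP[s0 s1] := s01 N (Y w); rewrite ger0_norm; nra.
  have intDB : Q.-integrable setT (EFin \o (D N \+ B)).
    exact: (integrable_EFinD measurableT (intD N) intB).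
  apply: (@le_trans _ _ (\int[Q]_w (g N (Y w) + (D N \+ B) w))).
    apply: le_Rintegral => //.
    - apply: (@bounded_integrable_prob _ _ _ _ (2 * M)) => [|w]; first exact: measurable_funD.
      by rewrite ger0_norm; have := Fle (Y w); have := Fge (Y w); lra.
    - exact: (integrable_EFinD measurableT (intgY N) intDB).
    - move=> w _; rewrite /D /B/=; have /andP[s0 s1] := s01 N (Y w); have := g0 N (Y w).
      by have := Fle (Y w); nra.
  rewrite (RintegralD measurableT (intgY N) intDB) lerD2l (RintegralD measurableT (intD N) intB).
  have -> : \int[Q]_w B w = 2 * M * \int[Q]_w (1 - s N (Y w)).
    rewrite RintegralZl//; apply: (@bounded_integrable_prob _ _ _ _ 1) => // w.
    by have /andP[s0 s1] := s01 N (Y w); rewrite ger0_norm; lra.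
  have M2 : 0 <= 2 * M by rewrite mulr_ge0.
  rewrite (_ : e / 2 = e / 4 + e / 4); last by lra.
  by apply: lerD => //; apply: le_trans N2; exact: ler_wpM2l.
have gP_cvg : \sum_(k <- K_ N) a N k * fine (P n (X n @^-1` (c N @^-1` [set k]))) @[n --> \oo]
    --> \int[Q]_w g N (Y w).
  rewrite (@Rintegral_prob_sum_indic _ _ Q _ (K_ N) (a N) (A N)); last first.
    by move=> k kK; have [_ /(_ k kK)[]] := hK N.
  apply: cvg_sum_seq => k kK; apply: cvgMl_tmp.
  by have [_ /(_ k kK)[]] := hK N.
near=> n.
have : \int[Q]_w g N (Y w) - e / 2 <= \sum_(k <- K_ N) a N k * fine (P n (X n @^-1` (c N @^-1` [set k]))).
  near: n; apply: (cvgr_ge _ gP_cvg); rewrite ltrBlDr ltrDl; by rewrite divr_gt0.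
have : \sum_(k <- K_ N) a N k * fine (P n (X n @^-1` (c N @^-1` [set k]))) <= \int[P n]_w F (X n w) + M.
  rewrite -(@Rintegral_prob_sum_indic _ _ (P n) _ (K_ N) (a N) (fun k => X n @^-1` (c N @^-1` [set k]))); last first.
    by move=> k kK; have [_ /(_ k kK)[]] := hK N.
  have mFX := random_element_continuous (rX n) cF.
  have -> : \int[P n]_w F (X n w) + M = \int[P n]_w (F (X n w) + M).
    rewrite RintegralD// ?Rintegral_prob_cst//; last exact: finite_measure_integrable_cst.
    by apply: (bounded_integrable_prob _ mFX) => w; exact: FM.
  apply: le_Rintegral => //.
  - apply: (@bounded_integrable_prob _ _ _ _ (2 * M)) => [|w]; last first.
      by have := gF N (X n w); have := g0 N (X n w); have := g2M N (X n w) => *; rewrite ger0_norm.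
    apply: measurable_sum_seq => k kK; apply: measurable_funM => //.
    by apply: measurable_indic; have [_ /(_ k kK)[]] := hK N.
  - apply: (@bounded_integrable_prob _ _ _ _ (2 * M)) => [|w]; first exact: measurable_funD.
    by rewrite ger0_norm; have := Fle (X n w); have := Fge (X n w); lra.
  - by move=> w _; exact: gF.
move: int_le; lra.
Unshelve. all: by end_near. Qed.

(** The lower bound applied to F and to -F encloses the limit. *)
Lemma statistics_cvg_in_distribution : cvg_in_distribution P X Q Y.
Proof.
split => // F cF [M FM].
have EE d1 (O1 : measurableType d1) (P1 : probability O1 R) (X1 : O1 -> T) : random_element X1 ->
    'E_P1[F \o X1]%E = (\int[P1]_w F (X1 w))%:E.
  move=> rX1; rewrite expectation.unlock /Rintegral fineK//.
  have mFX := random_element_continuous rX1 cF.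
  have := bounded_integrable_prob P1 mFX (fun w => FM (X1 w)).
  by move=> /integrable_fin_num; apply.
rewrite EE//; under eq_fun do rewrite EE//.
apply: cvg_EFin; first exact: nearW.
apply/cvgrPdist_le => e e0; near=> n.
have h1 : \int[Q]_w F (Y w) - e <= \int[P n]_w F (X n w).
  by near: n; exact: (@statistics_liminf F M).
have : \int[Q]_w (- F (Y w)) - e <= \int[P n]_w (- F (X n w)).
  near: n; apply: (@statistics_liminf (fun x => - F x) M) => //.
    by move=> x; apply: cvgN; exact: cF.
  by move=> x; rewrite normrN.
have N_E d1 (O1 : measurableType d1) (P1 : probability O1 R) (X1 : O1 -> T) : random_element X1 ->
    \int[P1]_w (- F (X1 w)) = - \int[P1]_w F (X1 w).
  move=> rX1; have mFX := random_element_continuous rX1 cF.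
  under eq_Rintegral do rewrite -mulN1r.
  by rewrite (RintegralZl _ _ (bounded_integrable_prob P1 mFX (fun w => FM (X1 w)))) ?mulN1r.
rewrite !N_E//= => h2; move: h1 h2; set u := \int[Q]_w _; set v := \int[P n]_w _ => h1 h2.
by rewrite ler_norml; apply/andP; split; lra.
Unshelve. all: by end_near. Qed.

End statistics.
End portmanteau.

(** * Real random variables with converging upper tails *)

Section real_criterion.
Context {R : realType}.
Unset Implicit Arguments.
Variables (d : nat -> measure_display) (Omega : forall n, measurableType (d n))
  (P : forall n, probability (Omega n) R) (X : forall n, Omega n -> R)
  (d' : measure_display) (Omega' : measurableType d') (Q : probability Omega' R)
  (Y : Omega' -> R).
Set Implicit Arguments.

(** The statistic is the index of x in the grid of step 1/(N+1) on [-(N+1), N+1], clipped at both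
    ends. Its classes are differences of upper-tail events at grid points; as the tails converge at
    every level, the grid can be placed anywhere. The [J N + 1] classes carry all the mass. *)
Lemma cvg_in_distribution_tails :
  (forall n, random_element (X n)) -> random_element Y ->
  (forall a, fine (P n [set w | a <= X n w]) @[n --> \oo] --> fine (Q [set w | a <= Y w])) ->
  cvg_in_distribution P X Q Y.
Proof.
move=> rX rY hP.
pose z N (x : R) := (x + N.+1%:R) * N.+1%:R.
pose J N : nat := (2 * N.+1 ^ 2)%N.
pose c N (x : R) : nat := minn (Num.truncn (z N x)) (J N).
have cge N k x : (0 < k <= J N)%N -> (k <= c N x)%N = (k%:R / N.+1%:R - N.+1%:R <= x).
  move=> /andP[k0 kJ]; rewrite /c leq_min kJ andbT lerBlDr ler_pdivrMr// -/(z N x).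
  by case: k k0 kJ => // k _ _; rewrite truncn_gt_nat.
have rge d1 (O1 : measurableType d1) (Z : O1 -> R) : random_element Z ->
    forall a, measurable [set w | a <= Z w].
  move=> rZ a; have /measurableC := rZ _ (lray_open a).
  congr (measurable _); apply/seteqP; split=> w /=; rewrite in_itv/= => h.
    by rewrite leNgt; apply/negP.
  by apply/negP; rewrite -leNgt.
pose A (O1 : Type) (Z : O1 -> R) N k : set O1 :=
  if k == 0%N then setT else if (k <= J N)%N then [set w | k%:R / N.+1%:R - N.+1%:R <= Z w] else set0.
have mA d1 (O1 : measurableType d1) (Z : O1 -> R) N k : random_element Z -> measurable (A O1 Z N k).
  by move=> rZ; rewrite /A; case: ifP => // _; case: ifP => // _; exact: rge.
have AE O1 Z N k w : A O1 Z N k w <-> (k <= c N (Z w))%N.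
  rewrite /A; case: eqP => [->//|/eqP k0]; case: ifPn => kJ; first by rewrite cge// lt0n k0.
  by split => // h; move: kJ; rewrite (leq_trans h)// geq_minr.
have cellE O1 Z N k : Z @^-1` (c N @^-1` [set k]) = A O1 Z N k `\` A O1 Z N k.+1.
  apply/seteqP; split=> w /=.
    by move=> ck; split; [apply/AE; rewrite ck|move/AE; rewrite ck ltnn].
  move=> [/AE h1 h2]; apply/eqP; rewrite eqn_leq h1 andbT leqNgt; apply/negP => h.
  by apply: h2; apply/AE.
have sub O1 Z N k : A O1 Z N k.+1 `<=` A O1 Z N k.
  by move=> w /AE h; apply/AE; exact: ltnW.
have PT d1 (O1 : measurableType d1) (P1 : probability O1 R) (Z : O1 -> R) N k : random_element Z ->
    measurable (Z @^-1` (c N @^-1` [set k])) /\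
    fine (P1 (Z @^-1` (c N @^-1` [set k]))) = fine (P1 (A O1 Z N k)) - fine (P1 (A O1 Z N k.+1)).
  move=> rZ; rewrite cellE; split; first by apply: measurableD; exact: mA.
  rewrite measureD ?(setIidr (sub _ _ _ _)); [|exact: mA|exact: mA|by rewrite ltey_eq fin_num_measure//; exact: mA].
  by rewrite fineB// fin_num_measure//; exact: mA.
apply: (@statistics_cvg_in_distribution _ _ _ _ _ _ _ _ _ _ (fun=> nat : eqType) c) => //.
- move=> x U oU Ux; have /nbhs_ballP[r /= r0 bU] : nbhs x U by exact: open_nbhs_nbhs.
  (* From this bound on, x avoids both clipped classes and the step of the grid is below r. *)
  have [N0 _ hN0] := nbhs_infty_ger (`|x| + r^-1).
  exists N0 => N /hN0/= hN y cyx; apply: bU.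
  have rV : 0 < r^-1 by rewrite invr_gt0.
  have hN1 : `|x| + r^-1 < N.+1%:R by rewrite (le_lt_trans hN)// ltr_nat.
  have xN : `|x| < N.+1%:R by move: hN1; lra.
  have N1 : 1 <= N.+1%:R :> R by rewrite ler1n.
  have rN : N.+1%:R^-1 < r by rewrite -[ltRHS]invrK ltf_pV2 ?posrE//; have := normr_ge0 x; lra.
  have cJ : (c N x < J N)%N.
    rewrite ltnNge cge ?leqnn ?andbT ?muln_gt0 ?expn_gt0// -ltNge.
    rewrite /J natrM natrX expr2 mulrA mulfK ?pnatr_eq0//.
    by move: xN; rewrite ltr_norml => /andP[]; lra.
  have c0 : (0 < c N x)%N.
    rewrite cge ?muln_gt0 ?expn_gt0// mul1r.
    have : N.+1%:R^-1 <= 1 :> R by rewrite invf_le1.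
    have := ler_norm (- x); rewrite normrN; move: hN; rewrite -natr1.
    by move: rV; move: (r^-1) ((N%:R + 1)^-1) => s q *; lra.
  have := leqnn (c N x); rewrite cge ?c0 ?(ltnW cJ)// => h1.
  have := leqnn (c N x); rewrite -{2}cyx cge ?c0 ?(ltnW cJ)// => h2.
  have := ltnn (c N x); rewrite cge ?cJ// => /negbT; rewrite -ltNge => h3.
  have := ltnn (c N x); rewrite -{2}cyx cge ?cJ// => /negbT; rewrite -ltNge => h4.
  have e1 : (c N x).+1%:R / N.+1%:R = (c N x)%:R / N.+1%:R + N.+1%:R^-1 :> R.
    by rewrite -natr1 mulrDl mul1r.
  rewrite /ball/= ltr_norml; move: h1 h2 h3 h4 rN; rewrite e1.
  move: ((c N x)%:R / N.+1%:R : R) (N.+1%:R^-1 : R) (N.+1%:R : R) => p q M *.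
  by apply/andP; split; lra.
- move=> N e e0; exists (iota 0 (J N).+1); split; first exact: iota_uniq.
    move=> k _; split => [n||]; [by have [] := PT _ _ (P n) (X n) N k (rX n)|by have [] := PT _ _ Q Y N k rY|].
    have [_ ->] := PT _ _ Q Y N k rY.
    apply: cvg_trans (_ : fine (P n (A _ (X n) N k)) - fine (P n (A _ (X n) N k.+1)) @[n --> \oo] --> _).
      by apply: near_eq_cvg; apply: nearW => n; have [_ ->] := PT _ _ (P n) (X n) N k (rX n).
    have hA j : fine (P n (A _ (X n) N j)) @[n --> \oo] --> fine (Q (A _ Y N j)).
      rewrite /A; case: ifP => _.
        by under eq_fun do rewrite probability_setT; rewrite probability_setT; exact: cvg_cst.
      case: ifP => _; first exact: hP.
      by under eq_fun do rewrite measure0; rewrite measure0; exact: cvg_cst.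
    by apply: cvgB; exact: hA.
  rewrite (eq_bigr (fun k => - (fine (Q (A _ Y N k.+1)) - fine (Q (A _ Y N k))))); last first.
    by move=> k _; have [_ ->] := PT _ _ Q Y N k rY; rewrite opprB.
  have := telescope_sumr (fun k => fine (Q (A _ Y N k))) (leq0n (J N).+1).
  rewrite sumrN /index_iota subn0 => ->; rewrite opprB {1}/A/=.
  rewrite /A ltnn/= measure0 subr0 probability_setT/=.
  by rewrite ltrBlDr ltrDl.
Qed.

End real_criterion.

(** * Vague topology and compact supports on the compactified line *)

Section vague.
Context {R : realType}.

(** The vague topology is initial for the evaluations at functions of [Cc E], so convergence of a
    filter is tested on one f at a time. *)
Lemma Mp_filter_cvg (E : set \bar R) (m : Mp E) (F : set_system (Mp E)) : Filter F ->
  (forall f : Cc E, Mp_integral m' f @[m' --> F] --> (Mp_integral m f : R)) ->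
  forall U : set (Mp E), open U -> U m -> F U.
Proof.
move=> FF cvgF U [V oV <-] Vm.
have : {ptws, (Mp_integral (E := E) @ F) --> Mp_integral m}.
  apply/cvg_sup => f; rewrite cvg_image; last first.
    by rewrite eqEsubset; split=> v // _; exists (cst v).
  move=> W /(cvgF f) FW; exists (@^~ f @^-1` W) => //.
  by rewrite eqEsubset; split=> [j [? + <-//]|j Wj]; exists (fun=> j).
by apply; exact: open_nbhs_nbhs.
Qed.

Variables (c top : \bar R).
Let E : set \bar R := [set y | (c < y <= top)%E].

Definition upto (a : \bar R) : set \bar R := [set y | (a <= y <= top)%E].

Lemma measurable_upto a : measurable (upto a).
Proof.
rewrite (_ : upto a = [set` `[a, top]%E])//; exact: emeasurable_itv.
Qed.

Lemma measurable_Mp_space : measurable E.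
Proof.
rewrite (_ : E = [set` `]c, top]%E])//; exact: emeasurable_itv.
Qed.

Lemma expand_continuous_within : {within `[-1, 1], continuous (@expand R)}.
Proof.
apply/subspace_continuousP => u; rewrite /= in_itv/= => /andP[u1 u2].
apply/cvg_ballP => e e0; rewrite near_withinE.
near=> v; rewrite /= in_itv/= => /andP[v1 v2].
rewrite /ball/= /ereal_ball !expandK ?inE/=; try by rewrite ler_norml ?u1 ?u2 ?v1 ?v2.
by near: v; exact: cvgr_dist_lt.
Unshelve. all: by end_near. Qed.

Lemma contract_continuous : continuous (@contract R).
Proof.
move=> x; apply/cvg_ballP => e e0; have h := nbhsx_ballx x e e0.
exact: h.
Qed.

Lemma compact_upto a : compact (upto a).
Proof.
have [atop|topa] := leP a top; last first.
  rewrite (_ : upto a = set0); first exact: compact0.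
  by apply/seteqP; split=> // y /andP[ay yt]; have := lt_le_trans topa ay; rewrite ltNge yt.
rewrite (_ : upto a = @expand R @` `[contract a, contract top]).
  apply: continuous_compact; last exact: segment_compact.
  apply: continuous_subspaceW expand_continuous_within.
  move=> u /=; rewrite !in_itv/= => /andP[au ut].
  have := contract_le1 a; have := contract_le1 top; rewrite !ler_norml => /andP[_ t1] /andP[a1 _].
  by rewrite (le_trans a1)//= (le_trans ut).
apply/seteqP; split=> y /=.
  move=> /andP[ay yt]; exists (contract y); last by rewrite contractK.
  by rewrite in_itv/= !le_contract ay.
move=> [u]; rewrite in_itv/= => /andP[au ut] <-.
have u1 : `|u| <= 1.
  have := contract_le1 a; have := contract_le1 top; rewrite !ler_norml => /andP[_ t1] /andP[a1 _].
  by rewrite (le_trans a1)//= (le_trans ut).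
by rewrite /upto/= -[a]contractK -[top]contractK !le_expand_in ?inE ?contract_le1// au.
Qed.

Lemma upto_subset a : (c < a)%E -> upto a `<=` E.
Proof. by move=> ca y /andP[ay yt]; rewrite /E/= yt (lt_le_trans ca ay). Qed.

(** The complement of the compact support is a neighbourhood of c, hence contains a ball around c
    for the metric of [contract]. *)
Lemma Cc_support (f : \bar R -> R) : (c < top)%E -> Cc E f ->
  exists2 a : \bar R, (c < a)%E & forall y, (y < a)%E -> f y = 0.
Proof.
move=> ctop [_ [K [cK KE f0]]].
have [K0|/set0P K0] := eqVneq K set0.
  by exists top => // y _; apply: f0; rewrite K0.
have clK : closed K by apply: compact_closed => //; exact: ereal_hausdorff.
have : open_nbhs c (~` K).
  by split; [exact: closed_openC|move=> /KE; rewrite /E/= ltxx].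
move=> /open_nbhs_nbhs /nbhs_ballP[e /= e0 be].
(* The minimum with the midpoint between c and top keeps u in [-1, 1], where [expand] inverts
   [contract], even if the ball reaches beyond top. *)
pose u := Num.min (contract c + e / 2) ((contract c + contract top) / 2).
have ct : contract c < contract top by rewrite lt_contract.
have cu : contract c < u.
  by rewrite lt_min; apply/andP; split; [rewrite ltrDl divr_gt0|lra].
have u1 : `|u| <= 1.
  have := contract_le1 c; have := contract_le1 top; rewrite !ler_norml => /andP[_ t1] /andP[a1 _].
  by rewrite (le_trans a1 (ltW cu))/= /u ge_min; apply/orP; right; lra.
exists (expand u); first by rewrite -[c]contractK lt_expand ?inE ?contract_le1.
move=> y yu; apply: f0 => Ky; apply: (be y) => //.
have cy : (c < y)%E by have /andP[] := KE _ Ky.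
have : contract y < u by rewrite -lt_expand ?inE ?contract_le1// contractK.
have : contract c < contract y by rewrite lt_contract.
rewrite /ball/= /ereal_ball /u lt_min => h1 /andP[h2 _].
by rewrite ltr_norml; apply/andP; split; lra.
Qed.

(** Heine-Cantor for the metric of [contract], from the covering form of compactness applied to the
    filter of radii tending to 0 from the right. *)
Lemma Cc_uniformly_continuous (f : \bar R -> R) a e : (c < a)%E -> Cc E f -> 0 < e ->
  exists2 r : R, 0 < r & forall x y, upto a x -> upto a y ->
    `|contract x - contract y| < r -> `|f x - f y| <= e.
Proof.
move=> ca [cf _] e0.
have : near_covering (upto a) by apply/compact_near_coveringP; exact: compact_upto.
move=> /(_ R (0^'+) (fun r x => upto a x -> forall y, upto a y ->
    `|contract x - contract y| < r -> `|f x - f y| <= e) _).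
case=> [x ax|r0 /= r00 h].
  have /subspace_continuousP/(_ x (upto_subset ca ax)) := cf.
  move=> /cvgrPdist_le /(_ (e / 2)); rewrite divr_gt0// => /(_ erefl).
  rewrite near_withinE => /nbhs_ballP[r /= r0 br].
  exists (ball x (r / 2), `]0, r / 2[%classic).
    split; first by apply: nbhsx_ballx; rewrite divr_gt0.
    exists (r / 2) => /=; first by rewrite divr_gt0.
    move=> s /=; rewrite distrC subr0 => sr s0; rewrite in_itv/= s0/=.
    by rewrite (le_lt_trans _ sr)// ler_norm.
  move=> [x' r'] /= [xx']; rewrite in_itv/= => /andP[r'0 r'r] ax' y ay x'y.
  have h1 : `|f x - f x'| <= e / 2.
    apply: br; last exact: upto_subset ca _ ax'.
    by move: xx'; rewrite /ball/= /ereal_ball => /lt_trans; apply; rewrite ltr_pdivrMr// ltr_pMr// ltr1n.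
  have h2 : `|f x - f y| <= e / 2.
    apply: br; last exact: upto_subset ca _ ay.
    move: xx'; rewrite /ball/= /ereal_ball => xx'.
    rewrite -[contract x](subrK (contract x')) -addrA (le_lt_trans (ler_normD _ _))//.
    by move: xx' x'y r'r; lra.
  rewrite -[f x'](subrK (f x)) -addrA (le_trans (ler_normD _ _))//.
  by rewrite distrC; move: h1 h2; lra.
exists (r0 / 2); first by rewrite divr_gt0.
move=> x y ax ay; apply: h => //=; rewrite ?divr_gt0//.
by rewrite sub0r normrN gtr0_norm ?divr_gt0// ltr_pdivrMr// ltr_pMr// ltr1n.
Qed.

End vague.

(** * Measurability of masses and approximation by step functions on meshes *)

Section vague_cells.
Context {R : realType}.

Lemma integrable_sum_indic d (T : measurableType d) (mu : {measure set T -> \bar R})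
    (D : set T) (S : Type) (K : seq S) (a : S -> R) (A : S -> set T) : measurable D ->
  (forall k, measurable (A k)) -> (forall k, (mu (A k) < +oo)%E) ->
  mu.-integrable D (EFin \o (fun x => \sum_(k <- K) a k * \1_(A k) x)).
Proof.
move=> mD mA Aoo; rewrite (_ : _ \o _ = fun x => (\sum_(k <- K) (a k)%:E * (\1_(A k) x)%:E)%E).
  apply: integrable_sum => // k _; apply: integrableZl => //.
  apply/integrableP; split; first by apply/measurable_EFinP/measurable_funTS; exact: measurable_indic.
  under eq_integral do rewrite /= ger0_norm//.
  by rewrite integral_indic// (le_lt_trans _ (Aoo k))// measureIl.
by apply/funext => x /=; rewrite -sumEFin.
Qed.

Lemma Rintegral_sum_indic d (T : measurableType d) (mu : {measure set T -> \bar R})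
    (D : set T) (S : Type) (K : seq S) (a : S -> R) (A : S -> set T) : measurable D ->
  (forall k, measurable (A k)) -> (forall k, A k `<=` D) -> (forall k, (mu (A k) < +oo)%E) ->
  \int[mu]_(x in D) (\sum_(k <- K) a k * \1_(A k) x) = \sum_(k <- K) a k * fine (mu (A k)).
Proof.
move=> mD mA AD Aoo; rewrite /Rintegral.
have intA k : mu.-integrable D (fun x => (\1_(A k) x)%:E).
  apply/integrableP; split; first by apply/measurable_EFinP/measurable_funTS; exact: measurable_indic.
  under eq_integral do rewrite /= ger0_norm//.
  by rewrite integral_indic// (le_lt_trans _ (Aoo k))// measureIl.
under eq_integral do rewrite -sumEFin.
rewrite integral_sum//; last first.
  by move=> k; under eq_fun do rewrite EFinM; exact: integrableZl.
have intE k : (\int[mu]_(x in D) (a k * \1_(A k) x)%:E = (a k * fine (mu (A k)))%:E)%E.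
  under eq_integral do rewrite EFinM; rewrite integralZl// integral_indic// setIidl//.
  by rewrite EFinM fineK// ge0_fin_numE.
by under eq_bigr do rewrite intE; rewrite sumEFin.
Qed.

Lemma open_emeasurable (U : set \bar R) : open U -> measurable U.
Proof.
move=> oU; rewrite (_ : U = EFin @` (EFin @^-1` U) `|` (U `&` [set +oo%E]) `|` (U `&` [set -oo%E])).
  have mUx x : measurable (U `&` [set x]).
    have [Ux|nUx] := pselect (U x).
      by rewrite (_ : _ `&` _ = [set x])//; apply/seteqP; split=> y; [case|move=> ->].
    by rewrite (_ : _ `&` _ = set0)//; apply/seteqP; split=> y // [Uy yx]; apply: nUx; rewrite -yx.
  apply: measurableU; last exact: mUx.
  apply: measurableU; last exact: mUx.
  apply: measurable_image_EFin; apply: open_measurable; apply: open_comp => // x _.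
  by move=> A.
apply/seteqP; split=> [[r| |]|y]/=.
- by move=> Ur; left; left; exists r.
- by move=> Ur; left; right.
- by move=> Ur; right.
- by move=> [[[r Ur <-//]|[]//]|[]//].
Qed.

Lemma within_continuous_emeasurable (D : set \bar R) (f : \bar R -> R) : measurable D ->
  {within D, continuous f} -> measurable_fun D f.
Proof.
move=> mD cf _; apply: (measurability _ (RGenOInfty.measurableE R)) => //= _ [_ [a ->] <-].
have : open (f @^-1` `]a, +oo[ : set (subspace D)).
  by apply: open_comp => // x _; exact: cf.
move=> /open_subspaceP[V oV VD]; rewrite setIC -VD.
by apply: measurableI => //; exact: open_emeasurable.
Qed.

Variables (c top : \bar R).
Let E : set \bar R := [set y | (c < y <= top)%E].
Hypothesis ctop : (c < top)%E.

Let mE : measurable E.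
Proof. exact: measurable_Mp_space. Qed.

Lemma Mp_upto_fin (m : Mp E) a : (c < a)%E -> (m (upto top a) < +oo)%E.
Proof.
by move=> ca; apply: Mp_locally_finite; [exact: compact_upto|exact: upto_subset].
Qed.

(** The slope factor k + 2 is at least 2, so all these tents vanish below the midpoint of c and a in
    the coordinate [contract]. This gives them a common compact support and a common integrable
    bound. *)
Lemma upto_tent0 a (k : nat) y : (c < a)%E -> (y < expand ((contract a + contract c) / 2))%E ->
  Num.max 0 (1 - k.+2%:R / (contract a - contract c) * Num.max 0 (contract a - contract y)) = 0.
Proof.
move=> ca; have d0 : 0 < contract a - contract c by rewrite subr_gt0 lt_contract.
set s := _ / _; have s0 : 0 < s by rewrite divr_gt0.
have b1 : `|(contract a + contract c) / 2| <= 1.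
  have := contract_le1 c; have := contract_le1 a; rewrite !ler_norml => /andP[? ?] /andP[? ?].
  by apply/andP; split; lra.
rewrite -lt_contract expandK ?inE// => yb.
apply/max_idPl; rewrite subr_le0 (@le_trans _ _ (s * (contract a - contract y)))//; last first.
  by rewrite ler_pM2l// le_max lexx orbT.
rewrite (@le_trans _ _ (s * ((contract a - contract c) / 2)))//; last first.
  by rewrite ler_pM2l//; move: yb; lra.
by rewrite /s mulrA divfK ?gt_eqF// ler_pdivlMr// mul1r ler_nat.
Qed.

(** Continuous approximations of the indicator of [a, top]: equal to 1 there and affine below a in
    the coordinate [contract], with a slope that grows with k. *)
Lemma upto_tent_Cc a (k : nat) : (c < a)%E ->
  Cc E (fun y => if (y <= top)%E then Num.max 0 (1 - k.+2%:R / (contract a - contract c) *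
    Num.max 0 (contract a - contract y)) else 0).
Proof.
move=> ca; have d0 : 0 < contract a - contract c by rewrite subr_gt0 lt_contract.
set s := _ / _; have s0 : 0 < s by rewrite divr_gt0.
split.
  apply: (@subspace_eq_continuous _ _ _ (fun y => Num.max 0 (1 - s * Num.max 0 (contract a - contract y)))).
    by move=> y; rewrite inE => /andP[_ yt]; rewrite /from_subspace/= yt.
  apply: continuous_subspaceT => y.
  apply: (@continuous_max _ _ (cst 0) (fun y => 1 - s * Num.max 0 (contract a - contract y))); first exact: cvg_cst.
  apply: cvgB; first exact: cvg_cst.
  apply: cvgMl_tmp; apply: (@continuous_max _ _ (cst 0) (fun y => contract a - contract y)); first exact: cvg_cst.
  by apply: cvgB; [exact: cvg_cst|exact: contract_continuous].
pose b := (contract a + contract c) / 2.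
have b1 : `|b| <= 1.
  have := contract_le1 c; have := contract_le1 a; rewrite !ler_norml /b => /andP[? ?] /andP[? ?].
  by apply/andP; split; lra.
exists (upto top (expand b)); split.
- exact: compact_upto.
- by apply: upto_subset; rewrite -[c]contractK lt_expand ?inE ?contract_le1// /b; lra.
- move=> y /negP; rewrite negb_and; case: (leP y top) => //= yt; rewrite orbF -ltNge => yb.
  exact: upto_tent0.
Qed.

(** Integrals of functions of [Cc E] are continuous in the measure, hence measurable along a random
    element; the mass of [a, top] is the limit of the integrals of the tents by dominated
    convergence. *)
Lemma measurable_Mp_upto d (Omega : measurableType d) (eta : Omega -> Mp E) a :
  (c < a)%E -> random_element eta ->
  measurable_fun setT (fun w => fine (eta w (upto top a))).
Proof.
move=> ca reta; have d0 : 0 < contract a - contract c by rewrite subr_gt0 lt_contract.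
pose f k : Cc E := SigSub (mem_set (upto_tent_Cc k ca)).
have mf k : measurable_fun setT (fun w => Mp_integral (eta w) (f k) : R).
  apply: (random_element_continuous (F := fun m : Mp E => Mp_integral m (f k) : R) reta).
  move=> m; apply: (@continuous_comp (Mp E) _ _ (@Mp_integral _ E) (fun g => g (f k) : R)).
    exact: initial_continuous.
  exact: proj_continuous.
apply: (measurable_fun_cvg mf) => w _.
apply: fine_cvg; rewrite fineK; last by rewrite ge0_fin_numE// Mp_upto_fin.
pose b := (contract a + contract c) / 2.
have b1 : `|b| <= 1.
  have := contract_le1 c; have := contract_le1 a; rewrite !ler_norml /b => /andP[? ?] /andP[? ?].
  by apply/andP; split; lra.
have cb : (c < expand b)%E by rewrite -[c]contractK lt_expand ?inE ?contract_le1// /b; lra.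
have intE x : (c < x)%E -> (\int[eta w]_(y in E) (\1_(upto top x) y)%:E = eta w (upto top x))%E.
  move=> cx; rewrite integral_indic ?setIidl//; last exact: measurable_upto.
  exact: upto_subset.
rewrite -intE//.
apply: (@dominated_cvg _ _ _ _ _ mE _ _ (EFin \o \1_(upto top (expand b)))).
- move=> k; apply/measurable_EFinP; apply: within_continuous_emeasurable => //.
  by have [] := upto_tent_Cc k ca.
- move=> y /andP[cy yt]; apply: cvg_EFin; first exact: nearW.
  rewrite /comp/= yt indicE; have [ay|ya] := leP a y.
    rewrite mem_set; last by rewrite /upto/= ay.
    rewrite (_ : (fun _ => _) = cst 1); first exact: cvg_cst.
    apply/funext => k; have : contract a - contract y <= 0 by rewrite subr_le0 le_contract.
    by move=> /max_idPl ->; rewrite mulr0 subr0; apply/max_idPr.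
  rewrite memNset; last by rewrite /upto/= leNgt ya.
  have e0 : 0 < contract a - contract y by rewrite subr_gt0 lt_contract.
  apply: (@cvg_near_cst _ _ _ _ _) ; near=> k.
  rewrite (max_idPr (ltW e0)); apply/max_idPl; rewrite subr_le0 mulrAC ler_pdivlMr// mul1r.
  rewrite -ler_pdivrMr//; apply: (@le_trans _ _ k%:R); last by rewrite ler_nat -addn2 leq_addr.
  by near: k; exact: nbhs_infty_ger.
- by [].
- apply/integrableP; split.
    by apply/measurable_EFinP/measurable_funTS/measurable_indic; exact: measurable_upto.
  under eq_integral do rewrite /= ger0_norm//.
  by rewrite intE// Mp_upto_fin.
- move=> k y /andP[cy yt] /=; rewrite yt lee_fin ger0_norm ?le_max ?lexx// indicE.
  have [by_|yb] := leP (expand b) y.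
    rewrite mem_set; last by rewrite /upto/= by_.
    rewrite ge_max ler01/= lerBlDr lerDl mulr_ge0 ?le_max ?lexx// divr_ge0 ?ler0n// ltW//.
  rewrite memNset; last by rewrite /upto/= leNgt yb.
  by rewrite upto_tent0.
Unshelve. all: by end_near. Qed.

(** Cells are half-open except for the last one, j = N, which extends up to top inclusive. For a
    monotone t the cells 0 to N partition [t 0, top]. *)
Definition cell (t : nat -> R) (N j : nat) : set \bar R :=
  [set y | ((t j)%:E <= y <= top)%E /\ ((j < N)%N -> (y < (t j.+1)%:E)%E)].

Lemma measurable_cell t N j : measurable (cell t N j).
Proof.
rewrite (_ : cell t N j = if (j < N)%N then upto top (t j)%:E `&` [set` `]-oo, (t j.+1)%:E[%E]
   else upto top (t j)%:E).
  case: ifP => _; last exact: measurable_upto.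
  by apply: measurableI; [exact: measurable_upto|exact: emeasurable_itv].
apply/seteqP; split=> y; rewrite /cell/=; case: ifP => // jN.
- by move=> [yt /(_ erefl)]; split => //=; rewrite in_itv.
- by move=> [].
- by move=> []; rewrite /= in_itv/=.
Qed.

Lemma cell_subset t N j : cell t N j `<=` upto top (t j)%:E.
Proof. by move=> y []. Qed.

Lemma cellE t N j : (j <= N)%N -> {homo t : i j / (i <= j)%N >-> i <= j} ->
  cell t N j = upto top (t j)%:E `\` (if (j < N)%N then upto top (t j.+1)%:E else set0).
Proof.
move=> jN ht; apply/seteqP; split=> y.
  by move=> [ty yt]; split => //; case: ifP => [jN' /andP[]|_ //]; rewrite leNgt (yt jN').
move=> [/andP[ty yt] ny]; split; first exact/andP.
move=> jN'; rewrite jN' in ny; rewrite ltNge; apply/negP => ty'; apply: ny.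
by rewrite /upto/= ty'.
Qed.

Lemma cell_disjoint t N i j : {homo t : i j / (i <= j)%N >-> i <= j} ->
  (i < j)%N -> (j <= N)%N -> cell t N i `&` cell t N j = set0.
Proof.
move=> ht ij jN; apply/seteqP; split=> // y [[_ yi] [/andP[yj _] _]].
have tij : ((t i.+1)%:E <= (t j)%:E)%E by rewrite lee_fin ht.
by have := lt_le_trans (yi (leq_trans ij jN)) (le_trans tij yj); rewrite ltxx.
Qed.

Lemma cell_exists t N y : {homo t : i j / (i <= j)%N >-> i <= j} ->
  ((t 0%N)%:E <= y <= top)%E -> exists2 j, (j <= N)%N & cell t N j y.
Proof.
move=> ht /andP[t0y yt].
elim: N => [|N [j jN [tj yj]]].
  by exists 0%N => //; split => //; rewrite t0y yt.
have [/yj yj' |Nj] := ltnP j N.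
  by exists j; [exact: leqW|split].
have {jN Nj}jN : j = N by apply/eqP; rewrite eqn_leq jN Nj.
have [yN|Ny] := ltP y (t N.+1)%:E.
  by exists N => //; split => [|_]; [move: tj; rewrite jN|].
by exists N.+1 => //; split; [rewrite Ny yt|rewrite ltnn].
Qed.

Variable t : nat -> nat -> R.
Hypothesis t_homo : forall N, {homo t N : i j / (i <= j)%N >-> i <= j}.
Hypothesis t_gt : forall N j, (c < (t N j)%:E)%E.
Hypothesis t_le : forall N j, (j <= N)%N -> ((t N j)%:E <= top)%E.
Hypothesis t_start : forall a, (c < a)%E -> exists N0, forall N, (N0 <= N)%N -> ((t N 0%N)%:E <= a)%E.
Hypothesis t_fine : forall e, 0 < e -> exists N0, forall N, (N0 <= N)%N -> forall j y, (j <= N)%N ->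
  cell (t N) N j y -> contract y - contract (t N j)%:E < e.

Lemma sum_cell N (b : nat -> R) j y : (j <= N)%N -> cell (t N) N j y ->
  \sum_(i <- iota 0 N.+1) b i * \1_(cell (t N) N i) y = b j.
Proof.
move=> jN cy; rewrite (bigD1_seq j) ?iota_uniq ?mem_iota//.
rewrite indicE mem_set// mulr1 big_seq_cond big1 => [|i /andP[]]; first exact: addr0.
rewrite mem_iota add0n ltnS => iN ij; rewrite indicE memNset ?mulr0// => ciy.
have : (cell (t N) N i `&` cell (t N) N j) y by [].
by move: ij; rewrite neq_ltn => /orP[ij|ji]; [rewrite cell_disjoint|rewrite setIC cell_disjoint].
Qed.

Lemma sum_cell0 N (b : nat -> R) y : (y < (t N 0%N)%:E)%E ->
  \sum_(i <- iota 0 N.+1) b i * \1_(cell (t N) N i) y = 0.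
Proof.
move=> yt; rewrite big1// => i _; rewrite indicE memNset ?mulr0// => -[/andP[ty _] _].
have : ((t N 0%N)%:E <= (t N i)%:E)%E by rewrite lee_fin t_homo.
by move=> /le_trans/(_ ty); rewrite leNgt yt.
Qed.

(** Uniform continuity gives the error e on cells above a'; below, both f and its step function
    vanish. Charging the error only to cells above a' keeps it integrable, since the total mass near
    c may be infinite. *)
Lemma Cc_cell_approx (f : \bar R -> R) : Cc E f -> exists2 a', (c < a')%E &
  forall e, 0 < e -> exists N0, forall N, (N0 <= N)%N -> forall y, E y ->
  `|f y - \sum_(i <- iota 0 N.+1) f (t N i)%:E * \1_(cell (t N) N i) y| <=
  \sum_(i <- iota 0 N.+1) (if (a' <= (t N i)%:E)%E then e else 0) * \1_(cell (t N) N i) y.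
Proof.
move=> Cf; have [a ca fa] := Cc_support ctop Cf.
pose b := (contract a + contract c) / 2.
have cac : contract c < contract a by rewrite lt_contract.
have b1 : `|b| <= 1.
  have := contract_le1 c; have := contract_le1 a; rewrite !ler_norml /b => /andP[? ?] /andP[? ?].
  by apply/andP; split; lra.
have cb : (c < expand b)%E by rewrite -[c]contractK lt_expand ?inE ?contract_le1// /b; lra.
have ba : (expand b < a)%E by rewrite -[a]contractK lt_expand ?inE ?contract_le1// /b; lra.
exists (expand b) => // e e0.
have [r r0 fr] := Cc_uniformly_continuous cb Cf e0.
have [N1 hN1] := t_start cb.
(* A mesh finer than contract a - b ensures that a cell starting below [expand b] ends below a,
   where f is already 0. *)
have m0 : 0 < Num.min r (contract a - b) by rewrite lt_min r0/= /b; lra.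
have [N2 hN2] := t_fine m0.
exists (maxn N1 N2) => N; rewrite geq_max => /andP[N1N N2N] y /andP[cy yt].
have [ty|ty] := ltP y (t N 0%N)%:E.
  rewrite !sum_cell0// subr0 fa ?normr0//.
  by apply: lt_trans ba; apply: lt_le_trans ty _; exact: hN1.
have [j jN cjy] : exists2 j, (j <= N)%N & cell (t N) N j y.
  by apply: cell_exists; [exact: t_homo|rewrite ty].
rewrite !(sum_cell _ jN cjy).
have := hN2 _ N2N _ _ jN cjy; rewrite lt_min => /andP[h1 h2].
have [/andP[tjy _] _] := cjy.
case: ifPn => [btj|]; last rewrite -ltNge => tjb.
  apply: fr.
  - by rewrite /upto/= yt (le_trans btj).
  - by rewrite /upto/= btj t_le.
  - by rewrite ger0_norm// subr_ge0 le_contract.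
have tb : contract (t N j)%:E < b by rewrite -lt_expand ?inE ?contract_le1// contractK.
have ya : (y < a)%E by rewrite -lt_contract; move: h2 tb; lra.
by rewrite !fa ?subrr ?normr0//; exact: lt_trans ba.
Qed.

Lemma Mp_cell_fin (m : Mp E) N j : (m (cell (t N) N j) < +oo)%E.
Proof.
apply: le_lt_trans (Mp_upto_fin m (t_gt N j)).
by apply: le_measure; rewrite ?inE; [exact: measurable_cell|exact: measurable_upto|exact: cell_subset].
Qed.

Lemma cell_subset_space N j : cell (t N) N j `<=` E.
Proof. by apply: subset_trans (@cell_subset _ _ _) _; exact: upto_subset. Qed.

(** The intermediate sum depends on m only through its cell masses. A second measure with the same
    masses therefore inherits the error bound without any control of its own mass on [a', top]. *)
Lemma Mp_integral_cell_approx (m : Mp E) (f : Cc E) (e : R) (b : R) N a' :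
  (c < a')%E -> 0 < e ->
  (forall y, E y ->
    `|(\val f : \bar R -> R) y - \sum_(i <- iota 0 N.+1) (\val f : \bar R -> R) (t N i)%:E * \1_(cell (t N) N i) y| <=
    \sum_(i <- iota 0 N.+1) (if (a' <= (t N i)%:E)%E then e else 0) * \1_(cell (t N) N i) y) ->
  `|Mp_integral m f - \sum_(i <- iota 0 N.+1) (\val f : \bar R -> R) (t N i)%:E * fine (m (cell (t N) N i))| <=
  \sum_(i <- iota 0 N.+1) (if (a' <= (t N i)%:E)%E then e else 0) * fine (m (cell (t N) N i)) /\
  \sum_(i <- iota 0 N.+1) (if (a' <= (t N i)%:E)%E then e else 0) * fine (m (cell (t N) N i)) <=
  e * fine (m (upto top a')).
Proof.
move=> ca' e0; set fv := (\val f : \bar R -> R) => hf.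
have mf : measurable_fun E fv.
  by apply: within_continuous_emeasurable => //; have [] := set_mem (valP f).
have mc j : measurable (cell (t N) N j) by exact: measurable_cell.
pose g := fun y => \sum_(i <- iota 0 N.+1) fv (t N i)%:E * \1_(cell (t N) N i) y.
pose h := fun y => \sum_(i <- iota 0 N.+1) (if (a' <= (t N i)%:E)%E then e else 0) * \1_(cell (t N) N i) y.
have ig : m.-integrable E (EFin \o g).
  by apply: integrable_sum_indic => // j; exact: Mp_cell_fin.
have ih : m.-integrable E (EFin \o h).
  by apply: integrable_sum_indic => // j; exact: Mp_cell_fin.
have igh : m.-integrable E (EFin \o (fun y => `|g y| + h y)).
  by apply: integrable_EFinD => //; exact: (integrable_abse ig).
have iff : m.-integrable E (EFin \o fv).
  apply: le_integrable igh => //; first exact/measurable_EFinP.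
  move=> y Ey; rewrite lee_fin; have := hf y Ey; rewrite -/(g y) -/(h y) => hfy.
  have h0 : 0 <= h y by exact: le_trans hfy.
  rewrite [leRHS]ger0_norm ?addr_ge0// -[fv y](subrK (g y)) (le_trans (ler_normD _ _))// addrC.
  by rewrite lerD2l.
have Eg : \int[m]_(y in E) g y = \sum_(i <- iota 0 N.+1) fv (t N i)%:E * fine (m (cell (t N) N i)).
  by apply: Rintegral_sum_indic => // j; [exact: cell_subset_space|exact: Mp_cell_fin].
have Eh : \int[m]_(y in E) h y = \sum_(i <- iota 0 N.+1) (if (a' <= (t N i)%:E)%E then e else 0) * fine (m (cell (t N) N i)).
  by apply: Rintegral_sum_indic => // j; [exact: cell_subset_space|exact: Mp_cell_fin].
rewrite -Eg -Eh; split.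
  rewrite /Mp_integral -RintegralB//.
  have iB : m.-integrable E (EFin \o (fun y => fv y - g y)).
    by apply: eq_integrable (integrableB mE iff ig) => // y _ /=; rewrite EFinB.
  apply: le_trans (le_normr_Rintegral _ _) _ => //.
  by apply: le_Rintegral => //; exact: (integrable_abse iB).
have mU := measurable_upto top a'.
have -> : e * fine (m (upto top a')) = \int[m]_(y in E) (\sum_(k <- [:: tt]) e * \1_(upto top a') y).
  rewrite (Rintegral_sum_indic _ (fun=> e) (A := fun=> upto top a')) ?big_seq1//.
    by move=> _; exact: upto_subset.
  by move=> _; exact: Mp_upto_fin.
apply: le_Rintegral => //.
  by apply: (integrable_sum_indic _ (fun=> e) (A := fun=> upto top a')) => // _; exact: Mp_upto_fin.
move=> y /andP[cy yt]; rewrite big_seq1.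
have [ty|ty] := ltP y (t N 0%N)%:E.
  by rewrite /h sum_cell0// mulr_ge0// ltW.
have [j jN cjy] : exists2 j, (j <= N)%N & cell (t N) N j y.
  by apply: cell_exists; [exact: t_homo|rewrite ty].
rewrite /h (sum_cell _ jN cjy) indicE; case: ifPn => [atj|_]; last by rewrite mulr_ge0// ltW.
rewrite mem_set ?mulr1//; have [/andP[tjy _] _] := cjy.
by rewrite /upto/= yt (le_trans atj).
Qed.

(** [Mp_filter_cvg] is applied to the filter of those sets that contain every measure with the cell
    masses of m on all fine enough meshes. For such a measure the integral of f and that under m are
    both within e/2 of the same step sum. *)
Lemma cells_refine (m : Mp E) (U : set (Mp E)) : open U -> U m ->
  exists N0, forall N, (N0 <= N)%N -> forall m' : Mp E,
    (forall j, (j <= N)%N -> m' (cell (t N) N j) = m (cell (t N) N j)) -> U m'.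
Proof.
move=> oU Um.
pose F : set_system (Mp E) := [set A | exists N0, forall N, (N0 <= N)%N -> forall m' : Mp E,
    (forall j, (j <= N)%N -> m' (cell (t N) N j) = m (cell (t N) N j)) -> A m'].
have FF : Filter F.
  split.
  - by exists 0%N.
  - move=> A B [N1 h1] [N2 h2]; exists (maxn N1 N2) => N; rewrite geq_max => /andP[N1N N2N] m' hm'.
    by split; [exact: (h1 N)|exact: (h2 N)].
  - by move=> A B AB [N1 h1]; exists N1 => N N1N m' hm'; apply: AB; exact: (h1 N).
apply: (Mp_filter_cvg (m := m) FF) => // f.
apply/cvgrPdist_le => e e0.
have [a' ca' hf] := Cc_cell_approx (set_mem (valP f)).
pose M := fine (m (upto top a')).
have M0 : 0 <= M by rewrite fine_ge0.
have r0 : 0 < e / 2 / (M + 1) by rewrite !divr_gt0// ltr_wpDl.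
have [N0 hN0] := hf _ r0.
exists N0 => N N0N m' hm'; have hN := hN0 N N0N.
have [h1 h3] := Mp_integral_cell_approx m 0 ca' r0 hN.
have [h2 _] := Mp_integral_cell_approx m' 0 ca' r0 hN.
move: h2; rewrite (eq_big_seq (fun i => (\val f : \bar R -> R) (t N i)%:E * fine (m (cell (t N) N i)))); last first.
  by move=> j; rewrite mem_iota add0n ltnS => /andP[_ jN]; rewrite hm'.
rewrite [X in _ <= X](eq_big_seq (fun i => (if (a' <= (t N i)%:E)%E then e / 2 / (M + 1) else 0) * fine (m (cell (t N) N i)))); last first.
  by move=> j; rewrite mem_iota add0n ltnS => /andP[_ jN]; rewrite hm'.
move: h1 h3; set A := \sum_(_ <- _) _; set B := \sum_(_ <- _) _ => h1 h3 h2.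
have B2 : B <= e / 2.
  rewrite (le_trans h3)// -/M mulrAC ler_pdivrMr ?ltr_wpDl// ler_wpM2l ?lerDl//.
  by rewrite ltW// divr_gt0.
rewrite -[Mp_integral m f](subrK A) -addrA (le_trans (ler_normD _ _))//.
by rewrite -(distrC (Mp_integral m' f)); lra.
Qed.

End vague_cells.

(** * Convergence to a Poisson process from counts on meshes *)

Section poisson_limit_criterion.
Context {R : realType}.

Lemma cvg_prod_ord (m : nat) (f : 'I_m -> nat -> R) (l : 'I_m -> R) :
  (forall k, f k n @[n --> \oo] --> l k) ->
  \prod_(k < m) f k n @[n --> \oo] --> \prod_(k < m) l k.
Proof.
elim: m f l => [|m IH] f l fl.
  rewrite big_ord0 (_ : (fun _ => _) = cst 1); first exact: cvg_cst.
  by apply/funext => n; rewrite big_ord0.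
rewrite big_ord_recl (_ : (fun _ => _) = f ord0 \* (fun n => \prod_(k < m) f (lift ord0 k) n)); last first.
  by apply/funext => n; rewrite big_ord_recl.
by apply: cvgM => //; exact: IH.
Qed.

Lemma poisson_weight_sum_cvg (r : R) :
  \sum_(k < n) poisson_weight r%:E k @[n --> \oo] --> (1 : R).
Proof.
have E1 : (1 : R) = expR r * expR (- r) by rewrite -expRD subrr expR0.
rewrite [X in _ --> X]E1.
apply: cvg_trans (cvgMr_tmp (b := expR (- r)) (@is_cvg_series_exp_coeff R r)).
apply: near_eq_cvg; near=> n.
by rewrite /series/= big_mkord mulr_suml.
Unshelve. all: by end_near. Qed.

Lemma empirical_count (E A : set \bar R) n (y : 'I_n -> \bar R) : A `<=` E ->
  empirical E y A = (#|[pred i | `[< A (y i) >]]|%:R : R)%:E.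
Proof.
move=> AE; rewrite [LHS]/= /point_sum -sum1_card natr_sum -sumEFin.
rewrite [RHS]big_mkcond/= big_mkcond/=; apply: eq_bigr => i _.
rewrite diracE; have [Ay|nAy] := pselect (A (y i)).
  by rewrite (mem_set (AE _ Ay)) (mem_set Ay) inE asboolT.
by rewrite (memNset nAy) inE asboolF//; case: ifP.
Qed.

(** Cell masses are differences of masses of sets [a, top], hence measurable; disjointness of the
    cells and independence then give the product. *)
Lemma poisson_cells d (Omega : measurableType d) (Q : probability Omega R)
    (c top : \bar R) (lambda : set \bar R -> \bar R)
    (eta : Omega -> Mp [set y | (c < y <= top)%E]) (t : nat -> R) N (k : nat -> nat) :
  (c < top)%E -> {homo t : i j / (i <= j)%N >-> i <= j} -> (forall j, (c < (t j)%:E)%E) ->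
  poisson_process Q lambda eta ->
  let A := [set w | forall j : 'I_N.+1, eta w (cell top t N j) = (k j)%:R%:E] in
  measurable A /\
  Q A = (\prod_(j < N.+1) poisson_weight (lambda (cell top t N j)) (k j))%:E.
Proof.
move=> ctop ht ct [reta wgt indep].
have cE j : cell top t N j `<=` [set y | (c < y <= top)%E].
  by apply: subset_trans (@cell_subset _ _ _ _ _) _; exact: upto_subset.
have mc j : measurable (cell top t N j) by exact: measurable_cell.
have ufin w j : eta w (upto top (t j)%:E) \is a fin_num.
  by rewrite ge0_fin_numE// Mp_upto_fin.
have etaE w (j : 'I_N.+1) : eta w (cell top t N j) = (fine (eta w (upto top (t j)%:E)) -
      (if (j < N)%N then fine (eta w (upto top (t j.+1)%:E)) else 0))%:E.
  rewrite cellE//; last by rewrite -ltnS.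
  case: ifPn => jN; last by rewrite setD0 subr0 fineK.
  rewrite measureD; [|exact: measurable_upto|exact: measurable_upto|by rewrite Mp_upto_fin].
  rewrite EFinB !fineK//; congr (_ - eta w _)%E; apply: setIidr.
  by move=> y /andP[ty yt]; rewrite /upto/= yt (le_trans _ ty)// lee_fin ht.
have mcell (j : 'I_N.+1) v : measurable [set w | eta w (cell top t N j) = v%:E].
  pose f w := fine (eta w (upto top (t j)%:E)) -
      (if (j < N)%N then fine (eta w (upto top (t j.+1)%:E)) else 0).
  have mf : measurable_fun setT f.
    apply: measurable_funB; first exact: measurable_Mp_upto.
    by case: (j < N)%N => //; exact: measurable_Mp_upto.
  rewrite (_ : [set w | _] = setT `&` f @^-1` [set v]); first exact: mf.
  by rewrite setTI; apply/seteqP; split=> w; rewrite /= etaE -/(f w); [case|move=> <-].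
move=> A; have AE : A = [set w | forall j, j \in [set: 'I_N.+1]%SET -> [set (k j)%:R%:E] (eta w (cell top t N j))].
  by apply/seteqP; split=> w h j; [move=> _; exact: h|apply: h; rewrite inE].
split.
  rewrite (_ : A = \bigcap_(j in [set: 'I_N.+1]) [set w | eta w (cell top t N j) = (k j)%:R%:E]).
    by apply: fin_bigcap_measurable => // j _; exact: mcell.
  by apply/seteqP; split=> w h j; [move=> _; exact: h|exact: h].
have tI : trivIset setT (fun j : 'I_N.+1 => cell top t N j).
  move=> i j _ _ [y [iy jy]]; apply/val_inj => /=; case: (ltngtP i j) => // ij.
    have : (cell top t N i `&` cell top t N j) y by [].
    by rewrite (cell_disjoint _ ht)// -ltnS.
  have : (cell top t N j `&` cell top t N i) y by [].
  by rewrite (cell_disjoint _ ht)// -ltnS.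
have := indep _ (fun j : 'I_N.+1 => cell top t N j) (fun j => conj (mc j) (@cE j)) tI
  [set: 'I_N.+1]%SET (fun j => [set (k j)%:R%:E]) (fun j => emeasurable_set1 _).
rewrite -AE => ->; rewrite -prodEFin; apply: eq_big => [j|j _]; first by rewrite inE.
by rewrite -wgt.
Qed.

(** The mass of [cell top t N j] when G a is the mass of [a, top]; nothing is subtracted for the
    last cell. *)
Definition tail_increment (G : R -> R) (t : nat -> R) N j : R :=
  G (t j) - (if (j < N)%N then G (t j.+1) else 0).

(** Equal spacing in the coordinate [contract] treats infinite and finite values of c and top
    alike. *)
Lemma mesh_exists (c top : \bar R) : (c < top)%E -> exists t : nat -> nat -> R, [/\
  forall N, {homo t N : i j / (i <= j)%N >-> i <= j},
  forall N j, (c < (t N j)%:E)%E,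
  forall N j, ((t N j)%:E < top)%E,
  forall a, (c < a)%E -> exists N0, forall N, (N0 <= N)%N -> ((t N 0%N)%:E <= a)%E &
  forall e, 0 < e -> exists N0, forall N, (N0 <= N)%N -> forall j y, (j <= N)%N ->
    cell top (t N) N j y -> contract y - contract (t N j)%:E < e].
Proof.
move=> ctop; pose h : R := contract top - contract c.
have h0 : 0 < h by rewrite subr_gt0 lt_contract.
(* Dividing by N + 2 leaves the points of index 0 to N strictly between c and top; [minn] freezes
   the sequence beyond N, so that the bounds hold for every index. *)
pose u N j : R := contract c + (minn j N).+1%:R * h / N.+2%:R.
have uc N j : contract c < u N j by rewrite ltrDl divr_gt0// mulr_gt0.
have ut N j : u N j < contract top.
  rewrite /u -ltrBrDl -/h ltr_pdivrMr// mulrC ltr_pM2l// ltr_nat ltnS ltnS geq_minr//.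
have u1 N j : `|u N j| < 1.
  have := contract_le1 c; have := contract_le1 top; rewrite !ler_norml => /andP[? ?] /andP[? ?].
  by rewrite ltr_norml; have := uc N j; have := ut N j => *; apply/andP; split; lra.
pose t N j := fine (expand (u N j)).
have tE N j : (t N j)%:E = expand (u N j).
  rewrite /t fineK// fin_numE expand_eqNoo expand_eqoo -!ltNge.
  by have := u1 N j; rewrite ltr_norml.
have tcontract N j : contract (t N j)%:E = u N j by rewrite tE expandK// inE ltW.
have hN e : 0 < e -> exists N0, forall N, (N0 <= N)%N -> h / N.+2%:R < e.
  move=> e0; have [N0 _ hN0] := nbhs_infty_ger (h / e).
  exists N0 => N /hN0; rewrite /= ltr_pdivrMr// ler_pdivrMr// => hN.
  by rewrite mulrC (le_lt_trans hN)// ltr_pM2r// ltr_nat.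
exists t; split.
- move=> N i j ij; rewrite -lee_fin -le_contract !tcontract lerD2l ler_pM2r ?invr_gt0//.
  by rewrite ler_pM2r// ler_nat ltnS leq_min geq_minr (leq_trans (geq_minl _ _) ij).
- by move=> N j; rewrite -lt_contract tcontract.
- by move=> N j; rewrite -lt_contract tcontract.
- move=> a ca; have d0 : 0 < contract a - contract c by rewrite subr_gt0 lt_contract.
  have [N0 hN0] := hN _ d0; exists N0 => N N0N.
  by rewrite -le_contract tcontract /u min0n mul1r -lerBrDl ltW// hN0.
- move=> e e0; have [N0 hN0] := hN _ e0; exists N0 => N N0N j y jN [/andP[_ yt] yj].
  apply: le_lt_trans (hN0 _ N0N); rewrite tcontract /u (minn_idPl jN) lerBlDl -addrA -mulrDl.
  rewrite -{2}[h]mul1r -mulrDl natr1.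
  have [jN'|Nj] := ltnP j N.
    have := yj jN'; rewrite -lt_contract tcontract /u => /ltW.
    by rewrite (minn_idPl jN').
  have -> : j = N by apply/eqP; rewrite eqn_leq jN Nj.
  by rewrite mulrAC mulfV ?pnatr_eq0// mul1r /h addrC subrK le_contract.
Qed.

Section criterion.
Unset Implicit Arguments.
Variables (d : nat -> measure_display) (Omega : forall n, measurableType (d n))
  (P : forall n, probability (Omega n) R) (y : forall n, Omega n -> 'I_n -> \bar R)
  (d' : measure_display) (Omega' : measurableType d') (Q : probability Omega' R)
  (c top : \bar R).
Set Implicit Arguments.
Let E : set \bar R := [set x | (c < x <= top)%E].

(** The statistic of a measure is the vector of its masses on the N-th mesh, which refines the vague
    topology by [cells_refine]. Its law converges by hypothesis, and finitely many count vectors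
    carry almost all of the limit because Poisson weights sum to 1. *)
Lemma poisson_criterion (lambda : set \bar R -> \bar R) (G : R -> R) (eta : Omega' -> Mp E) :
  (c < top)%E ->
  (forall n (U : set (Mp E)), measurable [set w | U (empirical E (y n w))]) ->
  poisson_process Q lambda eta ->
  (forall (t : nat -> R) N, {homo t : i j / (i <= j)%N >-> i <= j} ->
     (forall j, (c < (t j)%:E < top)%E) -> forall j, (j <= N)%N ->
     lambda (cell top t N j) = (tail_increment G t N j)%:E) ->
  (forall (t : nat -> R) N, {homo t : i j / (i <= j)%N >-> i <= j} ->
     (forall j, (c < (t j)%:E < top)%E) -> forall k : nat -> nat,
     fine (P n [set w | forall j, (j <= N)%N ->
       #|[pred i | `[< cell top t N j (y n w i) >]]| = k j]) @[n --> \oo] -->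
     \prod_(j < N.+1) poisson_weight (tail_increment G t N j)%:E (k j)) ->
  cvg_in_distribution P (fun n w => empirical E (y n w)) Q eta.
Proof.
move=> ctop mX etaP hlam hP.
have [t [ht ct tt tstart tfine]] := mesh_exists ctop.
have ctt N j : (c < (t N j)%:E < top)%E by rewrite ct tt.
have cE N j : cell top (t N) N j `<=` E by exact: cell_subset_space.
pose S N : eqType := {ffun 'I_N.+1 -> \bar R}.
pose st N (m : Mp E) : S N := [ffun j : 'I_N.+1 => m (cell top (t N) N j)].
have stE N (m : Mp E) (k : nat -> nat) : st N m = [ffun j : 'I_N.+1 => (k j)%:R%:E] <->
    forall j : 'I_N.+1, m (cell top (t N) N j) = (k j)%:R%:E.
  split=> [/ffunP h j|h]; first by have := h j; rewrite !ffunE.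
  by apply/ffunP => j; rewrite !ffunE.
have QE N (k : nat -> nat) : let A := [set w | st N (eta w) = [ffun j : 'I_N.+1 => (k j)%:R%:E]] in
    measurable A /\ Q A = (\prod_(j < N.+1) poisson_weight (tail_increment G (t N) N j)%:E (k j))%:E.
  move=> A; have [mA QA] := @poisson_cells _ _ Q c top lambda eta (t N) N k ctop (ht N) (ct N) etaP.
  rewrite (_ : A = [set w | forall j : 'I_N.+1, eta w (cell top (t N) N j) = (k j)%:R%:E]); last first.
    by apply/seteqP; split=> w /stE.
  split => //; rewrite QA; congr EFin; apply: eq_bigr => j _.
  by rewrite (hlam (t N) N)// -ltnS.
apply: (@statistics_cvg_in_distribution _ _ _ _ _ _ _ _ _ _ S st).
- by move=> n U _; exact: mX.
- by case: etaP.
- move=> m U oU Um.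
  have [N0 hN0] := cells_refine ctop ht ct (fun N j _ => ltW (tt N j)) tstart tfine oU Um.
  exists N0 => N N0N m' /ffunP h; apply: (hN0 N N0N) => j; rewrite -ltnS => jN.
  by have := h (Ordinal jN); rewrite !ffunE.
move=> N e e0.
pose pw j := poisson_weight (tail_increment G (t N) N j)%:E.
have sum1 : \prod_(j < N.+1) \sum_(k < M) pw j k @[M --> \oo] --> (1 : R).
  rewrite [X in _ --> X](_ : 1 = \prod_(j < N.+1) (1 : R)); last by rewrite big1.
  by apply: cvg_prod_ord => j; exact: poisson_weight_sum_cvg.
have [M0 _ hM0] := cvgr_gt _ sum1 (1 - e) ltac:(by rewrite ltrBlDr ltrDl).
have {}hM0 := hM0 M0.+1 (leqnSn _); rewrite /= in hM0.
(* The retained classes are the count vectors with all entries at most M0; [kf] extends such a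
   vector to all natural indices, and only those up to N are read. *)
pose mk (f : {ffun 'I_N.+1 -> 'I_M0.+1}) : S N := [ffun j => (f j)%:R%:E].
pose kf (f : {ffun 'I_N.+1 -> 'I_M0.+1}) (j : nat) : nat := f (inord j).
have mkE f : mk f = [ffun j : 'I_N.+1 => (kf f j)%:R%:E].
  by apply/ffunP => j; rewrite !ffunE /kf inord_val.
exists [seq mk f | f <- enum {: {ffun 'I_N.+1 -> 'I_M0.+1}}]; split.
- rewrite map_inj_uniq ?enum_uniq// => f g /ffunP h; apply/ffunP => j; apply/val_inj.
  by have := h j; rewrite !ffunE => -[] /eqP; rewrite eqr_nat => /eqP.
- move=> _ /mapP[f _ ->]; rewrite mkE.
  have [mA QA] := QE N (kf f); split => //; first by move=> n; exact: mX.
  rewrite [X in _ --> fine X]QA.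
  apply: cvg_trans (hP (t N) N (ht N) (ctt N) (kf f)).
  apply: near_eq_cvg; apply: nearW => n; congr (fine (P n _)); apply/seteqP; split=> w /=.
    move=> h; apply/stE => j; rewrite empirical_count// h//; by rewrite -ltnS.
  move=> /stE h j; rewrite -ltnS => jN; have := h (Ordinal jN).
  by rewrite empirical_count// => -[] /eqP; rewrite eqr_nat => /eqP.
rewrite big_map big_enum/=; apply: lt_le_trans hM0 _.
rewrite bigA_distr_bigA/= le_eqVlt; apply/orP; left; apply/eqP; apply: eq_bigr => f _.
rewrite mkE; have [_ ->] := QE N (kf f); apply: eq_bigr => j _.
by rewrite /kf inord_val.
Qed.

End criterion.
End poisson_limit_criterion.

(** * Hyperbolic geometry and the law of a node *)

Section hyperbolic_basics.
Context {R : realType}.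
Implicit Types x y r s f a b c : R.

Lemma sinh0 : sinh (0 : R) = 0.
Proof. by rewrite /sinh oppr0 subrr mul0r. Qed.

Lemma cosh0 : cosh (0 : R) = 1.
Proof. by rewrite /cosh oppr0 expR0; lra. Qed.

Lemma sinh_gt0 x : 0 < x -> 0 < sinh x.
Proof. by move=> x0; rewrite divr_gt0// subr_gt0 ltr_expR; lra. Qed.

Lemma ler_sinh : {mono (@sinh R) : x y / x <= y}.
Proof.
apply: le_mono => x y xy.
have h1 : expR x < expR y by rewrite ltr_expR.
have h2 : expR (- y) < expR (- x) by rewrite ltr_expR ltrN2.
by rewrite /sinh; lra.
Qed.

Lemma expRE x : expR x = cosh x + sinh x.
Proof. by rewrite /cosh /sinh; lra. Qed.

Lemma expRNE x : expR (- x) = cosh x - sinh x.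
Proof. by rewrite /cosh /sinh; lra. Qed.

Lemma cosh_sqr x : cosh x ^+ 2 = 1 + sinh x ^+ 2.
Proof. by have := cosh2B1 x; lra. Qed.

Lemma coshB1 x : cosh x - 1 = 2 * sinh (x / 2) ^+ 2.
Proof. by rewrite cosh_double cosh_sqr; lra. Qed.

Lemma cosh_ge1 x : 1 <= cosh x.
Proof. by rewrite -subr_ge0 coshB1 mulr_ge0// sqr_ge0. Qed.

Lemma ler_cosh x y : 0 <= x -> 0 <= y -> (cosh x <= cosh y) = (x <= y).
Proof.
move=> x0 y0; rewrite -(ler_pXn2r (n := 2))// ?nnegrE ?(ltW (cosh_gt0 _))// !cosh_sqr lerD2l.
by rewrite ler_pXn2r// ?nnegrE ?sinh_ge0// ler_sinh.
Qed.

Lemma ltr_cosh x y : 0 <= x -> 0 <= y -> (cosh x < cosh y) = (x < y).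
Proof. by move=> x0 y0; rewrite !ltNge ler_cosh. Qed.

Lemma is_derive_sinh x : is_derive x 1 (@sinh R) (cosh x).
Proof.
rewrite /sinh; apply: is_derive_eq.
by rewrite /cosh /GRing.scale/= !mulr0; lra.
Qed.

Lemma is_derive_cosh x : is_derive x 1 (@cosh R) (sinh x).
Proof.
rewrite /cosh; apply: is_derive_eq.
by rewrite /sinh /GRing.scale/= !mulr0; lra.
Qed.

Lemma continuous_sinh : continuous (@sinh R).
Proof. by move=> x; apply/differentiable_continuous/derivable1_diffP; have [] := is_derive_sinh x. Qed.

Lemma continuous_cosh : continuous (@cosh R).
Proof. by move=> x; apply/differentiable_continuous/derivable1_diffP; have [] := is_derive_cosh x. Qed.

(* With y = e^x the bound on [a e^x + b e^(-x)] becomes quadratic in y. *)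
Lemma exp_comb_le a b c x y : 0 <= a -> 0 <= x -> x <= y ->
  a + b <= c -> a * expR y + b * expR (- y) <= c -> a * expR x + b * expR (- x) <= c.
Proof.
move=> a0 x0 xy h0 hy; have ex := expR_gt0 x; have ey := expR_gt0 y.
have ex1 : 1 <= expR x by rewrite -expR0 ler_expR.
have exy : expR x <= expR y by rewrite ler_expR.
move: hy; rewrite !expRN => hy; rewrite -subr_ge0; move: hy; rewrite -subr_ge0.
move: (expR x) (expR y) ex ey ex1 exy => u v u0 v0 u1 uv hv.
have {}hv : 0 <= c * v - a * v ^+ 2 - b.
  have : 0 <= (c - (a * v + b / v)) * v by rewrite mulr_ge0// ltW.
  by rewrite (_ : _ * v = c * v - a * v ^+ 2 - b)//; field; rewrite gt_eqF.
suff h : 0 <= c * u - a * u ^+ 2 - b.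
  have : 0 <= (c * u - a * u ^+ 2 - b) / u by rewrite divr_ge0// ltW.
  by rewrite (_ : _ / u = c - (a * u + b / u))//; field; rewrite gt_eqF.
have [v1|v1] := leP v 1; first by have -> : u = v; lra.
have : 0 <= (v - 1) * (c * u - a * u ^+ 2 - b).
  have -> : (v - 1) * (c * u - a * u ^+ 2 - b) = (v - u) * (c - a - b) + (u - 1) * (c * v - a * v ^+ 2 - b)
    + a * (u - 1) * (v - u) * (v - 1) by ring.
  by rewrite !addr_ge0// ?mulr_ge0//; lra.
by rewrite pmulr_rge0// subr_gt0.
Qed.

Definition hyp_close (Rn r s f : R) : Prop :=
  cosh r * cosh s - sinh r * sinh s * cos f <= cosh Rn.

(** The coefficient of e^s / 2 in cosh of the distance between points at radii r, s and relative
    angle f. Its logarithm is the limit of this distance minus s as s -> oo, a Busemann function. *)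
Definition kappa r f : R := cosh r - sinh r * cos f.

Lemma kappa_ge r f : 0 <= r -> expR (- r) <= kappa r f.
Proof.
by move=> r0; rewrite expRNE /kappa lerD2l lerN2 -[leRHS]mulr1 ler_wpM2l ?sinh_ge0// cos_le1.
Qed.

Lemma kappa_le r f : 0 <= r -> kappa r f <= expR r.
Proof.
by move=> r0; rewrite expRE /kappa lerD2l -mulrN -[leRHS]mulr1 ler_wpM2l ?sinh_ge0// lerNl cos_geN1.
Qed.

Lemma kappa_gt0 r f : 0 <= r -> 0 < kappa r f.
Proof. by move=> r0; rewrite (lt_le_trans (expR_gt0 _) (kappa_ge _ r0)). Qed.

(** As a function of the radius x, cosh of the distance is a combination of e^x and e^(-x). It is at
    most cosh Rn at x = 0, because s <= Rn, and at r', hence in between. This is the source of the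
    monotonicity of the adjacency probability. *)
Lemma hyp_close_mono Rn r r' s f : 0 <= r -> r <= r' -> 0 <= s <= Rn ->
  hyp_close Rn r' s f -> hyp_close Rn r s f.
Proof.
move=> r0 rr' /andP[s0 sR].
have E x : cosh x * cosh s - sinh x * sinh s * cos f =
    kappa s f / 2 * expR x + (cosh s + sinh s * cos f) / 2 * expR (- x).
  by rewrite /kappa /cosh /sinh; field.
rewrite /hyp_close !E; apply: exp_comb_le => //.
  by rewrite divr_ge0// ltW// kappa_gt0.
by rewrite (_ : _ + _ = cosh s) ?ler_cosh//; rewrite /kappa; lra || exact: le_trans s0 sR.
Qed.

Definition reach_num (Rn r f : R) : R := cosh Rn + Num.sqrt (sinh Rn ^+ 2 - sinh r ^+ 2 * sin f ^+ 2).

Lemma reach_disc_ge0 Rn r f : 0 <= r -> r <= Rn -> 0 <= sinh Rn ^+ 2 - sinh r ^+ 2 * sin f ^+ 2.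
Proof.
move=> r0 rR; have sr := sinh_ge0 r0.
have h : sinh r ^+ 2 <= sinh Rn ^+ 2 by rewrite lerXn2r ?nnegrE ?ler_sinh// (le_trans sr)// ler_sinh.
rewrite subr_ge0 (le_trans _ h)// -[leRHS]mulr1 ler_wpM2l ?sqr_ge0//.
Qed.

(** With y = e^s the condition is quadratic in y. Since r <= Rn, the value y = 1 satisfies it, so
    the smaller root is at most 1 and only the larger one restricts y >= 1. *)
Lemma hyp_closeP Rn r s f : 0 <= r -> r <= Rn -> 0 <= s ->
  hyp_close Rn r s f <-> expR s * kappa r f <= reach_num Rn r f.
Proof.
move=> r0 rR s0; have k0 := kappa_gt0 f r0.
have D0 := reach_disc_ge0 f r0 rR.
pose k' := cosh r + sinh r * cos f.
have DE : sinh Rn ^+ 2 - sinh r ^+ 2 * sin f ^+ 2 = cosh Rn ^+ 2 - kappa r f * k'.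
  have h : sin f ^+ 2 = 1 - cos f ^+ 2 by have := cos2Dsin2 f; lra.
  by rewrite /kappa /k' -subr_sqr !cosh_sqr h; ring.
have y1 : 1 <= expR s by rewrite -expR0 ler_expR.
rewrite /hyp_close /reach_num; set q := Num.sqrt _.
have q2 : q ^+ 2 = cosh Rn ^+ 2 - kappa r f * k' by rewrite sqr_sqrtr.
have q0 : 0 <= q by exact: sqrtr_ge0.
have crR : cosh r <= cosh Rn by rewrite ler_cosh// (le_trans r0).
have E : cosh r * cosh s - sinh r * sinh s * cos f = (kappa r f * expR s + k' * expR (- s)) / 2.
  by rewrite /kappa /k' /cosh /sinh; field.
rewrite E expRN {E D0 DE}; have ck : kappa r f + k' = 2 * cosh r by rewrite /kappa /k'; ring.
move: q q0 q2 => q q0 q2; move: (kappa r f) k' (expR s) (cosh Rn) (cosh r) k0 y1 q2 crR ck => k {}k' y C cr k0 y1 q2 crR ck.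
have y0 : 0 < y by lra.
have -> : ((k * y + k' / y) / 2 <= C) = ((k * y - C) ^+ 2 <= q ^+ 2).
  rewrite q2 ler_pdivrMr// -(ler_pM2r y0) mulrDl -[k' / y * y]mulrA mulVf ?gt_eqF// mulr1.
  rewrite -subr_ge0 -[RHS]subr_ge0.
  have -> : C ^+ 2 - k * k' - (k * y - C) ^+ 2 = k * (C * 2 * y - (k * y * y + k')) by ring.
  by rewrite pmulr_rge0.
have h1 : (k - C) ^+ 2 <= q ^+ 2 by rewrite q2; nra.
have kq : C - q <= k.
  have : `|k - C| <= q by rewrite -(ler_pXn2r (n := 2))// ?nnegrE// real_normK// num_real.
  by rewrite ler_norml => /andP[]; lra.
split => h.
  have : `|k * y - C| <= q by rewrite -(ler_pXn2r (n := 2))// ?nnegrE// real_normK// num_real.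
  by rewrite ler_norml => /andP[]; lra.
have : `|k * y - C| <= q.
  rewrite ler_norml; apply/andP; split; last by lra.
  by have : k <= k * y by [rewrite ler_peMr// ltW]; lra.
by rewrite -(ler_pXn2r (n := 2))// ?nnegrE// real_normK// num_real.
Qed.

End hyperbolic_basics.

(** * Radial distribution function and reach of a node *)

Section radial_cdf.
Context {R : realType}.
Implicit Types (alpha nu r s f t u Rn : R) (n : nat).

Definition radial_cdf alpha Rn s : R :=
  (cosh (alpha * s) - 1) / (cosh (alpha * Rn) - 1).

Lemma continuous_radial_cdf alpha Rn : continuous (radial_cdf alpha Rn).
Proof.
move=> s; rewrite /radial_cdf; apply: cvgMr_tmp; apply: cvgB; last exact: cvg_cst.
apply: continuous_comp; last exact: continuous_cosh.
by apply: cvgMl_tmp; exact: cvg_id.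
Qed.

Lemma radial_law_itv alpha nu n s : 0 <= s -> s <= rhg_radius nu n ->
  radial_law alpha nu n `[0, s] = (radial_cdf alpha (rhg_radius nu n) s)%:E.
Proof.
rewrite le_eqVlt => /predU1P[<- _|s0 sR].
  by rewrite set_itv1 /radial_law integral_set1 /radial_cdf mulr0 cosh0 subrr mul0r.
rewrite /radial_law -integral_itv_bndo_bndc; last first.
  by apply: measurable_funTS; apply/measurable_EFinP; exact: measurable_radial_density.
set D := cosh (alpha * rhg_radius nu n) - 1.
transitivity (\int[lebesgue_measure]_(r in `[0%R, s[) (alpha * sinh (alpha * r) / D)%:E)%E.
  apply: eq_integral => r; rewrite inE/= in_itv/= => /andP[r0 rs].
  by rewrite /radial_density r0 (lt_le_trans rs).
have cf : continuous (fun r => alpha * sinh (alpha * r) / D : R).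
  move=> r; apply: cvgMr_tmp; apply: cvgMl_tmp.
  apply: continuous_comp; last exact: continuous_sinh.
  by apply: cvgMl_tmp; exact: cvg_id.
rewrite integral_itv_bndo_bndc; last first.
  by apply: measurable_funTS; apply/measurable_EFinP; exact: continuous_measurable_fun.
rewrite (@continuous_FTC2 _ _ (radial_cdf alpha (rhg_radius nu n)))//.
- by rewrite /radial_cdf mulr0 cosh0 subrr mul0r sube0.
- exact: continuous_subspaceT.
- split.
  + move=> r _; apply: derivableM => //; apply: derivableB.
  + by apply: cvg_at_right_filter; exact: continuous_radial_cdf.
  + by apply: cvg_at_left_filter; exact: continuous_radial_cdf.
- move=> r _; rewrite derive1E.
  have h : is_derive r 1 (fun s => cosh (alpha * s)) (alpha * sinh (alpha * r)).
    have h1 := is_derive_cosh (alpha * r).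
    have h2 : is_derive r 1 (fun s => alpha * s) alpha.
      by apply: is_derive_eq; rewrite /GRing.scale/= mulr1.
    have h3 := @is_derive1_comp _ _ (fun s => alpha * s) r _ _ h1 h2.
    by move: h3; rewrite mulrC.
  have h4 : is_derive r 1 (radial_cdf alpha (rhg_radius nu n)) (alpha * sinh (alpha * r) / D).
    by rewrite /radial_cdf; apply: is_derive_eq; rewrite /GRing.scale/= mulr0 subr0 add0r mulrC.
  by rewrite derive_val.
Qed.

Lemma radial_law_setI alpha nu n (A : set R) : measurable A ->
  radial_law alpha nu n A = radial_law alpha nu n (A `&` `[0, rhg_radius nu n[).
Proof.
move=> mA; rewrite /radial_law [RHS]integral_mkcondr/=; apply: eq_integral => r _.
by rewrite patchE mem_setE in_itv/= /radial_density; case: ifP.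
Qed.

Lemma radial_law_fin alpha nu n : fin_num_fun (radial_law alpha nu n).
Proof.
move=> A mA; rewrite ge0_fin_numE//.
have h : (radial_law alpha nu n A <= radial_law alpha nu n (`[0%R, rhg_radius nu n] : set R))%E.
  rewrite radial_law_setI// le_measure// ?inE//; first exact: measurableI.
  by apply: subIset; right; exact: subset_itv_co_cc.
apply: (le_lt_trans h).
have [R0|R0] := ltP (rhg_radius nu n) 0; first by rewrite set_itv_ge ?bnd_simp -?ltNge// measure0.
by rewrite radial_law_itv// ltry.
Qed.

HB.instance Definition _ alpha nu n := Measure_isFinite.Build _ _ _
  (radial_law alpha nu n) (@radial_law_fin alpha nu n).

Lemma disc_dist_ge0 (x y : R * R) : sqnorm x < 1 -> sqnorm y < 1 -> 0 <= disc_dist x y.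
Proof.
move=> x1 y1; rewrite /disc_dist /arcosh; set z := 1 + _.
have z1 : 1 <= z.
  rewrite lerDl divr_ge0//; first by rewrite mulr_ge0// addr_ge0// sqr_ge0.
  by rewrite mulr_ge0// subr_ge0 ltW.
by rewrite ln_ge0// (le_trans z1)// lerDl sqrtr_ge0.
Qed.

Lemma disc_dist_hyp_close Rn r t s u : 0 <= Rn ->
  disc_dist (polar_point (r, t)) (polar_point (s, u)) <= Rn <-> hyp_close Rn r s (t - u).
Proof.
move=> R0; rewrite /hyp_close -cosh_disc_dist ler_cosh//.
by rewrite disc_dist_ge0// polar_point_in_disc.
Qed.

(* The largest s <= Rn with [hyp_close Rn r s f]: multiplied by e^s that inequality is
   quadratic in e^s, with larger root [reach_num Rn r f / kappa r f]. *)
Definition reach Rn r f : R := Num.min Rn (ln (reach_num Rn r f / kappa r f)).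

Lemma reach_num_gt0 Rn r f : 0 < reach_num Rn r f.
Proof. by rewrite /reach_num ltr_pwDl ?cosh_gt0 ?sqrtr_ge0. Qed.

Lemma continuous_kappa r : continuous (kappa r).
Proof. by move=> f; apply: cvgB; [exact: cvg_cst|apply: cvgMl_tmp; exact: continuous_cos]. Qed.

Lemma continuous_reach_num Rn r : continuous (reach_num Rn r).
Proof.
move=> f; rewrite /reach_num; apply: cvgD; first exact: cvg_cst.
apply: (@continuous_comp _ _ _ (fun f => sinh Rn ^+ 2 - sinh r ^+ 2 * sin f ^+ 2) (@Num.sqrt R));
  last exact: sqrt_continuous.
apply: cvgB; first exact: cvg_cst.
apply: cvgMl_tmp; apply: (@continuous_comp _ _ _ sin (fun x => x ^+ 2)); last exact: exprn_continuous.
exact: continuous_sin.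
Qed.

Lemma continuous_reach Rn r : 0 <= r -> continuous (reach Rn r).
Proof.
move=> r0 f.
apply: (@continuous_min _ _ (fun=> Rn) (fun f => ln (reach_num Rn r f / kappa r f))).
  exact: cvg_cst.
apply: (@continuous_comp _ _ _ (fun f => reach_num Rn r f / kappa r f) (@ln R)); last first.
  by apply: continuous_ln; rewrite divr_gt0// ?reach_num_gt0 ?kappa_gt0.
apply: cvgM; first exact: continuous_reach_num.
by apply: cvgV; [rewrite gt_eqF// kappa_gt0|exact: continuous_kappa].
Qed.

Lemma reach_ge0 Rn r f : 0 <= r -> r <= Rn -> 0 <= reach Rn r f.
Proof.
move=> r0 rR; rewrite le_min (le_trans r0)//= ln_ge0// ler_pdivlMr ?kappa_gt0// mul1r.
have /(hyp_closeP f r0 rR (lexx 0)) : hyp_close Rn r 0 f.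
  by rewrite /hyp_close cosh0 sinh0 mulr1 mulr0 mul0r subr0 ler_cosh// (le_trans r0).
by rewrite expR0 mul1r.
Qed.

Lemma radial_law_hyp_close alpha nu n r f (Rn := rhg_radius nu n) : 0 <= r -> r <= Rn ->
  radial_law alpha nu n [set s | hyp_close Rn r s f] =
  (radial_cdf alpha Rn (reach Rn r f))%:E.
Proof.
move=> r0 rR; have R0 : 0 <= Rn := le_trans r0 rR.
have mh : measurable [set s | hyp_close Rn r s f].
  have mf : measurable_fun setT (fun s => cosh r * cosh s - sinh r * sinh s * cos f).
    apply: continuous_measurable_fun => s; apply: cvgB.
      by apply: cvgMl_tmp; exact: continuous_cosh.
    by apply: cvgMr_tmp; apply: cvgMl_tmp; exact: continuous_sinh.
  by have := mf measurableT _ (measurable_itv `]-oo, cosh Rn]); rewrite setTI set_itvE.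
rewrite -(@radial_law_itv alpha nu n)//; last 2 first.
- exact: reach_ge0.
- by rewrite ge_min lexx.
rewrite radial_law_setI// [RHS]radial_law_setI//; congr (radial_law _ _ _ _).
apply/seteqP; split => s /=; rewrite !in_itv/= => -[h /andP[s0 sR]]; split; rewrite ?s0 ?sR//=.
- rewrite le_min (ltW sR)/= -ler_expR lnK ?posrE ?divr_gt0 ?reach_num_gt0 ?kappa_gt0//.
  by rewrite ler_pdivlMr ?kappa_gt0//; apply/hyp_closeP.
- move: h; rewrite s0/= le_min (ltW sR)/= -ler_expR lnK ?posrE ?divr_gt0 ?reach_num_gt0 ?kappa_gt0//.
  by rewrite ler_pdivlMr ?kappa_gt0// => /hyp_closeP; exact.
Qed.

End radial_cdf.

Section affine_substitution.
Context {R : realType}.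
Notation mu := lebesgue_measure.
Implicit Types (G : R -> R) (a b c k t : R).

Lemma integral_affine k c a b G : 0 < k -> a <= b -> continuous G ->
  (\int[mu]_(x in `[(k * a + c)%R, (k * b + c)%R]) (G x)%:E =
   \int[mu]_(x in `[a, b]) (G (k * x + c)%R * k)%:E)%E.
Proof.
move=> k0 ab cG.
have dF (x : R) : is_derive x 1 (fun x : R => k * x + c) k.
  by apply: is_derive_eq; rewrite /GRing.scale/= mulr1 addr0.
have cF : continuous (fun x : R => k * x + c).
  by move=> x; apply: cvgD; [apply: cvgMl_tmp; exact: cvg_id|exact: cvg_cst].
have F' : derive1 (fun x : R => k * x + c) = cst k.
  by apply/funext => x; rewrite derive1E; exact: derive_val.
rewrite (integration_by_substitution_increasing (F := fun x : R => k * x + c))// ?F'//.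
- by move=> x y _ _ xy; rewrite ltrD2r ltr_pM2l.
- by move=> x _; exact: cvg_cst.
- exact: is_cvg_cst.
- exact: is_cvg_cst.
- split; first by move=> x _; have [] := dF x.
    by apply: cvg_at_right_filter; exact: cF.
  by apply: cvg_at_left_filter; exact: cF.
- exact: continuous_subspaceT.
Qed.

Lemma integral_shift c a b G : a <= b -> continuous G ->
  (\int[mu]_(x in `[(a + c)%R, (b + c)%R]) (G x)%:E = \int[mu]_(x in `[a, b]) (G (x + c)%R)%:E)%E.
Proof.
move=> ab cG; have := integral_affine c (@ltr01 R) ab cG; rewrite !mul1r => ->.
by apply: eq_integral => x _; rewrite mul1r mulr1.
Qed.

Lemma ge0_integral_itv_cat a b c G : a <= b -> b <= c -> continuous G -> (forall x, 0 <= G x) ->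
  (\int[mu]_(x in `[a, c]) (G x)%:E =
   \int[mu]_(x in `[a, b]) (G x)%:E + \int[mu]_(x in `[b, c]) (G x)%:E)%E.
Proof.
move=> ab bc cG G0.
have mG D : measurable_fun D (EFin \o G).
  by apply: measurable_funTS; apply/measurable_EFinP; exact: continuous_measurable_fun.
rewrite -(@integral_itv_bndo_bndc _ (BLeft a) b _ (mG _)).
rewrite -ge0_integral_setU//=.
- by rewrite -itv_bndbnd_setU// bnd_simp.
- exact: mG.
- by move=> x _; rewrite lee_fin.
- by apply: lt_disjoint => x y; rewrite !in_itv/= => /andP[_ xb] /andP[by' _]; exact: lt_le_trans by'.
Qed.

(** After a translation the part of the interval below -pi is moved by one period; the restriction
    on t makes a single period enough. *)
Lemma integral_periodic_even G t : continuous G -> (forall x, 0 <= G x) ->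
  (forall x, G (- x) = G x) -> (forall x, G (x + 2 * pi) = G x) -> 0 <= t <= 2 * pi ->
  (\int[mu]_(x in `[(- pi)%R, (pi)%R]) (G (t - x)%R)%:E = 2%:E * \int[mu]_(x in `[(0)%R, (pi)%R]) (G x)%:E)%E.
Proof.
move=> cG G0 Ge Gp /andP[t0 t2]; have p0 := pi_gt0 R.
transitivity (\int[mu]_(x in `[(- pi - t)%R, (pi - t)%R]) (G x)%:E)%E.
  rewrite integral_shift//; last by lra.
  by apply: eq_integral => x _; rewrite -Ge opprB.
rewrite (@ge0_integral_itv_cat _ (- pi))//; [|lra|lra].
have -> : (\int[mu]_(x in `[(- pi - t)%R, (- pi)%R]) (G x)%:E = \int[mu]_(x in `[(pi - t)%R, pi]) (G x)%:E)%E.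
  have := @integral_shift (2 * pi) (- pi - t) (- pi) _ _ cG.
  rewrite (_ : - pi - t + 2 * pi = pi - t); last by lra.
  rewrite (_ : - pi + 2 * pi = pi); last by lra.
  by move=> ->; [apply: eq_integral => x _; rewrite Gp|lra].
rewrite addeC -ge0_integral_itv_cat//; [|lra|lra].
rewrite (@ge0_integral_itv_cat _ 0)//; [|lra|lra].
rewrite -{1}oppr0 integration_by_substitution_oppr//; [|lra|exact: continuous_subspaceT].
rewrite [X in (X + _)%E](_ : _ = \int[mu]_(x in `[0%R, pi]) (G x)%:E)%E; last first.
  by apply: eq_integral => x _ /=; rewrite Ge.
by rewrite (_ : 2%:E = 1%:E + 1%:E)%E// ge0_muleDl// ?lee_fin// !mul1e.
Qed.

End affine_substitution.

(** * Probability of adjacency to a given point *)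

Section node_law.
Context {R : realType}.
Variables (alpha nu : R) (n : nat).
Notation Rn := (rhg_radius nu n).
Notation mu := lebesgue_measure.
Implicit Types (r s f t u : R) (x y : R * R).

(* The probability that a node is adjacent to a node at distance r of the origin. *)
Definition adjacency_prob alpha Rn r : R :=
  pi^-1 * \int[mu]_(f in `[0, pi]) radial_cdf alpha Rn (reach Rn r f).

Lemma reachN Rn' r f : reach Rn' r (- f) = reach Rn' r f.
Proof. by rewrite /reach /reach_num /kappa cosN sinN sqrrN. Qed.

Lemma reachD2pi Rn' r f : reach Rn' r (f + 2 * pi) = reach Rn' r f.
Proof.
have e : 2 * pi = pi *+ 2 :> R by rewrite mulr_natl.
by rewrite /reach /reach_num /kappa e cosD2pi sinD2pi.
Qed.

Lemma radial_cdf_ge0 Rn' s : 0 <= radial_cdf alpha Rn' s.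
Proof. by rewrite divr_ge0// subr_ge0 cosh_ge1. Qed.

(** Integrating the radius out first leaves a function of t - u alone, even and of period 2 pi. Its
    mean over a period does not depend on t and equals its mean over [0, pi]. *)
Lemma rhg_law_ball r t : 0 <= r -> r <= Rn -> 0 <= t <= 2 * pi ->
  rhg_law alpha nu n [set y | disc_dist (polar_point (r, t)) y <= Rn] =
  (adjacency_prob alpha Rn r)%:E.
Proof.
move=> r0 rR t02; have R0 := le_trans r0 rR.
rewrite /rhg_law /pushforward.
set B := _ @^-1` _.
have BE : B = [set p | hyp_close Rn r p.1 (t - p.2)].
  by apply/seteqP; split => -[s u] /=; rewrite /B/= => /disc_dist_hyp_close; apply.
have mB : measurable B.
  rewrite BE; have mf : measurable_fun setT (fun p : R * R =>
    cosh r * cosh p.1 - sinh r * sinh p.1 * cos (t - p.2)).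
    have m1 : measurable_fun setT (fun p : R * R => cosh p.1).
      by apply: measurableT_comp => //; exact: continuous_measurable_fun continuous_cosh.
    have m2 : measurable_fun setT (fun p : R * R => sinh p.1).
      by apply: measurableT_comp => //; exact: continuous_measurable_fun continuous_sinh.
    have m3 : measurable_fun setT (fun p : R * R => cos (t - p.2)).
      apply: (@measurableT_comp _ _ _ _ _ _ (@cos R)).
        by apply: continuous_measurable_fun; exact: continuous_cos.
      exact: measurable_funB.
    apply: measurable_funB; first exact: measurable_funM.
    by apply: measurable_funM => //; exact: measurable_funM.
  by have := mf measurableT _ (measurable_itv `]-oo, cosh Rn]); rewrite setTI set_itvE.
rewrite /product_measure1.
rewrite -(indic_fubini_tonelli_FE (uniform_prob (@ltNpipi R)) mB).
rewrite (indic_fubini_tonelli (radial_law alpha nu n) (uniform_prob (@ltNpipi R)) mB).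
rewrite indic_fubini_tonelli_GE//.
under eq_integral => u _.
  rewrite /= (_ : ysection B u = [set s | hyp_close Rn r s (t - u)]); last first.
    by apply/seteqP; split => s; rewrite /ysection/= inE BE.
  rewrite radial_law_hyp_close//; over.
pose G f := radial_cdf alpha Rn (reach Rn r f).
have cG : continuous G.
  move=> f; apply: (@continuous_comp _ _ _ (reach Rn r) (radial_cdf alpha Rn)).
    exact: continuous_reach.
  exact: continuous_radial_cdf.
have G0 f : 0 <= G f by exact: radial_cdf_ge0.
have cGt : continuous (fun u => G (t - u)).
  move=> u; apply: (@continuous_comp _ _ _ (fun u => t - u)); last exact: cG.
  by apply: cvgB; [exact: cvg_cst|exact: cvg_id].
rewrite (integral_uniform (@ltNpipi R) (f := fun u => (G (t - u))%:E)); last 2 first.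
- by apply/measurable_EFinP; exact: continuous_measurable_fun.
- by move=> u; rewrite lee_fin.
rewrite (integral_periodic_even cG)//; last 2 first.
- by move=> f; rewrite /G reachN.
- by move=> f; rewrite /G reachD2pi.
have iG : mu.-integrable `[0, pi] (EFin \o G).
  apply: continuous_compact_integrable; first exact: segment_compact.
  exact: continuous_subspaceT.
rewrite -[X in (_ * (_ * X))%E]fineK ?integrable_fin_num//.
rewrite -!EFinM /adjacency_prob /Rintegral; congr EFin.
by rewrite mulrA; congr (_ * _); have := pi_gt0 R => p0; field; lra.
Qed.

End node_law.

Section node_radius.
Context {R : realType}.
Notation mu := lebesgue_measure.
Implicit Types (alpha nu r s f t u Rn : R) (n : nat) (x y : R * R).

(** The inverse is discontinuous at 0, with value 0 there; on each half-line it is expressed through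
    exp and ln. *)
Lemma measurable_invr : measurable_fun setT (fun z : R => z^-1).
Proof.
apply: (eq_measurable_fun (fun z : R => if 0 < z then expR (- ln z)
    else if z < 0 then - expR (- ln (- z)) else 0)).
  move=> z _; case: ltP => [z0|]; first by rewrite -lnV ?posrE// lnK// posrE invr_gt0.
  rewrite le_eqVlt => /predU1P[->|z0]; first by rewrite ltxx invr0.
  by rewrite z0 -lnV ?posrE ?oppr_gt0// lnK ?posrE ?invr_gt0 ?oppr_gt0// invrN opprK.
have me (h : R -> R) : measurable_fun setT h -> measurable_fun setT (fun z => expR (- ln (h z))).
  move=> mh; apply: measurableT_comp => //.
  by apply: measurableT_comp => //; apply: measurableT_comp => //; exact: measurable_ln.
apply: measurable_fun_ifT; [exact: measurable_fun_ltr|exact: me|].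
apply: measurable_fun_ifT => //; first exact: measurable_fun_ltr.
by apply: measurableT_comp => //; exact: me.
Qed.

Lemma measurable_arcosh : measurable_fun setT (@arcosh R).
Proof.
apply: measurableT_comp; first exact: measurable_ln.
apply: measurable_funD => //; apply: (@measurableT_comp _ _ _ _ _ _ (@Num.sqrt R)).
  by apply: continuous_measurable_fun; exact: sqrt_continuous.
by apply: measurable_funB => //; exact: measurable_funX.
Qed.

Lemma measurable_sqnorm : measurable_fun setT (@sqnorm R).
Proof. by apply: measurable_funD; exact: measurable_funX. Qed.

Lemma measurable_disc_dist : measurable_fun setT (fun p : (R * R) * (R * R) => disc_dist p.1 p.2).
Proof.
apply: measurableT_comp; first exact: measurable_arcosh.
have mN (h : (R * R) * (R * R) -> R * R) : measurable_fun setT h ->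
    measurable_fun setT (fun p => 1 - sqnorm (h p)).
  by move=> mh; apply: measurable_funB => //; apply: measurableT_comp => //; exact: measurable_sqnorm.
apply: measurable_funD => //; apply: measurable_funM.
  apply: measurable_funM => //; apply: measurable_funD; apply: measurable_funX; apply: measurable_funB.
  - exact: (measurableT_comp (f := fst) measurable_fst measurable_fst).
  - exact: (measurableT_comp (f := fst) measurable_fst measurable_snd).
  - exact: (measurableT_comp (f := snd) measurable_snd measurable_fst).
  - exact: (measurableT_comp (f := snd) measurable_snd measurable_snd).
apply: measurableT_comp; first exact: measurable_invr.
by apply: measurable_funM; apply: mN.
Qed.

Lemma measurable_disc_dist0 : measurable_fun setT (fun x => disc_dist 0 x).
Proof.
have h : measurable_fun setT (fun x : R * R => ((0, 0) : R * R, x)) by exact: measurable_pair1.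
exact: (measurableT_comp measurable_disc_dist h).
Qed.

Lemma measurable_close_pairs Rn : measurable [set p : (R * R) * (R * R) | disc_dist p.1 p.2 <= Rn].
Proof.
by have := measurable_disc_dist measurableT (measurable_itv `]-oo, Rn]); rewrite setTI set_itvE.
Qed.

Lemma measurable_in_disc : measurable [set x : R * R | sqnorm x < 1].
Proof.
by have := measurable_sqnorm measurableT (measurable_itv `]-oo, (1 : R)[); rewrite setTI set_itvE.
Qed.

Lemma unit_vector_angle (a b : R) : a ^+ 2 + b ^+ 2 = 1 ->
  exists2 t, 0 <= t <= 2 * pi & a = cos t /\ b = sin t.
Proof.
move=> ab; have a1 : -1 <= a <= 1 by nra.
have b2 : b ^+ 2 = 1 - a ^+ 2 by lra.
have /andP[t0 tp] : 0 <= acos a <= pi by rewrite acos_ge0 ?acos_lepi.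
have ct : cos (acos a) = a by rewrite acosK// in_itv.
have st : sin (acos a) = Num.sqrt (1 - a ^+ 2) by rewrite sin_acos.
have [b0|b0] := leP 0 b.
  exists (acos a); first by rewrite t0; have := pi_gt0 R; lra.
  by rewrite ct st -b2 sqrtr_sqr ger0_norm.
exists (2 * pi - acos a); first by apply/andP; split; lra.
have e : 2 * pi - acos a = - acos a + pi *+ 2 by rewrite addrC mulr_natl.
by rewrite e cosD2pi sinD2pi cosN sinN ct st -b2 sqrtr_sqr ltr0_norm// opprK.
Qed.

Lemma polar_point_surj x : sqnorm x < 1 ->
  exists r t, [/\ 0 <= r, 0 <= t <= 2 * pi & x = polar_point (r, t)].
Proof.
move=> x1; pose p := Num.sqrt (sqnorm x).
have n0 : 0 <= sqnorm x by rewrite addr_ge0// sqr_ge0.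
have p2 : p ^+ 2 = sqnorm x by rewrite sqr_sqrtr.
have p0 : 0 <= p by exact: sqrtr_ge0.
have p1 : p < 1 by rewrite -(ltr_pXn2r (n := 2))// ?nnegrE// expr1n p2.
(* The solution of tanh(r/2) = p. *)
pose r := ln ((1 + p) / (1 - p)).
have q1 : 1 <= (1 + p) / (1 - p) by rewrite ler_pdivlMr; lra.
have r0 : 0 <= r by rewrite ln_ge0.
have thE : tanh (r / 2) = p.
  have e : expR (r / 2) ^+ 2 = (1 + p) / (1 - p).
    by rewrite -expRM_natr (_ : _ * _ = r) ?lnK ?posrE ?(lt_le_trans ltr01)//; lra.
  rewrite /tanh /sinh /cosh expRN; move: e; have := expR_gt0 (r / 2); move: (expR _) => z z0 e.
  have -> : (z - z^-1) / 2 / ((z + z^-1) / 2) = (z ^+ 2 - 1) / (z ^+ 2 + 1).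
    by field; apply/andP; split; rewrite gt_eqF//; nra.
  by rewrite e; field; apply/andP; split; lra.
exists r.
have [t t02 [ct st]] : exists2 t, 0 <= t <= 2 * pi & x.1 = p * cos t /\ x.2 = p * sin t.
  have [p00|pn0] := eqVneq p 0.
    exists 0; first by rewrite lexx mulr_ge0// pi_ge0.
    move: p2; rewrite p00 expr0n/= => /esym/eqP; rewrite /sqnorm paddr_eq0 ?sqr_ge0// !sqrf_eq0.
    by move=> /andP[/eqP-> /eqP->]; rewrite !mul0r.
  have [|t t02 [ct st]] := @unit_vector_angle (x.1 / p) (x.2 / p).
    by rewrite !expr_div_n -mulrDl -/(sqnorm x) -p2 divff// sqrf_eq0.
  by exists t => //; rewrite -ct -st; split; field.
by exists t; split => //; rewrite /polar_point/= thE -ct -st -surjective_pairing.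
Qed.

End node_radius.

Section law_of_radius.
Context {R : realType}.
Variables (alpha nu : R) (n : nat).
Notation Rn := (rhg_radius nu n).
Notation mu := lebesgue_measure.
Implicit Types (r s f t u : R) (x y : R * R).

Lemma radial_cdf1 : 0 < alpha -> 0 < Rn -> radial_cdf alpha Rn Rn = 1.
Proof.
move=> a0 R0; rewrite /radial_cdf divff// coshB1 mulf_neq0// sqrf_eq0 gt_eqF//.
by rewrite sinh_gt0// divr_gt0// mulr_gt0.
Qed.

(** B is constrained only at radii in [0, Rn[, which carry all of the radial law. There the section
    of B over r is everything or empty according to whether r <= s, so the integral is that of an
    indicator. *)
Lemma rhg_law_radius (B : set (R * R)) (s : R) : 0 <= s -> s <= Rn -> measurable B ->
  (forall r t, 0 <= r -> r < Rn -> B (polar_point (r, t)) <-> r <= s) ->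
  rhg_law alpha nu n B = (radial_cdf alpha Rn s)%:E.
Proof.
move=> s0 sR mB hB; rewrite /rhg_law /pushforward /product_measure1 -(@radial_law_itv _ alpha nu n)//.
set A := _ @^-1` _.
have mA : measurable A.
  have mf : measurable_fun setT (@polar_point R).
    have mt : measurable_fun setT (fun p : R * R => tanh (p.1 / 2)).
      have mh (h : R -> R) : continuous h -> measurable_fun setT (fun p : R * R => h (p.1 / 2)).
        move=> ch; apply: (@measurableT_comp _ _ _ _ _ _ h); first exact: continuous_measurable_fun.
        exact: measurable_funM.
      apply: measurable_funM; first exact: (mh _ continuous_sinh).
      by apply: measurableT_comp; [exact: measurable_invr|exact: (mh _ continuous_cosh)].
    apply/measurable_fun_pairP => /=; split; apply: measurable_funM => //.
      by apply: (@measurableT_comp _ _ _ _ _ _ (@cos R)) => //; apply: continuous_measurable_fun; exact: continuous_cos.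
    by apply: (@measurableT_comp _ _ _ _ _ _ (@sin R)) => //; apply: continuous_measurable_fun; exact: continuous_sin.
  by have := mf measurableT _ mB; rewrite setTI.
transitivity (\int[radial_law alpha nu n]_r (\1_(`[0, s] : set R) r)%:E)%E; last first.
  by rewrite integral_indic ?setIT.
apply: ae_eq_integral => //.
- exact: measurable_fun_xsection.
- by apply/measurable_EFinP; exact: measurable_indic.
exists (~` `[0, Rn[); split.
- by apply: measurableC.
- etransitivity; first by apply: radial_law_setI; exact: measurableC.
  by rewrite setICl measure0.
move=> r; apply: contra_not => /=; rewrite in_itv/= => /andP[r0 rR] _.
rewrite indicE mem_setE in_itv/= r0/=; case: (boolP (r <= s)) => rs.
  rewrite (_ : xsection A r = setT) ?probability_setT//; apply/seteqP; split => // t _.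
  by rewrite /xsection/= inE; apply/hB.
rewrite (_ : xsection A r = set0) ?measure0//; apply/seteqP; split => // t.
by rewrite /xsection/= inE => /(hB _ _ r0 rR); rewrite (negbTE rs).
Qed.

Lemma radial_cdf_le Rn' s s' : 0 < alpha -> 0 <= s -> s <= s' ->
  radial_cdf alpha Rn' s <= radial_cdf alpha Rn' s'.
Proof.
move=> a0 s0 ss'; rewrite ler_wpM2r// ?invr_ge0 ?subr_ge0 ?cosh_ge1// lerD2r ler_cosh//.
- by rewrite ler_wpM2l// ltW.
- by rewrite mulr_ge0// ltW.
- by rewrite mulr_ge0 ?(ltW a0)// (le_trans s0).
Qed.

(** A point at radius reach(r') stays within the distance Rn' when r' is lowered to r, by
    [hyp_close_mono]; the explicit formula need not be differentiated. *)
Lemma reach_le Rn' r r' f : 0 <= r -> r <= r' -> r' <= Rn' -> reach Rn' r' f <= reach Rn' r f.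
Proof.
move=> r0 rr' rR; have r'0 := le_trans r0 rr'.
have h1 := reach_ge0 f r'0 rR.
rewrite {2}/reach le_min ge_min lexx/= -ler_expR lnK ?posrE ?divr_gt0 ?reach_num_gt0 ?kappa_gt0//.
rewrite ler_pdivlMr ?kappa_gt0//; apply/hyp_closeP => //; first exact: le_trans rR.
apply: (hyp_close_mono r0 rr'); first by rewrite h1 ge_min lexx.
apply/hyp_closeP => //; rewrite -ler_pdivlMr ?kappa_gt0//.
have q0 : 0 < reach_num Rn' r' f / kappa r' f by rewrite divr_gt0 ?reach_num_gt0 ?kappa_gt0.
by rewrite -[leRHS]lnK ?posrE// ler_expR ge_min lexx orbT.
Qed.

Lemma continuous_cdf_reach alpha' Rn' r : 0 <= r ->
  continuous (fun f => radial_cdf alpha' Rn' (reach Rn' r f)).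
Proof.
move=> r0 f; apply: (@continuous_comp _ _ _ (reach Rn' r) (radial_cdf alpha' Rn')).
  exact: continuous_reach.
exact: continuous_radial_cdf.
Qed.

Lemma adjacency_prob_le r r' : 0 < alpha -> 0 <= r -> r <= r' -> r' <= Rn ->
  adjacency_prob alpha Rn r' <= adjacency_prob alpha Rn r.
Proof.
move=> a0 r0 rr' rR; have r'0 := le_trans r0 rr'.
rewrite /adjacency_prob; apply: ler_wpM2l; first by rewrite invr_ge0 pi_ge0.
have ig r1 : 0 <= r1 -> mu.-integrable `[0, pi] (EFin \o (fun f => radial_cdf alpha Rn (reach Rn r1 f))).
  move=> r10; apply: continuous_compact_integrable; first exact: segment_compact.
  by apply: continuous_subspaceT; exact: continuous_cdf_reach.
apply: le_Rintegral; [by []|exact: ig|exact: ig|] => f _.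
by rewrite radial_cdf_le// ?reach_ge0// reach_le.
Qed.

End law_of_radius.

(** * Asymptotics of the adjacency probability *)

Section bounded_convergence.
Context {R : realType}.
Notation mu := (@lebesgue_measure R).

(** Dominated convergence whose measurability and domination hold only eventually, as for radii that
    lie in range only for large n; a shift of the index reduces it to the usual form. *)
Lemma cvg_Rintegral_dominated (D : set R) (f_ : nat -> R -> R) (f g : R -> R) :
  measurable D -> (\forall n \near \oo, measurable_fun D (f_ n)) -> measurable_fun D f ->
  {ae mu, forall x, D x -> f_ n x @[n --> \oo] --> f x} ->
  mu.-integrable D (EFin \o g) ->
  (\forall n \near \oo, forall x, D x -> `|f_ n x| <= g x) ->
  (\int[mu]_(x in D) f_ n x) @[n --> \oo] --> \int[mu]_(x in D) f x.
Proof.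
move=> mD mf_ mf cf ig bf.
have [N _ hN] := filterI mf_ bf.
rewrite -(cvg_shiftn N) /=.
have [] := @dominated_convergence _ _ _ mu D mD (fun n x => (f_ (n + N)%N x)%:E) (EFin \o f) (EFin \o g).
- by move=> n; apply/measurable_EFinP; exact: (hN _ (leq_addl _ _)).1.
- by apply/measurable_EFinP.
- have [M [mM M0 sM]] := cf; exists M; split => // x /= h; apply: sM => /= h2; apply: h => Dx.
  apply: cvg_EFin; first exact: nearW.
  by have := h2 Dx; rewrite -(cvg_shiftn N).
- exact: ig.
- apply: aeW => x n Dx; rewrite lee_fin; exact: (hN _ (leq_addl _ _)).2.
move=> fi _ h; apply: fine_cvg; rewrite fineK//; exact: integrable_fin_num.
Qed.

End bounded_convergence.

Section reach_estimates.
Context {R : realType}.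
Implicit Types (alpha Rn r s f d : R).

Lemma cosh_convex (a b : R) : cosh a - cosh b <= (a - b) * sinh a.
Proof.
have h1 := expR_ge1Dx (b - a); have h2 := expR_ge1Dx (a - b).
have e1 : expR b = expR a * expR (b - a) by rewrite -expRD; congr expR; lra.
have e2 : expR (- b) = expR (- a) * expR (a - b) by rewrite -expRD; congr expR; lra.
rewrite /cosh /sinh e1 e2; have a0 := expR_gt0 a; have a1 := expR_gt0 (- a).
move: (expR a) (expR (- a)) (expR (b - a)) (expR (a - b)) h1 h2 a0 a1 => u v x y h1 h2 u0 v0.
have : 0 <= u * (x - (1 + (b - a))) by rewrite mulr_ge0 ?subr_ge0// ltW.
have : 0 <= v * (y - (1 + (a - b))) by rewrite mulr_ge0 ?subr_ge0// ltW.
by nra.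
Qed.

(** The half-angle form has no cancellation, and a ratio of hyperbolic sines is easily compared with
    an exponential. *)
Lemma radial_cdfE alpha Rn s :
  radial_cdf alpha Rn s = (sinh (alpha * s / 2) / sinh (alpha * Rn / 2)) ^+ 2.
Proof. rewrite /radial_cdf !coshB1; move: (sinh _) (sinh _) => a b.
by rewrite expr_div_n invfM mulrACA divff ?mul1r. Qed.

Lemma sinh_ratio_le (x y : R) : 0 < y -> x <= y -> sinh x / sinh y <= expR (x - y).
Proof.
move=> y0 xy; rewrite ler_pdivrMr ?sinh_gt0// /sinh expRD.
have h : expR x * expR (- y) * expR (- y) <= expR (- x).
  by rewrite -!expRD ler_expR; lra.
have e : expR (- y) * expR y = 1 by rewrite -expRD addNr expR0.
move: (expR x) (expR y) (expR (- x)) (expR (- y)) h e => a b c d' h e.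
rewrite (_ : a * d' * ((b - d') / 2) = (a * (d' * b) - a * d' * d') / 2); last by field.
by rewrite e; lra.
Qed.

Lemma sinh_ratio_ge (x y : R) : 0 < y -> 0 <= x ->
  expR (x - y) * (1 - expR (- (2 * x))) <= sinh x / sinh y.
Proof.
move=> y0 x0; rewrite ler_pdivlMr ?sinh_gt0// /sinh.
have -> : expR (- (2 * x)) = expR (- x) * expR (- x) by rewrite -expRD; congr expR; lra.
rewrite expRD; have e : expR (- y) * expR y = 1 by rewrite -expRD addNr expR0.
have e' : expR (- x) * expR x = 1 by rewrite -expRD addNr expR0.
have := expR_gt0 (- x); have : expR (- x) <= expR x by rewrite ler_expR; lra.
move: (expR x) (expR y) (expR (- x)) (expR (- y)) (expR_gt0 (- y)) e e' => a b c d' d0 e e' ca c0.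
rewrite (_ : a * d' * (1 - c * c) * ((b - d') / 2) = (a - (c * a) * c) * (d' * b - d' * d') / 2); last by field.
rewrite e e' mul1r; have : 0 <= (a - c) * (d' * d') by rewrite mulr_ge0 ?subr_ge0// mulr_ge0// ltW.
by nra.
Qed.

Lemma radial_cdf_le_expR alpha Rn s : 0 < alpha -> 0 < Rn -> 0 <= s -> s <= Rn ->
  radial_cdf alpha Rn s <= expR (- (alpha * (Rn - s))).
Proof.
move=> a0 R0 s0 sR; rewrite radial_cdfE.
have -> : expR (- (alpha * (Rn - s))) = expR (alpha * s / 2 - alpha * Rn / 2) ^+ 2.
  by rewrite -expRM_natr; congr expR; lra.
have y0 : 0 < alpha * Rn / 2 by rewrite divr_gt0// mulr_gt0.
have x0 : 0 <= alpha * s / 2 by rewrite divr_ge0// mulr_ge0// ltW.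
have q0 : 0 <= sinh (alpha * s / 2) / sinh (alpha * Rn / 2).
  by apply: divr_ge0; apply: sinh_ge0 => //; exact: ltW.
rewrite lerXn2r ?nnegrE ?expR_ge0//.
by apply: sinh_ratio_le => //; rewrite ler_pM2r ?ler_pM2l.
Qed.

Lemma radial_cdf_ge_expR alpha Rn s : 0 < alpha -> 0 < Rn -> 0 <= s ->
  expR (- (alpha * (Rn - s))) * (1 - expR (- (alpha * s))) ^+ 2 <= radial_cdf alpha Rn s.
Proof.
move=> a0 R0 s0; rewrite radial_cdfE.
have -> : expR (- (alpha * (Rn - s))) = expR (alpha * s / 2 - alpha * Rn / 2) ^+ 2.
  by rewrite -expRM_natr; congr expR; lra.
have y0 : 0 < alpha * Rn / 2 by rewrite divr_gt0// mulr_gt0.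
have x0 : 0 <= alpha * s / 2 by rewrite divr_ge0// mulr_ge0// ltW.
have e1 : 0 <= 1 - expR (- (alpha * s)).
  by rewrite subr_ge0 -expR0 ler_expR oppr_le0 mulr_ge0// ltW.
have q0 : 0 <= sinh (alpha * s / 2) / sinh (alpha * Rn / 2).
  by apply: divr_ge0; apply: sinh_ge0 => //; exact: ltW.
rewrite -exprMn lerXn2r ?nnegrE//; first by rewrite mulr_ge0 ?expR_ge0.
by have := sinh_ratio_ge y0 x0; rewrite (_ : 2 * (alpha * s / 2) = alpha * s)//; lra.
Qed.

Lemma radial_cdf_gap alpha Rn s : 0 < alpha -> 0 < Rn ->
  1 - radial_cdf alpha Rn s <= alpha * (Rn - s) * (sinh (alpha * Rn) / (cosh (alpha * Rn) - 1)).
Proof.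
move=> a0 R0; rewrite /radial_cdf.
have c0 : 0 < cosh (alpha * Rn) - 1.
  by rewrite coshB1 mulr_gt0// exprn_gt0// sinh_gt0// divr_gt0// mulr_gt0.
rewrite -[X in X - _](divff (lt0r_neq0 c0)) -mulrBl mulrA ler_pM2r ?invr_gt0//.
by rewrite mulrBr; have := cosh_convex (alpha * Rn) (alpha * s); lra.
Qed.

(** A bound for Rn - ln(reach_num): [reach_num] lies between e^Rn - sinh(r)^2 / sinh(Rn) and e^Rn,
    and the factor 2 comes from dividing by [reach_num] >= e^Rn / 2. *)
Definition reach_err Rn r : R := 2 * expR (- Rn) * sinh r ^+ 2 / sinh Rn.

(** Rn - reach equals max(0, Rn - ln(reach_num) + ln kappa), and Rn - ln(reach_num) lies in
    [0, reach_err], uniformly in the angle. *)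
Lemma reach_gap Rn r f : 0 <= r -> r <= Rn -> 0 < Rn ->
  Num.max 0 (ln (kappa r f)) <= Rn - reach Rn r f <= Num.max 0 (ln (kappa r f)) + reach_err Rn r.
Proof.
move=> r0 rR R0; have k0 := kappa_gt0 f r0; have n0 := reach_num_gt0 Rn r f.
have sR := sinh_gt0 R0.
have D0 := reach_disc_ge0 f r0 rR.
have qle : Num.sqrt (sinh Rn ^+ 2 - sinh r ^+ 2 * sin f ^+ 2) <= sinh Rn.
  rewrite -[leRHS](ger0_norm (ltW sR)) -sqrtr_sqr ler_wsqrtr// lerBlDr lerDl.
  by rewrite mulr_ge0 ?sqr_ge0.
have qge : sinh Rn - sinh r ^+ 2 / sinh Rn <= Num.sqrt (sinh Rn ^+ 2 - sinh r ^+ 2 * sin f ^+ 2).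
  have q2 := sqr_sqrtr D0; have q0 := sqrtr_ge0 (sinh Rn ^+ 2 - sinh r ^+ 2 * sin f ^+ 2).
  move: (Num.sqrt _) q2 q0 qle => q q2 q0 qle.
  have s1 : sinh r ^+ 2 * sin f ^+ 2 <= sinh r ^+ 2.
    by rewrite ler_piMr ?sqr_ge0//; have := cos2Dsin2 f; have := sqr_ge0 (cos f); lra.
  rewrite lerBlDr -lerBlDl ler_pdivlMr//.
  have : 0 <= q * (sinh Rn - q) by rewrite mulr_ge0// subr_ge0.
  by nra.
have nle : reach_num Rn r f <= expR Rn by rewrite expRE lerD2l.
have nge : expR Rn - sinh r ^+ 2 / sinh Rn <= reach_num Rn r f.
  by rewrite expRE -addrA lerD2l.
have nge2 : expR Rn <= 2 * reach_num Rn r f.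
  rewrite /reach_num; have := sqrtr_ge0 (sinh Rn ^+ 2 - sinh r ^+ 2 * sin f ^+ 2).
  by move: (Num.sqrt _) => q q0; rewrite /cosh; have := expR_gt0 (- Rn); lra.
have lnle : ln (reach_num Rn r f) <= Rn by rewrite -ler_expR lnK ?posrE.
have lnge : Rn - ln (reach_num Rn r f) <= reach_err Rn r.
  have h := le_ln1Dx (x := expR Rn / reach_num Rn r f - 1).
  have eR0 := expR_gt0 Rn.
  have -> : Rn - ln (reach_num Rn r f) = ln (expR Rn / reach_num Rn r f).
    by rewrite ln_div ?posrE// expRK.
  have {h} h : ln (expR Rn / reach_num Rn r f) <= expR Rn / reach_num Rn r f - 1.
    move: h; rewrite (addrC 1) subrK; apply.
    by rewrite ltrBrDl subrr divr_gt0.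
  apply: (le_trans h); rewrite /reach_err expRN.
  rewrite lerBlDr ler_pdivrMr//.
  set N := reach_num _ _ _ in n0 nge2 nge *; set q := sinh r ^+ 2 / sinh Rn in nge *.
  have q0 : 0 <= q by rewrite divr_ge0 ?sqr_ge0// ltW.
  rewrite (_ : 2 * _ * _ / _ = 2 * q / expR Rn); last by rewrite /q; field; rewrite !gt_eqF.
  rewrite mulrDl mul1r.
  have : q <= 2 * q / expR Rn * N.
    rewrite mulrAC ler_pdivlMr//.
    by have : 0 <= q * (2 * N - expR Rn) by [rewrite mulr_ge0// subr_ge0]; lra.
  by lra.
have rE : Rn - reach Rn r f = Num.max 0 (Rn - ln (reach_num Rn r f) + ln (kappa r f)).
  rewrite /reach ln_div ?posrE// /Num.max /Num.min; case: ltP => h1; case: ltP => h2; lra.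
have e0 : 0 <= reach_err Rn r.
  apply: mulr_ge0; last by rewrite invr_ge0 ltW.
  apply: mulr_ge0; last exact: sqr_ge0.
  by apply: mulr_ge0 => //; exact: expR_ge0.
rewrite rE; move: (ln (kappa r f)) (ln (reach_num Rn r f)) (reach_err Rn r) lnle lnge e0.
move=> a b c h1 h2 h3; apply/andP; split.
  by rewrite ge_max !le_max lexx/=; apply/orP; right; lra.
rewrite ge_max; apply/andP; split.
  by have : 0 <= Num.max 0 a by [rewrite le_max lexx]; lra.
by have : a <= Num.max 0 a by [rewrite le_max lexx orbT]; lra.
Qed.

End reach_estimates.

(** * Limits of the adjacency probability at fixed and at vanishing radius *)

Section adjacency_limits.
Context {R : realType}.
Notation mu := (@lebesgue_measure R).
Implicit Types (alpha Rn r s f d : R).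

Lemma near_gty (u : R^nat) A : u n @[n --> \oo] --> +oo -> \forall n \near \oo, A < u n.
Proof. by move=> /cvgryPgt. Qed.

Lemma cvg_expRNy (u : R^nat) : u n @[n --> \oo] --> +oo -> expR (- u n) @[n --> \oo] --> (0 : R).
Proof. by move=> h; exact: (cvg_comp _ (fun x => expR (- x)) h (@cvgr_expR R)). Qed.

Lemma cvg_radial_cdf alpha (Rs s : R^nat) d : 0 < alpha ->
  Rs n @[n --> \oo] --> +oo -> (\forall n \near \oo, 0 <= s n <= Rs n) ->
  Rs n - s n @[n --> \oo] --> d ->
  radial_cdf alpha (Rs n) (s n) @[n --> \oo] --> expR (- (alpha * d)).
Proof.
move=> a0 Roo sR sd.
have e1 : expR (- (alpha * (Rs n - s n))) @[n --> \oo] --> expR (- (alpha * d)).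
  apply: (continuous_cvg _ (f := fun n => - (alpha * (Rs n - s n))) (h := expR)).
    exact: continuous_expR.
  by apply: cvgN; exact: cvgMl_tmp.
have soo : alpha * s n @[n --> \oo] --> +oo.
  apply/cvgryPge => A; have /cvgryPge/(_ (A / alpha + d + 1)) h1 := Roo.
  have /cvgrPdist_lt/(_ _ ltr01) h2 := sd.
  near=> n; rewrite mulrC -ler_pdivrMr//.
  have := near h1 n; have : `|d - (Rs n - s n)| < 1 by near: n.
  have : A / alpha + d + 1 <= Rs n by near: n.
  by rewrite ltr_norml => ? /andP[]; lra.
have e2 : expR (- (alpha * (Rs n - s n))) * (1 - expR (- (alpha * s n))) ^+ 2 @[n --> \oo]
    --> expR (- (alpha * d)) * (1 - 0) ^+ 2.
  apply: cvgM => //; apply: (continuous_cvg _ (f := fun n => 1 - expR (- (alpha * s n))) (h := fun x : R => x ^+ 2)).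
      exact: exprn_continuous.
  by apply: cvgB; [exact: cvg_cst|exact: cvg_expRNy].
rewrite subr0 expr1n mulr1 in e2.
apply: (squeeze_cvgr _ e2 e1).
near=> n; have /andP[s0 sRn] : 0 <= s n <= Rs n by near: n.
have R0 : 0 < Rs n by near: n; exact: near_gty.
by rewrite radial_cdf_ge_expR// radial_cdf_le_expR.
Unshelve. all: by end_near. Qed.

Lemma cvg_reach (Rs r f : R^nat) d :
  (\forall n \near \oo, 0 <= r n <= Rs n) -> (\forall n \near \oo, 0 < Rs n) ->
  reach_err (Rs n) (r n) @[n --> \oo] --> (0 : R) ->
  Num.max 0 (ln (kappa (r n) (f n))) @[n --> \oo] --> d ->
  Rs n - reach (Rs n) (r n) (f n) @[n --> \oo] --> d.
Proof.
move=> r0 R0 e0 kd.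
have h : Num.max 0 (ln (kappa (r n) (f n))) + reach_err (Rs n) (r n) @[n --> \oo] --> d.
  by rewrite -[X in _ --> X]addr0; exact: cvgD.
apply: (squeeze_cvgr _ kd h).
near=> n; have /andP[r0n rRn] : 0 <= r n <= Rs n by near: n.
by apply: reach_gap => //; near: n.
Unshelve. all: by end_near. Qed.

Lemma sinh_le r : sinh r <= expR r / 2.
Proof. by rewrite /sinh; have := expR_gt0 (- r); lra. Qed.

Lemma sinh_ge r : 1 <= r -> expR r / 4 <= sinh r.
Proof.
move=> r1; rewrite /sinh expRN; have := expR_ge1Dx r; move: (expR r) => z hz.
have : z^-1 <= 1 by rewrite invf_le1; lra.
by lra.
Qed.

Lemma sinh_le2 r : 0 <= r -> r <= 2^-1 -> sinh r <= 2 * r.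
Proof.
move=> r0 r2; rewrite /sinh expRN.
have h : 1 - r <= expR (- r) by have := expR_ge1Dx (- r); lra.
rewrite expRN in h; have z0 := expR_gt0 r; move: (expR r) h z0 => z h z0.
have : z * (1 - r) <= 1.
  by have := ler_wpM2l (ltW z0) h; rewrite mulfV// gt_eqF.
have : (1 - r) <= z^-1 by [].
by nra.
Qed.

Lemma reach_err_le Rn r : 1 <= Rn -> 0 <= r -> reach_err Rn r <= 2 * expR (- (2 * (Rn - r))).
Proof.
move=> R1 r0; rewrite /reach_err ler_pdivrMr; last by rewrite sinh_gt0; lra.
have h : expR (- (2 * (Rn - r))) * expR Rn = expR (- Rn) * expR r ^+ 2.
  by rewrite -expRM_natr -!expRD; congr expR; lra.
have hs : sinh r ^+ 2 <= expR r ^+ 2 / 4.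
  have := sinh_le r; have := sinh_ge0 r0; move: (sinh r) (expR r) => a b; nra.
have hR := sinh_ge R1.
have e0 := expR_gt0 (- (2 * (Rn - r))).
have e1 := expR_gt0 (- Rn).
have h1 := ler_wpM2l (ltW e1) hs.
have h2 := ler_wpM2l (ltW e0) hR.
by move: h h1 h2; rewrite !mulrA => h h1 h2; lra.
Qed.

Lemma reach_err_ge0 Rn r : 0 < Rn -> 0 <= reach_err Rn r.
Proof.
move=> R0; apply: mulr_ge0; last by rewrite invr_ge0 ltW// sinh_gt0.
apply: mulr_ge0; last exact: sqr_ge0.
by apply: mulr_ge0 => //; exact: expR_ge0.
Qed.

Lemma cvg_reach_err (Rs r : R^nat) : (\forall n \near \oo, 0 <= r n) ->
  Rs n @[n --> \oo] --> +oo -> Rs n - r n @[n --> \oo] --> +oo ->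
  reach_err (Rs n) (r n) @[n --> \oo] --> (0 : R).
Proof.
move=> r0 Roo doo.
have h : 2 * expR (- (2 * (Rs n - r n))) @[n --> \oo] --> 2 * (0 : R).
  apply: cvgMl_tmp; apply: cvg_expRNy; apply/cvgryPge => A.
  have /cvgryPge/(_ (A / 2)) := doo; apply: filterS => n; lra.
rewrite mulr0 in h; apply: (squeeze_cvgr _ (cvg_cst 0) h).
near=> n; have R1 : 1 <= Rs n by apply: ltW; near: n; exact: near_gty.
by rewrite reach_err_ge0 ?reach_err_le//; [near: n|lra].
Unshelve. all: by end_near. Qed.

Lemma integrable_cdf_reach alpha Rn r : 0 <= r ->
  mu.-integrable `[0, pi] (EFin \o (fun f => radial_cdf alpha Rn (reach Rn r f))).
Proof.
move=> r0; apply: continuous_compact_integrable; first exact: segment_compact.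
by apply: continuous_subspaceT; exact: continuous_cdf_reach.
Qed.

Lemma measurable_cdf_reach (D : set R) alpha Rn r : 0 <= r ->
  measurable_fun D (fun f => radial_cdf alpha Rn (reach Rn r f)).
Proof.
move=> r0; apply: measurable_funTS; apply: continuous_measurable_fun.
exact: continuous_cdf_reach.
Qed.

Lemma radial_cdf_reach_bound alpha Rn r f : 0 < alpha -> 0 <= r -> r <= Rn -> 0 < Rn ->
  0 <= radial_cdf alpha Rn (reach Rn r f) <= expR (- (alpha * Num.max 0 (ln (kappa r f)))).
Proof.
move=> a0 r0 rR R0; rewrite radial_cdf_ge0/=.
have /andP[h1 h2] := reach_gap f r0 rR R0.
apply: (le_trans (radial_cdf_le_expR a0 R0 (reach_ge0 f r0 rR) _)); first by rewrite ge_min lexx.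
by rewrite ler_expR lerN2 ler_pM2l.
Qed.

(** This is min(1, kappa^(-alpha)), the limit for large Rn of the conditional adjacency probability
    given the relative angle f. *)
Definition reach_limit alpha r f : R := expR (- (alpha * Num.max 0 (ln (kappa r f)))).

Lemma continuous_reach_limit alpha r : 0 <= r -> continuous (reach_limit alpha r).
Proof.
move=> r0 f; apply: (@continuous_comp _ _ _
  (fun f => - (alpha * Num.max 0 (ln (kappa r f)))) expR); last exact: continuous_expR.
apply: cvgN; apply: cvgMl_tmp.
apply: (@continuous_max _ _ (fun=> 0) (fun f => ln (kappa r f))); first exact: cvg_cst.
apply: (@continuous_comp _ _ _ (kappa r) (@ln R)); first exact: continuous_kappa.
by apply: continuous_ln; exact: kappa_gt0.
Qed.

Lemma reach_limit_le1 alpha r f : 0 < alpha -> reach_limit alpha r f <= 1.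
Proof.
move=> a0; rewrite -[leRHS]expR0 ler_expR oppr_le0 mulr_ge0 ?(ltW a0)//.
by rewrite le_max lexx.
Qed.

Lemma cvg_adjacency_prob_fixed alpha (Rs : R^nat) r : 0 < alpha -> 0 <= r ->
  Rs n @[n --> \oo] --> +oo ->
  adjacency_prob alpha (Rs n) r @[n --> \oo] -->
  pi^-1 * \int[mu]_(f in `[0, pi]) reach_limit alpha r f.
Proof.
move=> a0 r0 Roo; apply: cvgMl_tmp.
have rR : \forall n \near \oo, 0 <= r <= Rs n.
  by have /cvgryPge/(_ r) := Roo; apply: filterS => n ->; rewrite r0.
have R0 : \forall n \near \oo, 0 < Rs n by exact: near_gty.
apply: (@cvg_Rintegral_dominated _ `[0, pi] _ _ (fun=> 1)) => //.
- by apply: nearW => n; exact: measurable_cdf_reach.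
- apply: measurable_funTS; apply: continuous_measurable_fun; exact: continuous_reach_limit.
- apply: aeW => f _; apply: cvg_radial_cdf => //.
    near=> n; rewrite ge_min lexx andbT.
    have /andP[_ h] : 0 <= r <= Rs n by near: n.
    by rewrite reach_ge0.
  apply: cvg_reach => //; last exact: cvg_cst.
  apply: cvg_reach_err => //; first exact: nearW.
  by apply/cvgryPge => A; have /cvgryPge/(_ (A + r)) := Roo; apply: filterS => n; lra.
- apply: continuous_compact_integrable; first exact: segment_compact.
  by apply: continuous_subspaceT => x; exact: cvg_cst.
- near=> n => f _; have /andP[_ h] : 0 <= r <= Rs n by near: n.
  have h0 : 0 < Rs n by near: n.
  have /andP[h1 h2] := @radial_cdf_reach_bound alpha (Rs n) r f a0 r0 h h0.
  by rewrite ger0_norm// (le_trans h2)// (@reach_limit_le1 alpha r f).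
Unshelve. all: by end_near. Qed.

(** The ratio is coth(x/2). *)
Lemma coth_bound (x : R) : 2 <= x -> sinh x / (cosh x - 1) <= 2.
Proof.
move=> x2; have e1 := expR_ge1Dx x; have e2 : expR (- x) <= 1.
  by rewrite -expR0 ler_expR; lra.
have c0 : 0 < cosh x - 1 by rewrite /cosh; have := expR_gt0 (- x); lra.
rewrite ler_pdivrMr// /cosh /sinh.
suff : 4 <= expR x + 3 * expR (- x) by lra.
have e4 : 4 <= expR 2 :> R.
  have -> : 2 = 1 + 1 :> R by lra.
  by rewrite expRD; have := expR_ge1Dx (1 : R); nra.
have : expR 2 <= expR x by rewrite ler_expR.
by have := expR_gt0 (- x); lra.
Qed.

Lemma cvg_coth (u : R^nat) : u n @[n --> \oo] --> +oo ->
  sinh (u n) / (cosh (u n) - 1) @[n --> \oo] --> (1 : R).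
Proof.
move=> uoo.
have h : (1 - expR (- u n) * expR (- u n)) / (1 + expR (- u n) * expR (- u n) - 2 * expR (- u n))
    @[n --> \oo] --> ((1 - 0 * 0) / (1 + 0 * 0 - 2 * 0) : R).
  have e := cvg_expRNy uoo.
  have ee : expR (- u n) * expR (- u n) @[n --> \oo] --> (0 * 0 : R) by exact: cvgM.
  have h1 : 1 - expR (- u n) * expR (- u n) @[n --> \oo] --> (1 - 0 * 0 : R).
    by apply: cvgB; [exact: cvg_cst|exact: ee].
  have h2 : 1 + expR (- u n) * expR (- u n) @[n --> \oo] --> (1 + 0 * 0 : R).
    by apply: cvgD; [exact: cvg_cst|exact: ee].
  have h3 : 2 * expR (- u n) @[n --> \oo] --> (2 * 0 : R) by exact: cvgMl_tmp.
  apply: cvgM; first exact: h1.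
  apply: cvgV; first by rewrite !mulr0 addr0 subr0 oner_eq0.
  by apply: cvgB; [exact: h2|exact: h3].
rewrite !mulr0 addr0 subr0 divr1 in h; apply: cvg_trans h; apply: near_eq_cvg.
near=> n; have u0 : 0 < u n by near: n; exact: near_gty.
rewrite /sinh /cosh expRN; have : 1 < expR (u n) by rewrite -expR0 ltr_expR.
move: (expR (u n)) => z z1; field; rewrite !gt_eqF//; last by nra.
by have : 0 < (z - 1) ^+ 2 by [rewrite exprn_gt0// subr_gt0]; nra.
Unshelve. all: by end_near. Qed.

Lemma integral_pos_part_cos : \int[mu]_(f in `[0, pi]) Num.max 0 (- cos f) = 1.
Proof.
have p0 := pi_gt0 R.
have cm : continuous (fun f : R => Num.max 0 (- cos f)).
  move=> f; apply: (@continuous_max _ _ (fun=> 0) (fun f => - cos f)); first exact: cvg_cst.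
  by apply: cvgN; exact: continuous_cos.
have m0 f : 0 <= Num.max 0 (- cos f) :> R by rewrite le_max lexx.
have h1 : 0 <= pi / 2 :> R by lra.
have h2 : pi / 2 <= pi :> R by lra.
rewrite /Rintegral (ge0_integral_itv_cat h1 h2 cm m0).
rewrite (_ : integral _ _ _ = 0)%E ?add0e; last first.
  apply: integral0_eq => f; rewrite /= in_itv/= => /andP[f0 f1]; congr EFin.
  by apply/max_idPl; rewrite oppr_le0 cos_ge0_pihalf//; lra.
rewrite (_ : integral _ _ _ = \int[mu]_(f in `[(pi / 2)%R, pi]) (- cos f)%:E)%E; last first.
  apply: eq_integral => f; rewrite inE/= in_itv/= => /andP[f0 f1]; congr EFin.
  apply/max_idPr; rewrite oppr_ge0.
  have -> : f = (f - pi) + pi by lra.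
  by rewrite cosDpi oppr_le0 cos_ge0_pihalf//; lra.
rewrite (@continuous_FTC2 _ _ (fun f => - sin f))//=.
- by rewrite sinpi sin_pihalf; lra.
- lra.
- by apply: continuous_subspaceT => f; apply: cvgN; exact: continuous_cos.
- have cs : continuous (fun f : R => - sin f) by move=> f; apply: cvgN; exact: continuous_sin.
  split; first by move=> f _; exact: derivableN.
    by apply: cvg_at_right_filter; exact: cs.
  by apply: cvg_at_left_filter; exact: cs.
- by move=> f _; rewrite derive1E derive_val.
Qed.

(** A difference quotient at radius 0, where kappa is 1 and has derivative -cos f. *)
Lemma cvg_ln_kappa_rate (r : R^nat) f : (forall n, 0 < r n) -> r n @[n --> \oo] --> (0 : R) ->
  ln (kappa (r n) f) / r n @[n --> \oo] --> - cos f.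
Proof.
move=> r0 rc.
have d0 : is_derive (0 : R) 1 (fun x => ln (kappa x f)) (- cos f).
  have dk : is_derive (0 : R) 1 (fun x => kappa x f) (- cos f).
    have h1 := is_derive_cosh (0 : R); have h2 := is_derive_sinh (0 : R).
    rewrite /kappa; apply: is_derive_eq.
    by rewrite /GRing.scale/= sinh0 cosh0; lra.
  have k1 : kappa 0 f = 1 by rewrite /kappa cosh0 sinh0; lra.
  have dl : is_derive (kappa 0 f) 1 (@ln R) 1^-1.
    by rewrite k1; exact: is_derive1_ln.
  by have := @is_derive1_comp _ (@ln R) (fun x => kappa x f) 0 _ _ dl dk; rewrite invr1 mul1r.
have [h1 h2] := d0.
have h : (h^-1 *: (ln (kappa (h *: 1 + 0) f) - ln (kappa 0 f))) @[h --> (0 : R)^'] --> - cos f.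
  by rewrite -h2; exact: h1.
have k1 : kappa 0 f = 1 by rewrite /kappa cosh0 sinh0; lra.
have /cvgr_dnbhsP/(_ r) := h; rewrite k1 ln1.
move=> /(_ (conj _ rc)) hh; apply: cvg_trans (hh _); last by move=> n; rewrite gt_eqF.
by apply: near_eq_cvg; apply: nearW => n; rewrite /GRing.scale/= mulr1 addr0 subr0 mulrC.
Qed.

(* With d the gap Rn - reach, convexity of cosh gives
   a d / (1 + a d) <= 1 - F <= a d coth (a Rn / 2). *)
Lemma cvg_adjacency_prob_small alpha (Rs r : R^nat) : 0 < alpha ->
  (forall n, 0 < r n) -> r n @[n --> \oo] --> (0 : R) -> Rs n @[n --> \oo] --> +oo ->
  (1 - adjacency_prob alpha (Rs n) (r n)) / r n @[n --> \oo] --> alpha / pi.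
Proof.
move=> a0 r0 rc Roo; have p0 := pi_gt0 R.
have rR : \forall n \near \oo, 0 <= r n <= Rs n.
  near=> n; rewrite ltW//= (@le_trans _ _ 1)//; last by apply: ltW; near: n; exact: near_gty.
  by apply: ltW; near: n; apply: (cvgr_lt _ rc).
have R0 : \forall n \near \oo, 0 < Rs n by exact: near_gty.
(* From sinh r <= 2 r and sinh Rn >= 1/4: the error is quadratic in r, hence negligible after
   division by r. *)
have eb : \forall n \near \oo, reach_err (Rs n) (r n) <= 32 * r n ^+ 2.
  near=> n; have R1 : 1 <= Rs n by apply: ltW; near: n; exact: near_gty.
  have r2 : r n <= 2^-1 by apply: ltW; near: n; apply: (cvgr_lt _ rc); lra.
  have h1 := sinh_le2 (ltW (r0 n)) r2; have h2 := sinh_ge R1.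
  have h3 : expR (- Rs n) <= 1 by rewrite -expR0 ler_expR; lra.
  have h4 : 1 <= expR (Rs n) by rewrite -expR0 ler_expR; lra.
  have h5 : sinh (r n) ^+ 2 <= 4 * r n ^+ 2.
    by have := sinh_ge0 (ltW (r0 n)); have := r0 n; move: (sinh _) h1 => x h1; nra.
  rewrite /reach_err ler_pdivrMr; last by lra.
  have h6 : 8 * r n ^+ 2 <= 32 * r n ^+ 2 * sinh (Rs n).
    by have : 0 <= r n ^+ 2 * (sinh (Rs n) - 4^-1) by [rewrite mulr_ge0 ?sqr_ge0// subr_ge0; lra]; lra.
  apply: le_trans h6; rewrite -mulrA (_ : 8 * _ = 2 * (1 * (4 * r n ^+ 2))); last by lra.
  rewrite ler_pM2l// ler_pM ?expR_ge0//; exact: sqr_ge0.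
have e0 : reach_err (Rs n) (r n) / r n @[n --> \oo] --> (0 : R).
  have h : 32 * r n @[n --> \oo] --> (32 * 0 : R) by exact: cvgMl_tmp.
  rewrite mulr0 in h; apply: (squeeze_cvgr _ (cvg_cst 0) h); near=> n.
  rewrite divr_ge0 ?reach_err_ge0 ?(ltW (r0 n))//=; last by near: n.
  rewrite ler_pdivrMr// -mulrA -expr2; near: n; exact: eb.
have gap f : (Rs n - reach (Rs n) (r n) f) / r n @[n --> \oo] --> Num.max 0 (- cos f).
  have km : Num.max 0 (ln (kappa (r n) f)) / r n @[n --> \oo] --> Num.max 0 (- cos f).
    apply: (@cvg_trans _ (Num.max 0 (ln (kappa (r n) f) / r n) @[n --> \oo])).
      apply: near_eq_cvg; apply: nearW => n; rewrite maxr_pMl ?mul0r// invr_ge0 ltW//.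
    apply: (continuous_cvg _ (f := fun n => ln (kappa (r n) f) / r n) (h := fun x => Num.max 0 x)).
      by apply: (@continuous_max _ _ (fun=> 0) id); [exact: cvg_cst|exact: cvg_id].
    exact: cvg_ln_kappa_rate.
  have h : Num.max 0 (ln (kappa (r n) f)) / r n + reach_err (Rs n) (r n) / r n @[n --> \oo]
    --> Num.max 0 (- cos f) by rewrite -[X in _ --> X]addr0; exact: cvgD.
  apply: (squeeze_cvgr _ km h); near=> n.
  have /andP[h1 h2] : 0 <= r n <= Rs n by near: n.
  have h3 : 0 < Rs n by near: n.
  have /andP[g1 g2] := reach_gap f h1 h2 h3.
  by rewrite -mulrDl !ler_pM2r ?invr_gt0// g1.
have -> : alpha / pi = pi^-1 * \int[mu]_(f in `[0, pi]) (alpha * Num.max 0 (- cos f)).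
  rewrite RintegralZl//; last first.
    apply: continuous_compact_integrable; first exact: segment_compact.
    apply: continuous_subspaceT => f.
    apply: (@continuous_max _ _ (fun=> 0) (fun f => - cos f)); first exact: cvg_cst.
    by apply: cvgN; exact: continuous_cos.
  by rewrite integral_pos_part_cos mulr1 mulrC.
have E n : (1 - adjacency_prob alpha (Rs n) (r n)) / r n =
    pi^-1 * \int[mu]_(f in `[0, pi]) ((r n)^-1 * (1 - radial_cdf alpha (Rs n) (reach (Rs n) (r n) f))).
  have i1 : mu.-integrable `[0, pi] (EFin \o (fun=> 1)).
    apply: continuous_compact_integrable; first exact: segment_compact.
    by apply: continuous_subspaceT => x; exact: cvg_cst.
  have i2 := @integrable_cdf_reach alpha (Rs n) (r n) (ltW (r0 n)).
  have i3 : mu.-integrable `[0, pi] (EFin \o (fun f => 1 - radial_cdf alpha (Rs n) (reach (Rs n) (r n) f))).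
    apply: eq_integrable (integrableB _ i1 i2) => //.
  have iE : \int[mu]_(f in `[0, pi]) (1 : R) = pi.
    rewrite Rintegral_cst// mul1r; have e : (mu (`[0%R, pi]%classic : set R) = pi%:E)%E.
      by rewrite lebesgue_measure_itv/= lte_fin p0 oppr0 adde0.
    exact: (congr1 fine e).
  rewrite RintegralZl//.
  rewrite RintegralB// iE /adjacency_prob.
  by rewrite mulrCA mulrBr mulVf ?gt_eqF// mulrC.
rewrite (_ : (fun n => _) = (fun n => pi^-1 * \int[mu]_(f in `[0, pi])
  ((r n)^-1 * (1 - radial_cdf alpha (Rs n) (reach (Rs n) (r n) f))))); last exact/funext.
apply: cvgMl_tmp.
have mc n (D : set R) : measurable_fun D (fun f => (r n)^-1 *
    (1 - radial_cdf alpha (Rs n) (reach (Rs n) (r n) f))).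
  apply: measurable_funM => //; apply: measurable_funB => //.
  by apply: measurable_cdf_reach; exact: ltW.
(* For the bound 4 alpha: the gap is at most r + reach_err <= 2 r, and the hyperbolic cotangent is
   at most 2. *)
apply: (@cvg_Rintegral_dominated _ `[0, pi] _ _ (fun=> 4 * alpha)) => //.
- by apply: nearW.
- apply: measurable_funTS; apply: continuous_measurable_fun => f; apply: cvgMl_tmp.
  apply: (@continuous_max _ _ (fun=> 0) (fun f => - cos f)); first exact: cvg_cst.
  by apply: cvgN; exact: continuous_cos.
- apply: aeW => f _; set l := Num.max 0 _.
  have gd : alpha * ((Rs n - reach (Rs n) (r n) f) / r n) @[n --> \oo] --> alpha * l.
    by apply: cvgMl_tmp; exact: gap.
  have g0 : alpha * (Rs n - reach (Rs n) (r n) f) @[n --> \oo] --> alpha * (l * 0).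
    apply: cvgMl_tmp; apply: cvg_trans (cvgM (gap f) rc); apply: near_eq_cvg; apply: nearW => n /=.
    by rewrite -mulrA mulVf ?mulr1// gt_eqF.
  have up : alpha * ((Rs n - reach (Rs n) (r n) f) / r n) *
      (sinh (alpha * Rs n) / (cosh (alpha * Rs n) - 1)) @[n --> \oo] --> alpha * l * 1.
    apply: cvgM => //; apply: cvg_coth; apply/cvgryPge => A.
    have /cvgryPge/(_ (A / alpha)) := Roo; apply: filterS => n.
    by rewrite ler_pdivrMr// mulrC.
  have lo : alpha * ((Rs n - reach (Rs n) (r n) f) / r n) *
      (1 + alpha * (Rs n - reach (Rs n) (r n) f))^-1 @[n --> \oo] --> alpha * l * (1 + alpha * (l * 0))^-1.
    apply: cvgM => //; apply: cvgV; first by rewrite !mulr0 addr0 oner_eq0.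
    by apply: cvgD => //; exact: cvg_cst.
  rewrite !mulr0 addr0 invr1 !mulr1 in up lo.
  apply: (squeeze_cvgr _ lo up); near=> n.
  have /andP[h1 h2] : 0 <= r n <= Rs n by near: n.
  have h3 : 0 < Rs n by near: n.
  have g1 := reach_ge0 f h1 h2.
  have g2 : reach (Rs n) (r n) f <= Rs n by rewrite ge_min lexx.
  have b1 := radial_cdf_le_expR a0 h3 g1 g2.
  have b2 := radial_cdf_gap (reach (Rs n) (r n) f) a0 h3.
  have ad0 : 0 <= alpha * (Rs n - reach (Rs n) (r n) f) by rewrite mulr_ge0 ?subr_ge0// ltW.
  have b3 : alpha * (Rs n - reach (Rs n) (r n) f) / (1 + alpha * (Rs n - reach (Rs n) (r n) f))
      <= 1 - radial_cdf alpha (Rs n) (reach (Rs n) (r n) f).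
    move: (alpha * (_ - _)) ad0 b1 => x x0 b1.
    have := expR_ge1Dx x; rewrite expRN in b1 => ex.
    have : (expR x)^-1 <= (1 + x)^-1 by rewrite lef_pV2// ?posrE; lra.
    rewrite (_ : x / (1 + x) = 1 - (1 + x)^-1); first by lra.
    by field; rewrite gt_eqF//; lra.
  rewrite [X in X <= _](_ : _ = (r n)^-1 * (alpha * (Rs n - reach (Rs n) (r n) f) / (1 + alpha * (Rs n - reach (Rs n) (r n) f)))); last by ring.
  rewrite [X in _ <= _ <= X](_ : _ = (r n)^-1 * (alpha * (Rs n - reach (Rs n) (r n) f) *
    (sinh (alpha * Rs n) / (cosh (alpha * Rs n) - 1)))); last by ring.
  by rewrite !ler_pM2l ?invr_gt0// b3 b2.
- apply: continuous_compact_integrable; first exact: segment_compact.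
  by apply: continuous_subspaceT => x; exact: cvg_cst.
- near=> n => f _.
  have /andP[h1 h2] : 0 <= r n <= Rs n by near: n.
  have h3 : 0 < Rs n by near: n.
  have aR : 2 <= alpha * Rs n.
    by rewrite mulrC -ler_pdivrMr//; apply: ltW; near: n; exact: near_gty.
  have b2 := radial_cdf_gap (reach (Rs n) (r n) f) a0 h3.
  have b1 : radial_cdf alpha (Rs n) (reach (Rs n) (r n) f) <= 1.
    have /andP[_ b] := radial_cdf_reach_bound f a0 h1 h2 h3.
    exact: (le_trans b (@reach_limit_le1 alpha (r n) f a0)).
  rewrite ger0_norm; last by rewrite mulr_ge0 ?subr_ge0// invr_ge0.
  rewrite mulrC ler_pdivrMr//.
  have /andP[g1 g2] := reach_gap f h1 h2 h3.
  have g3 : reach_err (Rs n) (r n) <= r n.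
    have : reach_err (Rs n) (r n) / r n < 1 by near: n; exact: (cvgr_lt _ e0).
    by rewrite ltr_pdivrMr// mul1r => /ltW.
  have g4 : Num.max 0 (ln (kappa (r n) f)) <= r n.
    by rewrite ge_max h1 -ler_expR lnK ?posrE ?kappa_gt0// kappa_le.
  have c2 := coth_bound aR.
  apply: (le_trans b2).
  have x0 : 0 <= alpha * (Rs n - reach (Rs n) (r n) f).
    by rewrite mulr_ge0 ?(ltW a0)// subr_ge0 ge_min lexx.
  apply: (le_trans (ler_wpM2l x0 c2)).
  have : alpha * (Rs n - reach (Rs n) (r n) f) <= alpha * (2 * r n) by rewrite ler_pM2l//; lra.
  by lra.
Unshelve. all: by end_near. Qed.

End adjacency_limits.

(** * Limit of the adjacency probability at large radius *)

Section adjacency_large_radius.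
Context {R : realType}.
Notation mu := (@lebesgue_measure R).
Implicit Types (alpha Rn r s f d v : R).

(** The mean value theorem gives y cos y <= sin y. At y = x/2, doubling the angle yields sin x >= x
    cos(x/2)^2, and cos x >= 0 forces cos(x/2)^2 >= 1/2. *)
Lemma sin_ge_half (x : R) : 0 <= x <= pi / 2 -> x / 2 <= sin x.
Proof.
move=> /andP[x0 xp]; have p0 := pi_gt0 R.
move: x0; rewrite le_eqVlt => /predU1P[<-|x0]; first by rewrite sin0 mul0r.
have h (y : R) : 0 < y -> y <= pi / 2 -> y * cos y <= sin y.
  move=> y0 yp; have [|c] := @MVT _ sin cos 0 y y0 (fun z _ => is_derive_sin z).
    by apply: continuous_subspaceT; exact: continuous_sin.
  rewrite in_itv/= => /andP[c0 cy]; rewrite sin0 !subr0 => ->.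
  rewrite mulrC ler_pM2r//; apply: ltW; rewrite ltr_cos// in_itv/=; apply/andP; split; lra.
have h1 := h (x / 2) ltac:(lra) ltac:(lra).
have cx0 : 0 <= cos x by rewrite cos_ge0_pihalf//; lra.
have cx2 : 0 <= cos (x / 2) by rewrite cos_ge0_pihalf//; lra.
have xE : x = x / 2 + x / 2 by lra.
have := cos2Dsin2 (x / 2).
have sE : sin x = 2 * (sin (x / 2) * cos (x / 2)) by rewrite [in LHS]xE sinD; lra.
have cE : cos x = cos (x / 2) ^+ 2 - sin (x / 2) ^+ 2 by rewrite [in LHS]xE cosD !expr2.
have h2 := ler_wpM2r cx2 h1.
rewrite sE; move: cE cx0 h2; move: (cos (x / 2)) (sin (x / 2)) => c s cE cx0 h2 cs.
have : 2^-1 <= c ^+ 2 by lra.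
by nra.
Qed.

Lemma kappaE r f : kappa r f = expR (- r) + 2 * sinh r * sin (f / 2) ^+ 2.
Proof.
have e : cos f = 1 - 2 * sin (f / 2) ^+ 2.
  have fE : f = f / 2 + f / 2 by lra.
  by rewrite [in LHS]fE cosD; have := cos2Dsin2 (f / 2); lra.
by rewrite expRNE /kappa e; lra.
Qed.

(** Here v is the rescaled angle f e^(r/2) / 2. The constant comes from 2 sinh(r) sin(f/2)^2 with
    sinh r >= e^r / 4 and sin x >= x / 2 at x = f/2. *)
Lemma kappa_ge_sqr r v : 1 <= r -> 0 <= v -> v <= pi * expR (r / 2) / 2 ->
  v ^+ 2 / 8 <= kappa r (2 * expR (- (r / 2)) * v).
Proof.
move=> r1 v0 vr; rewrite kappaE.
have e : expR (- (r / 2)) * expR (r / 2) = 1 by rewrite -expRD addNr expR0.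
have e0 := expR_gt0 (- (r / 2)).
rewrite (_ : 2 * expR (- (r / 2)) * v / 2 = expR (- (r / 2)) * v); last by lra.
set x := _ * v.
have x0 : 0 <= x by rewrite mulr_ge0// ltW.
have xp : x <= pi / 2.
  have := ler_wpM2l (ltW e0) vr; rewrite -/x => h; apply: (le_trans h).
  rewrite (_ : expR (- (r / 2)) * (pi * expR (r / 2) / 2) = pi / 2 * (expR (- (r / 2)) * expR (r / 2))).
    by rewrite e mulr1.
  by field.
have sx : x / 2 <= sin x by rewrite sin_ge_half// x0.
have sx2 : x ^+ 2 / 4 <= sin x ^+ 2.
  have h0 : 0 <= x / 2 by rewrite divr_ge0.
  have := lerXn2r 2 h0 (le_trans h0 sx) sx; rewrite expr_div_n; lra.
have sh := sinh_ge r1; have er := expR_gt0 (- r).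
have xE : expR r * x ^+ 2 = v ^+ 2.
  have -> : expR r = expR (r / 2) * expR (r / 2) by rewrite -expRD; congr expR; lra.
  transitivity ((expR (- (r / 2)) * expR (r / 2)) ^+ 2 * v ^+ 2); first by rewrite /x; ring.
  by rewrite e expr1n mul1r.
have h1 : sinh r * (x ^+ 2 / 4) <= sinh r * sin x ^+ 2 by rewrite ler_wpM2l// sinh_ge0; lra.
have h2 : expR r / 4 * (x ^+ 2 / 4) <= sinh r * (x ^+ 2 / 4) by rewrite ler_wpM2r// divr_ge0// sqr_ge0.
by lra.
Qed.

(* expR (- (alpha * Num.max 0 (ln (v ^+ 2)))) is min(1, v^(-2 alpha)), also at v = 0. *)
Definition angle_tail alpha v : R := expR (- (alpha * Num.max 0 (ln (v ^+ 2)))).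

Lemma angle_tailE alpha v : 1 <= v -> angle_tail alpha v = expR (- (2 * alpha * ln v)).
Proof.
move=> v1; rewrite /angle_tail lnXn ?(lt_le_trans ltr01)// (max_idPr _); first by congr expR; lra.
by rewrite mulrn_wge0// ln_ge0.
Qed.

Lemma angle_tail1 alpha v : 0 <= v <= 1 -> angle_tail alpha v = 1.
Proof.
move=> /andP[v0 v1]; rewrite /angle_tail (max_idPl _) ?mulr0 ?oppr0 ?expR0//.
by rewrite ln_le0// exprn_ile1.
Qed.

Lemma measurable_angle_tail alpha : measurable_fun setT (angle_tail alpha).
Proof.
apply: measurableT_comp => //; apply: measurableT_comp => //; apply: measurable_funM => //.
apply: measurable_maxr => //; apply: measurableT_comp; first exact: measurable_ln.
exact: measurable_funX.
Qed.

Lemma integral_angle_tail alpha : 2^-1 < alpha ->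
  (\int[mu]_(v in `[0%R, +oo[) (angle_tail alpha v)%:E = (2 * alpha / (2 * alpha - 1))%:E)%E.
Proof.
move=> a2.
have mh D : measurable_fun D (EFin \o angle_tail alpha).
  by apply: measurable_funTS; apply/measurable_EFinP; exact: measurable_angle_tail.
rewrite (@itv_bndbnd_setU _ _ _ (BLeft 1))// ?bnd_simp//.
rewrite ge0_integral_setU//=; [|exact: mh|by move=> x _; rewrite lee_fin expR_ge0|]; last first.
  by apply: lt_disjoint => x y; rewrite !in_itv/= andbT => /andP[_ x1] y1; exact: lt_le_trans y1.
rewrite [X in (X + _)%E](_ : _ = 1)%E; last first.
  rewrite (eq_integral (fun=> 1%:E)); last first.
    by move=> x; rewrite inE/= in_itv/= => /andP[x0 /ltW x1]; rewrite angle_tail1 ?x0.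
  by rewrite integral_cst//= lebesgue_measure_itv/= lte_fin ltr01 mul1e oppr0 adde0.
have lnc x : 1 <= x -> {for x, continuous (@ln R)}.
  by move=> x1; apply: continuous_ln; rewrite (lt_le_trans ltr01).
have ec (c x : R) : 1 <= x -> {for x, continuous (fun y => expR (- (c * ln y)))}.
  move=> x1; apply: (@continuous_comp _ _ _ (fun y => - (c * ln y)) expR); last exact: continuous_expR.
  by apply: cvgN; apply: cvgMl_tmp; exact: lnc.
rewrite [X in (_ + X)%E](_ : _ = \int[mu]_(v in `[1%R, +oo[) (expR (- (2 * alpha * ln v)))%:E)%E; last first.
  by apply: eq_integral => x; rewrite inE/= in_itv/= andbT => x1; rewrite angle_tailE.
pose F (v : R) : R := - (2 * alpha - 1)^-1 * expR (- ((2 * alpha - 1) * ln v)).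
have F0 : F x @[x --> +oo%R] --> (0 : R).
  rewrite -(mulr0 (- (2 * alpha - 1)^-1)); apply: cvgMl_tmp.
  apply: (cvg_comp (fun x => (2 * alpha - 1) * ln x) (fun x => expR (- x))); last exact: cvgr_expR.
  apply/cvgryPge => A; near=> x.
  rewrite mulrC -ler_pdivrMr; last by lra.
  rewrite -ler_expR lnK; first by near: x; exact: nbhs_pinfty_ge.
  by rewrite posrE; near: x; exact: nbhs_pinfty_gt.
have h1 x : 1 <= x -> 0 <= expR (- (2 * alpha * ln x)) by move=> _; exact: expR_ge0.
have h2 : {within `[1, +oo[, continuous (fun v => expR (- (2 * alpha * ln v)))}.
  apply/continuous_within_itvcyP; split.
    by move=> x; rewrite in_itv/= andbT => /ltW; exact: ec.
  by apply: cvg_at_right_filter; apply: ec.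
have dF (x : R) : 1 < x -> is_derive x 1 F (expR (- (2 * alpha * ln x))).
  move=> x1; have x0 : 0 < x by rewrite (lt_trans ltr01).
  have d1 := is_derive1_ln x0.
  have d2 : is_derive x 1 (fun v => - ((2 * alpha - 1) * ln v)) (- ((2 * alpha - 1) * x^-1)).
    by apply: is_derive_eq.
  have d3 := @is_derive1_comp _ expR (fun v => - ((2 * alpha - 1) * ln v)) x _ _ (is_derive_expR _) d2.
  have d4 := is_deriveZ (- (2 * alpha - 1)^-1) d3.
  apply: (is_derive_eq d4).
  rewrite /GRing.scale/=.
  have -> : expR (- (2 * alpha * ln x)) = expR (- ((2 * alpha - 1) * ln x)) * x^-1.
    rewrite (_ : - (2 * alpha * ln x) = - ((2 * alpha - 1) * ln x) + - ln x); last by lra.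
    by rewrite expRD [X in _ * X]expRN lnK// posrE.
  by field; rewrite gt_eqF//=; lra.
have h4 (x : R) : 1 < x -> derivable F x 1 by move=> x1; have [] := dF _ x1.
have h5 : F x @[x --> 1^'+] --> F 1.
  by apply: cvg_at_right_filter; apply: cvgMl_tmp; exact: ec.
have h6 : {in `]1, +oo[, derive1 F =1 (fun v => expR (- (2 * alpha * ln v)))}.
  move=> x; rewrite in_itv/= andbT => x1; rewrite derive1E.
  by have [_ ->] := dF _ x1.
rewrite (ge0_continuous_FTC2y h1 h2 F0 h4 h5 h6).
rewrite /F ln1 mulr0 oppr0 expR0 mulr1 sub0e -EFinN opprK -EFinD; congr EFin.
by field; lra.
Unshelve. all: by end_near. Qed.

Lemma cvg_sin_ratio (u : R^nat) : (forall n, 0 < u n) -> u n @[n --> \oo] --> (0 : R) ->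
  sin (u n) / u n @[n --> \oo] --> (1 : R).
Proof.
move=> u0 uc; have [h1 h2] := is_derive_sin (0 : R).
have h : (h^-1 *: (sin (h *: 1 + 0) - sin 0)) @[h --> (0 : R)^'] --> (1 : R).
  by rewrite -[X in _ --> X]cos0 -h2; exact: h1.
move: h; rewrite sin0 => /cvgr_dnbhsP/(_ u) hh.
apply: (cvg_trans _ (hh (conj _ uc))); last by move=> n; rewrite gt_eqF.
by apply: near_eq_cvg; apply: nearW => n; rewrite /GRing.scale/= mulr1 addr0 subr0 mulrC.
Qed.

(** With u = f/2 one has e^r u^2 = v^2, so kappa is e^(-r) + (1 - e^(-2r)) v^2 (sin(u)/u)^2. *)
Lemma cvg_kappa_scaled (r : R^nat) v : 0 < v -> r n @[n --> \oo] --> +oo ->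
  kappa (r n) (2 * expR (- (r n / 2)) * v) @[n --> \oo] --> v ^+ 2.
Proof.
move=> v0 roo; pose u n := expR (- (r n / 2)) * v.
have u0 n : 0 < u n by rewrite mulr_gt0// expR_gt0.
have uc : u n @[n --> \oo] --> (0 : R).
  rewrite -[X in _ --> X](mul0r v); apply: cvgMr_tmp; apply: cvg_expRNy.
  by apply/cvgryPge => A; have /cvgryPge/(_ (2 * A)) := roo; apply: filterS => n; lra.
have e1 : expR (- r n) @[n --> \oo] --> (0 : R) by exact: cvg_expRNy.
have e2 := cvg_sin_ratio u0 uc.
have h : expR (- r n) + (1 - expR (- r n) * expR (- r n)) * v ^+ 2 * (sin (u n) / u n * (sin (u n) / u n))
    @[n --> \oo] --> (0 + (1 - 0 * 0) * v ^+ 2 * (1 * 1) : R).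
  apply: cvgD; first exact: e1.
  apply: cvgM; last by apply: cvgM; exact: e2.
  by apply: cvgMr_tmp; apply: cvgB; [exact: cvg_cst|apply: cvgM; exact: e1].
rewrite mul0r subr0 add0r !mulr1 mul1r in h; apply: cvg_trans h; apply: near_eq_cvg; apply: nearW => n.
rewrite kappaE (_ : 2 * _ * v / 2 = u n); last by rewrite /u; lra.
congr (_ + _).
have eu : u n ^+ 2 * expR (r n) = v ^+ 2.
  have -> : expR (r n) = expR (r n / 2) ^+ 2 by rewrite -expRM_natr; congr expR; lra.
  by rewrite -exprMn /u mulrAC -expRD addNr expR0 mul1r.
rewrite -eu /sinh expRN; have er := expR_gt0 (r n).
by move: (expR (r n)) (u n) (sin _) er (u0 n) => a b c a0 b0; field; rewrite !gt_eqF.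
Qed.

(** Only angles of order e^(-r/2) matter. After the substitution f = 2 e^(-r/2) v the integrand
    tends to min(1, v^(-2 alpha)), whose integral 2 alpha / (2 alpha - 1) over the half-line, times
    2/pi, is [rhg_C alpha]. Integrability at infinity is where alpha > 1/2 enters. *)
Lemma cvg_adjacency_prob_large alpha (Rs r : R^nat) : 2^-1 < alpha ->
  (forall n, 0 <= r n) -> r n @[n --> \oo] --> +oo -> Rs n - r n @[n --> \oo] --> +oo ->
  expR (r n / 2) * adjacency_prob alpha (Rs n) (r n) @[n --> \oo] --> rhg_C alpha.
Proof.
move=> a2 r0 roo doo; have p0 := pi_gt0 R; have a0 : 0 < alpha by lra.
have Roo : Rs n @[n --> \oo] --> +oo.
  apply/cvgryPge => A; have /cvgryPge/(_ A) := doo; apply: filterS => n; have := r0 n; lra.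
have rR : \forall n \near \oo, 0 <= r n <= Rs n.
  by have /cvgryPge/(_ 0) := doo; apply: filterS => n; rewrite r0 subr_ge0.
have R0 : \forall n \near \oo, 0 < Rs n by exact: near_gty.
pose k n := 2 * expR (- (r n / 2)).
have k0 n : 0 < k n by rewrite mulr_gt0// expR_gt0.
have ke n : expR (r n / 2) * k n = 2.
  by rewrite /k mulrCA -expRD subrr expR0 mulr1.
have ki n : pi / k n = pi * expR (r n / 2) / 2.
  apply: (mulIf (lt0r_neq0 (k0 n))); rewrite divfK ?gt_eqF//.
  by rewrite mulrAC -(mulrA pi) ke mulfK.
pose G n v := radial_cdf alpha (Rs n) (reach (Rs n) (r n) (k n * v)).
have cG n : continuous (G n).
  move=> v; apply: (@continuous_comp _ _ _ (fun v => k n * v)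
    (fun f => radial_cdf alpha (Rs n) (reach (Rs n) (r n) f))).
    by apply: cvgMl_tmp; exact: cvg_id.
  exact: continuous_cdf_reach.
(* The indicator replaces the moving domain [0, pi / k n] by the fixed half-line, as dominated
   convergence requires; the factor 2 is e^(r/2) times [k n]. *)
pose H n v := 2 * G n v * \1_(`[0, pi / k n] : set R) v.
have E n : expR (r n / 2) * adjacency_prob alpha (Rs n) (r n) =
    pi^-1 * \int[mu]_(v in `[0, +oo[) H n v.
  have pk : 0 <= pi / k n by rewrite divr_ge0 ?ltW.
  have cF : continuous (fun f => radial_cdf alpha (Rs n) (reach (Rs n) (r n) f)).
    exact: continuous_cdf_reach.
  have h := integral_affine 0 (k0 n) pk cF.
  rewrite mulr0 addr0 addr0 mulrCA divff ?gt_eqF// mulr1 in h.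
  have i1 : mu.-integrable `[0, pi / k n] (EFin \o G n).
    apply: continuous_compact_integrable; first exact: segment_compact.
    exact: continuous_subspaceT.
  have h' : \int[mu]_(f in `[0, pi]) radial_cdf alpha (Rs n) (reach (Rs n) (r n) f) =
      k n * \int[mu]_(v in `[0, pi / k n]) G n v.
    rewrite -RintegralZl//; rewrite /Rintegral h; congr fine; apply: eq_integral => v _.
    by rewrite addr0 mulrC.
  rewrite /adjacency_prob h' mulrCA; congr (_ * _); rewrite mulrA ke.
  rewrite -RintegralZl// /Rintegral; congr fine.
  rewrite [RHS](_ : _ = \int[mu]_(v in `[0%R, +oo[ `&` `[0%R, (pi / k n)%R]) (2 * G n v)%:E)%E.
    congr (integral _ _ _); apply/seteqP; split => v /=; rewrite !in_itv/= ?andbT.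
      by move=> /andP[v0 vp]; rewrite v0.
    by move=> [].
  rewrite [RHS]integral_mkcondr/=; apply: eq_integral => v _; rewrite patchE /H indicE.
  by case: (v \in _); rewrite ?mulr1 ?mulr0.
rewrite (_ : (fun n => _) = (fun n => pi^-1 * \int[mu]_(v in `[0, +oo[) H n v)); last exact/funext.
have mt (D : set R) : measurable_fun D (angle_tail alpha).
  by apply: measurable_funTS; exact: measurable_angle_tail.
have it : mu.-integrable `[0, +oo[ (EFin \o angle_tail alpha).
  apply/integrableP; split; first by apply/measurable_EFinP; exact: mt.
  rewrite [ltLHS](_ : _ = \int[mu]_(v in `[0%R, +oo[) (angle_tail alpha v)%:E)%E.
    by rewrite integral_angle_tail// ltry.
  by apply: eq_integral => v _; rewrite /= ger0_norm// expR_ge0.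
have -> : rhg_C alpha = pi^-1 * \int[mu]_(v in `[0, +oo[) (2 * angle_tail alpha v).
  rewrite RintegralZl// /Rintegral integral_angle_tail//= /rhg_C.
  rewrite (_ : 2 * alpha - 1 = 2 * (alpha - 2^-1)); last by lra.
  have b0 : 0 < alpha - 2^-1 by lra.
  move: (alpha - 2^-1) b0 (lt0r_neq0 p0) => b /lt0r_neq0 b0 q0.
  rewrite (invfM 2 b) (mulrC 2 alpha) -!mulrA mulVKf// invfM.
  by rewrite (mulrC alpha) -!mulrA (mulrCA 2) (mulrC _ alpha).
apply: cvgMl_tmp.
(* M is 8^alpha: [kappa_ge_sqr] gives kappa >= v^2 / 8 on the whole range of v. *)
pose M := expR (alpha * ln 8).
have iM : mu.-integrable `[0, +oo[ (EFin \o (fun v => 2 * M * angle_tail alpha v)).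
  apply: eq_integrable (integrableZl _ (2 * M) it) => //.
apply: (@cvg_Rintegral_dominated _ _ _ _ (fun v => 2 * M * angle_tail alpha v)) => //.
- apply: nearW => n; apply: measurable_funM.
    by apply: measurable_funM => //; apply: measurable_funTS; exact: continuous_measurable_fun.
  by apply: measurable_funTS; exact: measurable_indic.
- exact: measurable_funM.
- apply: aeW => v; rewrite /= in_itv/= andbT => v0.
  rewrite -[X in _ --> X]mulr1; apply: cvgM; last first.
    apply: cvg_near_cst; near=> n.
    rewrite indicE mem_setE in_itv/= v0/= ki; apply/eqP; rewrite pnatr_eq1 eqb1.
    have h1 : 4 * v / pi < r n by near: n; exact: near_gty.
    have h2 := expR_ge1Dx (r n / 2).
    rewrite ltr_pdivrMr// in h1; have := ler_wpM2l (ltW p0) h2; lra.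
  apply: cvgMl_tmp; apply: cvg_radial_cdf => //.
    near=> n; rewrite ge_min lexx andbT.
    have /andP[h1 h2] : 0 <= r n <= Rs n by near: n.
    by rewrite reach_ge0.
  apply: cvg_reach => //.
    by apply: cvg_reach_err => //; exact: nearW.
  (* At v = 0 the limit relies on the default value ln 0 = 0, while kappa = e^(-r) has a nonpositive
     logarithm, so both maxima are 0. *)
  move: v0; rewrite le_eqVlt => /predU1P[<-|v0].
    apply: cvg_near_cst; apply: nearW => n.
    rewrite mulr0 /kappa cos0 mulr1 -expRNE expRK expr0n/= ln0//.
    by rewrite (max_idPl _)// ?maxxx// oppr_le0.
  apply: (continuous_cvg _ (f := fun n => ln (kappa (r n) (k n * v))) (h := fun x => Num.max 0 x)).
    by apply: (@continuous_max _ _ (fun=> 0) id); [exact: cvg_cst|exact: cvg_id].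
  apply: (continuous_cvg _ (f := fun n => kappa (r n) (k n * v)) (h := @ln R)).
    by apply: continuous_ln; rewrite exprn_gt0.
  exact: cvg_kappa_scaled.
- near=> n => v; rewrite /= in_itv/= andbT => v0.
  have /andP[_ h2] : 0 <= r n <= Rs n by near: n.
  have h3 : 0 < Rs n by near: n.
  have h4 : 1 <= r n by apply: ltW; near: n; exact: near_gty.
  rewrite /H indicE; case: (boolP (v \in _)) => [|_]; last first.
    by rewrite mulr0 normr0 !mulr_ge0 ?expR_ge0.
  rewrite mulr1 inE/= in_itv/= => /andP[_ vk]; rewrite ki in vk.
  have /andP[b1 b2] := radial_cdf_reach_bound (k n * v) a0 (r0 n) h2 h3.
  have G0 : 0 <= 2 * G n v by exact: mulr_ge0.
  rewrite (ger0_norm G0) -[leRHS]mulrA ler_pM2l// (le_trans b2)//.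
  rewrite /angle_tail -expRD ler_expR.
  suff h : Num.max 0 (ln (v ^+ 2)) <= ln 8 + Num.max 0 (ln (kappa (r n) (k n * v))).
    by have := ler_wpM2l (ltW a0) h; lra.
  have l8 : 0 <= ln 8 :> R by rewrite ln_ge0//; lra.
  have m0 : 0 <= Num.max 0 (ln (kappa (r n) (k n * v))) by rewrite le_max lexx.
  rewrite ge_max addr_ge0//=.
  have [v00|v1] := leP (v ^+ 2) 1; first by apply: le_trans (addr_ge0 l8 m0); rewrite ln_le0.
  have v2 : 0 < v ^+ 2 by rewrite (lt_trans ltr01).
  have vp : 0 < v by nra.
  apply: (@le_trans _ _ (ln 8 + ln (kappa (r n) (k n * v)))).
    rewrite -lnM ?posrE ?kappa_gt0// ler_ln ?posrE ?mulr_gt0 ?kappa_gt0//.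
    by have := kappa_ge_sqr h4 v0 vk; rewrite -/(k n); lra.
  by rewrite lerD2l le_max lexx orbT.
Unshelve. all: by end_near. Qed.

End adjacency_large_radius.

(** * The function V_half and its inverse *)

Section V_half_as_angular_integral.
Context {R : realType}.
Notation mu := (@lebesgue_measure R).
Implicit Types r f x : R.

Lemma V_arg_le1 r x : 0 < r -> 0 < x <= 1 -> (cosh r - x ^- 2) / sinh r <= 1.
Proof.
move=> r0 /andP[x0 x1]; rewrite ler_pdivrMr ?sinh_gt0// mul1r.
have h1 : 1 <= x ^- 2 by rewrite -[leLHS]invr1 lef_pV2 ?posrE ?exprn_gt0// exprn_ile1// ltW.
have h2 : expR (- r) <= 1 by rewrite -expR0 ler_expR; lra.
by have := expRNE r; lra.
Qed.

Lemma V_halfE r : 0 <= r ->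
  V_half r = pi^-1 * \int[mu]_(f in `[0, pi]) reach_limit 2^-1 r f.
Proof.
rewrite le_eqVlt => /predU1P[<-|r0].
  rewrite /V_half ltxx (_ : \int[mu]_(f in `[0, pi]) _ = pi) ?mulVf ?gt_eqF ?pi_gt0//.
  rewrite (_ : reach_limit 2^-1 0 = fun=> 1); last first.
    apply/funext => f; rewrite /reach_limit /kappa cosh0 sinh0 mul0r subr0 ln1 maxxx mulr0 oppr0.
    exact: expR0.
  rewrite Rintegral_cst// mul1r.
  have e : (mu (`[0%R, pi]%classic : set R) = pi%:E)%E.
    by rewrite lebesgue_measure_itv/= lte_fin pi_gt0 oppr0 adde0.
  exact: (congr1 fine e).
have s0 := sinh_gt0 r0.
rewrite /V_half r0; congr (_ * _).
pose A : set (R * R) := [set p | (0 < p.1 <= 1 /\ 0 <= p.2 <= pi) /\ p.1 ^+ 2 * kappa r p.2 <= 1].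
have mA : measurable A.
  have m1 : measurable_fun setT (fun p : R * R => p.1 ^+ 2 * kappa r p.2).
    apply: measurable_funM; first exact: measurable_funX.
    apply: (@measurableT_comp _ _ _ _ _ _ (kappa r)) => //.
    by apply: continuous_measurable_fun; exact: continuous_kappa.
  have m2 : measurable [set p : R * R | p.1 ^+ 2 * kappa r p.2 <= 1].
    by have := m1 measurableT _ (measurable_itv `]-oo, 1]); rewrite setTI set_itvE.
  apply: measurableI => //.
  have := measurableX (measurable_itv `]0 : R, 1]) (measurable_itv `[0 : R, pi]).
  by congr measurable; apply/seteqP; split => -[x f] /=; rewrite !in_itv/=.
have sx x : 0 < x <= 1 -> mu (xsection A x) = (acos (Num.max (-1) ((cosh r - x ^- 2) / sinh r)))%:E.
  move=> x01; have c1 := V_arg_le1 r0 x01; have /andP[x0 x1] := x01.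
  set c := Num.max _ _.
  have cb : -1 <= c <= 1 by rewrite /c le_max lexx/= ge_max c1 andbT; lra.
  rewrite (_ : xsection A x = `[0, acos c]%classic).
    rewrite lebesgue_measure_itv/= lte_fin; case: ltP => h; first by rewrite oppr0 adde0.
    by congr EFin; apply/eqP; rewrite eq_le h acos_ge0.
  have key f : 0 <= f <= pi -> (x ^+ 2 * kappa r f <= 1) = (f <= acos c).
    move=> f0p.
    have cfb : -1 <= cos f <= 1 by rewrite cos_geN1 cos_le1.
    rewrite [RHS]leNgt -ltr_cos ?in_itv/= ?acos_ge0 ?acos_lepi ?cosK ?in_itv//= -leNgt acosK ?in_itv//.
    rewrite /c ge_max cos_geN1/= ler_pdivrMr// /kappa.
    by rewrite -ler_pdivlMl ?exprn_gt0// mulr1 -subr_ge0 -[RHS]subr_ge0; congr (0 <= _); ring.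
  apply/seteqP; split => f; rewrite /xsection/= inE /A/= in_itv/=.
    by move=> [[_ f0p]]; rewrite key// => ->; case/andP: f0p => ->.
  move=> /andP[f0 fa]; have f0p : 0 <= f <= pi by rewrite f0 (le_trans fa)// acos_lepi.
  by split; [split|rewrite key].
have sy f : 0 <= f <= pi -> mu (ysection A f) = (reach_limit 2^-1 r f)%:E.
  move=> f0p; have k0 := kappa_gt0 f (ltW r0).
  pose l := expR (- (2^-1 * ln (kappa r f))).
  have l2 : l ^+ 2 * kappa r f = 1.
    by rewrite -expRM_natr -{2}(lnK (x := kappa r f)) ?posrE// -expRD -[RHS]expR0; congr expR; lra.
  have l0 : 0 < l by exact: expR_gt0.
  have lE : reach_limit 2^-1 r f = Num.min 1 l.
    rewrite /reach_limit; have [h|h] := leP (ln (kappa r f)) 0.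
      by rewrite mulr0 oppr0 expR0; apply/esym/min_idPl; rewrite -expR0 ler_expR; lra.
    by apply/esym/min_idPr; rewrite -[leRHS]expR0 ler_expR; lra.
  rewrite (_ : ysection A f = `]0, Num.min 1 l]%classic).
    rewrite lebesgue_measure_itv/= lte_fin lt_min ltr01 l0 oppr0 adde0 lE//.
  apply/seteqP; split => x; rewrite /ysection/= inE /A/= in_itv/= le_min.
    move=> [[/andP[x0 x1] _]] h; rewrite x0 x1/=.
    rewrite leNgt; apply/negP => lx.
    have : l ^+ 2 * kappa r f < x ^+ 2 * kappa r f by rewrite ltr_pM2r// ltr_pXn2r// nnegrE ltW.
    by rewrite l2; lra.
  move=> /and3P[x0 x1 xl]; rewrite x0 x1; split => //.
  by rewrite -l2 ler_pM2r// lerXn2r// nnegrE ltW.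
have fub := indic_fubini_tonelli mu mu mA.
rewrite indic_fubini_tonelli_FE// indic_fubini_tonelli_GE// in fub.
have lhs : (\int[mu]_x mu (xsection A x) = \int[mu]_(x in `[0%R, 1%R])
    (acos (Num.max (-1) ((cosh r - x ^- 2) / sinh r)))%:E)%E.
  rewrite -integral_itv_obnd_cbnd; last first.
    apply: (@eq_measurable_fun _ _ _ _ _ (mu \o xsection A)).
      by move=> x; rewrite inE/= in_itv/= => /sx.
    by apply: measurable_funTS; exact: measurable_fun_xsection.
  rewrite [RHS]integral_mkcond; apply: eq_integral => x _; rewrite patchE mem_setE in_itv/=.
  case: ifPn => [/sx//|nx]; rewrite (_ : xsection A x = set0) ?measure0//.
  by apply/seteqP; split => // f; rewrite /xsection/= inE => -[[h _] _]; rewrite h in nx.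
have rhs : (\int[mu]_f mu (ysection A f) = \int[mu]_(f in `[0%R, pi]) (reach_limit 2^-1 r f)%:E)%E.
  rewrite [RHS]integral_mkcond; apply: eq_integral => f _; rewrite patchE mem_setE in_itv/=.
  case: ifPn => [/sy//|nf]; rewrite (_ : ysection A f = set0) ?measure0//.
  by apply/seteqP; split => // x; rewrite /ysection/= inE => -[[_ h] _]; rewrite h in nf.
by rewrite /Rintegral -lhs -rhs; congr fine.
Qed.

Lemma kappa_exp r f : kappa r f = (expR r * (1 - cos f) + expR (- r) * (1 + cos f)) / 2.
Proof. by rewrite expRE expRNE /kappa; lra. Qed.

(** kappa is a combination of e^r and e^(-r) with nonnegative coefficients, so changing r by d
    changes it at most by a factor e^d either way. *)
Lemma ln_kappa_lipschitz r r' f : 0 <= r -> r <= r' ->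
  `|ln (kappa r' f) - ln (kappa r f)| <= r' - r.
Proof.
move=> r0 rr'; have r'0 := le_trans r0 rr'.
have k0 := kappa_gt0 f r0; have k0' := kappa_gt0 f r'0.
have c1 : 0 <= 1 - cos f by rewrite subr_ge0 cos_le1.
have c2 : 0 <= 1 + cos f by have := cos_geN1 f; lra.
have ex a b d (c : R) : 0 <= c -> a <= b + d -> expR a * c <= expR b * expR d * c.
  by move=> c0 ab; rewrite -expRD ler_wpM2r// ler_expR.
have h1 : kappa r' f <= expR (r' - r) * kappa r f.
  have := ex r' (r' - r) r _ c1 ltac:(lra); have := ex (- r') (r' - r) (- r) _ c2 ltac:(lra).
  by rewrite !kappa_exp; lra.
have h2 : kappa r f <= expR (r' - r) * kappa r' f.
  have := ex r (r' - r) r' _ c1 ltac:(lra); have := ex (- r) (r' - r) (- r') _ c2 ltac:(lra).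
  by rewrite !kappa_exp; lra.
have l (a b : R) : 0 < a -> 0 < b -> a <= expR (r' - r) * b -> ln a <= r' - r + ln b.
  by move=> a0 b0 ab; rewrite -[X in X + _](expRK (r' - r)) -lnM ?posrE ?expR_gt0// ler_ln ?posrE ?mulr_gt0 ?expR_gt0.
rewrite ler_norml; have := l _ _ k0' k0 h1; have := l _ _ k0 k0' h2.
by move=> a b; apply/andP; split; lra.
Qed.

Lemma expRN_lipschitz (a b : R) : 0 <= a -> 0 <= b -> `|expR (- a) - expR (- b)| <= `|a - b|.
Proof.
wlog ab : a b / a <= b => [hw a0 b0|a0 b0].
  by have [ab|/ltW ba] := leP a b; [exact: hw|rewrite distrC [leRHS]distrC; exact: hw].
rewrite ger0_norm ?subr_ge0 ?ler_expR ?lerN2// distrC ger0_norm ?subr_ge0//.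
have e : expR (- b) = expR (- a) * expR (a - b) by rewrite -expRD; congr expR; lra.
have h := expR_ge1Dx (a - b); have h1 : expR (- a) <= 1 by rewrite -expR0 ler_expR; lra.
rewrite e; have := expR_gt0 (- a); move: (expR (- a)) (expR (a - b)) h h1 => x y h h1 x0.
have : 0 <= x * (y - (1 + (a - b))) by rewrite mulr_ge0 ?subr_ge0// ltW.
have : 0 <= (1 - x) * (b - a) by rewrite mulr_ge0 ?subr_ge0.
by nra.
Qed.

Lemma reach_limit_lipschitz r r' f : 0 <= r -> 0 <= r' ->
  `|reach_limit 2^-1 r' f - reach_limit 2^-1 r f| <= `|r' - r| / 2.
Proof.
wlog rr' : r r' / r <= r' => [hw r0 r'0|r0 r'0].
  by have [rr'|/ltW rr'] := leP r r'; [exact: hw|rewrite distrC [`|r' - r|]distrC; exact: hw].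
have m0 x : 0 <= Num.max 0 x :> R by rewrite le_max lexx.
apply: le_trans (expRN_lipschitz _ _) _; rewrite ?mulr_ge0// ?invr_ge0//.
rewrite -mulrBr normrM ger0_norm ?invr_ge0// mulrC ler_pM2r ?invr_gt0//.
have := ln_kappa_lipschitz f r0 rr'; rewrite [`|r' - r|]ger0_norm ?subr_ge0//.
move: (ln _) (ln _) => a b; rewrite !ler_norml => /andP[h1 h2].
rewrite /Num.max; case: ifP => ha; case: ifP => hb; move: ha hb; rewrite ?ltNge => ha hb;
  apply/andP; split; lra.
Qed.

End V_half_as_angular_integral.

(** * Derivative and inverse of [V_half], primitive of the critical intensity *)

Section V_half_derivative.
Context {R : realType}.
Notation mu := (@lebesgue_measure R).
Implicit Types r f x : R.

(* Minus the r-derivative of [reach_limit 2^-1 r f], except where [kappa r f = 1]. *)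
Definition half_rate r f : R :=
  if 1 < kappa r f then
    2^-1 * expR (- (2^-1 * ln (kappa r f))) * ((sinh r - cosh r * cos f) / kappa r f)
  else 0.

Definition V_rate r : R := pi^-1 * \int[mu]_(f in `[0, pi]) half_rate r f.

Lemma half_rate_bound r f : 0 <= r -> 0 <= half_rate r f <= 2^-1.
Proof.
move=> r0; rewrite /half_rate; case: ifPn => [k1|_]; last by rewrite lexx/= invr_ge0.
have k0 : 0 < kappa r f by rewrite (lt_trans ltr01).
have e0 := expR_gt0 (- (2^-1 * ln (kappa r f))).
have e1 : expR (- (2^-1 * ln (kappa r f))) <= 1.
  by rewrite -[leRHS]expR0 ler_expR oppr_le0 mulr_ge0 ?invr_ge0// ln_ge0// ltW.
have n1 : sinh r - cosh r * cos f <= kappa r f.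
  have := kappa_exp r f; rewrite expRE expRNE /kappa => _.
  have : 0 <= expR (- r) * (1 + cos f) by rewrite mulr_ge0 ?expR_ge0//; have := cos_geN1 f; lra.
  by rewrite expRNE; lra.
(* The condition kappa > 1 reads cos f < tanh(r/2), which is below tanh r; hence the numerator is
   nonnegative. For cos f <= 0 this is immediate. *)
have n0 : 0 <= sinh r - cosh r * cos f.
  have h1 : sinh r * cos f < cosh r - 1 by move: k1; rewrite /kappa; lra.
  have [c0|c0] := leP (cos f) 0.
    have := sinh_ge0 r0; have := cosh_gt0 r; have := mulr_ge0 (ltW (cosh_gt0 r)) (_ : 0 <= - cos f).
    by rewrite oppr_ge0 => /(_ c0); lra.
  have sp : 0 < sinh (r / 2).
    rewrite sinh_gt0// divr_gt0// lt_neqAle r0 andbT; apply/eqP => r00.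
    by move: k1; rewrite /kappa -r00 cosh0 sinh0; lra.
  move: h1; rewrite coshB1 (sinh_double r) (cosh_double r).
  have cc := cosh_sqr (r / 2); have cp := cosh_gt0 (r / 2).
  move: (sinh (r / 2)) (cosh (r / 2)) sp cc cp => s c sp cc cp h1.
  have h2 : c * cos f < s.
    by rewrite -(ltr_pM2l (_ : 0 < 2 * s)) ?mulr_gt0//; lra.
  rewrite -(pmulr_rge0 _ cp).
  have : 0 <= (c ^+ 2 + s ^+ 2) * (s - c * cos f).
    by apply: mulr_ge0; [rewrite addr_ge0// sqr_ge0|rewrite subr_ge0 ltW].
  have : 0 < s * (c ^+ 2 - s ^+ 2) by rewrite mulr_gt0// cc; lra.
  by lra.
have q0 : 0 <= (sinh r - cosh r * cos f) / kappa r f by rewrite divr_ge0// ltW.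
have q1 : (sinh r - cosh r * cos f) / kappa r f <= 1 by rewrite ler_pdivrMr// mul1r.
apply/andP; split.
  by apply: mulr_ge0.
rewrite -[leLHS]mulrA -[leRHS]mulr1 ler_pM2l ?invr_gt0//.
by rewrite mulr_ile1// ltW.
Qed.

Lemma measurable_half_rate (D : set R) r : 0 <= r -> measurable_fun D (half_rate r).
Proof.
move=> r0; apply: measurable_funTS; have ck : continuous (kappa r) by exact: continuous_kappa.
have mk : measurable_fun setT (kappa r) by exact: continuous_measurable_fun.
have mc : measurable_fun setT (@cos R) by apply: continuous_measurable_fun; exact: continuous_cos.
apply: measurable_fun_ifT => //; first exact: measurable_fun_ltr.
apply: measurable_funM.
  apply: measurable_funM => //; apply: measurableT_comp => //; apply: measurableT_comp => //.
  by apply: measurable_funM => //; apply: measurableT_comp => //; exact: measurable_ln.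
apply: measurable_funM; first by apply: measurable_funB => //; exact: measurable_funM.
by apply: measurableT_comp => //; exact: measurable_invr.
Qed.

Lemma integrable_half : mu.-integrable `[0, pi] (EFin \o (fun=> 2^-1 : R)).
Proof.
apply: continuous_compact_integrable; first exact: segment_compact.
by apply: continuous_subspaceT => x; exact: cvg_cst.
Qed.

Lemma integrable_half_rate r : 0 <= r -> mu.-integrable `[0, pi] (EFin \o half_rate r).
Proof.
move=> r0; apply: le_integrable integrable_half => //.
  by apply/measurable_EFinP; exact: measurable_half_rate.
move=> f _ /=; rewrite lee_fin; have /andP[h0 h1] := half_rate_bound f r0.
by rewrite !ger0_norm ?invr_ge0.
Qed.

(** Angles with negative cosine suffice: there kappa > 1, the numerator is at least sinh r, and
    kappa <= e^r bounds the rate below by c. *)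
Lemma V_rate_gt0 r : 0 < r -> 0 < V_rate r.
Proof.
move=> r0; have s0 := sinh_gt0 r0; rewrite mulr_gt0 ?invr_gt0 ?pi_gt0//.
pose c := 2^-1 * expR (- (2^-1 * r)) * (sinh r / expR r).
have c0 : 0 < c.
  apply: mulr_gt0; last by apply: divr_gt0 => //; exact: expR_gt0.
  by rewrite mulr_gt0 ?invr_gt0 ?expR_gt0.
apply: (@lt_le_trans _ _ (\int[mu]_(f in `[0, pi]) (c * Num.max 0 (- cos f)))).
  rewrite RintegralZl//; first by rewrite integral_pos_part_cos mulr1.
  apply: continuous_compact_integrable; first exact: segment_compact.
  apply: continuous_subspaceT => f.
  apply: (@continuous_max _ _ (fun=> 0) (fun f => - cos f)); first exact: cvg_cst.
  by apply: cvgN; exact: continuous_cos.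
apply: le_Rintegral; [by []| |exact: integrable_half_rate (ltW r0)|].
  apply: continuous_compact_integrable; first exact: segment_compact.
  apply: continuous_subspaceT => f; apply: cvgMl_tmp.
  apply: (@continuous_max _ _ (fun=> 0) (fun f => - cos f)); first exact: cvg_cst.
  by apply: cvgN; exact: continuous_cos.
move=> f _; have /andP[h0 h1] := half_rate_bound f (ltW r0).
have [cf|cf] := leP 0 (cos f); first by rewrite (max_idPl _) ?mulr0// oppr_le0.
rewrite (max_idPr _); last by rewrite oppr_ge0 ltW.
have sc : 0 < sinh r * - cos f by rewrite mulr_gt0// oppr_gt0.
have cc : 0 < cosh r * - cos f by rewrite mulr_gt0 ?cosh_gt0// oppr_gt0.
have k1 : 1 < kappa r f by rewrite /kappa; have := cosh_ge1 r; lra.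
have k0 : 0 < kappa r f by rewrite (lt_trans ltr01).
have kr := kappa_le f (ltW r0).
rewrite /half_rate k1 (@le_trans _ _ c)//.
  by rewrite -[leRHS]mulr1 ler_pM2l//; have := cos_geN1 f; lra.
have nn : sinh r <= sinh r - cosh r * cos f by lra.
apply: ler_pM.
- by rewrite mulr_ge0 ?invr_ge0 ?expR_ge0.
- by apply: mulr_ge0; [exact: ltW|rewrite invr_ge0 expR_ge0].
- rewrite ler_pM2l ?invr_gt0// ler_expR lerN2 ler_pM2l ?invr_gt0//.
  by rewrite -[leRHS]expRK ler_ln ?posrE ?expR_gt0.
- apply: ler_pM; [exact: ltW|by rewrite invr_ge0 expR_ge0|exact: nn|].
  by rewrite lef_pV2 ?posrE ?expR_gt0.
Qed.

(** On [0, pi], kappa r f = 1 only at the angle with cosine tanh(r/2), where the maximum in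
    [reach_limit] has its kink. *)
Lemma kappa_neq1_ae r (P : R -> Prop) : 0 < r ->
  (forall f, kappa r f != 1 -> P f) -> {ae mu, forall f, `[0, pi]%classic f -> P f}.
Proof.
move=> r0 hP; exists [set acos (tanh (r / 2))]; split => //; first exact: lebesgue_measure_set1.
move=> f /=; apply: contra_notP => hf; rewrite /= in_itv/= => f0p; apply: hP.
apply/eqP => k1; apply: hf; rewrite -[LHS](@cosK _ f) ?in_itv//; congr acos.
have sp : 0 < sinh (r / 2) by rewrite sinh_gt0// divr_gt0.
have cp := cosh_gt0 (r / 2).
have : cosh r - 1 = sinh r * cos f by move: k1; rewrite /kappa; lra.
rewrite coshB1 (sinh_double r) /tanh; move: (sinh (r / 2)) (cosh (r / 2)) sp cp => s c sp cp h.
apply: (mulfI (lt0r_neq0 cp)); rewrite mulrCA divff ?gt_eqF// mulr1.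
by apply: (mulfI (lt0r_neq0 sp)); lra.
Qed.

Lemma continuous_kappa_radius f : continuous (fun x => kappa x f).
Proof.
move=> x; apply: cvgB; first exact: continuous_cosh.
by apply: cvgMr_tmp; exact: continuous_sinh.
Qed.

Lemma near_kappa_gt1 r f : 1 < kappa r f -> \forall x \near r, 1 < kappa x f.
Proof. move=> h; have h' : kappa x f @[x --> r] --> kappa r f := @continuous_kappa_radius f r.
exact: (cvgr_gt _ h'). Qed.

Lemma near_kappa_lt1 r f : kappa r f < 1 -> \forall x \near r, kappa x f < 1.
Proof. move=> h; have h' : kappa x f @[x --> r] --> kappa r f := @continuous_kappa_radius f r.
exact: (cvgr_lt _ h'). Qed.

Lemma continuous_half_rate r f : kappa r f != 1 -> {for r, continuous (half_rate^~ f)}.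
Proof.
rewrite neq_lt => /orP[k1|k1].
  suff : half_rate x f @[x --> r] --> half_rate r f by [].
  rewrite [X in _ --> X](_ : _ = 0); last by rewrite /half_rate ltNge (ltW k1).
  apply: cvg_near_cst; have := near_kappa_lt1 k1; apply: filterS => x kx.
  by rewrite /half_rate ltNge (ltW kx).
have k0 : 0 < kappa r f by rewrite (lt_trans ltr01).
suff : half_rate x f @[x --> r] --> half_rate r f by [].
rewrite [X in _ --> X](_ : _ = 2^-1 * expR (- (2^-1 * ln (kappa r f))) *
    ((sinh r - cosh r * cos f) / kappa r f)); last by rewrite /half_rate k1.
have ck : continuous (fun x => kappa x f) by exact: continuous_kappa_radius.
have h1 : 2^-1 * expR (- (2^-1 * ln (kappa x f))) @[x --> r] --> 2^-1 * expR (- (2^-1 * ln (kappa r f))).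
  apply: cvgMl_tmp; apply: (@continuous_comp _ _ _ (fun x => - (2^-1 * ln (kappa x f))) expR); last exact: continuous_expR.
  apply: cvgN; apply: cvgMl_tmp; apply: (@continuous_comp _ _ _ (fun x => kappa x f) (@ln R)); first exact: ck.
  exact: continuous_ln.
have h2 : (sinh x - cosh x * cos f) @[x --> r] --> sinh r - cosh r * cos f.
  apply: cvgB; first exact: continuous_sinh.
  by apply: cvgMr_tmp; exact: continuous_cosh.
have h3 : (kappa x f)^-1 @[x --> r] --> (kappa r f)^-1 by apply: cvgV; [rewrite gt_eqF|exact: ck].
apply: cvg_trans (cvgM h1 (cvgM h2 h3)).
by apply: near_eq_cvg; have := near_kappa_gt1 k1; apply: filterS => x kx; rewrite /half_rate kx.
Qed.

Lemma near_is_derive1 (g h : R -> R) r d : (\forall x \near r, g x = h x) ->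
  is_derive r 1 g d -> is_derive r 1 h d.
Proof. exact: near_eq_is_derive. Qed.

Lemma is_derive_reach_limit r f : kappa r f != 1 ->
  is_derive r 1 (fun x => reach_limit 2^-1 x f) (- half_rate r f).
Proof.
rewrite neq_lt => /orP[k1|k1].
  apply: (@near_is_derive1 (fun=> 1)).
    have := near_kappa_lt1 k1; apply: filterS => x kx; rewrite /reach_limit (max_idPl _).
      by rewrite mulr0 oppr0 expR0.
    by rewrite ln_le0// ltW.
  by rewrite /half_rate ltNge (ltW k1)/= oppr0; exact: is_derive_cst.
have k0 : 0 < kappa r f by rewrite (lt_trans ltr01).
apply: (@near_is_derive1 (fun x => expR (- (2^-1 * ln (kappa x f))))).
  have := near_kappa_gt1 k1; apply: filterS => x kx; rewrite /reach_limit (max_idPr _)//.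
  by rewrite ln_ge0// ltW.
rewrite /half_rate k1.
have dk : is_derive r 1 (fun x => kappa x f) (sinh r - cosh r * cos f).
  have h1 := is_derive_cosh r; have h2 := is_derive_sinh r.
  rewrite /kappa; apply: is_derive_eq.
  by rewrite /GRing.scale/=; lra.
have dl := @is_derive1_comp _ (@ln R) (fun x => kappa x f) r _ _ (is_derive1_ln k0) dk.
have d2 : is_derive r 1 (fun x => - (2^-1 * ln (kappa x f)))
    (- (2^-1 * ((kappa r f)^-1 * (sinh r - cosh r * cos f)))).
  by apply: is_derive_eq.
have d3 := @is_derive1_comp _ expR (fun x => - (2^-1 * ln (kappa x f))) r _ _ (is_derive_expR _) d2.
by apply: (is_derive_eq d3); rewrite /=; ring.
Qed.

Lemma integrable_reach_limit r : 0 <= r -> mu.-integrable `[0, pi] (EFin \o reach_limit 2^-1 r).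
Proof.
move=> r0; apply: continuous_compact_integrable; first exact: segment_compact.
by apply: continuous_subspaceT; exact: continuous_reach_limit.
Qed.

(** Differentiation under the integral sign along sequences: the difference quotients converge off
    one angle and are bounded by the Lipschitz constant 1/2 of [reach_limit]. *)
Lemma is_derive_V_half r : 0 < r -> is_derive r 1 V_half (- V_rate r).
Proof.
move=> r0.
suff h : (h^-1 *: (V_half (h *: 1 + r) - V_half r)) @[h --> (0 : R)^'] --> - V_rate r.
  apply: DeriveDef; first by apply/cvg_ex; exists (- V_rate r).
  exact: cvg_lim h.
apply/cvgr_dnbhsP => u [u0 uc].
have ur : \forall n \near \oo, 0 <= u n + r.
  have /cvgrPdist_lt/(_ r r0) := uc; apply: filterS => n; rewrite sub0r normrN ltr_norml => /andP[]; lra.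
have E : \forall n \near \oo, pi^-1 * \int[mu]_(f in `[0, pi])
    ((u n)^-1 * (reach_limit 2^-1 (u n + r) f - reach_limit 2^-1 r f)) =
    (u n)^-1 *: (V_half (u n *: 1 + r) - V_half r).
  apply: filterS ur => n un; rewrite /GRing.scale/= mulr1 !V_halfE ?(ltW r0)// -mulrBr [RHS]mulrCA.
  have i1 := integrable_reach_limit un; have i2 := integrable_reach_limit (ltW r0).
  have i3 : mu.-integrable `[0, pi] (EFin \o (fun f => reach_limit 2^-1 (u n + r) f - reach_limit 2^-1 r f)).
    by apply: eq_integrable (integrableB _ i1 i2) => //.
  rewrite -(RintegralB _ i1 i2); last by [].
  by rewrite (RintegralZl _ _ i3).
apply: (cvg_trans (near_eq_cvg E)).
rewrite /V_rate -mulrN; apply: cvgMl_tmp.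
rewrite -[X in _ --> X]mulN1r -RintegralZl//; last exact: integrable_half_rate (ltW r0).
apply: (@cvg_Rintegral_dominated _ _ _ _ (fun=> 2^-1 : R)) => //.
- apply: filterS ur => n un; apply: measurable_funM; first by [].
  apply: measurable_funB; apply: measurable_funTS; apply: continuous_measurable_fun.
    exact: continuous_reach_limit.
  by apply: continuous_reach_limit; exact: ltW.
- by apply: measurable_funM => //; exact: measurable_half_rate (ltW r0).
- apply: kappa_neq1_ae r0 _ => f kf.
  have [d1 d2] := is_derive_reach_limit kf.
  have h : (h^-1 *: (reach_limit 2^-1 (h *: 1 + r) f - reach_limit 2^-1 r f)) @[h --> (0 : R)^']
      --> - half_rate r f by rewrite -d2; exact: d1.
  move/cvgr_dnbhsP/(_ u (conj u0 uc)) : h; rewrite mulN1r => h; apply: cvg_trans h.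
  by apply: near_eq_cvg; apply: nearW => n; rewrite /GRing.scale/= mulr1.
- exact: integrable_half.
- apply: filterS ur => n un f _; rewrite normrM normfV ler_pdivrMl ?normr_gt0//.
  by have := reach_limit_lipschitz f (ltW r0) un; rewrite addrK.
Qed.

Lemma continuous_V_rate r : 0 < r -> {for r, continuous V_rate}.
Proof.
move=> r0; apply/continuous_withinNx; apply/cvgr_dnbhsP => u [u0 uc].
have ur : \forall n \near \oo, 0 <= u n.
  have up : \forall n \near \oo, 0 < u n by exact: (cvgr_gt _ uc).
  by apply: filterS up => n /ltW.
apply: cvgMl_tmp; apply: (@cvg_Rintegral_dominated _ _ _ _ (fun=> 2^-1 : R)) => //.
- by apply: filterS ur => n un; exact: measurable_half_rate.
- exact: measurable_half_rate (ltW r0).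
- apply: kappa_neq1_ae r0 _ => f kf; have := continuous_half_rate kf.
  by move=> /(continuous_cvg _ (f := u)); exact.
- exact: integrable_half.
- apply: filterS ur => n un f _; have /andP[h0 h1] := half_rate_bound f un.
  by rewrite ger0_norm.
Qed.

Lemma V_half_neg r : r <= 0 -> V_half r = 1.
Proof. by move=> r0; rewrite /V_half ltNge r0. Qed.

Lemma V_half0 : V_half 0 = 1 :> R.
Proof. by rewrite V_half_neg. Qed.

Lemma V_half_lipschitz r s : 0 <= r -> 0 <= s -> `|V_half r - V_half s| <= `|r - s|.
Proof.
move=> r0 s0; rewrite !V_halfE// -mulrBr -(RintegralB _ (integrable_reach_limit r0) (integrable_reach_limit s0))//.
have i3 : mu.-integrable `[0, pi] (EFin \o (fun f => reach_limit 2^-1 r f - reach_limit 2^-1 s f)).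
  by apply: eq_integrable (integrableB _ (integrable_reach_limit r0) (integrable_reach_limit s0)) => //.
rewrite normrM ger0_norm ?invr_ge0 ?pi_ge0//.
have p0 := pi_gt0 R; rewrite ler_pdivrMl//.
apply: (le_trans (le_normr_Rintegral _ i3)); first by [].
have iE : \int[mu]_(f in `[0, pi]) (`|r - s| : R) = pi * `|r - s|.
  rewrite Rintegral_cst//; have e : (mu (`[0%R, pi]%classic : set R) = pi%:E)%E.
    by rewrite lebesgue_measure_itv/= lte_fin p0 oppr0 adde0.
  rewrite mulrC; congr (_ * _); exact: (congr1 fine e).
rewrite -iE; apply: le_Rintegral; [by []| | |].
- apply: continuous_compact_integrable; first exact: segment_compact.
  apply: continuous_subspaceT => f; apply: cvg_norm.
  by apply: cvgB; exact: continuous_reach_limit.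
- apply: continuous_compact_integrable; first exact: segment_compact.
  by apply: continuous_subspaceT => x; exact: cvg_cst.
- move=> f _; apply: (le_trans (reach_limit_lipschitz f s0 r0)).
  by have := normr_ge0 (r - s); lra.
Qed.

Lemma continuous_V_half : continuous (@V_half R).
Proof.
have e x : V_half x = V_half (Num.max 0 x) :> R.
  by have [x0|//] := leP x 0; rewrite !V_half_neg.
move=> x; apply/cvgrPdist_lt => eps eps0; exists eps => //= y xy.
have m0 z : 0 <= Num.max 0 z :> R by rewrite le_max lexx.
rewrite (e x) (e y); apply: (le_lt_trans (V_half_lipschitz (m0 _) (m0 _))).
apply: le_lt_trans xy; have [x0|x0] := leP x 0; have [y0|y0] := leP y 0.
- by rewrite subrr normr0.
- by rewrite distrC [leRHS]distrC !ger0_norm ?subr_ge0; lra.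
- by rewrite !ger0_norm ?subr_ge0; lra.
- by [].
Qed.

Lemma V_half_decr r s : 0 <= r -> r < s -> V_half s < V_half r.
Proof.
move=> r0 rs.
have [| |c] := @MVT _ V_half (fun x => - V_rate x) r s rs.
- by move=> x; rewrite in_itv/= => /andP[rx _]; apply: is_derive_V_half; exact: le_lt_trans rx.
- exact: continuous_subspaceT continuous_V_half.
rewrite in_itv/= => /andP[rc _] h; rewrite -subr_lt0 h mulNr oppr_lt0 mulr_gt0 ?subr_gt0//.
by rewrite V_rate_gt0// (le_lt_trans r0).
Qed.

Local Opaque V_half V_rate.

Lemma V_half_decrE r s : 0 <= r -> 0 <= s -> (V_half r < V_half s) = (s < r).
Proof.
move=> r0 s0; case: (ltgtP s r) => [sr|rs|->]; last by rewrite ltxx.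
  exact: V_half_decr.
by apply/negbTE; rewrite -leNgt ltW// V_half_decr.
Qed.

Lemma V_half_ge0 r : 0 <= V_half r.
Proof.
have [r0|/ltW r0] := leP r 0; first by rewrite V_half_neg.
rewrite V_halfE// mulr_ge0 ?invr_ge0 ?pi_ge0//; apply: Rintegral_ge0 => f _; exact: expR_ge0.
Qed.

Lemma cvg_V_half : V_half n%:R @[n --> \oo] --> (0 : R).
Proof.
have h : pi^-1 * \int[mu]_(f in `[0, pi]) reach_limit 2^-1 (n%:R : R) f @[n --> \oo] -->
    pi^-1 * \int[mu]_(f in `[0, pi]) (0 : R).
  apply: cvgMl_tmp; apply: (@cvg_Rintegral_dominated _ _ _ _ (fun=> 1 : R)) => //.
  - apply: nearW => n; apply: measurable_funTS; apply: continuous_measurable_fun.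
    exact: continuous_reach_limit.
  (* The angle 0 is exceptional: there kappa = e^(-r) and the integrand stays 1. *)
  - exists [set 0]; split => //; first exact: lebesgue_measure_set1.
    move=> f /=; apply: contra_notP => f0; rewrite in_itv/= => /andP[f0' fp].
    have {f0 f0'} f0 : 0 < f by rewrite lt_neqAle f0' andbT; apply/eqP => e; apply: f0.
    have c1 : 0 < 1 - cos f.
      by rewrite subr_gt0 -cos0 ltr_cos ?in_itv/= ?lexx ?pi_ge0 ?(ltW f0).
    apply: cvg_expRNy; apply/cvgryPge => A.
    near=> n; rewrite mulrC ler_pdivlMr// le_max; apply/orP; right.
    have nA : A * 2 - ln ((1 - cos f) / 2) <= n%:R by near: n; exact: nbhs_infty_ger.
    have c2 : 0 < (1 - cos f) / 2 by rewrite divr_gt0.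
    have kb : expR n%:R * ((1 - cos f) / 2) <= kappa n%:R f.
      rewrite kappa_exp; have : 0 <= expR (- n%:R) * (1 + cos f).
        by rewrite mulr_ge0 ?expR_ge0//; have := cos_geN1 f; lra.
      lra.
    apply: (@le_trans _ _ (n%:R + ln ((1 - cos f) / 2))); first by lra.
    rewrite -{1}(expRK n%:R) -lnM ?posrE ?expR_gt0// ler_ln ?posrE ?mulr_gt0 ?expR_gt0//.
    exact: kappa_gt0.
  - apply: continuous_compact_integrable; first exact: segment_compact.
    by apply: continuous_subspaceT => x; exact: cvg_cst.
  - apply: nearW => n f _; rewrite ger0_norm ?expR_ge0//.
    by apply: reach_limit_le1; rewrite invr_gt0.
rewrite Rintegral_cst// mul0r mulr0 in h; apply: cvg_trans h; apply: near_eq_cvg; apply: nearW => n.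
by rewrite V_halfE.
Unshelve. all: by end_near. Qed.

Lemma V_half_surj (y : R) : 0 < y <= 1 -> exists2 r : R, 0 <= r & V_half r = y.
Proof.
move=> /andP[y0 y1].
have : \forall n \near \oo, V_half (n%:R : R) < y by exact: (cvgr_lt _ cvg_V_half).
move=> [N _ /(_ N (leqnn N))/= hN].
have [|c] := @IVT _ V_half 0 N%:R y (ler0n _ _) (continuous_subspaceT continuous_V_half).
  by rewrite V_half0 ge_min le_max y1 (ltW hN) !orbT.
by rewrite in_itv/= => /andP[c0 _] <-; exists c.
Qed.

Lemma V_half_invK r : 0 <= r -> V_half_inv (V_half r) = r.
Proof.
move=> r0; apply: pinvKV; last by rewrite inE/= in_itv/= r0.
move=> x y; rewrite !inE/= !in_itv/= !andbT => x0 y0 xy.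
case: (ltgtP x y) => [h|h|//].
  by have := V_half_decr x0 h; rewrite xy ltxx.
by have := V_half_decr y0 h; rewrite xy ltxx.
Qed.

Lemma is_derive_V_half_inv r : 0 < r -> is_derive (V_half r) 1 V_half_inv (- V_rate r)^-1.
Proof.
move=> r0; apply: is_derive_inverse.
- have : \forall x \near r, 0 < x by exact: lt_nbhsr.
  by apply: filterS => x /ltW; exact: V_half_invK.
- have : \forall x \near r, 0 < x by exact: lt_nbhsr.
  by apply: filterS => x _; exact: continuous_V_half.
- exact: is_derive_V_half.
- by rewrite oppr_eq0 gt_eqF// V_rate_gt0.
Qed.

Lemma rhg_g2E nu r : 0 < r -> rhg_g2 nu (V_half r) =
  nu * (V_rate (V_half_inv (V_half r)))^-1 * sinh (V_half_inv (V_half r) / 2).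
Proof.
move=> r0; rewrite /rhg_g2 derive1E; have [_ ->] := is_derive_V_half_inv r0.
by rewrite invrN normrN V_half_invK ?(ltW r0)// gtr0_norm ?invr_gt0 ?V_rate_gt0.
Qed.

Lemma V_half_in01 r : 0 < r -> 0 < V_half r < 1.
Proof.
move=> r0; apply/andP; split; last by rewrite -V_half0; exact: V_half_decr.
apply: (@le_lt_trans _ _ (V_half (r + 1))); first exact: V_half_ge0.
by apply: V_half_decr; [exact: ltW|rewrite ltrDl].
Qed.

Lemma V_half_surj_oo (y : R) : 0 < y < 1 -> exists2 r : R, 0 < r & V_half r = y.
Proof.
move=> /andP[y0 y1]; have [|z z0 zy] := @V_half_surj y; first by rewrite y0 ltW.
exists z => //; rewrite lt_neqAle z0 andbT; apply/eqP => z00.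
by move: y1; rewrite -zy -z00 V_half0 ltxx.
Qed.

Lemma continuous_g2 nu r : 0 < r -> {for V_half r, continuous (rhg_g2 nu)}.
Proof.
move=> x0.
have cW : {for V_half r, continuous V_half_inv}.
  by have [h _] := is_derive_V_half_inv x0; exact/differentiable_continuous/derivable1_diffP.
have h : nu * (V_rate (V_half_inv y))^-1 * sinh (V_half_inv y / 2) @[y --> V_half r] -->
    nu * (V_rate (V_half_inv (V_half r)))^-1 * sinh (V_half_inv (V_half r) / 2).
  apply: cvgM.
    apply: cvgMl_tmp; apply: cvgV; first by rewrite V_half_invK ?gt_eqF ?V_rate_gt0// ltW.
    apply: (@continuous_comp _ _ _ V_half_inv V_rate); first exact: cW.
    by rewrite V_half_invK ?(ltW x0)//; exact: continuous_V_rate.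
  apply: (@continuous_comp _ _ _ (fun y => V_half_inv y / 2) (@sinh R)).
    by apply: cvgMr_tmp; exact: cW.
  exact: continuous_sinh.
suff : rhg_g2 nu y @[y --> V_half r] --> rhg_g2 nu (V_half r) by [].
rewrite [X in _ --> X]rhg_g2E//; apply: cvg_trans h; apply: near_eq_cvg.
have : V_half r \in `]0, 1[ by rewrite in_itv/= V_half_in01.
move/near_in_itvoo; apply: filterS => y; rewrite in_itv/= => /V_half_surj_oo[z z0 <-].
by rewrite rhg_g2E.
Qed.

(** The primitive is -2 nu cosh(V_half_inv y / 2): the chain rule produces the hyperbolic sine times
    the derivative of [V_half_inv], which is negative, whence the absolute value in [rhg_g2]. *)
Lemma integral_g2_itv nu r s : 0 < nu -> 0 < s -> s < r ->
  (\int[mu]_(y in `[V_half r, V_half s]) (rhg_g2 nu y)%:E =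
   (2 * nu * (cosh (r / 2) - cosh (s / 2)))%:E)%E.
Proof.
move=> nu0 s0 sr; have Vrs : V_half r < V_half s by apply: V_half_decr => //; exact: ltW.
pose F y := - (2 * nu) * cosh (V_half_inv y / 2).
have sur y : V_half r <= y <= V_half s -> exists2 x, s <= x <= r & V_half x = y.
  move=> /andP[ry ys]; have [|x x0 xy] := @V_half_surj y.
    have /andP[V0 _] := V_half_in01 (lt_trans s0 sr); have /andP[_ V1] := V_half_in01 s0.
    by rewrite (lt_le_trans V0 ry) (le_trans ys (ltW V1)).
  exists x => //; apply/andP; split; rewrite leNgt; apply/negP => h.
    by have := V_half_decr x0 h; rewrite xy ltNge ys.
  by have := V_half_decr (ltW (lt_trans s0 sr)) h; rewrite xy ltNge ry.
have dF x : s <= x -> is_derive (V_half x) 1 F (rhg_g2 nu (V_half x)).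
  move=> sx; have x0 : 0 < x by exact: lt_le_trans sx.
  have dW := is_derive_V_half_inv x0.
  have W' : derive1 V_half_inv (V_half x) = (- V_rate x)^-1.
    by rewrite derive1E; have [_ ->] := dW.
  have d2 : is_derive (V_half x) 1 (fun y => V_half_inv y / 2) ((- V_rate x)^-1 / 2).
    rewrite (_ : (fun y => V_half_inv y / 2) = (fun y => 2^-1 *: V_half_inv y)); last first.
      by apply/funext => y; rewrite /GRing.scale/= mulrC.
    by rewrite (mulrC _ 2^-1); exact: is_deriveZ.
  have d3 := @is_derive1_comp _ (@cosh R) (fun y => V_half_inv y / 2) _ _ _ (is_derive_cosh _) d2.
  have d4 := is_deriveZ (- (2 * nu)) d3.
  apply: (is_derive_eq d4).
  have k0 := V_rate_gt0 x0.
  rewrite /rhg_g2 W' V_half_invK ?(ltW x0)// /GRing.scale/= invrN normrN gtr0_norm ?invr_gt0//.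
  by lra.
have cg x : s <= x -> {for V_half x, continuous (rhg_g2 nu)}.
  by move=> sx; apply: continuous_g2; exact: lt_le_trans sx.
have cF : forall x, s <= x -> {for V_half x, continuous F}.
  by move=> x sx; have [h _] := dF x sx; exact/differentiable_continuous/derivable1_diffP.
rewrite (@continuous_FTC2 _ (rhg_g2 nu) F _ _ Vrs).
- rewrite /F (V_half_invK (ltW s0)) (V_half_invK (ltW (lt_trans s0 sr))).
  by rewrite -EFinB; congr EFin; lra.
- apply: continuous_in_subspaceT => y; rewrite inE/= in_itv/= => /sur[x /andP[sx _] <-].
  exact: cg.
- split.
  + move=> y; rewrite in_itv/= => /andP[/ltW a /ltW b].
    by have [|x /andP[sx _] <-] := sur y; [rewrite a|have [] := dF x sx].
  + by apply: cvg_at_right_filter; apply: cF; exact: ltW.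
  + by apply: cvg_at_left_filter; apply: cF.
- move=> y; rewrite in_itv/= => /andP[/ltW a /ltW b].
  have [|x /andP[sx _] <-] := sur y; first by rewrite a.
  by rewrite derive1E; have [_ ->] := dF x sx.
Qed.

Lemma rhg_g2_ge0 nu (y : R) : 0 < nu -> 0 < y < 1 -> 0 <= rhg_g2 nu y.
Proof.
move=> nu0 /V_half_surj_oo[r r0 <-]; rewrite rhg_g2E// V_half_invK ?(ltW r0)//.
apply: mulr_ge0; last by apply: sinh_ge0; rewrite divr_ge0// ltW.
by apply: mulr_ge0; [exact: ltW|rewrite invr_ge0 ltW// V_rate_gt0].
Qed.

Lemma measurable_g2 nu (D : set R) : measurable D -> D `<=` `]0, 1[ -> measurable_fun D (rhg_g2 nu).
Proof.
move=> mD D01; apply: (measurable_funS (measurable_itv `]0, 1[) D01).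
apply: open_continuous_measurable_fun; first exact: interval_open.
by move=> y; rewrite inE/= in_itv/= => /V_half_surj_oo[r r0 <-]; exact: continuous_g2.
Qed.

(** Differentiability of [V_half_inv] is known only at values [V_half r] with r > 0, so the end
    point 1 is reached by exhausting the interval with [V_half r, V_half s_i], s_i -> 0, and
    monotone convergence. *)
Lemma integral_g2 nu r : 0 < nu -> 0 < r ->
  (\int[mu]_(y in `[V_half r, 1%R]) (rhg_g2 nu y)%:E = (2 * nu * (cosh (r / 2) - 1))%:E)%E.
Proof.
move=> nu0 r0; have /andP[V0 V1] := V_half_in01 r0.
have mg (D : set R) : measurable D -> D `<=` `]0, 1[ -> measurable_fun D (EFin \o rhg_g2 nu).
  by move=> mD D01; apply/measurable_EFinP; exact: measurable_g2.
rewrite -integral_itv_bndo_bndc; last first.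
  apply: mg => // y /=; rewrite !in_itv/= => /andP[a ->]; rewrite andbT; exact: lt_le_trans a.
(* The shift by 2 gives s_i < r strictly for every i. *)
pose s (i : nat) : R := r / i.+2%:R.
have s0 i : 0 < s i by rewrite divr_gt0.
have sr i : s i < r by rewrite ltr_pdivrMr// ltr_pMr// ltr1n.
pose S (i : nat) : set R := `[V_half r, V_half (s i)]%classic.
have SE i y : S i y = (V_half r <= y <= V_half (s i)) :> Prop by rewrite /S/= in_itv.
have S01 i : S i `<=` `]0, 1[.
  move=> y; rewrite SE => /andP[a b]; have /andP[_ c] := V_half_in01 (s0 i).
  by rewrite /= in_itv/= (lt_le_trans V0 a) (le_lt_trans b c).
have US : \bigcup_i S i = `[V_half r, 1[%classic.
  apply/seteqP; split => y.
    move=> [i _ Si]; have := S01 _ _ Si; move: Si; rewrite SE => /andP[a _].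
    by rewrite /= !in_itv/= a => /andP[_ ->].
  rewrite /= in_itv/= => /andP[a b].
  have [|z z0 zy] := @V_half_surj_oo y; first by rewrite b (lt_le_trans V0 a).
  have [i ri] : exists i : nat, r / z < i%:R by exists (Num.bound (r / z)); apply: archi_boundP; rewrite divr_ge0 ?ltW.
  exists i => //; rewrite SE a -zy leNgt (V_half_decrE (ltW (s0 _)) (ltW z0)) -leNgt.
  rewrite /s ler_pdivrMr// mulrC -ler_pdivrMr//; apply: (le_trans (ltW ri)).
  by rewrite ler_nat; apply: leq_trans (leqnSn _) (leqnSn _).
have ndS : nondecreasing_seq S.
  move=> i j ij; apply/subsetPset => y; rewrite !SE => /andP[a b]; rewrite a.
  apply: (le_trans b); rewrite leNgt (V_half_decrE (ltW (s0 _)) (ltW (s0 _))) -leNgt.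
  by rewrite /s ler_pM2l// lef_pV2 ?posrE// ler_nat !ltnS.
have cv : (\int[mu]_(y in S i) (rhg_g2 nu y)%:E)%E @[i --> \oo] -->
    (\int[mu]_(y in \bigcup_i S i) (rhg_g2 nu y)%:E)%E.
  apply: ge0_nondecreasing_set_cvg_integral; first exact: ndS.
  - by move=> i; exact: measurable_itv.
  - by move=> i; apply: mg; [exact: measurable_itv|exact: S01].
  - by move=> i y Sy; rewrite lee_fin; apply: rhg_g2_ge0 nu0 _; have := S01 i y Sy; rewrite /= in_itv.
rewrite US in cv; apply: (cvg_unique _ cv) => //.
rewrite (_ : (fun i => _) = (fun i => (2 * nu * (cosh (r / 2) - cosh (s i / 2)))%:E)); last first.
  by apply/funext => i; rewrite /S integral_g2_itv.
apply: cvg_EFin; first exact: nearW.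
apply: cvgMl_tmp; apply: cvgB; first exact: cvg_cst.
rewrite -[X in _ --> X](@cosh0 R); apply: (continuous_cvg _ (f := fun i => s i / 2) (h := @cosh R)).
  exact: continuous_cosh.
rewrite -[X in _ --> X](mul0r (2^-1 : R)); apply: cvgMr_tmp.
rewrite -[X in _ --> X](mulr0 r); apply: cvgMl_tmp.
have h := @cvg_harmonic R; rewrite -(cvg_shiftS) in h; exact: h.
Qed.

End V_half_derivative.

(** * From radii to degrees *)

Section density_tails.
Context {R : realType}.
Notation mu := (@lebesgue_measure R).
Variables (c top : \bar R) (g G : R -> R).
Let E : set \bar R := [set x | (c < x <= top)%E].
Let tail (a : R) : set R := [set y | a <= y /\ (y%:E <= top)%E].
Hypothesis mg : forall a, (c < a%:E < top)%E -> measurable_fun (tail a) g.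
Hypothesis g0 : forall a y, (c < a%:E < top)%E -> tail a y -> 0 <= g y.
Hypothesis gG : forall a, (c < a%:E < top)%E -> (\int[mu]_(y in tail a) (g y)%:E = (G a)%:E)%E.

Let measurable_tail a : measurable (tail a).
Proof.
rewrite /tail; case: top => [r||].
- rewrite (_ : [set y | _] = `[a, r]%classic)//; apply/seteqP; split => y /=; rewrite in_itv/= lee_fin.
    by move=> [-> ->].
  by move=> /andP[].
- rewrite (_ : [set y | _] = `[a, +oo[%classic)//; apply/seteqP; split => y /=; rewrite in_itv/= andbT leey.
    by move=> [].
  by [].
- rewrite (_ : [set y | _] = set0)//; apply/seteqP; split => // y /= [_]; rewrite leeNy_eq; by [].
Qed.

(** A cell is the difference of two sets of type [a, top], whose masses are finite and can be
    subtracted. *)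
Lemma density_tail_increment (t : nat -> R) N :
  {homo t : i j / (i <= j)%N >-> i <= j} -> (forall j, (c < (t j)%:E < top)%E) ->
  forall j, (j <= N)%N -> density_measure E g (cell top t N j) = (tail_increment G t N j)%:E.
Proof.
move=> tmono tin j jN; rewrite /density_measure /tail_increment.
set S := [set y : R | _].
have SE : S = [set y | tail (t j) y /\ ((j < N)%N -> y < t j.+1)].
  apply/seteqP; split => y; rewrite /S /cell /tail /=.
    by move=> [_ [/andP[]]]; rewrite !lee_fin => ty yt h; split => // /h; rewrite lte_fin.
  move=> [[ty yt] h]; have /andP[ct _] := tin j.
  split; first by rewrite /E/= yt andbT (lt_le_trans ct)// lee_fin.
  by rewrite lee_fin ty yt; split => // /h; rewrite lte_fin.
have [jlt|] := ltnP j N; last first.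
  move=> Nj; rewrite subr0 -gG//; congr (integral _ _ _); rewrite SE; apply/seteqP; split => y /=.
    by move=> [].
  by move=> h; split => //; rewrite ltnNge Nj.
have tE : tail (t j) = S `|` tail (t j.+1).
  rewrite SE; apply/seteqP; split => y /=.
    move=> [ty yt]; have [h|h] := ltP y (t j.+1); [left|right]; split => //.
  move=> [[]//|[ty yt]]; split => //; apply: le_trans ty; exact: tmono.
have mS : measurable S.
  rewrite (_ : S = tail (t j) `\` tail (t j.+1)); first exact: measurableD.
  rewrite SE; apply/seteqP; split => y /=.
    by move=> [h /(_ jlt) yj]; split => // -[]; rewrite leNgt yj.
  by move=> [[ty yt] h]; split => // _; rewrite ltNge; apply/negP => h'; apply: h.
have St : S `<=` tail (t j) by rewrite tE => y; left.
have h := gG (tin j); rewrite tE ge0_integral_setU//= in h; first last.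
- rewrite SE; apply/disj_setPS => y [/= [_ /(_ jlt)]]; rewrite ltNge => /negP h' [h'' _]; exact: h'.
- by move=> y ty; rewrite lee_fin; apply: (g0 (tin j)); rewrite tE; exact: ty.
- by rewrite -tE; apply/measurable_EFinP; exact: mg.
- exact: measurable_tail.
rewrite (gG (tin j.+1)) in h.
have : (\int[mu]_(y in S) (g y)%:E + (G (t j.+1))%:E - (G (t j.+1))%:E = (G (t j))%:E - (G (t j.+1))%:E)%E.
  by rewrite h.
by rewrite addeK// => ->; rewrite EFinB.
Qed.

End density_tails.

(** * Chernoff bounds strong enough for a union over all nodes *)

Section chernoff_asymptotics.
Context {R : realType}.

(** The optimal exponent would be ln(a2 / a1). The rational choices below avoid logarithms, allow a
    zero level, and work through e^lam - 1 <= lam / (1 - lam), which replaces the larger level by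
    the mean of the two. *)
Lemma chernoff_exponent (a1 a2 : R) : 0 <= a1 -> 0 <= a2 -> a1 != a2 ->
  exists2 lam, 0 < lam * (a2 - a1) & a1 * (expR lam - 1) < lam * a2.
Proof.
move=> a10 a20 a12.
have h (lam : R) : lam < 1 -> expR lam - 1 <= lam / (1 - lam).
  move=> l1; have l10 : 0 < 1 - lam by lra.
  have := expR_ge1Dx (- lam); rewrite expRN => e; have := expR_gt0 lam.
  rewrite ler_pdivlMr//; move: (expR lam) e => x e x0.
  have : x * (1 - lam) <= 1 by have := ler_wpM2l (ltW x0) e; rewrite mulfV ?gt_eqF.
  by lra.
have [lt12|lt21|e] := ltgtP a1 a2; last by rewrite e eqxx in a12.
  pose lam := (a2 - a1) / (2 * a2).
  have a2p : 0 < a2 by lra.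
  have l0 : 0 < lam by rewrite divr_gt0; lra.
  have l1 : lam < 1 by rewrite ltr_pdivrMr; lra.
  have e1 : a2 * (1 - lam) = (a1 + a2) / 2 by rewrite /lam; field; rewrite gt_eqF.
  exists lam; first by rewrite mulr_gt0 ?subr_gt0.
  apply: (le_lt_trans (ler_wpM2l a10 (h _ l1))).
  rewrite mulrCA ltr_pM2l// ltr_pdivrMr; lra.
pose de := (a1 - a2) / (2 * a1).
have a1p : 0 < a1 by lra.
have l0 : 0 < de by rewrite divr_gt0; lra.
have l1 : a2 * (1 + de) < a1.
  have : a2 * de <= a1 * de by rewrite ler_pM2r// ltW.
  have : a1 * de = (a1 - a2) / 2 by rewrite /de; field; rewrite gt_eqF.
  by lra.
exists (- de); first by rewrite mulNr oppr_gt0 pmulr_rlt0; lra.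
have h1 := h (- de) ltac:(lra).
apply: (le_lt_trans (ler_wpM2l a10 h1)); rewrite opprK.
rewrite mulrCA !mulNr ltrN2 ltr_pM2l// ltr_pdivlMr; lra.
Qed.

(** Divided by -s, the exponent tends to lam a2 - a1 (e^lam - 1) > 0; half of this limit serves as
    k. The factor n + 1 pays for the union over the nodes. *)
Lemma cvg_chernoff_bound (s p t : R^nat) (a1 a2 lam : R) :
  (forall n, 0 < s n) -> (forall k, 0 < k -> n.+1%:R * expR (- (k * s n)) @[n --> \oo] --> (0 : R)) ->
  n%:R * p n / s n @[n --> \oo] --> a1 -> t n @[n --> \oo] --> a2 ->
  a1 * (expR lam - 1) < lam * a2 ->
  n.+1%:R * expR (n%:R * (p n * (expR lam - 1)) - lam * (s n * t n)) @[n --> \oo] --> (0 : R).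
Proof.
move=> s0 sg pa ta hlam.
pose k := (lam * a2 - a1 * (expR lam - 1)) / 2.
have k0 : 0 < k by rewrite divr_gt0// subr_gt0.
have h : lam * t n - n%:R * p n / s n * (expR lam - 1) @[n --> \oo] --> lam * a2 - a1 * (expR lam - 1).
  by apply: cvgB; [exact: cvgMl_tmp|exact: cvgMr_tmp].
have kh : \forall n \near \oo, k < lam * t n - n%:R * p n / s n * (expR lam - 1).
  apply: (cvgr_gt _ h); rewrite /k; lra.
apply: (squeeze_cvgr _ (cvg_cst 0) (sg k k0)).
apply: filterS kh => n kn; rewrite mulr_ge0 ?expR_ge0//= ler_pM2l// ler_expR.
have e1 : n%:R * p n / s n * s n = n%:R * p n by rewrite divfK ?gt_eqF.
have e2 : n%:R * p n / s n * s n * (expR lam - 1) = n%:R * p n * (expR lam - 1) by rewrite e1.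
have := ler_wpM2r (ltW (s0 n)) (ltW kn); move: e2; move: (n%:R * p n / s n) => q e2.
by lra.
Qed.

(** With L = ln(n + 1) the product is exp(L - k e^(gam L)), and e^(gam L) >= (1 + gam L / 2)^2
    dominates L. *)
Lemma cvg_expR_power (gam : R) : 0 < gam -> forall k, 0 < k ->
  n.+1%:R * expR (- (k * n.+1%:R `^ gam)) @[n --> \oo] --> (0 : R).
Proof.
move=> g0 k k0.
have Loo : ln (n.+1%:R : R) @[n --> \oo] --> +oo.
  apply/cvgryPge => A; near=> n; rewrite -ler_expR lnK ?posrE//.
  have h : expR A <= n%:R by near: n; exact: nbhs_infty_ger.
  by apply: (le_trans h); rewrite ler_nat.
have uoo : k * expR (gam * ln (n.+1%:R : R)) - ln (n.+1%:R : R) @[n --> \oo] --> +oo.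
  apply/cvgryPge => A; near=> n.
  have L1 : 1 <= ln (n.+1%:R : R) by apply: ltW; near: n; exact: near_gty.
  (* Chosen so that k gam^2 L^2 / 4 >= (|A| + 1) L, which is at least A + L once L >= 1. *)
  have LA : (`|A| + 1) * 4 / (k * gam ^+ 2) < ln (n.+1%:R : R) by near: n; exact: near_gty.
  move: (ln _) L1 LA => L L1 LA.
  have e : (1 + gam * L / 2) ^+ 2 <= expR (gam * L).
    have -> : expR (gam * L) = expR (gam * L / 2) ^+ 2 by rewrite -expRM_natr; congr expR; lra.
    have h := expR_ge1Dx (gam * L / 2).
    have h0 : 0 <= 1 + gam * L / 2 by rewrite addr_ge0// divr_ge0// mulr_ge0 ?(ltW g0)//; lra.
    by rewrite lerXn2r// nnegrE// (le_trans h0).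
  rewrite ltr_pdivrMr in LA; last by rewrite mulr_gt0// exprn_gt0.
  have gL : 0 <= gam * L by rewrite mulr_ge0 ?(ltW g0)//; lra.
  have e2 : gam ^+ 2 * L ^+ 2 / 4 <= expR (gam * L) by apply: le_trans e; nra.
  have := ler_wpM2l (ltW k0) e2.
  have := ler_norm A; have := normr_ge0 A; move: (`|A|) LA => B LA B0 AB h.
  have : (B + 1) * 4 * L <= L * (k * gam ^+ 2) * L by rewrite ler_wpM2r//; lra.
  by have : B * 1 <= B * L by [rewrite ler_wpM2l]; lra.
apply: cvg_trans (cvg_expRNy uoo); apply: near_eq_cvg; apply: nearW => n.
rewrite opprB expRD lnK ?posrE// /powR gt_eqF//.
Unshelve. all: by end_near. Qed.

End chernoff_asymptotics.

Section finite_events.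
Context {R : realType}.

Lemma probabilityU_le d (Omega : measurableType d) (P : probability Omega R)
    (A B : set Omega) (a b : R) : measurable A -> measurable B ->
  (P A <= a%:E)%E -> (P B <= b%:E)%E -> (P (A `|` B) <= (a + b)%:E)%E.
Proof.
move=> mA mB Aa Bb; apply: (@le_trans _ _ (P A + P B)%E); last by rewrite EFinD leeD.
by apply: measureU2; rewrite ?inE.
Qed.

Lemma probability_exists_le d (Omega : measurableType d) (P : probability Omega R)
    (I : finType) (F : I -> set Omega) (b : I -> R) :
  (forall i, measurable (F i)) -> (forall i, (P (F i) <= (b i)%:E)%E) ->
  (P [set w | exists i, F i w] <= (\sum_i b i)%:E)%E.
Proof.
move=> mF Fb.
have h (s : seq I) : measurable [set w | exists2 i, i \in s & F i w] /\
    (P [set w | exists2 i, i \in s & F i w] <= (\sum_(i <- s) b i)%:E)%E.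
  elim: s => [|i s [mS IH]].
    rewrite (_ : [set w | _] = set0) ?measure0 ?big_nil//.
    by apply/seteqP; split => // w [].
  rewrite (_ : [set w | _] = F i `|` [set w | exists2 i, i \in s & F i w]); last first.
    apply/seteqP; split => w /=.
      by move=> [k]; rewrite inE => /orP[/eqP->|ks] Fk; [left|right; exists k].
    by move=> [Fi|[k ks Fk]]; [exists i; rewrite ?mem_head|exists k; rewrite ?inE ?ks ?orbT].
  split; first exact: measurableU.
  by rewrite big_cons; exact: probabilityU_le.
have [mS hS] := h (index_enum I).
rewrite (_ : [set w | _] = [set w | exists2 i, i \in index_enum I & F i w])//.
apply/seteqP; split => w /=; first by move=> [i Fi]; exists i; rewrite ?mem_index_enum.
by move=> [i _ Fi]; exists i.
Qed.

Lemma probability_close d (Omega : measurableType d) (P : probability Omega R)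
    (A B C : set Omega) (e : R) : measurable A -> measurable B -> measurable C ->
  (P C <= e%:E)%E -> (forall w, ~ C w -> A w <-> B w) ->
  `|fine (P A) - fine (P B)| <= e.
Proof.
move=> mA mB mC Ce AB.
have h (A' B' : set Omega) : measurable A' -> measurable B' -> (forall w, ~ C w -> A' w -> B' w) ->
    fine (P A') <= fine (P B') + e.
  move=> mA' mB' AB'; rewrite -lee_fin fineK ?fin_num_measure//.
  apply: (@le_trans _ _ (P (B' `|` C))).
    apply: le_measure; rewrite ?inE//; first exact: measurableU.
    by move=> w Aw; have [Cw|nC] := pselect (C w); [right|left; exact: AB'].
  apply: probabilityU_le => //.
  by rewrite fineK ?fin_num_measure.
rewrite ler_norml; apply/andP; split.
  by have := h B A mB mA (fun w nC => (AB w nC).2); lra.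
by have := h A B mA mB (fun w nC => (AB w nC).1); lra.
Qed.

End finite_events.

Section graph_events.
Context {R : realType}.
Variables (nu : R) (n : nat) (d : measure_display) (Omega : measurableType d)
  (P : probability Omega R) (X : 'I_n -> {RV P >-> (R * R)%type}).

Lemma measurable_close_event i j (Rn : R) : measurable [set w | disc_dist (X i w) (X j w) <= Rn].
Proof.
have m : measurable_fun setT (fun w => (X i w, X j w)).
  by apply: measurable_fun_pair; exact: measurable_funPT.
by have := m measurableT _ (measurable_close_pairs Rn); rewrite setTI.
Qed.

(** The degrees depend on w only through the finite array of edge indicators, so the event is a
    finite union of measurable ones, for an arbitrary predicate V. Every random element built from
    degrees is measurable for this reason. *)
Lemma measurable_degree_event (V : ('I_n -> nat) -> Prop) :
  measurable [set w | V (rhg_degree nu (fun j => X j w))].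
Proof.
pose e w : {ffun 'I_n * 'I_n -> bool} := [ffun p => rhg_edge nu (fun j => X j w) p.1 p.2].
pose dg (f : {ffun 'I_n * 'I_n -> bool}) (i : 'I_n) := #|[pred j | f (i, j)]|.
have eE w : rhg_degree nu (fun j => X j w) = dg (e w).
  by apply/funext => i; apply: eq_card => j; rewrite !inE ffunE.
have me f : measurable [set w | e w = f].
  rewrite (_ : [set w | _] = \bigcap_(p in [set: 'I_n * 'I_n])
      [set w | rhg_edge nu (fun j => X j w) p.1 p.2 = f p]); last first.
    apply/seteqP; split => w /=; first by move=> <- p _ /=; rewrite ffunE.
    by move=> h; apply/ffunP => p; rewrite ffunE; exact: h.
  apply: fin_bigcap_measurable => [|p _]; first exact: finite_finset.
  rewrite /rhg_edge; have mc := measurable_close_event p.1 p.2 (rhg_radius nu n).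
  case: (p.1 != p.2); case: (f p) => /=.
  - exact: mc.
  - rewrite (_ : [set w | _] = ~` [set w | disc_dist (X p.1 w) (X p.2 w) <= rhg_radius nu n]).
      exact: measurableC.
    by apply/seteqP; split => w /=; [move=> ->|move=> /negP/negbTE].
  - by rewrite (_ : [set w | _] = set0)//; apply/seteqP; split.
  - by rewrite (_ : [set w | _] = setT)//; apply/seteqP; split.
rewrite (_ : [set w | _] = \bigcup_(f in [set f | (fun f => `[<V (dg f)>]) f]) [set w | e w = f]).
  by apply: bigcup_finType_measurable => f _; exact: me.
apply/seteqP; split => w /=; first by rewrite eE => h; exists (e w) => //=; exact/asboolP.
by move=> [f /= /asboolP Vf ef]; rewrite eE ef.
Qed.

End graph_events.

Lemma degree_le (R : realType) (nu : R) m (x : 'I_m.+1 -> R * R) i : (rhg_degree nu x i <= m)%N.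
Proof.
rewrite -ltnS -{2}(card_ord m.+1) /rhg_degree; apply: (@leq_ltn_trans #|predC1 i|).
  by apply: subset_leq_card; apply/fintype.subsetP => j; rewrite !inE eq_sym => /andP[].
by rewrite cardC1 card_ord.
Qed.

(** * From counts of radii to counts of degrees *)

Section assembly.
Context {R : realType}.
Variables (alpha nu : R).
Hypotheses (alpha_gt0 : 0 < alpha) (nu_gt0 : 0 < nu).
Unset Implicit Arguments.
Variables (d : nat -> measure_display) (Omega : forall n, measurableType (d n))
  (P : forall n, probability (Omega n) R) (X : forall n, 'I_n -> {RV (P n) >-> (R * R)%type}).
Set Implicit Arguments.
Hypothesis X_iid : forall n, nu < n%:R -> iid_of_law (P n) (fun i w => X n i w) (rhg_law alpha nu n).

Notation Rad m := (rhg_radius nu m.+1).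

(** The node law as a genuine probability measure, which [rhg_law] is only for nu < n. Writing n = m
    + 1 provides the node [ord0] and leaves m other nodes. *)
Definition node_law m : probability (R * R)%type R := distribution (P m.+1) (X m.+1 ord0).

Lemma near_nu : \forall m \near \oo, nu < m.+1%:R.
Proof.
near=> m; have h : nu < m%:R by near: m; exact: nbhs_infty_gtr.
by rewrite (lt_trans h)// ltr_nat.
Unshelve. all: by end_near. Qed.

Lemma Rad_gt0 m : nu < m.+1%:R -> 0 < Rad m.
Proof. by move=> h; rewrite mulr_gt0// ln_gt0// ltr_pdivlMr// mul1r. Qed.

Lemma node_lawE m : nu < m.+1%:R -> forall B, measurable B -> node_law m B = rhg_law alpha nu m.+1 B.
Proof. by move=> h B mB; have [_ +] := X_iid h; move=> /(_ ord0 B mB). Qed.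

Lemma iid_node_law m : nu < m.+1%:R -> iid_of_law (P m.+1) (fun i w => X m.+1 i w) (node_law m).
Proof.
move=> h; have [ind law] := X_iid h; split => // i B mB.
by rewrite law// -node_lawE.
Qed.

(** Membership in the unit disc is included because [disc_dist] is the hyperbolic distance only
    there. *)
Definition inner_disc (s : R) : set (R * R) := [set x | sqnorm x < 1 /\ disc_dist 0 x <= s].

Lemma measurable_inner_disc s : measurable (inner_disc s).
Proof.
apply: measurableI; first exact: measurable_in_disc.
by have := measurable_disc_dist0 measurableT (measurable_itv `]-oo, s]); rewrite setTI set_itvE.
Qed.

Lemma node_law_inner_disc m s : nu < m.+1%:R -> 0 <= s -> s <= Rad m ->
  node_law m (inner_disc s) = (radial_cdf alpha (Rad m) s)%:E.
Proof.
move=> h s0 sR; rewrite node_lawE//; last exact: measurable_inner_disc.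
apply: rhg_law_radius => //; first exact: measurable_inner_disc.
move=> r t r0 _; rewrite /inner_disc/= disc_dist_origin//.
by split => [[]//|rs]; split => //; exact: polar_point_in_disc.
Qed.

Lemma inner_disc_sub s s' : s <= s' -> inner_disc s `<=` inner_disc s'.
Proof. by move=> ss' x [x1 xs]; split => //; exact: le_trans xs ss'. Qed.

(* For sg = 1 the relation A m is adjacency and for sg = -1 non-adjacency, so that in both
   cases the counted degree is of order s m. A node at radius [rho m a] has conditional
   probability [pim m a] of being A-related to another one, chosen so that its rescaled
   degree concentrates at a. *)
Variables (sg : R) (A : nat -> set ((R * R) * (R * R))) (y : nat -> nat -> R)
  (s : R^nat) (tau pim rho : nat -> R -> R) (G : R -> R) (c top : \bar R).
Hypothesis sg1 : sg = 1 \/ sg = -1.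
Hypothesis mA : forall m, measurable (A m).
Hypothesis s_gt0 : forall m, 0 < s m.
Hypothesis s_growth : forall k, 0 < k -> m.+1%:R * expR (- (k * s m)) @[m --> \oo] --> (0 : R).
Notation inI a := (c < a%:E < top)%E.
Definition position m (w : Omega m.+1) (i : 'I_m.+1) : R :=
  y m (rhg_degree nu (fun j => X m.+1 j w) i).
Hypothesis yE : forall m a i w, inI a -> (a <= position w i) =
  (sg * (s m * tau m a) <= sg * \sum_(j < m) \1_(A m) (X m.+1 i w, X m.+1 (lift i j) w)).
Hypothesis tau_cvg : forall a, inI a -> tau m a @[m --> \oo] --> sg * a.
Hypothesis sga_ge0 : forall a, inI a -> 0 <= sg * a.
Hypothesis rho_mono : forall m a b, inI a -> inI b -> a <= b -> rho m b <= rho m a.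
Hypothesis rho_range : forall a, inI a -> \forall m \near \oo, 0 <= rho m a <= Rad m.
Hypothesis cdf_cvg : forall a, inI a ->
  m.+1%:R * radial_cdf alpha (Rad m) (rho m a) @[m --> \oo] --> G a.
Hypothesis pim_cvg : forall a, inI a -> m%:R * pim m a / s m @[m --> \oo] --> sg * a.
Hypothesis q_out : forall a, inI a -> \forall m \near \oo, forall x,
  (inner_disc (Rad m) `\` inner_disc (rho m a)) x ->
  sg * fine (node_law m (xsection (A m) x)) <= sg * pim m a.
Hypothesis q_in : forall a, inI a -> \forall m \near \oo, forall x, inner_disc (rho m a) x ->
  sg * pim m a <= sg * fine (node_law m (xsection (A m) x)).
Hypothesis G_tight : forall a e, inI a -> 0 < e ->
  exists a1 a2, [/\ inI a1, inI a2, a1 < a, a < a2 & G a1 - G a2 < e].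
Hypothesis y_top : forall m k, (k <= m)%N -> ((y m k)%:E <= top)%E.

(** [b] selects the tail: the count lies on the b-side of the level a2, while on C the conditional
    probability is at most, in the order given by b, that of the level a1, which is on the other
    side of a2. The exponent from [chernoff_exponent] then has the sign of b. *)
Lemma chernoff_vanishes a1 a2 (C : nat -> set (R * R)) (b : R) : b = 1 \/ b = -1 ->
  inI a1 -> inI a2 -> 0 < b * (sg * (a2 - a1)) -> (forall m, measurable (C m)) ->
  (\forall m \near \oo, forall x, C m x ->
     b * fine (node_law m (xsection (A m) x)) <= b * pim m a1) ->
  forall e, 0 < e -> \forall m \near \oo, forall i,
    (P m.+1 [set w | C m (X m.+1 i w) /\ (b * (s m * tau m a2) <=
       b * \sum_(j < m) \1_(A m) (X m.+1 i w, X m.+1 (lift i j) w))%R] <= (e / m.+1%:R)%:E)%E.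
Proof.
move=> b1 i1 i2 b12 mC hC e e0.
have [|lam l0 hlam] := chernoff_exponent (sga_ge0 i1) (sga_ge0 i2).
  by apply/eqP => h; move: b12; rewrite mulrBr h subrr mulr0 ltxx.
have lb : 0 < lam * b.
  rewrite -mulrBr in l0.
  have : 0 < (lam * (sg * (a2 - a1))) * (b * (sg * (a2 - a1))) by rewrite mulr_gt0.
  rewrite mulrACA pmulr_lgt0//.
  by case: b1 b12 => ->; rewrite -expr2 exprn_even_gt0//= => h; apply/eqP => h'; move: h; rewrite h' ?mulr0 ltxx.
have bb : b * b = 1 by case: b1 => ->; rewrite ?mulr1 ?mulrNN ?mulr1.
have lamE x : lam * x = lam * b * (b * x) by rewrite mulrA -(mulrA lam) bb mulr1.
have cv := cvg_chernoff_bound s_gt0 s_growth (pim_cvg i1) (tau_cvg i2) hlam.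
have cve : \forall m \near \oo, m.+1%:R *
   expR (m%:R * (pim m a1 * (expR lam - 1)) - lam * (s m * tau m a2)) < e by exact: (cvgr_lt _ cv).
near=> m => i.
have nm : nu < m.+1%:R by near: m; exact: near_nu.
have [ind law] := iid_node_law nm.
apply: (@le_trans _ _ (expR (m%:R * (pim m a1 * (expR lam - 1)) - lam * (s m * tau m a2)))%:E); last first.
  by rewrite lee_fin ler_pdivlMr// mulrC ltW//; near: m.
apply: le_trans (@chernoff_count _ _ _ _ _ _ _ _ _ (A m) (C m) i (pim m a1) lam (s m * tau m a2) ind law (mA m) (mC m) _).
  rewrite [X in (_ <= P _ X)%E](_ : _ = [set w | C m (X m.+1 i w) /\ (b * (s m * tau m a2) <=
       b * \sum_(j < m) \1_(A m) (X m.+1 i w, X m.+1 (lift i j) w))%R])//.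
  have key u v : (lam * u <= lam * v) = (b * u <= b * v) by rewrite (lamE u) (lamE v) ler_pM2l.
  by apply/seteqP; split => w /= [Cw h]; split; rewrite // ?key// -key.
move=> x Cx; have hx : b * fine (node_law m (xsection (A m) x)) <= b * pim m a1.
  by move: x Cx; near: m.
have el : 0 < (expR lam - 1) * b.
  case: b1 lb hx => -> lb hx.
    by move: lb; rewrite !mulr1 => lb; rewrite subr_gt0 -expR0 ltr_expR.
  by move: lb; rewrite !mulrN1 !oppr_gt0 => lb; rewrite subr_lt0 -expR0 ltr_expR.
have E x' : x' * (expR lam - 1) = (expR lam - 1) * b * (b * x').
  by rewrite mulrA -(mulrA (expR lam - 1)) bb mulr1 mulrC.
by rewrite (E (fine _)) (E (pim _ _)) ler_pM2l.
Unshelve. all: by end_near. Qed.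

Definition mismatch m a i : set (Omega m.+1) :=
  [set w | ~ ((a <= position w i) <-> inner_disc (rho m a) (X m.+1 i w))].

Lemma measurable_position_ge m a i : measurable [set w : Omega m.+1 | a <= position w i].
Proof.
exact: (@measurable_degree_event _ nu _ _ _ _ (X m.+1) (fun dg => a <= y m (dg i))).
Qed.

Lemma measurable_RV_in m i (B : set (R * R)) : measurable B ->
  measurable [set w : Omega m.+1 | B (X m.+1 i w)].
Proof.
by move=> mB; have := @measurable_funPT _ _ _ _ (X m.+1 i) measurableT _ mB; rewrite setTI.
Qed.

Lemma measurable_mismatch m a i : measurable (@mismatch m a i).
Proof.
have m1 := measurable_position_ge a i; have m2 := measurable_RV_in i (measurable_inner_disc (rho m a)).
rewrite (_ : mismatch a i = ([set w : Omega m.+1 | a <= position w i] `\` [set w | inner_disc (rho m a) (X m.+1 i w)])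
   `|` ([set w | inner_disc (rho m a) (X m.+1 i w)] `\` [set w | a <= position w i])).
  by apply: measurableU; exact: measurableD.
apply/seteqP; split => w; rewrite /mismatch/=.
  have [p|p] := pselect (a <= position w i); have [q|q] := pselect (inner_disc (rho m a) (X m.+1 i w)); tauto.
tauto.
Qed.

(** Levels a1 < a < a2 from [G_tight] bracket a. A node in the annulus between the radii [rho m a2]
    and [rho m a1] may go either way, but the expected number of such nodes is eventually below e/3.
    Everywhere else the conditional mean is off the level a by a definite amount and
    [chernoff_vanishes] applies. *)
Lemma mismatch_vanishes a e : inI a -> 0 < e ->
  \forall m \near \oo, forall i, (P m.+1 (@mismatch m a i) <= (e / m.+1%:R)%:E)%E.
Proof.
move=> ia e0; have e3 : 0 < e / 3 by rewrite divr_gt0.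
have [a1 [a2 [i1 i2 a1a aa2 Ge]]] := G_tight ia e3.
have sgg : sg * sg = 1 by case: sg1 => ->; rewrite ?mulr1 ?mulrNN ?mulr1.
have F1 : m.+1%:R * radial_cdf alpha (Rad m) (rho m a1)
   - m.+1%:R * radial_cdf alpha (Rad m) (rho m a2) @[m --> \oo] --> G a1 - G a2.
  by apply: cvgB; exact: cdf_cvg.
have F2 : \forall m \near \oo, m.+1%:R * radial_cdf alpha (Rad m) (rho m a1)
   - m.+1%:R * radial_cdf alpha (Rad m) (rho m a2) < e / 3 by exact: (cvgr_lt _ F1).
have mout m : measurable (inner_disc (Rad m) `\` inner_disc (rho m a1)).
  by apply: measurableD; exact: measurable_inner_disc.
have C1 := @chernoff_vanishes a1 a (fun m => inner_disc (Rad m) `\` inner_disc (rho m a1)) sg sg1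
  i1 ia _ mout (q_out i1) _ e3.
have C2 := @chernoff_vanishes a2 a (fun m => inner_disc (rho m a2)) (- sg) _ i2 ia _
  (fun m => measurable_inner_disc _) _ _ e3.
have {}C1 := C1 ltac:(rewrite mulrA sgg mul1r subr_gt0//).
have {}C2 := C2 ltac:(case: sg1 => ->; [right|left]; rewrite ?opprK//)
  ltac:(rewrite mulNr mulrA sgg mul1r oppr_gt0 subr_lt0//)
  ltac:(have := q_in i2; apply: filterS => m h x /h; rewrite !mulNr lerN2//).
near=> m.
have C1m : forall i : 'I_m.+1, (P m.+1 [set w | (inner_disc (Rad m) `\` inner_disc (rho m a1)) (X m.+1 i w) /\
   (sg * (s m * tau m a) <= sg * \sum_(j < m) \1_(A m) (X m.+1 i w, X m.+1 (lift i j) w))%R]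
   <= (e / 3 / m.+1%:R)%:E)%E by near: m; exact: C1.
have C2m : forall i : 'I_m.+1, (P m.+1 [set w | inner_disc (rho m a2) (X m.+1 i w) /\
   (- sg * (s m * tau m a) <= - sg * \sum_(j < m) \1_(A m) (X m.+1 i w, X m.+1 (lift i j) w))%R]
   <= (e / 3 / m.+1%:R)%:E)%E by near: m; exact: C2.
have F2m : m.+1%:R * radial_cdf alpha (Rad m) (rho m a1)
   - m.+1%:R * radial_cdf alpha (Rad m) (rho m a2) < e / 3 by near: m; exact: F2.
move=> i.
have nm : nu < m.+1%:R by near: m; exact: near_nu.
have R0 := Rad_gt0 nm.
have /andP[r10 r1R] : 0 <= rho m a1 <= Rad m by near: m; exact: rho_range.
have /andP[r20 r2R] : 0 <= rho m a2 <= Rad m by near: m; exact: rho_range.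
have [ind law] := iid_node_law nm.
(* The causes of a mismatch: a node outside the range of radii (null), one in the uncertain annulus,
   one beyond [rho m a1] with too large a position, one within [rho m a2] with too small a position.
   Each of the last three costs e/3 divided by m + 1. *)
pose E0 := [set w | (~` inner_disc (Rad m)) (X m.+1 i w)].
pose E1 := [set w | (inner_disc (rho m a1) `\` inner_disc (rho m a2)) (X m.+1 i w)].
pose E2 := [set w | (inner_disc (Rad m) `\` inner_disc (rho m a1)) (X m.+1 i w) /\
   (sg * (s m * tau m a) <= sg * \sum_(j < m) \1_(A m) (X m.+1 i w, X m.+1 (lift i j) w))%R].
pose E3 := [set w | inner_disc (rho m a2) (X m.+1 i w) /\
   (- sg * (s m * tau m a) <= - sg * \sum_(j < m) \1_(A m) (X m.+1 i w, X m.+1 (lift i j) w))%R].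
have mE0 : measurable E0 by apply: measurable_RV_in; apply: measurableC; exact: measurable_inner_disc.
have mE1 : measurable E1.
  by apply: measurable_RV_in; apply: measurableD; exact: measurable_inner_disc.
have mE2 : measurable E2.
  rewrite (_ : E2 = [set w | (inner_disc (Rad m) `\` inner_disc (rho m a1)) (X m.+1 i w)] `&`
     [set w | a <= position w i]).
    by apply: measurableI; [exact: measurable_RV_in|exact: measurable_position_ge].
  by apply/seteqP; split => w /=; rewrite yE.
have mE3 : measurable E3.
  rewrite (_ : E3 = [set w | inner_disc (rho m a2) (X m.+1 i w)] `&`
    [set w | sg * \sum_(j < m) \1_(A m) (X m.+1 i w, X m.+1 (lift i j) w) <= sg * (s m * tau m a)]).
    apply: measurableI; first by apply: measurable_RV_in; exact: measurable_inner_disc.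
    have mf : measurable_fun setT (fun w => sg * \sum_(j < m) (\1_(A m) (X m.+1 i w, X m.+1 (lift i j) w) : R)).
      apply: measurable_funM => //; apply: measurable_sum => j.
      apply: (measurableT_comp (f := (\1_(A m) : _ -> R))); first exact: measurable_indic.
      by apply: measurable_fun_pair; exact: measurable_funPT.
    by have := mf measurableT _ (measurable_itv `]-oo, sg * (s m * tau m a)]); rewrite setTI set_itvE.
  by apply/seteqP; split => w /= [h1 h2]; split => //; move: h2; rewrite !mulNr lerN2.
have sub : mismatch a i `<=` E0 `|` (E1 `|` (E2 `|` E3)).
  move=> w; rewrite /mismatch/= => h.
  have ra1 : rho m a <= rho m a1 by apply: rho_mono => //; exact: ltW.
  have ra2 : rho m a2 <= rho m a by apply: rho_mono => //; exact: ltW.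
  have [D|D] := pselect (inner_disc (Rad m) (X m.+1 i w)); last by left.
  right; have [p|p] := boolP (a <= position w i).
    have nS : ~ inner_disc (rho m a) (X m.+1 i w) by move=> q; apply: h.
    have [q1|q1] := pselect (inner_disc (rho m a1) (X m.+1 i w)).
      by left; split => // q2; apply: nS; exact: inner_disc_sub q2.
    by right; left; split => //; rewrite -yE.
  have S : inner_disc (rho m a) (X m.+1 i w).
    by have [//|nS] := pselect (inner_disc (rho m a) (X m.+1 i w)); exfalso; apply: h; split => // q; rewrite q in p.
  have [q2|q2] := pselect (inner_disc (rho m a2) (X m.+1 i w)).
    right; right; split => //; rewrite !mulNr lerN2.
    by move: p; rewrite yE// -ltNge => /ltW.
  by left; split => //; exact: inner_disc_sub S.
have P0 : P m.+1 E0 = 0%E.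
  rewrite /E0 (_ : [set w | _] = X m.+1 i @^-1` (~` inner_disc (Rad m)))//.
  have mI := measurable_inner_disc (Rad m).
  etransitivity; first by apply: law; exact: measurableC.
  by rewrite probability_setC// node_law_inner_disc ?(ltW R0)// radial_cdf1// subee.
have P1 : (P m.+1 E1 <= (e / 3 / m.+1%:R)%:E)%E.
  rewrite /E1 (_ : [set w | _] = X m.+1 i @^-1` (inner_disc (rho m a1) `\` inner_disc (rho m a2)))//.
  have r12 : rho m a2 <= rho m a1 by apply: rho_mono => //; exact: ltW (lt_trans a1a aa2).
  have m1 := measurable_inner_disc (rho m a1); have m2 := measurable_inner_disc (rho m a2).
  rewrite (_ : P m.+1 _ = node_law m (inner_disc (rho m a1) `\` inner_disc (rho m a2))); last first.
    by apply: law; exact: measurableD.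
  rewrite measureD//; last by rewrite -ge0_fin_numE// fin_num_measure.
  rewrite setIidr; last exact: inner_disc_sub.
  have n1 := node_law_inner_disc nm r10 r1R; have n2 := node_law_inner_disc nm r20 r2R.
  apply: (@le_trans _ _ ((radial_cdf alpha (Rad m) (rho m a1))%:E - (radial_cdf alpha (Rad m) (rho m a2))%:E)%E).
    by rewrite -n1 -n2.
  by rewrite -EFinB lee_fin ler_pdivlMr// mulrC mulrBr ltW.
have P2 : (P m.+1 E2 <= (e / 3 / m.+1%:R)%:E)%E := C1m i.
have P3 : (P m.+1 E3 <= (e / 3 / m.+1%:R)%:E)%E := C2m i.
apply: (@le_trans _ _ (P m.+1 (E0 `|` (E1 `|` (E2 `|` E3))))).
  apply: le_measure; rewrite ?inE//; first exact: measurable_mismatch.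
  by do 3! (apply: measurableU => //).
rewrite (_ : e / m.+1%:R = 0 + (e / 3 / m.+1%:R + (e / 3 / m.+1%:R + e / 3 / m.+1%:R))); last first.
  by rewrite add0r -!mulrDl; congr (_ / _); lra.
have mU : measurable (E2 `|` E3) by exact: measurableU.
apply: probabilityU_le => //; [exact: measurableU|by rewrite P0|].
by do 2! (apply: probabilityU_le => //).
Unshelve. all: by end_near. Qed.

Section cells.
Variables (t : nat -> R) (N : nat) (k : nat -> nat).
Hypothesis t_mono : {homo t : i j / (i <= j)%N >-> i <= j}.
Hypothesis t_in : forall j, inI (t j).

(** Discs decreasing in l, since larger positions mean smaller radii. The empty set beyond N makes
    the last layer [C m N] a full disc, matching the last cell, which extends up to top. *)
Let T m l : set (R * R) := if (l <= N)%N then inner_disc (rho m (t l)) else set0.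
Let C m l : set (R * R) := T m l `\` T m l.+1.

Let T_sub m l l' : (l <= l')%N -> T m l' `<=` T m l.
Proof.
move=> ll' x; rewrite /T; case: (leqP l' N) => // lN; rewrite (leq_trans ll' lN).
by apply: inner_disc_sub; apply: rho_mono => //; exact: t_mono.
Qed.

Let mT m l : measurable (T m l).
Proof. by rewrite /T; case: ifP => // _; exact: measurable_inner_disc. Qed.

Let T_layer m l x : T m 0 x -> ~ T m l x -> exists2 i, (i < l)%N & C m i x.
Proof.
move=> x0; elim: l => [//|l IH] xl.
have [xl'|nxl] := pselect (T m l x); first by exists l.
by have [i il Ci] := IH nxl; exists i => //; exact: ltnW.
Qed.

Let radius_counts m : set (Omega m.+1) :=
  [set w | forall l, (l <= N)%N -> #|[pred i | `[< C m l (X m.+1 i w) >]]| = k l].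

Let position_counts m : set (Omega m.+1) :=
  [set w | forall l, (l <= N)%N ->
    #|[pred i | `[< cell top t N l (position w i)%:E >]]| = k l].

Let radius_countsE m : @radius_counts m =
  cells_event (fun i w => X m.+1 i w) (C m) k (~` T m 0) N.+1 [set: 'I_m.+1]%SET (fun=> setT).
Proof.
apply/seteqP; split => w; rewrite /radius_counts /cells_event/=.
  move=> h; split => [i _|l lN|i]; last by rewrite inE.
    have [T0|] := pselect (T m 0 (X m.+1 i w)); last by right.
    left; have [|l lN Cl] := @T_layer m N.+1 _ T0; first by rewrite /T ltnn.
    by exists l.
  by rewrite -h//; apply: eq_card => i; rewrite !inE.
by move=> [_ h _] l lN; rewrite -h//; apply: eq_card => i; rewrite !inE.
Qed.

Let C_disjoint m l l' : l <> l' -> C m l `&` C m l' = set0.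
Proof.
move=> ll'; apply/seteqP; split => // x [[Tl nTl] [Tl' nTl']].
case: (ltngtP l l') ll' => // h _; first by apply: nTl; exact: (T_sub h) Tl'.
by apply: nTl'; exact: (T_sub h) Tl.
Qed.

Let mC m l : measurable (C m l).
Proof. exact: measurableD. Qed.

Let cells_probability m : nu < m.+1%:R -> measurable (@radius_counts m) /\
  P m.+1 (@radius_counts m) = (cells_pmf (fun l => fine (node_law m (C m l)))
    (fine (node_law m (~` T m 0))) k N.+1 m.+1)%:E.
Proof.
move=> nm; rewrite radius_countsE.
have CD l : C m l `&` ~` T m 0 = set0.
  by apply/seteqP; split => // x [[Tl _] nT0]; apply: nT0; exact: (T_sub (leq0n l)) Tl.
have [mE PE] := cells_eventP k (iid_node_law nm) (mC m) (measurableC (mT m 0)) (@C_disjoint m) CD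
  N.+1 [set: 'I_m.+1]%SET (B := fun=> setT) (fun=> measurableT).
split; first exact: mE.
rewrite PE cardsT card_ord big1 ?mulr1// => i; by rewrite !inE.
Qed.

Let law_T m l : nu < m.+1%:R -> (l <= N)%N -> 0 <= rho m (t l) <= Rad m ->
  fine (node_law m (T m l)) = radial_cdf alpha (Rad m) (rho m (t l)).
Proof. by move=> nm lN /andP[h1 h2]; rewrite /T lN; exact: (congr1 fine (node_law_inner_disc nm h1 h2)). Qed.

Let law_C m l : fine (node_law m (C m l)) = fine (node_law m (T m l)) - fine (node_law m (T m l.+1)).
Proof.
have -> : fine (node_law m (C m l)) = fine (node_law m (T m l) - node_law m (T m l.+1))%E.
  congr fine; rewrite /C measureD//; last by rewrite -ge0_fin_numE// fin_num_measure.
  by rewrite setIidr//; exact: T_sub.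
by rewrite fineB// fin_num_measure.
Qed.

Let radius_counts_cvg : fine (P m.+1 (@radius_counts m)) @[m --> \oo] -->
  \prod_(j < N.+1) poisson_weight (tail_increment G t N j)%:E (k j).
Proof.
have cvT l : (l <= N)%N -> m.+1%:R * fine (node_law m (T m l)) @[m --> \oo] --> G (t l).
  move=> lN; apply: cvg_trans (cdf_cvg (t_in l)); apply: near_eq_cvg.
  near=> m; rewrite law_T//; first by near: m; exact: near_nu.
  by near: m; exact: rho_range.
have cvC l : (l < N.+1)%N -> m.+1%:R * fine (node_law m (C m l)) @[m --> \oo] --> tail_increment G t N l.
  rewrite ltnS => lN; rewrite /tail_increment.
  rewrite (_ : (fun m => _) = (fun m => m.+1%:R * fine (node_law m (T m l)) -
      m.+1%:R * fine (node_law m (T m l.+1)))); last first.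
    by apply/funext => m; rewrite law_C mulrBr.
  apply: cvgB; first exact: cvT.
  case: ltnP => h; first exact: cvT.
  rewrite (_ : (fun m => _) = fun=> 0); first exact: cvg_cst.
  by apply/funext => m; rewrite /T ltnNge h/= measure0 mulr0.
have cv0 : m.+1%:R * (1 - fine (node_law m (~` T m 0))) @[m --> \oo] --> G (t 0).
  apply: cvg_trans (cvT 0 isT); apply: near_eq_cvg; apply: nearW => m.
  have -> : fine (node_law m (~` T m 0)) = 1 - fine (node_law m (T m 0)).
    have -> : fine (node_law m (~` T m 0)) = fine (1 - node_law m (T m 0))%E.
      by congr fine; rewrite probability_setC.
    by rewrite fineB// fin_num_measure.
  by rewrite opprB addrC subrK.
have le1 m : fine (node_law m (~` T m 0)) <= 1.
  rewrite -lee_fin fineK ?fin_num_measure//; last exact: measurableC.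
  by apply: probability_le1; exact: measurableC.
(* [cells_pmf_cvg] counts n points with rates in n; the match on n performs the shift n = m + 1. *)
have h := @cells_pmf_cvg R (fun n => if n is m.+1 then fun l => fine (node_law m (C m l)) else fun=> 0)
  (fun n => if n is m.+1 then fine (node_law m (~` T m 0)) else 0)
  (tail_increment G t N) (G (t 0)) k N.+1 0.
(* The exponents of the Poisson weights telescope to G (t 0). *)
rewrite (_ : \prod_(j < N.+1) _ = (\prod_(l < N.+1) (tail_increment G t N l ^+ k l / (k l)`!%:R)) * expR (- G (t 0))); last first.
  rewrite /poisson_weight big_split/=; congr (_ * _).
  rewrite -expR_sum sumrN; congr (expR (- _)).
  rewrite /tail_increment big_ord_recr/= ltnn subr0.
  rewrite (eq_bigr (fun i : 'I_N => - (G (t i.+1) - G (t i)))); last first.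
    by move=> i _; rewrite ltn_ord opprB.
  rewrite sumrN -(big_mkord xpredT (fun i => G (t i.+1) - G (t i))) telescope_sumr// opprB subrK//.
have {}h : cells_pmf (fun l => fine (node_law m (C m l))) (fine (node_law m (~` T m 0))) k N.+1 m.+1 @[m --> \oo]
    --> (\prod_(l < N.+1) (tail_increment G t N l ^+ k l / (k l)`!%:R)) * expR (- G (t 0)).
  have : (fun n => cells_pmf (match n with 0 => fun=> 0 | m.+1 => fun l => fine (node_law m (C m l)) end)
    (match n with 0 => 0 | m.+1 => fine (node_law m (~` T m 0)) end) k N.+1 (n - 0)) n @[n --> \oo] -->
    (\prod_(l < N.+1) (tail_increment G t N l ^+ k l / (k l)`!%:R)) * expR (- G (t 0)).
    apply: h.
    - by move=> l lN; rewrite -cvg_shiftS; exact: cvC.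
    - by apply: nearW => -[//|m]; exact: le1.
    - by rewrite -cvg_shiftS; exact: cv0.
  by rewrite -cvg_shiftS.
apply: cvg_trans h; apply: near_eq_cvg; near=> m.
have nm : nu < m.+1%:R by near: m; exact: near_nu.
by have [_ ->] := cells_probability nm.
Unshelve. all: by end_near. Qed.

(** Unless some node mismatches at some threshold, a node has its position in cell l exactly when it
    lies in layer l, and both count events coincide. *)
Lemma position_counts_cvg : fine (P m.+1 (@position_counts m)) @[m --> \oo] -->
  \prod_(j < N.+1) poisson_weight (tail_increment G t N j)%:E (k j).
Proof.
have mpc m : measurable (@position_counts m).
  exact: (@measurable_degree_event _ nu _ _ _ _ (X m.+1) (fun dg => forall l, (l <= N)%N ->
    #|[pred i | `[< cell top t N l (y m (dg i))%:E >]]| = k l)).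
apply/cvgrPdist_lt => e e0; have e2 : 0 < e / 2 by rewrite divr_gt0.
have /cvgrPdist_lt/(_ _ e2) h := radius_counts_cvg.
(* The union runs over (N + 1)(m + 1) pairs of a threshold and a node, each of probability at most
   e' / (m + 1): the total is e/4. *)
pose e' := e / 4 / N.+1%:R.
have e'0 : 0 < e' by rewrite !divr_gt0.
have mm : \forall m \near \oo, forall l : 'I_N.+1, forall i : 'I_m.+1,
    (P m.+1 (mismatch (t l) i) <= (e' / m.+1%:R)%:E)%E.
  apply: filter_forall => l; exact: mismatch_vanishes.
near=> m; have nm : nu < m.+1%:R by near: m; exact: near_nu.
have [mr _] := cells_probability nm.
have mmm : forall l : 'I_N.+1, forall i : 'I_m.+1, (P m.+1 (mismatch (t l) i) <= (e' / m.+1%:R)%:E)%E by near: m.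
have mE (p : 'I_N.+1 * 'I_m.+1) : measurable (@mismatch m (t p.1) p.2) by exact: measurable_mismatch.
have PE := @probability_exists_le _ _ _ (P m.+1) _ (fun p : 'I_N.+1 * 'I_m.+1 => @mismatch m (t p.1) p.2)
  (fun=> e' / m.+1%:R) mE (fun p => mmm p.1 p.2).
have SE : \sum_(p : 'I_N.+1 * 'I_m.+1) (e' / m.+1%:R) = e / 4.
  transitivity (\sum_(l < N.+1) \sum_(i < m.+1) (e' / m.+1%:R)); first by rewrite pair_bigA.
  rewrite !sumr_const !card_ord -[X in X *+ _]mulr_natr -[LHS]mulr_natr.
  by rewrite divfK ?pnatr_eq0// /e' divfK ?pnatr_eq0.
rewrite SE in PE.
have mEx : measurable [set w | exists p : 'I_N.+1 * 'I_m.+1, @mismatch m (t p.1) p.2 w].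
  rewrite (_ : [set w | _] = \bigcup_(p in [set: 'I_N.+1 * 'I_m.+1]) @mismatch m (t p.1) p.2).
    by apply: fin_bigcup_measurable => [|p _]; [exact: finite_finset|exact: mE].
  apply/seteqP; split => w /=; first by move=> [p mp]; exists p.
  by move=> [p _ mp]; exists p.
have close : `|fine (P m.+1 (@position_counts m)) - fine (P m.+1 (@radius_counts m))| <= e / 4.
  apply: probability_close (mpc m) mr mEx PE _ => w nex.
  have match_ l i : (l <= N)%N -> (t l <= position w i) <-> inner_disc (rho m (t l)) (X m.+1 i w).
    move=> lN; apply: contrapT => mis; apply: nex; exists (Ordinal (lN : (l < N.+1)%N), i).
    exact: mis.
  have cellC l i : (l <= N)%N -> cell top t N l (position w i)%:E <-> C m l (X m.+1 i w).
    move=> lN; rewrite /cell/= lee_fin lte_fin /C /T lN /setD/=.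
    have -> : ((position w i)%:E <= top)%E by apply: y_top; exact: degree_le.
    rewrite andbT; have hl := match_ l i lN; split.
      move=> [tl yl]; split; first exact/hl.
      case: (ltnP l N) => [lN' hin|_ []]; have := (match_ l.+1 i lN').2 hin.
      by rewrite leNgt yl.
    move=> [Tl nT]; split; first exact/hl.
    move=> lN'; rewrite ltNge; apply/negP => hin; apply: nT; rewrite lN'.
    exact: (match_ l.+1 i lN').1 hin.
  have cE l : (l <= N)%N -> #|[pred i | `[< cell top t N l (position w i)%:E >]]| =
      #|[pred i | `[< C m l (X m.+1 i w) >]]|.
    by move=> lN; apply: eq_card => i; rewrite !inE; apply: asbool_equiv_eq; exact: cellC.
  by split => hw l lN; move: (hw l lN); rewrite cE.
have hm : `|\prod_(j < N.+1) poisson_weight (tail_increment G t N j)%:E (k j)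
   - fine (P m.+1 (@radius_counts m))| < e / 2 by near: m.
rewrite distrC; apply: (@le_lt_trans _ _ (`|fine (P m.+1 (@position_counts m)) - fine (P m.+1 (@radius_counts m))|
  + `|fine (P m.+1 (@radius_counts m)) - \prod_(j < N.+1) poisson_weight (tail_increment G t N j)%:E (k j)|)).
  exact: ler_distD.
by rewrite [X in _ + X]distrC; lra.
Unshelve. all: by end_near. Qed.
End cells.

(** The case N = 0 with a zero count in the single cell [a, top]. *)
Lemma no_point_above_cvg a : inI a ->
  fine (P m.+1 [set w | forall i, position w i < a]) @[m --> \oo] --> expR (- G a).
Proof.
move=> ia; have h := @position_counts_cvg (fun=> a) 0 (fun=> 0) (fun _ _ _ => lexx _) (fun=> ia).
rewrite big_ord_recr big_ord0/= mul1r /tail_increment/= subr0 expr0 divr1 mul1r in h.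
apply: cvg_trans h; apply: near_eq_cvg; apply: nearW => m; congr (fine (P m.+1 _)).
apply/seteqP; split => w /=.
  move=> /(_ 0 isT) /card0_eq hw i; rewrite ltNge; apply/negP => ai.
  have := hw i; rewrite !inE => /negbT/asboolPn; apply; rewrite /cell/= lee_fin ai.
  by rewrite y_top ?degree_le.
move=> hw l; rewrite leqn0 => /eqP->; apply: eq_card0 => i; rewrite !inE.
by apply/negbTE/asboolPn; rewrite /cell/= lee_fin leNgt hw => -[].
Qed.

Lemma max_position_cvg a : inI a -> (forall m, {homo y m : k l / (k <= l)%N >-> k <= l}) ->
  fine (P m.+1 [set w | a <= y m (rhg_max_degree nu (fun j => X m.+1 j w))]) @[m --> \oo]
    --> 1 - expR (- G a).
Proof.
move=> ia ymono.
have h : 1 - fine (P m.+1 [set w | forall i, position w i < a]) @[m --> \oo] --> 1 - expR (- G a).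
  by apply: cvgB; [exact: cvg_cst|exact: no_point_above_cvg].
apply: cvg_trans h; apply: near_eq_cvg; apply: nearW => m.
have mS : measurable [set w : Omega m.+1 | forall i, position w i < a].
  exact: (@measurable_degree_event _ nu _ _ _ _ (X m.+1) (fun dg => forall i, y m (dg i) < a)).
rewrite (_ : [set w | a <= _] = ~` [set w : Omega m.+1 | forall i, position w i < a]).
  by rewrite probability_setC// -[P m.+1 _ in RHS]fineK ?fin_num_measure.
apply/seteqP; split => w /=.
  move=> aD h; have c0 : (0 < #|'I_m.+1|)%N by rewrite card_ord.
  have [i _ iE] := @bigop.eq_bigmax_cond _ 'I_m.+1 (rhg_degree nu (fun j => X m.+1 j w)) c0.
  by have := h i; rewrite /position -iE ltNge aD.
move=> h; rewrite leNgt; apply/negP => Da; apply: h => i; apply: le_lt_trans Da.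
by apply: ymono; exact: leq_bigmax.
Qed.

End assembly.

Section empirical_convergence.
Context {R : realType}.
Variables (nu : R).
Unset Implicit Arguments.
Variables (d : nat -> measure_display) (Omega : forall n, measurableType (d n))
  (P : forall n, probability (Omega n) R) (X : forall n, 'I_n -> {RV (P n) >-> (R * R)%type})
  (d' : measure_display) (Omega' : measurableType d') (Q : probability Omega' R)
  (c top : \bar R) (phi : nat -> nat -> R) (g G : R -> R).
Set Implicit Arguments.
Let E : set \bar R := [set x | (c < x <= top)%E].
Notation inI a := (c < a%:E < top)%E.
Let tail (a : R) : set R := [set y | a <= y /\ (y%:E <= top)%E].

Lemma empirical_cvg (eta : Omega' -> Mp E) : (c < top)%E ->
  (forall a, inI a -> measurable_fun (tail a) g) ->
  (forall a z, inI a -> tail a z -> 0 <= g z) ->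
  (forall a, inI a -> (\int[lebesgue_measure]_(z in tail a) (g z)%:E = (G a)%:E)%E) ->
  (forall t N k, {homo t : i j / (i <= j)%N >-> i <= j} -> (forall j, inI (t j)) ->
    fine (P m.+1 [set w | forall l, (l <= N)%N ->
      #|[pred i | `[< cell top t N l (phi m.+1 (rhg_degree nu (fun j => X m.+1 j w) i))%:E >]]| = k l])
      @[m --> \oo] --> \prod_(j < N.+1) poisson_weight (tail_increment G t N j)%:E (k j)) ->
  poisson_process Q (density_measure E g) eta ->
  cvg_in_distribution P (fun n w => empirical E (fun i =>
    (phi n (rhg_degree nu (fun j => X n j w) i))%:E)) Q eta.
Proof.
move=> ct mg g0 gG counts poi.
apply: (poisson_criterion (lambda := density_measure E g) (G := G)) => //.
- move=> n U; exact: (@measurable_degree_event _ nu _ _ _ _ (X n)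
    (fun dg => U (empirical E (fun i => (phi n (dg i))%:E)))).
- by move=> t N tmono tin j jN; apply: density_tail_increment.
- by move=> t N tmono tin k; rewrite -cvg_shiftS; exact: counts.
Qed.

End empirical_convergence.

Lemma tight_of_continuous (R : realType) (I : R -> Prop) (G : R -> R) a e :
  (\forall z \near a, I z) -> {for a, continuous G} -> 0 < e ->
  exists a1 a2, [/\ I a1, I a2, a1 < a, a < a2 & G a1 - G a2 < e].
Proof.
move=> nI cG e0; have e2 : 0 < e / 2 by rewrite divr_gt0.
have /cvgrPdist_lt/(_ _ e2) nG := cG.
have [r /= r0 hr] := filterI nI nG.
have rr : r / 2 < r by lra.
have h1 : ball a r (a - r / 2) by rewrite /ball/= opprB addrC subrK ger0_norm ?divr_ge0// ltW.
have h2 : ball a r (a + r / 2) by rewrite /ball/= opprD addrA subrr sub0r normrN ger0_norm ?divr_ge0// ltW.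
have [I1 G1] := hr _ h1; have [I2 G2] := hr _ h2.
exists (a - r / 2), (a + r / 2); split => //; [lra|lra|].
by move: G1 G2; rewrite !ltr_norml => /andP[? ?] /andP[? ?]; lra.
Qed.

Section degree_as_sum.
Context {R : realType}.

Lemma degree_sum (nu : R) m (x : 'I_m.+1 -> R * R) i :
  (rhg_degree nu x i)%:R = \sum_(j < m)
    \1_[set p : (R * R) * (R * R) | disc_dist p.1 p.2 <= rhg_radius nu m.+1] (x i, x (lift i j)) :> R.
Proof.
rewrite /rhg_degree -sum1_card natr_sum big_mkcond/= (bigD1_ord i)//= !inE /rhg_edge eqxx/= add0r.
apply: eq_bigr => j _; rewrite !inE indicE neq_lift/=.
by case: (boolP (disc_dist _ _ <= _)) => h; [rewrite mem_set|rewrite memNset//; exact/negP].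
Qed.

Lemma nondegree_sum (nu : R) m (x : 'I_m.+1 -> R * R) i :
  \sum_(j < m) \1_(~` [set p : (R * R) * (R * R) | disc_dist p.1 p.2 <= rhg_radius nu m.+1])
    (x i, x (lift i j)) = m%:R - (rhg_degree nu x i)%:R :> R.
Proof.
rewrite degree_sum; apply/eqP; rewrite eq_sym subr_eq -big_split/=; apply/eqP.
rewrite (eq_bigr (fun=> 1)) ?sumr_const ?card_ord// => j _.
by rewrite !indicE in_setC; case: (_ \in _); rewrite ?add0r ?addr0.
Qed.

Lemma node_law_section (alpha nu : R) (d : nat -> measure_display) (Omega : forall n, measurableType (d n))
  (P : forall n, probability (Omega n) R) (X : forall n, 'I_n -> {RV (P n) >-> (R * R)%type})
  m r t : 0 < alpha -> 0 < nu ->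
  (forall n, nu < n%:R -> iid_of_law (P n) (fun i w => X n i w) (rhg_law alpha nu n)) ->
  nu < m.+1%:R -> 0 <= r -> r <= rhg_radius nu m.+1 -> 0 <= t <= 2 * pi ->
  let A := [set p : (R * R) * (R * R) | disc_dist p.1 p.2 <= rhg_radius nu m.+1] in
  fine (node_law X m (xsection A (polar_point (r, t)))) = adjacency_prob alpha (rhg_radius nu m.+1) r
  /\ fine (node_law X m (xsection (~` A) (polar_point (r, t)))) = 1 - adjacency_prob alpha (rhg_radius nu m.+1) r.
Proof.
move=> a0 n0 iid nm r0 rR t0 A.
have mA : measurable A by exact: measurable_close_pairs.
have E1 : fine (node_law X m (xsection A (polar_point (r, t)))) = adjacency_prob alpha (rhg_radius nu m.+1) r.
  rewrite -[RHS]/(fine (adjacency_prob alpha (rhg_radius nu m.+1) r)%:E) -(rhg_law_ball _ r0 rR t0); congr fine.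
  etransitivity; first by apply: (node_lawE iid nm); exact: measurable_xsection.
  by congr (rhg_law _ _ _ _); apply/seteqP; split => z; rewrite /xsection/= inE.
split => //; rewrite -E1.
have -> : xsection (~` A) (polar_point (r, t)) = ~` xsection A (polar_point (r, t)).
  by apply/seteqP; split => z; rewrite /xsection/= !inE.
have mS : measurable (xsection A (polar_point (r, t))) by exact: measurable_xsection.
have -> : fine (node_law X m (~` xsection A (polar_point (r, t)))) =
    fine (1 - node_law X m (xsection A (polar_point (r, t))))%E.
  by congr fine; rewrite probability_setC.
by rewrite fineB// fin_num_measure.
Qed.

Section node_sections.
Variables (alpha nu : R).
Unset Implicit Arguments.
Variables (d : nat -> measure_display) (Omega : forall n, measurableType (d n))
  (P : forall n, probability (Omega n) R) (X : forall n, 'I_n -> {RV (P n) >-> (R * R)%type}).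
Set Implicit Arguments.
Hypotheses (alpha_gt0 : 0 < alpha) (nu_gt0 : 0 < nu)
  (X_iid : forall n, nu < n%:R -> iid_of_law (P n) (fun i w => X n i w) (rhg_law alpha nu n)).

(** Every point of the disc has polar coordinates, and the adjacency probability decreases with the
    radius; its value at s separates the inside from the outside. *)
Lemma adjacency_section_bounds m s : nu < m.+1%:R -> 0 <= s -> s <= rhg_radius nu m.+1 ->
  let A := [set p : (R * R) * (R * R) | disc_dist p.1 p.2 <= rhg_radius nu m.+1] in
  let p x := fine (node_law X m (xsection A x)) in
  let q x := fine (node_law X m (xsection (~` A) x)) in
  let p0 := adjacency_prob alpha (rhg_radius nu m.+1) s in
  [/\ forall x, (inner_disc (rhg_radius nu m.+1) `\` inner_disc s) x -> p x <= p0 /\ 1 - p0 <= q x &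
    forall x, inner_disc s x -> p0 <= p x /\ q x <= 1 - p0].
Proof.
move=> nm s0 sR A p q p0; split => x.
  move=> [[x1 xR] nxs]; have [r [t [r0 t0 xE]]] := polar_point_surj x1.
  move: xR nxs; rewrite /inner_disc/= xE disc_dist_origin// => rR nrs.
  have sr : s <= r.
    by rewrite leNgt; apply/negP => h; apply: nrs; split; [exact: polar_point_in_disc|exact: ltW].
  have [h1 h2] := node_law_section alpha_gt0 nu_gt0 X_iid nm r0 rR t0.
  have hp : p (polar_point (r, t)) = adjacency_prob alpha (rhg_radius nu m.+1) r := h1.
  have hq : q (polar_point (r, t)) = 1 - adjacency_prob alpha (rhg_radius nu m.+1) r := h2.
  have hle := adjacency_prob_le alpha_gt0 s0 sr rR.
  by rewrite hp hq; split; [exact: hle|rewrite lerD2l lerN2; exact: hle].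
move=> [x1 xs]; have [r [t [r0 t0 xE]]] := polar_point_surj x1.
move: xs; rewrite xE disc_dist_origin// => rs.
have [h1 h2] := node_law_section alpha_gt0 nu_gt0 X_iid nm r0 (le_trans rs sR) t0.
have hp : p (polar_point (r, t)) = adjacency_prob alpha (rhg_radius nu m.+1) r := h1.
have hq : q (polar_point (r, t)) = 1 - adjacency_prob alpha (rhg_radius nu m.+1) r := h2.
have hle := adjacency_prob_le alpha_gt0 r0 rs sR.
by rewrite hp hq; split; [exact: hle|rewrite lerD2l lerN2; exact: hle].
Qed.

End node_sections.

End degree_as_sum.

(** * The three regimes *)

Section degree_process.
Context {R : realType}.
Variables (alpha nu : R).
Hypotheses (alpha_gt0 : 0 < alpha) (nu_gt0 : 0 < nu).
Unset Implicit Arguments.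
Variables (d : nat -> measure_display) (Omega : forall n, measurableType (d n))
  (P : forall n, probability (Omega n) R) (X : forall n, 'I_n -> {RV (P n) >-> (R * R)%type}).
Set Implicit Arguments.
Hypothesis X_iid : forall n, nu < n%:R -> iid_of_law (P n) (fun i w => X n i w) (rhg_law alpha nu n).
Notation Rad m := (rhg_radius nu m.+1).
Notation adj m r := (adjacency_prob alpha (Rad m) r).

(** With [co] the counted relation is non-adjacency, of which a node of degree k has m - k instances
    among the m other nodes; the sign [sg] reverses the order accordingly. [phiE] translates a level
    a for the rescaled degree into a level for this count. *)
Variables (co : bool) (phi : nat -> nat -> R) (s : R^nat) (tau rho : nat -> R -> R)
  (g G : R -> R) (c top : \bar R).
Notation sg := (if co then -1 else 1 : R).
Notation inI a := (c < a%:E < top)%E.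
Hypothesis s_gt0 : forall m, 0 < s m.
Hypothesis s_growth : forall k, 0 < k -> m.+1%:R * expR (- (k * s m)) @[m --> \oo] --> (0 : R).
Hypothesis phiE : forall m a k, inI a -> (a <= phi m.+1 k) =
  (sg * (s m * tau m a) <= sg * (if co then m%:R - k%:R else k%:R)).
Hypothesis tau_cvg : forall a, inI a -> tau m a @[m --> \oo] --> sg * a.
Hypothesis sga_ge0 : forall a, inI a -> 0 <= sg * a.
Hypothesis rho_mono : forall m a b, inI a -> inI b -> a <= b -> rho m b <= rho m a.
Hypothesis rho_range : forall a, inI a -> \forall m \near \oo, 0 <= rho m a <= Rad m.
Hypothesis cdf_cvg : forall a, inI a ->
  m.+1%:R * radial_cdf alpha (Rad m) (rho m a) @[m --> \oo] --> G a.
Hypothesis adj_cvg : forall a, inI a ->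
  m%:R * (if co then 1 - adj m (rho m a) else adj m (rho m a)) / s m @[m --> \oo] --> sg * a.
Hypothesis G_cont : forall a, inI a -> {for a, continuous G}.
Hypothesis phi_top : forall m k, (k <= m)%N -> ((phi m.+1 k)%:E <= top)%E.
Hypothesis phi_mono : forall m, {homo phi m.+1 : k l / (k <= l)%N >-> k <= l}.
Let tail (a : R) : set R := [set y | a <= y /\ (y%:E <= top)%E].
Hypothesis ctop : (c < top)%E.
Hypothesis mg : forall a, inI a -> measurable_fun (tail a) g.
Hypothesis g_ge0 : forall a z, inI a -> tail a z -> 0 <= g z.
Hypothesis gG : forall a, inI a ->
  (\int[lebesgue_measure]_(z in tail a) (g z)%:E = (G a)%:E)%E.

Let close m : set ((R * R) * (R * R)) := [set p | disc_dist p.1 p.2 <= Rad m].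
Let A m := if co then ~` close m else close m.

Let mA m : measurable (A m).
Proof.
have mc : measurable (close m) by exact: measurable_close_pairs.
by rewrite /A; case: co => //; exact: measurableC.
Qed.

Let sg1 : sg = 1 \/ sg = -1.
Proof. by case: co; [right|left]. Qed.

Let y m := phi m.+1.

Let yE m a i w : inI a -> (a <= position nu X y w i) =
  (sg * (s m * tau m a) <= sg * \sum_(j < m) \1_(A m) (X m.+1 i w, X m.+1 (lift i j) w)).
Proof.
move=> ia; rewrite /position /y phiE//; congr (_ <= sg * _).
rewrite /A /close; case: co; first exact: esym (nondegree_sum nu (fun j => X m.+1 j w) i).
exact: (degree_sum nu (fun j => X m.+1 j w) i).
Qed.

Let bounds a : inI a -> \forall m \near \oo,
  (forall x, (inner_disc (Rad m) `\` inner_disc (rho m a)) x ->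
    sg * fine (node_law X m (xsection (A m) x)) <= sg * (if co then 1 - adj m (rho m a) else adj m (rho m a))) /\
  (forall x, inner_disc (rho m a) x ->
    sg * (if co then 1 - adj m (rho m a) else adj m (rho m a)) <= sg * fine (node_law X m (xsection (A m) x))).
Proof.
move=> ia; near=> m.
have nm : nu < m.+1%:R by near: m; exact: near_nu.
have /andP[r0 rR] : 0 <= rho m a <= Rad m by near: m; exact: rho_range.
have [h1 h2] := adjacency_section_bounds alpha_gt0 nu_gt0 X_iid nm r0 rR.
rewrite /A /close; split => x hx.
  have [k1 k2] := h1 x hx.
  by case: co; [rewrite !mulN1r lerN2; exact: k2|rewrite !mul1r; exact: k1].
have [k1 k2] := h2 x hx.
by case: co; [rewrite !mulN1r lerN2; exact: k2|rewrite !mul1r; exact: k1].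
Unshelve. all: by end_near. Qed.

Let near_in a : inI a -> \forall z \near a, inI z.
Proof.
move=> /andP[ca at_]; near=> z; apply/andP; split; near: z.
  case: (c) ca => [r||]//; last by move=> _; apply: nearW => z; exact: ltNyr.
  by rewrite lte_fin => ra; near do rewrite lte_fin; exact: lt_nbhsr.
case: (top) at_ => [r||]//; last by move=> _; apply: nearW => z; exact: ltry.
by rewrite lte_fin => ra; near do rewrite lte_fin; exact: lt_nbhsl.
Unshelve. all: by end_near. Qed.

Let G_tight a e : inI a -> 0 < e ->
  exists a1 a2, [/\ inI a1, inI a2, a1 < a, a < a2 & G a1 - G a2 < e].
Proof. by move=> ia; apply: tight_of_continuous; [exact: near_in|exact: G_cont]. Qed.

Let q_out a (ia : inI a) := filterS (fun m h => @proj1 _ _ h) (bounds ia).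
Let q_in a (ia : inI a) := filterS (fun m h => @proj2 _ _ h) (bounds ia).

Lemma degree_process_cvg : (forall E, E = [set x | (c < x <= top)%E] ->
    forall d' (Omega' : measurableType d') (Q : probability Omega' R) (eta : Omega' -> Mp E),
    poisson_process Q (density_measure E g) eta ->
    cvg_in_distribution P (fun n w => empirical E (fun i =>
      (phi n (rhg_degree nu (fun j => X n j w) i))%:E)) Q eta) /\
  (forall a, inI a ->
    fine (P m.+1 [set w | a <= phi m.+1 (rhg_max_degree nu (fun j => X m.+1 j w))]) @[m --> \oo]
      --> 1 - expR (- G a)).
Proof.
split => [_ -> d' Omega' Q eta poi|a ia].
  apply: (empirical_cvg (G := G) ctop mg g_ge0 gG _ poi) => t N k tmono tin.
  exact: (position_counts_cvg alpha_gt0 nu_gt0 X_iid sg1 mA s_gt0 s_growth yE tau_cvg sga_ge0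
    rho_mono rho_range cdf_cvg adj_cvg q_out q_in G_tight phi_top tmono tin).
exact: (max_position_cvg alpha_gt0 nu_gt0 X_iid sg1 mA s_gt0 s_growth yE tau_cvg sga_ge0
    rho_mono rho_range cdf_cvg adj_cvg q_out q_in G_tight phi_top ia phi_mono).
Qed.

End degree_process.

(** * Powers of n and the expected number of nodes near the origin *)

Section growth.
Context {R : realType}.
Implicit Types (a k nu alpha x : R).

Lemma powR_expR x k : 0 < x -> x `^ k = expR (k * ln x).
Proof. by move=> x0; rewrite /powR gt_eqF. Qed.

Lemma cvg_lnSn : ln (m.+1%:R : R) @[m --> \oo] --> +oo.
Proof.
apply/cvgryPge => A; near=> m.
rewrite -ler_expR lnK ?posrE// (@le_trans _ _ m%:R) ?ler_nat//.
by near: m; exact: nbhs_infty_ger.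
Unshelve. all: by end_near. Qed.

Lemma cvg_affine_lnSn k a : 0 < k -> k * ln (m.+1%:R : R) + a @[m --> \oo] --> +oo.
Proof.
move=> k0; apply/cvgryPgt => A; near=> m.
have h : (A - a) / k < ln m.+1%:R by near: m; apply: near_gty; exact: cvg_lnSn.
by move: h; rewrite ltr_pdivrMr// mulrC => h; lra.
Unshelve. all: by end_near. Qed.

Lemma cvg_power_oo k : 0 < k -> (m.+1%:R : R) `^ (- k) @[m --> \oo] --> (0 : R).
Proof.
move=> k0; apply: (cvg_trans _ (cvg_expRNy (cvg_affine_lnSn 0 k0))).
by apply: near_eq_cvg; apply: nearW => m; rewrite powR_expR// addr0 mulNr.
Qed.

Lemma cvg_ratio_succ : (m%:R / m.+1%:R : R) @[m --> \oo] --> (1 : R).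
Proof.
have h : 1 - (m.+1%:R : R)^-1 @[m --> \oo] --> (1 - 0 : R) by apply: cvgB; [exact: cvg_cst|exact: cvg_harmonic].
rewrite subr0 in h; apply: (cvg_trans _ h); apply: near_eq_cvg; apply: nearW => m.
by rewrite -[in RHS]natr1; field; rewrite natr1 pnatr_eq0.
Qed.

Lemma rhg_radiusE nu m : 0 < nu -> rhg_radius nu m.+1 = 2 * ln m.+1%:R + - (2 * ln nu).
Proof. by move=> n0; rewrite /rhg_radius ln_div ?posrE// mulrBr. Qed.

Lemma cvg_rhg_radius nu : 0 < nu -> rhg_radius nu m.+1 @[m --> \oo] --> +oo.
Proof.
move=> n0; have h := cvg_affine_lnSn (- (2 * ln nu)) (ltr0n R 2).
apply: (cvg_trans _ h); apply: near_eq_cvg; apply: nearW => m; by rewrite rhg_radiusE.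
Qed.

Lemma cvg_expR_sinh (u : R^nat) : u n @[n --> \oo] --> +oo ->
  expR (u n) / sinh (u n) @[n --> \oo] --> (2 : R).
Proof.
move=> uy.
have u2 : 2 * u n @[n --> \oo] --> +oo.
  apply/cvgryPgt => A; near=> n; have h : A / 2 < u n by near: n; exact: near_gty.
  by lra.
have h : 2 / (1 - expR (- (2 * u n))) @[n --> \oo] --> 2 / (1 - 0 : R).
  apply: cvgM; first exact: cvg_cst.
  apply: cvgV; first by rewrite subr0 oner_eq0.
  by apply: cvgB; [exact: cvg_cst|exact: cvg_expRNy].
rewrite subr0 divr1 in h; apply: (cvg_trans _ h); apply: near_eq_cvg; near=> n.
have u0 : 0 < u n by near: n; exact: near_gty.
have e1 : 1 < expR (u n) by rewrite expR_gt1.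
rewrite /sinh (_ : - (2 * u n) = - u n - u n); last by lra.
rewrite expRD expRN; move: (expR _) e1 => e e1.
have e2 : e ^+ 2 - 1 != 0 by rewrite gt_eqF//; nra.
field; rewrite e2 gt_eqF ?andbT//; last by lra.
Unshelve. all: by end_near. Qed.

Lemma cvg_sinh_ratio (u : R^nat) : (forall n, 0 < u n) -> u n @[n --> \oo] --> (0 : R) ->
  sinh (u n) / u n @[n --> \oo] --> (1 : R).
Proof.
move=> u0 uc.
have e1 : expR (u n) @[n --> \oo] --> (1 : R).
  by rewrite -expR0; apply: continuous_cvg => //; exact: continuous_expR.
have e2 : expR (- u n) @[n --> \oo] --> (1 : R).
  rewrite -expR0; apply: (@continuous_cvg _ _ _ _ _ (fun n => - u n) expR); first exact: continuous_expR.
  by rewrite -oppr0; exact: cvgN.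
apply: (squeeze_cvgr _ e2 e1); apply: nearW => n.
rewrite ler_pdivlMr// ler_pdivrMr//.
have h1 := expR_ge1Dx (2 * u n); have h2 := expR_ge1Dx (- (2 * u n)).
move: h1 h2; rewrite -mulrN (_ : 2 * u n = u n + u n); last by lra.
rewrite (_ : 2 * - u n = - u n - u n); last by lra.
rewrite !expRD /sinh expRN; have := u0 n; have := expR_gt0 (u n); move: (u n) (expR _) => v e e0 v0 h1 h2.
have ev : e * e^-1 = 1 by rewrite divff// gt_eqF.
have i0 : 0 < e^-1 by rewrite invr_gt0.
move: e^-1 ev i0 h1 h2 => f ev f0 h1 h2.
have k1 : 0 <= f * (e * e - (1 + (v + v))) by rewrite mulr_ge0 ?subr_ge0 ?(ltW f0).
have k2 : 0 <= e * (f * f - (1 + (- v - v))) by rewrite mulr_ge0 ?subr_ge0 ?(ltW e0).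
have j1 : f * (e * e) = e by rewrite mulrA (mulrC f) ev mul1r.
have j2 : e * (f * f) = f by rewrite mulrA ev mul1r.
by rewrite mulrBr j1 in k1; rewrite mulrBr j2 in k2; apply/andP; split; lra.
Qed.

(** n F(r) is the square of sqrt(n) sinh(alpha r / 2) / sinh(alpha Rn / 2). As e^(alpha Rn / 2) = (n
    / nu)^alpha, the denominator is asymptotic to (n / nu)^alpha / 2, whence the power n^(1/2 -
    alpha) and the factor 2 nu^alpha. *)
Lemma cvg_radial_cdf_scaled alpha nu (r : R^nat) (l : R) : 0 < alpha -> 0 < nu ->
  sinh (alpha * r m / 2) * m.+1%:R `^ (2^-1 - alpha) @[m --> \oo] --> l ->
  m.+1%:R * radial_cdf alpha (rhg_radius nu m.+1) (r m) @[m --> \oo] --> (2 * nu `^ alpha * l) ^+ 2.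
Proof.
move=> a0 n0 hl.
have ay : alpha * rhg_radius nu m.+1 / 2 @[m --> \oo] --> +oo.
  have h := cvg_affine_lnSn (- (alpha * ln nu)) a0.
  apply: (cvg_trans _ h); apply: near_eq_cvg; apply: nearW => m; rewrite rhg_radiusE//; lra.
have h : expR (alpha * rhg_radius nu m.+1 / 2) / sinh (alpha * rhg_radius nu m.+1 / 2) * nu `^ alpha *
    (sinh (alpha * r m / 2) * m.+1%:R `^ (2^-1 - alpha)) @[m --> \oo] --> 2 * nu `^ alpha * l.
  by apply: cvgM => //; apply: cvgM; [exact: cvg_expR_sinh|exact: cvg_cst].
have h2 := cvgM h h; rewrite expr2.
apply: (cvg_trans _ (h2 _)); apply: near_eq_cvg; apply: nearW => m.
rewrite radial_cdfE /=.
set e := expR _; set S := sinh _; set S' := sinh _.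
have key : (e * nu `^ alpha * m.+1%:R `^ (2^-1 - alpha)) ^+ 2 = m.+1%:R.
  rewrite /e !powR_expR// rhg_radiusE// -!expRD expr2 -expRD -[RHS](@lnK R) ?posrE//.
  by congr expR; lra.
move: key; set p := _ `^ (2^-1 - alpha) => key; rewrite -[in RHS]key !expr2; ring.
Unshelve. all: by end_near. Qed.

End growth.

(** * The three intensities and their primitives *)

Section tails.
Context {R : realType}.
Notation mu := (@lebesgue_measure R).
Variables (alpha nu : R).
Hypotheses (alpha_gt0 : 0 < alpha) (nu_gt0 : 0 < nu).

(** The masses of [a, top] under the intensities [rhg_g1], [rhg_g2], [rhg_g3]; they are also the
    limits of the expected numbers of nodes below the threshold radius. *)
Definition tail1 (a : R) : R := (pi * nu `^ alpha * a) ^+ 2.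
Definition tail2 (a : R) : R := 2 * nu * (cosh (V_half_inv a / 2) - 1).
Definition tail3 (a : R) : R := (rhg_C alpha * nu / a) `^ (2 * alpha).

Lemma continuous_g1 : continuous (rhg_g1 alpha nu).
Proof.
by move=> x; apply: cvgMl_tmp; exact: (@norm_continuous _ R^o x).
Qed.

Lemma integral_g1 a : a < 0 -> (\int[mu]_(z in `[a, 0%R]) (rhg_g1 alpha nu z)%:E = (tail1 a)%:E)%E.
Proof.
move=> a0.
pose K := 2 * pi ^+ 2 * nu `^ (2 * alpha).
pose F (z : R) : R := - (K / 2) * (z * z).
have dF (z : R) : is_derive z 1 F (- K * z).
  have d2 := is_deriveZ (- (K / 2)) (is_deriveM (is_derive_id z 1) (is_derive_id z 1)).
  apply: (is_derive_eq d2); rewrite /GRing.scale/=; lra.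
have cF : continuous F by move=> z; apply: differentiable_continuous; apply/derivable1_diffP; have [] := dF z.
rewrite (@continuous_FTC2 _ (rhg_g1 alpha nu) F _ _ a0).
- rewrite -EFinB; congr EFin; rewrite /F /tail1 mul0r mulr0 /K sub0r.
  have -> : nu `^ (2 * alpha) = (nu `^ alpha) ^+ 2.
    by rewrite !powR_expR// expr2 -expRD; congr expR; lra.
  by rewrite !exprMn; field.
- by apply: continuous_subspaceT; exact: continuous_g1.
- split; first by move=> z _; have [] := dF z.
    by apply: cvg_at_right_filter; exact: cF.
  by apply: cvg_at_left_filter; exact: cF.
- move=> z; rewrite in_itv/= => /andP[_ z0]; rewrite derive1E; have [_ ->] := dF z.
  by rewrite /rhg_g1 ltr0_norm// mulrN mulNr.
Qed.

Lemma rhg_C_gt0 : 2^-1 < alpha -> 0 < rhg_C alpha.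
Proof. by move=> h; rewrite divr_gt0 ?mulr_gt0 ?pi_gt0//; lra. Qed.

Lemma continuous_powR (k x : R) : 0 < x -> {for x, continuous (fun z : R => z `^ k)}.
Proof.
move=> x0; apply: differentiable_continuous; apply/derivable1_diffP.
by have [] := is_derive1_powR k x0.
Qed.

Lemma continuous_g3 x : 0 < x -> {for x, continuous (rhg_g3 alpha nu)}.
Proof. by move=> x0; apply: cvgMl_tmp; exact: continuous_powR. Qed.

Lemma rhg_g3_ge0 x : 0 <= rhg_g3 alpha nu x.
Proof. by rewrite !mulr_ge0 ?powR_ge0// ltW. Qed.

Lemma tail3E a : 2^-1 < alpha -> 0 < a ->
  tail3 a = (rhg_C alpha * nu) `^ (2 * alpha) * a `^ (- (2 * alpha)).
Proof.
move=> h a0; have C0 := rhg_C_gt0 h.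
have K0 : 0 < rhg_C alpha * nu by exact: mulr_gt0.
have Ka0 : 0 < rhg_C alpha * nu / a by exact: divr_gt0.
rewrite /tail3 (powR_expR _ Ka0) (powR_expR _ K0) (powR_expR _ a0) ln_div ?posrE// -expRD.
by congr expR; lra.
Qed.

Lemma integral_g3 a : 2^-1 < alpha -> 0 < a ->
  (\int[mu]_(z in `[a, +oo[) (rhg_g3 alpha nu z)%:E = (tail3 a)%:E)%E.
Proof.
move=> ha a0; pose K := (rhg_C alpha * nu) `^ (2 * alpha).
pose F (z : R) : R := - K * z `^ (- (2 * alpha)).
have dF (z : R) : 0 < z -> is_derive z 1 F (rhg_g3 alpha nu z).
  move=> z0; have d2 := is_deriveZ (- K) (is_derive1_powR (- (2 * alpha)) z0).
  apply: (is_derive_eq d2); rewrite /GRing.scale/= /rhg_g3 -/K -mulNr; lra.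
have F0 : F z @[z --> +oo%R] --> (0 : R).
  rewrite -(mulr0 (- K)); apply: cvgMl_tmp.
  have h : expR (- (2 * alpha * ln z)) @[z --> +oo] --> (0 : R).
    apply: (cvg_comp (fun x => 2 * alpha * ln x) (fun x => expR (- x))); last exact: cvgr_expR.
    apply/cvgryPge => A; near=> x.
    rewrite mulrC -ler_pdivrMr; last by lra.
    rewrite -ler_expR lnK; first by near: x; exact: nbhs_pinfty_ge.
    by rewrite posrE; near: x; exact: nbhs_pinfty_gt.
  apply: (cvg_trans _ h); apply: near_eq_cvg; near=> z.
  by rewrite powR_expR ?mulNr//; near: z; exact: nbhs_pinfty_gt.
have h2 : {within `[a, +oo[, continuous (rhg_g3 alpha nu)}.
  apply/continuous_within_itvcyP; split.
    by move=> x; rewrite in_itv/= andbT => ax; apply: continuous_g3; exact: lt_trans ax.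
  by apply: cvg_at_right_filter; apply: continuous_g3.
rewrite (ge0_continuous_FTC2y _ h2 F0).
- by rewrite sub0e -EFinN; congr EFin; rewrite tail3E// /F -/K mulNr opprK.
- by move=> x _; exact: rhg_g3_ge0.
- by move=> x ax; have [] := dF x (lt_trans a0 ax).
- by apply: cvg_at_right_filter; apply: cvgMl_tmp; exact: continuous_powR.
- move=> x; rewrite in_itv/= andbT => ax; rewrite derive1E.
  by have [_ ->] := dF x (lt_trans a0 ax).
Unshelve. all: by end_near. Qed.

Lemma V_half_inv_gt0 (a : R) : 0 < a < 1 -> 0 < V_half_inv a /\ V_half (V_half_inv a) = a.
Proof. by move=> /V_half_surj_oo[r r0 <-]; rewrite V_half_invK// ltW. Qed.

Lemma V_half_inv1 : V_half_inv 1 = 0 :> R.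
Proof. by rewrite -(@V_half0 R) V_half_invK. Qed.

Lemma integral_g2_tail a : 0 < a < 1 ->
  (\int[mu]_(z in `[a, 1%R]) (rhg_g2 nu z)%:E = (tail2 a)%:E)%E.
Proof.
move=> ha; have [r0 rE] := V_half_inv_gt0 ha.
by rewrite -{1}rE integral_g2.
Qed.

Lemma measurable_g2_tail a : 0 < a < 1 -> measurable_fun (`[a, 1%R]%classic : set R) (rhg_g2 nu).
Proof.
move=> /andP[a0 a1].
have -> : `[a, 1%R]%classic = `[a, 1%R[%classic `|` [set 1%R].
  apply/seteqP; split => z /=; rewrite !in_itv/=.
    by move=> /andP[az]; rewrite le_eqVlt => /orP[/eqP->|z1]; [right|left; rewrite az].
  by move=> [/andP[-> /ltW]//|->]; rewrite lexx ltW.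
apply/measurable_funU => //; split; last exact: measurable_fun_set1.
apply: measurable_g2 => // z /=; rewrite !in_itv/= => /andP[az ->]; by rewrite (lt_le_trans a0).
Qed.

Lemma rhg_g2_ge0_tail a z : 0 < a < 1 -> a <= z <= 1 -> 0 <= rhg_g2 nu z.
Proof.
move=> /andP[a0 a1] /andP[az]; rewrite le_eqVlt => /orP[/eqP->|z1]; last first.
  by apply: rhg_g2_ge0 => //; rewrite z1 (lt_le_trans a0).
(* At z = 1 the vanishing hyperbolic sine makes the value 0 whatever [derive1] returns there. *)
by rewrite /rhg_g2 V_half_inv1 mul0r /sinh oppr0 subrr mul0r mulr0.
Qed.

Lemma continuous_V_half_inv a : 0 < a < 1 -> {for a, continuous (@V_half_inv R)}.
Proof.
move=> ha; have [r0 rE] := V_half_inv_gt0 ha.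
rewrite -[X in {for X, _}]rE; apply: differentiable_continuous; apply/derivable1_diffP.
by have [] := is_derive_V_half_inv r0.
Qed.

Lemma continuous_tail2 a : 0 < a < 1 -> {for a, continuous tail2}.
Proof.
move=> ha; apply: cvgMl_tmp; apply: cvgB; last exact: cvg_cst.
have h : V_half_inv z / 2 @[z --> a] --> V_half_inv a / 2.
  by apply: cvgM; [exact: continuous_V_half_inv|exact: cvg_cst].
apply: cvgM; last exact: cvg_cst.
apply: cvgD; first by apply: continuous_cvg => //; exact: continuous_expR.
apply: (@continuous_cvg _ _ _ _ _ (fun z => - (V_half_inv z / 2)) expR); first exact: continuous_expR.
exact: cvgN.
Qed.

Lemma V_half_inv_le a b : 0 < a < 1 -> 0 < b < 1 -> a <= b -> V_half_inv b <= V_half_inv a :> R.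
Proof.
move=> ha hb ab; have [r0 rE] := V_half_inv_gt0 ha; have [s0 sE] := V_half_inv_gt0 hb.
rewrite leNgt -(V_half_decrE (ltW s0) (ltW r0)) rE sE -leNgt//.
Qed.

End tails.

Section regimes.
Context {R : realType}.
Variables (alpha nu : R).
Hypotheses (alpha_gt0 : 0 < alpha) (nu_gt0 : 0 < nu).
Unset Implicit Arguments.
Variables (d : nat -> measure_display) (Omega : forall n, measurableType (d n))
  (P : forall n, probability (Omega n) R) (X : forall n, 'I_n -> {RV (P n) >-> (R * R)%type}).
Set Implicit Arguments.
Hypothesis X_iid : forall n, nu < n%:R -> iid_of_law (P n) (fun i w => X n i w) (rhg_law alpha nu n).

(* [phi n k] is the rescaled value of a degree k. *)
Definition regime (phi : nat -> nat -> R) (g G : R -> R) (c top : \bar R) : Prop :=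
  (forall E, E = [set x | (c < x <= top)%E] ->
    forall d' (Omega' : measurableType d') (Q : probability Omega' R) (eta : Omega' -> Mp E),
    poisson_process Q (density_measure E g) eta ->
    cvg_in_distribution P (fun n w => empirical E (fun i =>
      (phi n (rhg_degree nu (fun j => X n j w) i))%:E)) Q eta) /\
  (forall a, (c < a%:E < top)%E ->
    fine (P m.+1 [set w | a <= phi m.+1 (rhg_max_degree nu (fun j => X m.+1 j w))]) @[m --> \oo]
      --> 1 - expR (- G a)).

Let le_scaled m (k : R) (a b : R) :
  (a <= m.+1%:R `^ (- k) * b) = (m.+1%:R `^ k * a <= b).
Proof.
have h : 0 < m.+1%:R `^ k :> R by exact: powR_gt0.
by rewrite powRN mulrC ler_pdivlMr// mulrC.
Qed.

(** [rho] solves n C_alpha e^(-r/2) = a n^gam with gam = 1/(2 alpha), the asymptotic form of the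
    expected degree at radius r. Both [rho] and its distance to the full radius tend to infinity, as
    [cvg_adjacency_prob_large] requires. *)
Lemma regime_large : 2^-1 < alpha ->
  regime (fun n k => n%:R `^ (- (2 * alpha)^-1) * k%:R) (rhg_g3 alpha nu) (tail3 alpha nu) 0 +oo.
Proof.
move=> ha; set gam := (2 * alpha)^-1.
have C0 := rhg_C_gt0 alpha_gt0 ha.
have gam0 : 0 < gam by rewrite invr_gt0 mulr_gt0.
have ga : alpha * gam = 2^-1 by rewrite /gam; field; exact: lt0r_neq0.
have gam1 : gam < 1 by rewrite invf_lt1 ?mulr_gt0//; lra.
pose raw m a : R := 2 * (1 - gam) * ln m.+1%:R + 2 * ln (rhg_C alpha / a).
(* The maximum matters only for small m: it keeps the radius nonnegative for every m. *)
pose rho m a := Num.max 0 (raw m a).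
have rawy a : raw m a @[m --> \oo] --> +oo by apply: cvg_affine_lnSn; rewrite mulr_gt0 ?subr_gt0.
have rho_raw a : \forall m \near \oo, rho m a = raw m a.
  near=> m; have h : 0 < raw m a by near: m; exact: near_gty.
  by rewrite /rho; apply: max_idPr; exact: ltW.
have rhoy a : rho m a @[m --> \oo] --> +oo.
  apply: (cvg_trans _ (rawy a)); apply: near_eq_cvg.
  by apply: filterS (rho_raw a) => m ->.
have gap a : rhg_radius nu m.+1 - rho m a @[m --> \oo] --> +oo.
  have h : 2 * gam * ln (m.+1%:R : R) + (- (2 * ln nu) - 2 * ln (rhg_C alpha / a)) @[m --> \oo] --> +oo.
    by apply: cvg_affine_lnSn; rewrite mulr_gt0.
  apply: (cvg_trans _ h); apply: near_eq_cvg; apply: filterS (rho_raw a) => m ->.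
  by rewrite rhg_radiusE// /raw; lra.
apply: (@degree_process_cvg R alpha nu alpha_gt0 nu_gt0 d Omega P X X_iid false _
  (fun m => m.+1%:R `^ gam) (fun m a => a) rho) => /=.
- by move=> m; exact: powR_gt0.
- by move=> k k0; exact: cvg_expR_power.
- by move=> m a k _; rewrite !mul1r le_scaled.
- by move=> a _; rewrite mul1r; exact: cvg_cst.
- by move=> a /andP[a0 _]; rewrite mul1r ltW.
- move=> m a b /andP[a0 _] /andP[b0 _] ab; rewrite !lte_fin in a0 b0.
  have Ca : 0 < rhg_C alpha / a by exact: divr_gt0.
  have Cb : 0 < rhg_C alpha / b by exact: divr_gt0.
  rewrite /rho /raw; apply: le_max2; rewrite // lerD2l ler_pM2l// ler_ln ?posrE//.
  by rewrite ler_pM2l// lef_pV2 ?posrE.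
- move=> a _; near=> m; rewrite /rho le_max lexx/= -/(rho m a) -subr_ge0 ltW//.
  by near: m; apply: near_gty; exact: gap.
- move=> a /andP[]; rewrite lte_fin => a0 _; have u0 : 0 < rhg_C alpha / a by exact: divr_gt0.
  have -> : tail3 alpha nu a = (2 * nu `^ alpha * ((rhg_C alpha / a) `^ alpha / 2)) ^+ 2.
    have -> : 2 * nu `^ alpha * ((rhg_C alpha / a) `^ alpha / 2) = nu `^ alpha * (rhg_C alpha / a) `^ alpha by lra.
    have h : 0 < rhg_C alpha * nu / a by apply: divr_gt0 => //; exact: mulr_gt0.
    rewrite /tail3 (powR_expR _ h) (powR_expR _ nu_gt0) (powR_expR _ u0).
    have -> : rhg_C alpha * nu / a = (rhg_C alpha / a) * nu by lra.
    by rewrite lnM ?posrE// -expRD expr2 -expRD; congr expR; lra.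
  apply: cvg_radial_cdf_scaled => //.
  have h : (rhg_C alpha / a) `^ alpha / 2 * (1 - expR (- (alpha * rho m a))) @[m --> \oo] -->
      (rhg_C alpha / a) `^ alpha / 2 * (1 - 0 : R).
    apply: cvgM; first exact: cvg_cst.
    apply: cvgB; first exact: cvg_cst.
    apply: cvg_expRNy; apply/cvgryPgt => A; near=> m.
    have : A / alpha < rho m a by near: m; exact: near_gty.
    by rewrite ltr_pdivrMr// mulrC.
  rewrite subr0 mulr1 in h; apply: (cvg_trans _ h); apply: near_eq_cvg; near=> m.
  have -> : sinh (alpha * rho m a / 2) = expR (alpha * rho m a / 2) * (1 - expR (- (alpha * rho m a))) / 2.
    by rewrite /sinh mulrBr mulr1 -expRD; congr ((_ - expR _) / 2); lra.
  have -> : rho m a = raw m a by near: m; exact: rho_raw.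
  rewrite (powR_expR _ u0) powR_expR// /raw.
  have -> : expR (alpha * ln (rhg_C alpha / a)) = expR (alpha *
    (2 * (1 - gam) * ln m.+1%:R + 2 * ln (rhg_C alpha / a)) / 2) * expR ((2^-1 - alpha) * ln m.+1%:R).
    rewrite -expRD; congr expR.
    have -> : alpha * (2 * (1 - gam) * ln m.+1%:R + 2 * ln (rhg_C alpha / a)) / 2 =
      (alpha - alpha * gam) * ln m.+1%:R + alpha * ln (rhg_C alpha / a) by lra.
    by rewrite ga; lra.
  lra.
- move=> a /andP[]; rewrite lte_fin => a0 _; have u0 : 0 < rhg_C alpha / a by exact: divr_gt0.
  have h1 : expR (rho m a / 2) * adjacency_prob alpha (rhg_radius nu m.+1) (rho m a) @[m --> \oo] --> rhg_C alpha.
    apply: (@cvg_adjacency_prob_large _ _ (fun m => rhg_radius nu m.+1) (rho^~ a)) ha _ (rhoy a) (gap a).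
    by move=> n; rewrite /rho le_max lexx.
  have h2 : (m%:R / m.+1%:R) * (a / rhg_C alpha) *
      (expR (rho m a / 2) * adjacency_prob alpha (rhg_radius nu m.+1) (rho m a)) @[m --> \oo] -->
      1 * (a / rhg_C alpha) * rhg_C alpha.
    by apply: cvgM => //; apply: cvgM; [exact: cvg_ratio_succ|exact: cvg_cst].
  have -> : 1 * a = 1 * (a / rhg_C alpha) * rhg_C alpha by rewrite !mul1r divfK// gt_eqF.
  apply: (cvg_trans _ h2); apply: near_eq_cvg; near=> m.
  have e1 : expR (rho m a / 2) = m.+1%:R / m.+1%:R `^ gam * (rhg_C alpha / a).
    have -> : rho m a = raw m a by near: m; exact: rho_raw.
    rewrite -[in RHS](@lnK _ (rhg_C alpha / a)) ?posrE// powR_expR// -[X in X / _](@lnK _ m.+1%:R) ?posrE//.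
    by rewrite -expRN -!expRD; congr expR; rewrite /raw; lra.
  rewrite e1; move: (adjacency_prob _ _ _) => p.
  have p0 : 0 < m.+1%:R `^ gam :> R by exact: powR_gt0.
  field; by rewrite !gt_eqF.
- move=> a /andP[]; rewrite lte_fin => a0 _.
  have : {for a, continuous ((fun z : R => z `^ (2 * alpha)) \o (fun a : R => rhg_C alpha * nu / a))}; last by [].
  apply: continuous_comp.
    by apply: cvgMl_tmp; apply: cvgV => //; rewrite gt_eqF.
  by apply: continuous_powR; apply: divr_gt0 => //; exact: mulr_gt0.
- by move=> m k _; exact: leey.
- by move=> m k l kl; rewrite ler_wpM2l ?powR_ge0// ler_nat.
- by [].
- move=> a /andP[]; rewrite lte_fin => a0 _.
  rewrite (_ : [set y | _] = `[a, +oo[%classic); last first.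
    by apply/seteqP; split => z /=; rewrite in_itv/= andbT leey => // -[].
  apply: subspace_continuous_measurable_fun => //.
  apply: continuous_in_subspaceT => z; rewrite inE/= in_itv/= andbT => az.
  by apply: continuous_g3; exact: lt_le_trans az.
- by move=> a z _ _; exact: (rhg_g3_ge0 _ alpha_gt0).
- move=> a /andP[]; rewrite lte_fin => a0 _.
  rewrite (_ : [set y | _] = `[a, +oo[%classic); first exact: (integral_g3 alpha_gt0 nu_gt0 ha a0).
  by apply/seteqP; split => z /=; rewrite in_itv/= andbT leey => // -[].
Unshelve. all: by end_near. Qed.

(** The threshold radius does not depend on n: p(r) tends to V_half r at fixed r, and n F(r) has a
    limit because n^(1/2 - alpha) is 1. The scale n is written as a power with exponent 1 to share
    the growth estimate. *)
Lemma regime_critical : alpha = 2^-1 ->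
  regime (fun n k => n%:R^-1 * k%:R) (rhg_g2 nu) (tail2 nu) 0 1.
Proof.
move=> aE.
have in01 (a : R) : (0 < a%:E < 1)%E -> 0 < a < 1 by [].
apply: (@degree_process_cvg R alpha nu alpha_gt0 nu_gt0 d Omega P X X_iid false _
  (fun m => m.+1%:R `^ 1) (fun m a => a) (fun m a => V_half_inv a)) => /=.
- by move=> m; exact: powR_gt0.
- by move=> k k0; exact: cvg_expR_power.
- by move=> m a k _; rewrite !mul1r powRr1// mulrC ler_pdivlMr// mulrC.
- by move=> a _; rewrite mul1r; exact: cvg_cst.
- by move=> a /andP[a0 _]; rewrite mul1r ltW.
- by move=> m a b /in01 ha /in01 hb; exact: V_half_inv_le.
- move=> a /in01/V_half_inv_gt0[r0 _]; near=> m; rewrite ltW//= ltW//.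
  by near: m; apply: near_gty; exact: cvg_rhg_radius.
- move=> a /in01/V_half_inv_gt0[r0 _].
  have -> : tail2 nu a = (2 * nu `^ alpha * sinh (alpha * V_half_inv a / 2)) ^+ 2.
    have -> : alpha * V_half_inv a / 2 = V_half_inv a / 2 / 2 by rewrite aE; lra.
    have q2 : (nu `^ alpha) ^+ 2 = nu.
      by rewrite powR_expR// expr2 -expRD -[RHS](@lnK _ nu) ?posrE//; congr expR; rewrite aE; lra.
    rewrite /tail2 cosh_double; have := cosh2B1 (V_half_inv a / 2 / 2).
    rewrite -[X in 2 * X]q2; move: (_ `^ _) (cosh _) (sinh _) => p ch sh h.
    have -> : ch ^+ 2 = sh ^+ 2 + 1 by lra.
    by ring.
  apply: cvg_radial_cdf_scaled => //.
  rewrite (_ : (fun m => _) = fun=> sinh (alpha * V_half_inv a / 2)); first exact: cvg_cst.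
  by apply/funext => m; rewrite aE subrr powRr0 mulr1.
- move=> a /in01/V_half_inv_gt0[r0 rE].
  have h1 : adjacency_prob alpha (rhg_radius nu m.+1) (V_half_inv a) @[m --> \oo] --> a.
    rewrite -[X in _ --> X]rE V_halfE ?(ltW r0)// -aE.
    by apply: cvg_adjacency_prob_fixed => //; [exact: ltW|exact: cvg_rhg_radius].
  have h2 : (m%:R / m.+1%:R) * adjacency_prob alpha (rhg_radius nu m.+1) (V_half_inv a) @[m --> \oo] --> 1 * a.
    by apply: cvgM => //; exact: cvg_ratio_succ.
  apply: (cvg_trans _ h2); apply: near_eq_cvg; apply: nearW => m.
  by rewrite powRr1// mulrAC.
- by move=> a /in01; exact: continuous_tail2.
- move=> m k km; rewrite lee_fin mulrC ler_pdivrMr// mul1r ler_nat.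
  by rewrite (leq_trans km).
- by move=> m k l kl; rewrite ler_wpM2l ?invr_ge0// ler_nat.
- by rewrite lte_fin.
- move=> a /in01 ha.
  rewrite (_ : [set y | _] = `[a, 1%R]%classic); first exact: measurable_g2_tail.
  by apply/seteqP; split => z /=; rewrite in_itv/= lee_fin; [by move=> [-> ->]|by move=> /andP[]].
- by move=> a z /in01 ha [az]; rewrite lee_fin => z1; apply: (rhg_g2_ge0_tail _ ha); rewrite ?az.
- move=> a /in01 ha.
  rewrite (_ : [set y | _] = `[a, 1%R]%classic); first exact: integral_g2_tail.
  by apply/seteqP; split => z /=; rewrite in_itv/= lee_fin; [by move=> [-> ->]|by move=> /andP[]].
Unshelve. all: by end_near. Qed.

(** [rho] solves n alpha r / pi = -a n^(alpha + 1/2), the asymptotic form of the expected number of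
    non-neighbours; it tends to 0 because alpha < 1/2. *)
Lemma regime_small : alpha < 2^-1 ->
  regime (fun n k => n%:R `^ (- (alpha + 2^-1)) * (k%:R - n%:R)) (rhg_g1 alpha nu) (tail1 alpha nu) -oo 0.
Proof.
move=> ha; set q := alpha + 2^-1.
have q0 : 0 < q by rewrite addr_gt0.
have p0 := pi_gt0 R.
have p1 : pi != 0 :> R by rewrite gt_eqF.
have al1 : alpha != 0 by rewrite gt_eqF.
have neg (a : R) : (-oo < a%:E < 0)%E -> a < 0 by move=> /andP[].
pose rho (m : nat) (a : R) : R := (- a * pi / alpha) * m.+1%:R `^ (alpha - 2^-1).
have u0 (a : R) : a < 0 -> 0 < - a * pi / alpha.
  by move=> a0; apply: divr_gt0 => //; apply: mulr_gt0 => //; rewrite oppr_gt0.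
have rho0 m a : a < 0 -> 0 < rho m a by move=> a0; apply: mulr_gt0; [exact: u0|exact: powR_gt0].
have rhoc a : rho m a @[m --> \oo] --> (0 : R).
  rewrite -(mulr0 (- a * pi / alpha)); apply: cvgMl_tmp; rewrite -opprB.
  by apply: cvg_power_oo; rewrite subr_gt0.
have sc : (m.+1%:R `^ q : R)^-1 @[m --> \oo] --> (0 : R).
  apply: (cvg_trans _ (cvg_power_oo q0)); apply: near_eq_cvg; apply: nearW => m.
  by rewrite powRN.
(* The degree is compared with n, but a node has only m = n - 1 potential neighbours: the difference
   of 1, divided by the scale, is the correction subtracted in [tau]. *)
apply: (@degree_process_cvg R alpha nu alpha_gt0 nu_gt0 d Omega P X X_iid true _
  (fun m => m.+1%:R `^ q) (fun m a => - a - (m.+1%:R `^ q)^-1) rho) => /=.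
- by move=> m; exact: powR_gt0.
- by move=> k k0; exact: cvg_expR_power.
- move=> m a k _; rewrite le_scaled !mulN1r lerN2 mulrBr divff; last by rewrite gt_eqF// powR_gt0.
  move: (_ `^ q) => w; rewrite -natr1 mulrN; apply/idP/idP; lra.
- move=> a _; rewrite mulN1r -[X in _ --> X]subr0.
  by apply: cvgB; [exact: cvg_cst|exact: sc].
- by move=> a /neg a0; rewrite mulN1r oppr_ge0 ltW.
- move=> m a b _ _ ab; apply: ler_wpM2r; first exact: powR_ge0.
  by rewrite ler_pM2r ?invr_gt0// ler_pM2r// lerN2.
- move=> a /neg a0; near=> m; rewrite ltW//=; last exact: rho0.
  have h1 : rho m a < 1 by near: m; exact: (cvgr_lt _ (rhoc a)).
  have h2 : 1 < rhg_radius nu m.+1 by near: m; apply: near_gty; exact: cvg_rhg_radius.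
  by rewrite ltW// (lt_trans h1).
- move=> a /neg a0.
  have -> : tail1 alpha nu a = (2 * nu `^ alpha * (1 * (- a * pi / 2))) ^+ 2.
    by rewrite /tail1; field.
  apply: cvg_radial_cdf_scaled => //.
  have r2 m : 0 < alpha * rho m a / 2 by apply: divr_gt0 => //; apply: mulr_gt0 => //; exact: rho0.
  have h1 : sinh (alpha * rho m a / 2) / (alpha * rho m a / 2) @[m --> \oo] --> (1 : R).
    apply: (@cvg_sinh_ratio _ (fun m => alpha * rho m a / 2)) => //.
    rewrite -(mul0r (2^-1)); apply: cvgM; last exact: cvg_cst.
    by rewrite -(mulr0 alpha); apply: cvgMl_tmp; exact: rhoc.
  have h2 : sinh (alpha * rho m a / 2) / (alpha * rho m a / 2) * (- a * pi / 2) @[m --> \oo] --> 1 * (- a * pi / 2).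
    by apply: cvgM => //; exact: cvg_cst.
  apply: (cvg_trans _ h2); apply: near_eq_cvg; apply: nearW => m.
  have pp : m.+1%:R `^ (2^-1 - alpha) = (m.+1%:R `^ (alpha - 2^-1))^-1 :> R by rewrite -powRN opprB.
  rewrite pp; move: (r2 m); rewrite /rho.
  have w0 : 0 < m.+1%:R `^ (alpha - 2^-1) :> R by exact: powR_gt0.
  move: (_ `^ _) w0 => w w0 r0; move: (sinh _) => S; have w1 : w != 0 by rewrite gt_eqF.
  have a1 : a != 0 by rewrite lt_eqF.
  by move: (pi : R) p1 => p p1; field; rewrite w1 al1 p1 a1.
- move=> a /neg a0.
  have h1 : (1 - adjacency_prob alpha (rhg_radius nu m.+1) (rho m a)) / rho m a @[m --> \oo] --> alpha / pi.
    apply: (@cvg_adjacency_prob_small _ _ (fun m => rhg_radius nu m.+1) (rho^~ a)) => //.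
      by move=> m; exact: rho0.
    exact: cvg_rhg_radius.
  have h2 : (m%:R / m.+1%:R) * (- a * pi / alpha) *
     ((1 - adjacency_prob alpha (rhg_radius nu m.+1) (rho m a)) / rho m a) @[m --> \oo] -->
     1 * (- a * pi / alpha) * (alpha / pi).
    by apply: cvgM => //; apply: cvgM; [exact: cvg_ratio_succ|exact: cvg_cst].
  have -> : -1 * a = 1 * (- a * pi / alpha) * (alpha / pi) by rewrite mul1r; move: (pi : R) p1 => p p1; field; rewrite al1 p1.
  apply: (cvg_trans _ h2); apply: near_eq_cvg; apply: nearW => m.
  have pp : m.+1%:R `^ (alpha - 2^-1) = m.+1%:R `^ q / m.+1%:R :> R.
    rewrite !powR_expR// -[X in _ / X](@lnK _ m.+1%:R) ?posrE// -expRN -expRD; congr expR; rewrite /q; lra.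
  move: (adjacency_prob _ _ _) => v; rewrite /rho pp.
  have w0 : 0 < m.+1%:R `^ q :> R by exact: powR_gt0.
  move: (_ `^ _) w0 => w w0; have w1 : w != 0 by rewrite gt_eqF.
  have a1 : a != 0 by rewrite lt_eqF.
  have n1 : m.+1%:R != 0 :> R by rewrite pnatr_eq0.
  move: (m.+1%:R) n1 (m%:R) => n n1 k; move: (pi : R) p1 => p p1.
  by field; rewrite w1 al1 p1 a1 n1.
- move=> a /neg a0.
  have h : {for a, continuous (fun a : R => pi * nu `^ alpha * a)} by apply: cvgMl_tmp; exact: cvg_id.
  have h2 := cvgM h h.
  have -> : tail1 alpha nu = (fun a => pi * nu `^ alpha * a) \* (fun a => pi * nu `^ alpha * a).
    by apply/funext => z; rewrite /tail1 expr2.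
  exact: (h2 _).
- move=> m k km; rewrite lee_fin mulr_ge0_le0 ?powR_ge0// subr_le0 ler_nat.
  by rewrite (leq_trans km).
- by move=> m k l kl; rewrite ler_wpM2l ?powR_ge0// lerD2r ler_nat.
- by [].
- move=> a _; apply: measurable_funTS; apply: continuous_measurable_fun; exact: continuous_g1.
- by move=> a z _ _; rewrite !mulr_ge0 ?powR_ge0 ?exprn_ge0 ?(ltW p0).
- move=> a /neg a0.
  rewrite (_ : [set y | _] = `[a, 0%R]%classic); first exact: integral_g1.
  by apply/seteqP; split => z /=; rewrite in_itv/= lee_fin; [by move=> [-> ->]|by move=> /andP[]].
Unshelve. all: by end_near. Qed.

End regimes.

(** * Limit laws of the maximum degree *)

Section real_random_elements.
Context {R : realType}.

Lemma cvg_in_distribution_comp (T : topologicalType) (d : nat -> measure_display)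
    (Omega : forall n, measurableType (d n)) (P : forall n, probability (Omega n) R)
    (X : forall n, Omega n -> T) (d' : measure_display) (Omega' : measurableType d')
    (Q : probability Omega' R) (Y : Omega' -> T) (T' : topologicalType) (h : T -> T') :
  continuous h -> cvg_in_distribution P X Q Y ->
  cvg_in_distribution P (fun n => h \o X n) Q (h \o Y).
Proof.
move=> ch [rX rY XY]; split.
- move=> n U oU; rewrite comp_preimage; apply: rX; apply: open_comp => // x _; exact: ch.
- move=> U oU; rewrite comp_preimage; apply: rY; apply: open_comp => // x _; exact: ch.
- move=> F cF [M FM]; apply: (XY (F \o h)); last by exists M => x; exact: FM.
  by move=> x; apply: continuous_comp; [exact: ch|exact: cF].
Qed.

Lemma random_element_real d (Omega : measurableType d) (Z : Omega -> R) :
  measurable_fun setT Z -> random_element Z.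
Proof. by move=> mZ U oU; have := mZ measurableT U (open_measurable oU); rewrite setTI. Qed.

Lemma exponential_prob_nonneg (rate : R) (S : set R) :
  exponential_prob rate S = exponential_prob rate (S `&` `[0, +oo[).
Proof.
rewrite /exponential_prob [LHS]integral_mkcond [RHS]integral_mkcond; apply: eq_integral => z _.
rewrite !patchE; case: (boolP (z \in S)) => zS; last first.
  by rewrite memNset// => -[/mem_set]; rewrite (negbTE zS).
have [z0|z0] := leP 0 z; last by rewrite lt0_exponential_pdf//; case: ifP.
rewrite mem_set//; split; first exact: set_mem.
by rewrite /= in_itv/= z0.
Qed.

Variables (d : measure_display) (Omega : measurableType d) (Q : probability Omega R)
  (Z : {RV Q >-> R}).

Lemma measurable_RV_le z : measurable [set w | Z w <= z].
Proof.
by have := @measurable_funPT _ _ _ _ Z measurableT _ (measurable_itv `]-oo, z]); rewrite setTI set_itvE.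
Qed.

Lemma measurable_RV_ge z : measurable [set w | z <= Z w].
Proof.
by have := @measurable_funPT _ _ _ _ Z measurableT _ (measurable_itv `[z, +oo[); rewrite setTI set_itvE.
Qed.

(** Continuity of F at a excludes an atom there: Q(Z < a) is squeezed between values of F just below
    a and F a. *)
Lemma upper_tail_of_cdf (F : R -> R) a : {for a, continuous F} ->
  (\forall z \near a, Q [set w | Z w <= z] = (F z)%:E) -> fine (Q [set w | a <= Z w]) = 1 - F a.
Proof.
move=> cF hF; have mlt : measurable [set w | Z w < a].
  by have := @measurable_funPT _ _ _ _ Z measurableT _ (measurable_itv `]-oo, a[); rewrite setTI set_itvE.
suff ltE : fine (Q [set w | Z w < a]) = F a.
  rewrite -ltE (_ : [set w | a <= Z w] = ~` [set w | Z w < a]); last first.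
    by apply/seteqP; split => w /=; rewrite leNgt => /negP.
  have -> : fine (Q (~` [set w | Z w < a])) = fine (1%E - Q [set w | (Z w < a)%R])%E.
    by congr fine; rewrite probability_setC.
  by rewrite fineB// fin_num_measure.
have fE : Q [set w | Z w < a] = (fine (Q [set w | Z w < a]))%:E by rewrite fineK ?fin_num_measure.
apply/eqP; rewrite eq_le; apply/andP; split.
  rewrite -lee_fin -fE -(nbhs_singleton hF); apply: le_measure; rewrite ?inE//; first exact: measurable_RV_le.
  by move=> w /= /ltW.
apply/ler_addgt0Pr => e e0.
have /cvgrPdist_lt/(_ _ e0) nF := cF.
have [r /= r0 hr] := filterI hF nF.
have h1 : ball a r (a - r / 2) by rewrite /ball/= opprB addrC subrK ger0_norm ?divr_ge0//; lra.
have [zE Fz] := hr _ h1.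
have : F (a - r / 2) <= fine (Q [set w | Z w < a]).
  rewrite -lee_fin -fE -zE; apply: le_measure; rewrite ?inE//; first exact: measurable_RV_le.
  by move=> w /=; lra.
by move: Fz; rewrite ltr_norml => /andP[]; lra.
Qed.

Lemma frechet_upper_tail k a : 0 < k -> frechet Q k Z -> 0 < a ->
  fine (Q [set w | a <= Z w]) = 1 - expR (- (a `^ (- k))).
Proof.
move=> k0 fZ a0; apply: (@upper_tail_of_cdf (fun z => expR (- (z `^ (- k))))).
  have h : {for a, continuous (expR \o (fun z : R => - (z `^ (- k))))}; last exact: h.
  by apply: continuous_comp; [apply: cvgN; exact: continuous_powR|exact: continuous_expR].
by near=> z; have z0 : 0 < z; [near: z; exact: lt_nbhsr|rewrite fZ ?(ltW z0)// gt_eqF].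
Unshelve. all: by end_near. Qed.

Lemma frechet_upper_tail0 k a : 0 < k -> frechet Q k Z -> a <= 0 ->
  fine (Q [set w | a <= Z w]) = 1.
Proof.
move=> k0 fZ a0; have h0 := fZ 0 (lexx _); rewrite eqxx in h0.
have : Q (~` [set w | a <= Z w]) = 0%E.
  apply/eqP; rewrite eq_le measure_ge0 andbT -[X in (_ <= X)%E]h0; apply: le_measure; rewrite ?inE.
  - by apply: measurableC; exact: measurable_RV_ge.
  - exact: measurable_RV_le.
  - by move=> w /= /negP; rewrite -ltNge => h; apply: ltW; exact: lt_le_trans a0.
rewrite probability_setC; last exact: measurable_RV_ge.
rewrite -[Q [set w | a <= Z w]]fineK ?fin_num_measure//; last exact: measurable_RV_ge.
by rewrite -EFinB => -[] /eqP; rewrite subr_eq0 => /eqP <-.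
Qed.

Lemma weibull_lower_tail a : weibull Q 2 Z -> 0 <= a ->
  fine (Q [set w | Z w <= a]) = 1 - expR (- a ^+ 2).
Proof. by move=> wZ a0; rewrite wZ//= powR_mulrn. Qed.

Lemma weibull_lower_tail0 a : weibull Q 2 Z -> a <= 0 -> fine (Q [set w | Z w <= a]) = 0.
Proof.
move=> wZ a0; have h0 := wZ 0 (lexx _); rewrite powR0 ?pnatr_eq0// oppr0 expR0 subrr in h0.
have -> : Q [set w | Z w <= a] = 0%E; last by [].
apply/eqP; rewrite eq_le measure_ge0 andbT -[X in (_ <= X)%E]h0; apply: le_measure; rewrite ?inE; try exact: measurable_RV_le.
by move=> w /= h; exact: le_trans a0.
Qed.

End real_random_elements.

Section profile.
Context {R : realType}.

Lemma arcosh_ge0 (x : R) : 1 <= x -> 0 <= arcosh x.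
Proof. by move=> x1; rewrite ln_ge0// ler_wpDr ?sqrtr_ge0. Qed.

Definition profile (z : R) : R := V_half (2 * arcosh (z + 1)).

Lemma profile_ge a z : 0 < a < 1 -> 0 <= z -> (a <= profile z) = (z <= cosh (V_half_inv a / 2) - 1).
Proof.
move=> ha z0; have [r0 rE] := V_half_inv_gt0 ha.
have z1 : 1 <= z + 1 by lra.
have az := arcosh_ge0 z1.
rewrite -[in LHS]rE /profile leNgt V_half_decrE ?(ltW r0)//; last by apply: mulr_ge0.
rewrite -leNgt -ler_pdivlMl// mulrC -ler_cosh// ?arcoshK//; last by rewrite ltW ?divr_gt0.
by apply/idP/idP; lra.
Qed.

Lemma measurable_profile : measurable_fun setT profile.
Proof.
have m1 : measurable_fun setT (fun z : R => z + 1) by apply: measurable_funD.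
have m2 := measurableT_comp (@measurable_arcosh R) m1.
have m3 : measurable_fun setT (fun z : R => 2 * z) by apply: measurable_funM.
have m4 := measurableT_comp m3 m2.
have m5 : measurable_fun setT (@V_half R) by apply: continuous_measurable_fun; exact: continuous_V_half.
exact: (measurableT_comp m5 m4).
Qed.

(** By [profile_ge] the event is, on the half-line, the interval [0, cosh(V_half_inv a / 2) - 1],
    whose exponential probability at rate 2 nu involves exactly [tail2 nu a]. *)
Lemma exponential_prob_profile nu a : 0 < nu -> 0 < a < 1 ->
  exponential_prob (2 * nu) [set z | a <= profile z] = (1 - expR (- tail2 nu a))%:E.
Proof.
move=> n0 ha; rewrite exponential_prob_nonneg.
have [r0 _] := V_half_inv_gt0 ha.
have t0 : 0 < cosh (V_half_inv a / 2) - 1.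
  have r2 : 0 < V_half_inv a / 2 by exact: divr_gt0.
  by have := ltr_cosh (lexx 0) (ltW r2); rewrite cosh0 r2 subr_gt0 => ->.
rewrite (_ : _ `&` _ = `[0, cosh (V_half_inv a / 2) - 1]%classic).
  by rewrite exponential_prob_itv0c// /tail2 mulNr.
apply/seteqP; split => z /=; rewrite !in_itv/= ?andbT.
  by move=> [h z0]; rewrite z0 -profile_ge.
by move=> /andP[z0 h]; rewrite profile_ge.
Qed.

(** On the half-line [profile z] reaches 1 only at z = 0, a null set. *)
Lemma exponential_prob_profile_top nu a : 1 <= a ->
  exponential_prob (2 * nu) [set z | a <= profile z] = 0%E.
Proof.
move=> a1; rewrite exponential_prob_nonneg.
have sub : [set z | a <= profile z] `&` `[0, +oo[ `<=` [set 0 : R].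
  move=> z [/= h]; rewrite in_itv/= andbT => z0.
  have [r0|r0] := leP (2 * arcosh (z + 1)) 0; last first.
    have /andP[_] := V_half_in01 r0; rewrite -/(profile z) => h'.
    by have := le_lt_trans a1 (le_lt_trans h h'); rewrite ltxx.
  have e : arcosh (z + 1) = 0.
    by apply/eqP; rewrite eq_le arcosh_ge0 ?andbT; lra.
  have z1 : 1 <= z + 1 by lra.
  by have := arcoshK z1; rewrite e cosh0 => h'; lra.
exact: integral_Sset1 sub.
Qed.

End profile.

Section maximum_degree.
Context {R : realType}.
Variables (alpha nu : R).
Hypotheses (alpha_gt0 : 0 < alpha) (nu_gt0 : 0 < nu).
Unset Implicit Arguments.
Variables (d : nat -> measure_display) (Omega : forall n, measurableType (d n))
  (P : forall n, probability (Omega n) R) (X : forall n, 'I_n -> {RV (P n) >-> (R * R)%type}).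
Set Implicit Arguments.
Notation maxdeg n w := (rhg_max_degree nu (fun j => X n j w)).

Lemma rhg_max_degree_le n (w : Omega n) : (maxdeg n w <= n.-1)%N.
Proof.
case: n w => [|m] w; first by rewrite /rhg_max_degree big_ord0.
by apply/bigmax_leqP => i _; exact: degree_le.
Qed.

Lemma random_element_max_degree (T : topologicalType) (h : nat -> nat -> T) n :
  random_element (fun w => h n (maxdeg n w)).
Proof.
move=> U _; exact: (@measurable_degree_event _ nu _ _ _ _ (X n)
  (fun dg => U (h n (\max_(i < n) dg i)%N))).
Qed.

Section conclusion.
Variables (d' : measure_display) (Omega' : measurableType d') (Q : probability Omega' R)
  (Y : Omega' -> R) (h : nat -> nat -> R).
Hypothesis mY : measurable_fun setT Y.

Lemma max_degree_cvg :
  (forall a, fine (P m.+1 [set w | a <= h m.+1 (maxdeg m.+1 w)]) @[m --> \oo] --> fine (Q [set w | a <= Y w])) ->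
  cvg_in_distribution P (fun n w => h n (maxdeg n w)) Q Y.
Proof.
move=> hc; apply: cvg_in_distribution_tails.
- by move=> n; exact: random_element_max_degree.
- exact: random_element_real.
- by move=> a; rewrite -cvg_shiftS; exact: hc.
Qed.

Lemma cvg_sure (D : forall m, set (Omega m.+1)) (S : set Omega') : fine (Q S) = 1 ->
  (forall m, D m = setT) -> fine (P m.+1 (D m)) @[m --> \oo] --> fine (Q S).
Proof.
move=> -> DE; rewrite (_ : (fun m => _) = fun=> 1); first exact: cvg_cst.
by apply/funext => k; rewrite DE probability_setT.
Qed.

Lemma cvg_null (D : forall m, set (Omega m.+1)) (S : set Omega') : fine (Q S) = 0 ->
  (forall m, D m = set0) -> fine (P m.+1 (D m)) @[m --> \oo] --> fine (Q S).
Proof.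
move=> -> DE; rewrite (_ : (fun m => _) = fun=> 0); first exact: cvg_cst.
by apply/funext => k; rewrite DE measure0.
Qed.

End conclusion.

Hypothesis X_iid : forall n, nu < n%:R -> iid_of_law (P n) (fun i w => X n i w) (rhg_law alpha nu n).
Variables (d' : measure_display) (Omega' : measurableType d') (Q : probability Omega' R)
  (Z : {RV Q >-> R}).

Let mZ : measurable_fun setT Z.
Proof. exact: measurable_funPT. Qed.

Lemma max_degree_large : 2^-1 < alpha -> frechet Q (2 * alpha) Z ->
  cvg_in_distribution P (fun n w => (maxdeg n w)%:R / (rhg_C alpha * nu * n%:R `^ (2 * alpha)^-1)) Q Z.
Proof.
move=> ha fZ; have C0 := rhg_C_gt0 alpha_gt0 ha.
have a2 : 0 < 2 * alpha by rewrite mulr_gt0.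
have [_ tails] := regime_large alpha_gt0 nu_gt0 X_iid ha.
apply: (max_degree_cvg (h := fun n k => k%:R / (rhg_C alpha * nu * n%:R `^ (2 * alpha)^-1)) mZ) => a.
have K0 : 0 < rhg_C alpha * nu by exact: mulr_gt0.
have pw m : 0 < m.+1%:R `^ (2 * alpha)^-1 :> R by exact: powR_gt0.
(* Outside the range of levels covered by the regime, a <= 0, both events have probability 1. *)
have [a0|a0] := ltP 0 a; last first.
  apply: cvg_sure => //; first exact: (frechet_upper_tail0 a2 fZ a0).
  move=> m; apply/seteqP; split => // w _ /=; apply: le_trans a0 _.
  by apply: divr_ge0 => //; apply: mulr_ge0; exact: ltW.
have Ka : (0 < (a * (rhg_C alpha * nu))%:E < +oo)%E by rewrite lte_fin ltry andbT mulr_gt0.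
have -> : fine (Q [set w | a <= Z w]) = 1 - expR (- tail3 alpha nu (a * (rhg_C alpha * nu))).
  rewrite (frechet_upper_tail a2 fZ a0); congr (1 - expR (- _)); rewrite /tail3.
  have -> : rhg_C alpha * nu / (a * (rhg_C alpha * nu)) = a^-1.
    by move: (rhg_C _ * nu) K0 => K K0; field; rewrite !gt_eqF.
  have ai : 0 < a^-1 by rewrite invr_gt0.
  by rewrite (powR_expR _ ai) (powR_expR _ a0) lnV ?posrE//; congr expR; lra.
apply: (cvg_trans _ (tails _ Ka)); apply: near_eq_cvg; apply: nearW => m; congr (fine (P m.+1 _)).
have key k : (a * (rhg_C alpha * nu) <= (m.+1%:R `^ (2 * alpha)^-1)^-1 * k) =
    (a <= k / (rhg_C alpha * nu * m.+1%:R `^ (2 * alpha)^-1)).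
  rewrite [RHS]ler_pdivlMr; last exact: mulr_gt0.
  by rewrite [_^-1 * k]mulrC (ler_pdivlMr _ _ (pw m)) !mulrA.
by apply/seteqP; split => w /=; rewrite powRN key.
Qed.

Lemma max_degree_critical : alpha = 2^-1 ->
  (forall A, measurable A -> distribution Q Z A = exponential_prob (2 * nu) A) ->
  cvg_in_distribution P (fun n w => n%:R^-1 * (maxdeg n w)%:R : R) Q (fun w => V_half (2 * arcosh (Z w + 1))).
Proof.
move=> aE eZ; have [_ tails] := regime_critical alpha_gt0 nu_gt0 X_iid aE.
have mY : measurable_fun setT (fun w => profile (Z w)).
  by apply: (measurableT_comp (@measurable_profile R)).
have mS a : measurable [set z : R | a <= profile z].
  by have := @measurable_profile R measurableT _ (measurable_itv `[a, +oo[); rewrite setTI set_itvE.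
have QE a : Q [set w | a <= profile (Z w)] = exponential_prob (2 * nu) [set z | a <= profile z].
  by rewrite -eZ.
apply: (max_degree_cvg (h := fun n k => n%:R^-1 * k%:R) mY) => a.
have [a0|a0] := ltP 0 a; last first.
  apply: cvg_sure => //.
    rewrite (_ : [set w | _] = setT) ?probability_setT//.
    by apply/seteqP; split => // w _ /=; exact: le_trans (V_half_ge0 _).
  move=> m; apply/seteqP; split => // w _ /=; apply: le_trans a0 _.
  by apply: mulr_ge0.
(* A degree is at most n - 1, so levels a >= 1 are never reached, and the limit reaches them with
   probability 0. *)
have [a1|a1] := ltP a 1; last first.
  apply: cvg_null; first by rewrite QE exponential_prob_profile_top.
  move=> m; apply/seteqP; split => // w /=; rewrite leNgt => /negP; apply.
  apply: lt_le_trans a1; rewrite mulrC ltr_pdivrMr// mul1r ltr_nat ltnS.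
  exact: rhg_max_degree_le w.
rewrite QE exponential_prob_profile ?a0//=.
by apply: tails; rewrite !lte_fin a0.
Qed.

(** The regime gives upper tails of the rescaled degree, which is negative here; convergence to -Z
    is proved first and the continuous map x -> -x is then applied. *)
Lemma max_degree_small : alpha < 2^-1 -> weibull Q 2 Z ->
  cvg_in_distribution P (fun n w => pi * nu `^ alpha * ((n%:R - (maxdeg n w)%:R) / n%:R `^ (alpha + 2^-1))) Q Z.
Proof.
move=> ha wZ; have [_ tails] := regime_small alpha_gt0 nu_gt0 X_iid ha.
pose K : R := pi * nu `^ alpha.
have K0 : 0 < K by rewrite mulr_gt0 ?pi_gt0 ?powR_gt0.
pose h n k : R := K * (n%:R `^ (- (alpha + 2^-1)) * (k%:R - n%:R)).
have hc : cvg_in_distribution P (fun n w => h n (maxdeg n w)) Q (-%R \o Z).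
  apply: max_degree_cvg => [|a]; first exact: measurableT_comp.
  have QE : [set w | a <= (-%R \o Z) w] = [set w | Z w <= - a].
    by apply/seteqP; split => w /=; rewrite lerNr.
  have [a0|a0] := ltP a 0; last first.
    apply: cvg_null; first by rewrite QE (weibull_lower_tail0 wZ)// oppr_le0.
    move=> m; apply/seteqP; split => // w /=; rewrite leNgt => /negP; apply.
    apply: lt_le_trans a0; rewrite /h pmulr_rlt0// pmulr_rlt0 ?powR_gt0// subr_lt0 ltr_nat ltnS.
    exact: rhg_max_degree_le w.
  rewrite QE (weibull_lower_tail wZ) ?oppr_ge0 ?(ltW a0)//.
  have ia : (-oo < (a / K)%:E < 0)%E by rewrite ltNyr lte_fin pmulr_llt0 ?invr_gt0.
  have -> : (- a) ^+ 2 = tail1 alpha nu (a / K).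
    by rewrite sqrrN /tail1 -/K mulrCA divff ?mulr1// gt_eqF.
  apply: (cvg_trans _ (tails _ ia)); apply: near_eq_cvg; apply: nearW => m; congr (fine (P m.+1 _)).
  by apply/seteqP; split => w /=; rewrite /h [a / K]mulrC ler_pdivrMl.
have co : continuous (-%R : R -> R) by move=> x; apply: cvgN; exact: cvg_id.
have := cvg_in_distribution_comp co hc.
have -> : -%R \o (-%R \o Z) = Z by apply/funext => w /=; rewrite opprK.
have -> : (fun n => -%R \o (fun w => h n (maxdeg n w))) =
    (fun n w => pi * nu `^ alpha * ((n%:R - (maxdeg n w)%:R) / n%:R `^ (alpha + 2^-1))).
  by apply/functional_extensionality_dep => n; apply/funext => w /=; rewrite /h -/K powRN; lra.
by [].
Qed.

End maximum_degree.

Unset Implicit Arguments.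

Theorem theorem3p3 (R : realType) (alpha nu : R)
  (alpha_gt0 : 0 < alpha) (nu_gt0 : 0 < nu)
  (d : nat -> measure_display) (Omega : forall n, measurableType (d n))
  (P : forall n, probability (Omega n) R)
  (X : forall n, 'I_n -> {RV (P n) >-> (R * R)%type})
  (X_iid : forall n, nu < n%:R ->
    iid_of_law (P n) (fun i w => X n i w) (rhg_law alpha nu n))
  (d' : measure_display) (Omega' : measurableType d')
  (Q : probability Omega' R) :
  let deg n (w : Omega n) (i : 'I_n) : R :=
    (rhg_degree nu (fun j => X n j w) i)%:R in
  let Dmax n (w : Omega n) : R :=
    (rhg_max_degree nu (fun j => X n j w))%:R in
  [/\ alpha < 2^-1 ->
        let E := [set y : \bar R | (-oo < y <= 0)%E] in
        (forall eta : Omega' -> Mp E,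
           poisson_process Q (density_measure E (rhg_g1 alpha nu)) eta ->
           cvg_in_distribution P
             (fun n w => empirical E (fun i =>
                (n%:R `^ (- (alpha + 2^-1)) * (deg n w i - n%:R))%:E))
             Q eta) /\
        (forall Z : {RV Q >-> R}, weibull Q 2 Z ->
           cvg_in_distribution P
             (fun n w => pi * nu `^ alpha *
                ((n%:R - Dmax n w) / n%:R `^ (alpha + 2^-1)))
             Q Z),
      alpha = 2^-1 ->
        let E := [set y : \bar R | (0 < y <= 1)%E] in
        (forall eta : Omega' -> Mp E,
           poisson_process Q (density_measure E (rhg_g2 nu)) eta ->
           cvg_in_distribution P
             (fun n w => empirical E (fun i => (n%:R^-1 * deg n w i)%:E))
             Q eta) /\
        (forall Z : {RV Q >-> R},
           (forall A, measurable A ->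
              distribution Q Z A = exponential_prob (2 * nu) A) ->
           cvg_in_distribution P (fun n w => n%:R^-1 * Dmax n w)
             Q (fun w => V_half (2 * arcosh (Z w + 1)))) &
      2^-1 < alpha ->
        let E := [set y : \bar R | (0 < y)%E] in
        (forall eta : Omega' -> Mp E,
           poisson_process Q (density_measure E (rhg_g3 alpha nu)) eta ->
           cvg_in_distribution P
             (fun n w => empirical E (fun i =>
                (n%:R `^ (- (2 * alpha)^-1) * deg n w i)%:E))
             Q eta) /\
        (forall Z : {RV Q >-> R}, frechet Q (2 * alpha) Z ->
           cvg_in_distribution P
             (fun n w => Dmax n w /
                (rhg_C alpha * nu * n%:R `^ (2 * alpha)^-1))
             Q Z)].
Proof.
move=> deg Dmax; split => h E; split.
- have [poi _] := regime_small alpha_gt0 nu_gt0 X_iid h.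
  by move=> eta; exact: poi.
- by move=> Z; exact: (max_degree_small alpha_gt0 nu_gt0 X_iid h).
- have [poi _] := regime_critical alpha_gt0 nu_gt0 X_iid h.
  by move=> eta; exact: poi.
- by move=> Z; exact: (max_degree_critical alpha_gt0 nu_gt0 X_iid h).
- have [poi _] := regime_large alpha_gt0 nu_gt0 X_iid h.
  (* The regime is stated on (0, +oo], whose upper bound every extended real satisfies. *)
  by move=> eta; apply: poi; apply/seteqP; split => x /=; rewrite leey andbT.
- by move=> Z; exact: (max_degree_large alpha_gt0 nu_gt0 X_iid h).
Qed.
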